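(* Let $G$ be a simply-connected simple algebraic group over $\mathbb{C}$ which is not of type $F_4$. Then the coordinate ring $\mathbb{C}[G]$ is generated, as a $\mathbb{C}$-algebra, by the generalized minors $\Delta_{w\lambda,w'\lambda}$ ($\lambda\in P_+$, $w,w'\in W$).
   Context: $\mathfrak{g}=\mathrm{Lie}(G)$ has Chevalley generators $e_s,f_s,h_s$ ($s\in S$), with Cartan subalgebra $\mathfrak{h}=\sum_s\mathbb{C}h_s$ the Lie algebra of a fixed maximal torus of $G$. $P_+$ is the set of dominant integral weights and $W$ is the Weyl group with simple reflections $r_s$. For $s\in S$, $\varphi_s\colon SL_2(\mathbb{C})\to G$ is the homomorphism with $\varphi_s\begin{pmatrix}1&t\\0&1\end{pmatrix}=\exp(te_s)$ and $\varphi_s\begin{pmatrix}1&0\\t&1\end{pmatrix}=\exp(tf_s)$. Put $\overline{r}_s=\varphi_s\begin{pmatrix}0&-1\\1&0\end{pmatrix}$ and $\overline{w}=\overline{r}_{s_1}\cdots\overline{r}_{s_\ell}$ for any reduced expression $w=r_{s_1}\cdots r_{s_\ell}$ (this is independent of the expression). For $\lambda\in P_+$, $V(\lambda)$ is the irreducible module of highest weight $\lambda$ (for $\mathfrak g$ and $G$) with a fixed highest weight vector $v_\lambda$. For $w\in W$ put $v_{w\lambda}=\overline{w}\cdot v_\lambda$, and let $f_{w\lambda}$ be the element of the weight space $(V(\lambda)^* )_{-w\lambda}$ with $\langle f_{w\lambda},v_{w\lambda}\rangle=1$. The generalized minor $\Delta_{w\lambda,w'\lambda}\in\mathbb{C}[G]$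 is the function $g\mapsto\langle f_{w\lambda},g\cdot v_{w'\lambda}\rangle$. *)

(* Defs.v *)
From HB Require Import structures.
From mathcomp Require Import all_boot all_order all_algebra.
From mathcomp Require Import boolp classical_sets cardinality reals.
From mathcomp Require Import complex.

Set Implicit Arguments.
Unset Strict Implicit.
Unset Printing Implicit Defensive.

Import Order.TTheory GRing.Theory Num.Theory.

Local Open Scope classical_set_scope.
Local Open Scope ring_scope.

(* Everything is set up over a closed field C of characteristic 0; the theorem
   takes C := R[i] with R : realType. *)

Section Subalgebras.
Variables (C : numClosedFieldType) (X : Type).

Definition is_subalgebra (B : set (X -> C)) : Prop :=
  [/\ forall c, B (fun=> c),
      forall f g, B f -> B g -> B (fun x => f x + g x)
    & forall f g, B f -> B g -> B (fun x => f x * g x)].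

Definition algebra_generated (E : set (X -> C)) : set (X -> C) :=
  smallest is_subalgebra E.

End Subalgebras.

(* An affine algebraic group, as a variety identified with its set of points:
   a group G with a finitely generated algebra A of functions G -> C, such that
   every algebra morphism A -> C is the evaluation at exactly one point, and
   such that multiplication and inversion are morphisms (the pullback of f by
   multiplication lies in the image of the tensor square of A). *)
Record affineGroup (C : numClosedFieldType) := AffineGroup {
  points :> groupType;
  coord_ring : set (points -> C);
  coord_ring_fingen : exists E : set (points -> C),
    finite_set E /\ coord_ring = algebra_generated E;
  coord_ring_separates : forall x y,
    (forall f, coord_ring f -> f x = f y) -> x = y;
  coord_ring_points : forall chi : (points -> C) -> C,
    (forall c, chi (fun=> c) = c) ->
    (forall f g, coord_ring f -> coord_ring g ->
       chi (fun x => f x + g x) = chi f + chi g) ->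
    (forall f g, coord_ring f -> coord_ring g ->
       chi (fun x => f x * g x) = chi f * chi g) ->
    exists x, forall f, coord_ring f -> chi f = f x;
  coord_ring_mul : forall f, coord_ring f ->
    exists (n : nat) (p q : 'I_n -> points -> C),
      (forall i, coord_ring (p i) /\ coord_ring (q i)) /\
      forall x y, f (x * y)%g = \sum_(i < n) p i x * q i y;
  coord_ring_inv : forall f, coord_ring f -> coord_ring (fun x => f (x^-1)%g)
}.

Arguments coord_ring {C} _ _.

Section Topology.
Variables (C : numClosedFieldType) (G : affineGroup C).

Definition zariski_closed (Z : set G) : Prop :=
  exists I : set (G -> C), I `<=` coord_ring G /\
    Z = [set x | forall f, I f -> f x = 0].

Definition zariski_connected (Z : set G) : Prop :=
  forall Z1 Z2 : set G, zariski_closed Z1 -> zariski_closed Z2 ->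
    Z `<=` Z1 `|` Z2 -> Z `&` (Z1 `&` Z2) = set0 -> Z `<=` Z1 \/ Z `<=` Z2.

Definition connected_group : Prop := zariski_connected setT.

Definition normal_subgroup (N : set G) : Prop :=
  [/\ N 1%g,
      forall x y, N x -> N y -> N (x * y)%g,
      forall x, N x -> N (x^-1)%g
    & forall x y, N x -> N (x ^ y)%g].

(* "Simple" in the sense of algebraic groups: a finite centre is allowed. *)
Definition simple_group : Prop :=
  [/\ connected_group,
      exists x y : G, (x * y)%g <> (y * x)%g
    & forall N : set G, normal_subgroup N -> zariski_closed N ->
        zariski_connected N -> N = [set 1%g] \/ N = setT].

End Topology.

Section SimplyConnected.
Variable C : numClosedFieldType.

Definition group_morphism (H G : affineGroup C) (p : H -> G) : Prop :=
  (forall x y, p (x * y)%g = (p x * p y)%g) /\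
  (forall f, coord_ring G f -> coord_ring H (f \o p)).

Definition isogeny (H G : affineGroup C) (p : H -> G) : Prop :=
  [/\ group_morphism p, forall y, exists x, p x = y
    & finite_set [set x | p x = 1%g]].

Definition group_isomorphism (H G : affineGroup C) (p : H -> G) : Prop :=
  [/\ group_morphism p, bijective p
    & forall b, coord_ring H b -> exists2 f, coord_ring G f & b = f \o p].

Definition simply_connected (G : affineGroup C) : Prop :=
  connected_group G /\
  forall (H : affineGroup C) (p : H -> G),
    connected_group H -> isogeny p -> group_isomorphism p.

End SimplyConnected.

Section LieAlgebra.
Variables (C : numClosedFieldType) (G : affineGroup C).

(* Elements of Lie(G) are the point derivations of the coordinate ring at 1.
   They are represented by functionals on all functions G -> C, of which only
   the values on the coordinate ring are meaningful: compare with lie_eq. *)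
Definition lie (X : (G -> C) -> C) : Prop :=
  (forall c f g, coord_ring G f -> coord_ring G g ->
     X (fun x => c * f x + g x) = c * X f + X g) /\
  (forall f g, coord_ring G f -> coord_ring G g ->
     X (fun x => f x * g x) = f 1%g * X g + X f * g 1%g).

Definition lie_eq (X Y : (G -> C) -> C) : Prop :=
  forall f, coord_ring G f -> X f = Y f.

(* The left-invariant vector field with value X at 1. *)
Definition left_inv (X : (G -> C) -> C) (f : G -> C) : G -> C :=
  fun x => X (fun y => f (x * y)%g).

(* The commutator of the left-invariant vector fields, evaluated at 1. *)
Definition bracket (X Y : (G -> C) -> C) : (G -> C) -> C :=
  fun f => X (left_inv Y f) - Y (left_inv X f).

Definition lie_subalgebra (L : set ((G -> C) -> C)) : Prop :=
  [/\ L (fun=> 0),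
      forall c X Y, L X -> L Y -> L (fun f => c * X f + Y f),
      forall X Y, L X -> L Y -> L (bracket X Y)
    & forall X Y, lie_eq X Y -> L X -> L Y].

(* g = exp X for a locally nilpotent X: the Taylor expansion at 1 of every
   regular function f along X is finite, and sums to f g. *)
Definition is_exp (X : (G -> C) -> C) (g : G) : Prop :=
  forall f, coord_ring G f -> exists N : nat,
    (forall k, (N <= k)%N -> iter k (left_inv X) f 1%g = 0) /\
    f g = \sum_(k < N) (k`!%:R)^-1 * iter k (left_inv X) f 1%g.

(* T is the image of a closed immersion of algebraic groups of the r-th power
   of the multiplicative group, whose points are the row vectors with non-zero
   entries. *)
Definition torus (T : set G) : Prop :=
  exists (r : nat) (p : 'rV[C]_r -> G),
    let Gm := [set x : 'rV[C]_r | forall i, x 0 i != 0] in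
    [/\ forall x y, Gm x -> Gm y ->
          p (\row_i (x 0 i * y 0 i)) = (p x * p y)%g,
        forall f, coord_ring G f -> exists2 q,
          algebra_generated
            [set u : 'rV[C]_r -> C | exists i,
               u = (fun x => x 0 i) \/ u = (fun x => (x 0 i)^-1)] q
          & forall x, Gm x -> f (p x) = q x,
        forall i, exists2 f, coord_ring G f & forall x, Gm x -> f (p x) = x 0 i
      & T = p @` Gm].

Definition maximal_torus (T : set G) : Prop :=
  torus T /\ forall T', torus T' -> T `<=` T' -> T' = T.

(* X belongs to the Lie algebra of the closed subgroup T. *)
Definition lie_of_subgroup (T : set G) (X : (G -> C) -> C) : Prop :=
  lie X /\
  forall f, coord_ring G f -> (forall x, T x -> f x = 0) -> X f = 0.

End LieAlgebra.

Definition is_cartan_matrix (S : finType) (a : S -> S -> int) : Prop :=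
  [/\ forall s, a s s = 2,
      forall s t, s != t -> a s t <= 0
    & forall s t, a s t = 0 -> a t s = 0].

Definition cartan_F4 (i j : 'I_4) : int :=
  nth 0 (nth [::] [:: [:: 2; -1;  0;  0];
                      [:: -1; 2; -2;  0];
                      [:: 0; -1;  2; -1];
                      [:: 0;  0; -1;  2]] i) j.

Definition type_F4 (S : finType) (a : S -> S -> int) : Prop :=
  exists2 u : S -> 'I_4, bijective u &
    forall s t, a s t = cartan_F4 (u s) (u t).

Definition mx2 (C : numClosedFieldType) (a b c d : C) : 'M[C]_2 :=
  \matrix_(i < 2, j < 2)
    if i == 0 then (if j == 0 then a else b) else (if j == 0 then c else d).

(* The Chevalley generators, the maximal torus and the homomorphisms from SL_2
   that are fixed together with G.  The homomorphism gen_phi s is only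
   meaningful on matrices of determinant 1. *)
Record chevalley_data (C : numClosedFieldType) (G : affineGroup C)
    (S : finType) := ChevalleyData {
  cartan : S -> S -> int;
  gen_e : S -> (G -> C) -> C;
  gen_f : S -> (G -> C) -> C;
  gen_h : S -> (G -> C) -> C;
  max_torus : set G;
  gen_phi : S -> 'M[C]_2 -> G;

  cartanP : is_cartan_matrix cartan;
  gen_lie : forall s, [/\ lie (gen_e s), lie (gen_f s) & lie (gen_h s)];
  gen_hh : forall s t, lie_eq (bracket (gen_h s) (gen_h t)) (fun=> 0);
  gen_ef : forall s t, lie_eq (bracket (gen_e s) (gen_f t))
    (fun f => if s == t then gen_h s f else 0);
  gen_he : forall s t, lie_eq (bracket (gen_h s) (gen_e t))
    (fun f => (cartan s t)%:~R * gen_e t f);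
  gen_hf : forall s t, lie_eq (bracket (gen_h s) (gen_f t))
    (fun f => - (cartan s t)%:~R * gen_f t f);
  gen_h_free : forall c : S -> C,
    lie_eq (fun f => \sum_s c s * gen_h s f) (fun=> 0) -> forall s, c s = 0;
  gen_generate : forall L : set ((G -> C) -> C), lie_subalgebra L ->
    (forall s, [/\ L (gen_e s), L (gen_f s) & L (gen_h s)]) ->
    forall X, lie X -> L X;

  max_torusP : maximal_torus max_torus;
  lie_max_torus : forall X, lie_of_subgroup max_torus X <->
    lie X /\ exists c : S -> C, lie_eq X (fun f => \sum_s c s * gen_h s f);

  gen_phiM : forall s x y, \det x = 1 -> \det y = 1 ->
    gen_phi s (x *m y) = (gen_phi s x * gen_phi s y)%g;
  gen_phi_morphism : forall s f, coord_ring G f -> exists2 q,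
    algebra_generated
      [set u : 'M[C]_2 -> C | exists i j, u = (fun x => x i j)] q
    & forall x, \det x = 1 -> f (gen_phi s x) = q x;
  gen_phi_e : forall s t,
    is_exp (fun f => t * gen_e s f) (gen_phi s (mx2 1 t 0 1));
  gen_phi_f : forall s t,
    is_exp (fun f => t * gen_f s f) (gen_phi s (mx2 1 0 t 1))
}.

Section WeylGroup.
Variables (C : numClosedFieldType) (G : affineGroup C) (S : finType).
Variable D : chevalley_data G S.

(* The h_s form a basis of the Cartan subalgebra; a linear form mu on it is
   given by the values mu s = mu(h_s).  In these coordinates, the simple root
   of index s is t |-> cartan D t s. *)
Definition weight := {ffun S -> C}.

Definition dominant_integral (lam : weight) : Prop :=
  forall s, exists m : nat, lam s = m%:R.

Definition reflection (s : S) (mu : weight) : weight :=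
  [ffun t => mu t - mu s * (cartan D t s)%:~R].

(* r_{s_1} ... r_{s_l} for the word [:: s_1; ...; s_l] *)
Definition word_act (i : seq S) : weight -> weight :=
  fun mu => foldr reflection mu i.

Definition weyl_group : set (weight -> weight) := range word_act.

Definition reduced_expression (i : seq S) (w : weight -> weight) : Prop :=
  word_act i = w /\ forall j, word_act j = w -> (size i <= size j)%N.

Definition rbar (s : S) : G := gen_phi D s (mx2 0 (-1) 1 0).

(* g is the representative of w given by some reduced expression *)
Definition weyl_lift (w : weight -> weight) (g : G) : Prop :=
  exists2 i : seq S, reduced_expression i w & g = (\prod_(s <- i) rbar s)%g.

End WeylGroup.

Section Representations.
Variables (C : numClosedFieldType) (G : affineGroup C).

(* Modules are written in coordinates: G acts on column vectors through rho,
   and linear forms are row vectors. *)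
Definition rational_rep (n : nat) (rho : G -> 'M[C]_n) : Prop :=
  [/\ rho 1%g = 1%:M,
      forall x y, rho (x * y)%g = rho x *m rho y
    & forall i j, coord_ring G (fun x => rho x i j)].

Definition irreducible_rep (n : nat) (rho : G -> 'M[C]_n) : Prop :=
  (0 < n)%N /\
  forall U : set 'cV[C]_n,
    U 0 -> (forall c u v, U u -> U v -> U (c *: u + v)) ->
    (forall x u, U u -> U (rho x *m u)) -> U = [set 0] \/ U = setT.

Definition drep (n : nat) (rho : G -> 'M[C]_n) (X : (G -> C) -> C) : 'M[C]_n :=
  \matrix_(i, j) X (fun x => rho x i j).

Variables (S : finType) (D : chevalley_data G S).

Definition weight_vector (n : nat) (rho : G -> 'M[C]_n)
    (mu : weight C S) (v : 'cV[C]_n) : Prop :=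
  forall s, drep rho (gen_h D s) *m v = mu s *: v.

(* h acts on a linear form xi of the dual module by - xi *m drep rho h. *)
Definition dual_weight_vector (n : nat) (rho : G -> 'M[C]_n)
    (mu : weight C S) (xi : 'rV[C]_n) : Prop :=
  forall s, - (xi *m drep rho (gen_h D s)) = mu s *: xi.

(* (rho, v) is V(lam) with its highest weight vector v_lam *)
Definition highest_weight_module (lam : weight C S) (n : nat)
    (rho : G -> 'M[C]_n) (v : 'cV[C]_n) : Prop :=
  [/\ rational_rep rho, irreducible_rep rho, v != 0, weight_vector rho lam v
    & forall s, drep rho (gen_e D s) *m v = 0].

(* Delta is the generalized minor of (w lam, w' lam).  It does not depend on
   the model of V(lam) nor on the scaling of its highest weight vector. *)
Definition generalized_minor (lam : weight C S)
    (w w' : weight C S -> weight C S) (Delta : G -> C) : Prop :=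
  exists (n : nat) (rho : G -> 'M[C]_n) (v : 'cV[C]_n)
         (wbar wbar' : G) (xi : 'rV[C]_n),
    [/\ highest_weight_module lam rho v,
        weyl_lift D w wbar,
        weyl_lift D w' wbar',
        dual_weight_vector rho [ffun s => - w lam s] xi /\
          (xi *m (rho wbar *m v)) 0 0 = 1
      & Delta = fun g => (xi *m (rho g *m (rho wbar' *m v))) 0 0].

Definition generalized_minors : set (G -> C) :=
  [set Delta | exists lam w w',
     [/\ dominant_integral lam, weyl_group D w, weyl_group D w'
       & generalized_minor lam w w' Delta]].

End Representations.

(* Main.v *)
(** Write [A] for the coordinate ring and [B] for the algebra generated by the
    minors.  If the weights of a representation [V] span the weight lattice, its
    matrix coefficients generate [A]: on the big cell, the entries of the
    triangular factors of [V], hence those of any other representation [W], are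
    quotients of polynomials in the coefficients of [V] whose denominators do
    not vanish at [1], and translates of these denominators generate the unit
    ideal.  So it is enough to find such a [V] all of whose coefficients lie in
    [B].  A coefficient between two extremal weight vectors is a multiple of a
    minor.

    If the root lattice is not the whole weight lattice, each nontrivial coset
    has a minimal orbit, which carries a minuscule representation; it integrates
    to the simply connected group [G], and all of its weights are extremal.
    Otherwise an inspection of positive definite Cartan matrices of determinant
    one leaves, besides F4, the simply laced case and G2.  There the adjoint
    representation (resp. the imaginary octonions) has an invariant form and an
    equivariant product, whose component of weight zero only involves nonzero
    weights; these express the remaining coefficients through extremal ones. *)
Require Import Defs.
From HB Require Import structures.
From mathcomp Require Import all_boot all_order all_algebra.
From mathcomp Require Import fingroup perm cyclic separable cyclotomic.
From mathcomp Require Import boolp classical_sets cardinality reals.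
From mathcomp Require Import complex.
From mathcomp Require Import ring zify.

Set Implicit Arguments.
Unset Strict Implicit.
Unset Printing Implicit Defensive.

Import Order.TTheory GRing.Theory Num.Theory.

Local Open Scope classical_set_scope.
Local Open Scope ring_scope.

(** * Noetherian rings *)

Section Noetherian.

(** Everything is reached from the Chevalley generators and the homomorphisms from SL_2, by three
    passages. From the Lie algebra to the group: a regular function whose iterated invariant
    derivatives all vanish at 1 lies in every power of the maximal ideal there, so Krull's
    intersection theorem and connectedness make it zero; hence words in the root elements are dense,
    and so is the big cell. From one representation to another: among the pairs of matrices
    generated by corresponding generators, a subspace stable under the generators and avoiding the
    Cartan part is zero, so the pairs form the graph of a linear map. This rests on a positive
    definite Cartan matrix, which the trace form of a faithful representation provides. From
    matrices back to the group: in the product of G and the m by m matrices, the closure of the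
    pairs of corresponding words is a connected group; its kernel over G consists of scalars that
    are m-th roots of unity, so simple connectedness turns it into a graph. F4 appears when a
    unimodular diagram is grown from a double bond: parity forces one more node on each side, and
    positivity forbids any other. *)

Definition in_ideal (R : comNzRingType) (r : seq R) (p : R) : Prop :=
  exists q : nat -> R, p = \sum_(i < size r) q i * r`_i.

(** The ascending chain condition in sequential form. It passes to polynomial rings and is used as
    it stands: Krull's theorem needs one relation that expresses some term through the earlier
    ones. *)
Definition noetherian (R : comNzRingType) : Prop :=
  forall f : nat -> R, exists N, in_ideal (mkseq f N) (f N).

Variable R : comNzRingType.
Implicit Types (r : seq R) (p : R).

Lemma in_ideal0 r : in_ideal r 0.
Proof. by exists (fun=> 0); rewrite big1 // => i _; rewrite mul0r. Qed.

Lemma in_idealD r p1 p2 : in_ideal r p1 -> in_ideal r p2 -> in_ideal r (p1 + p2).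
Proof.
move=> [q1 ->] [q2 ->]; exists (fun i => q1 i + q2 i).
by rewrite -big_split; apply: eq_bigr => i _; rewrite mulrDl.
Qed.

Lemma in_idealM r c p : in_ideal r p -> in_ideal r (c * p).
Proof.
move=> [q ->]; exists (fun i => c * q i).
by rewrite mulr_sumr; apply: eq_bigr => i _; rewrite mulrA.
Qed.

Lemma in_ideal_sum r (I : Type) (s : seq I) (F : I -> R) :
  (forall i, in_ideal r (F i)) -> in_ideal r (\sum_(i <- s) F i).
Proof. by move=> H; elim/big_ind: _ => //; [exact: in_ideal0 | exact: in_idealD]. Qed.

Lemma in_ideal_nth r i : in_ideal r r`_i.
Proof.
have [lt_i|ge_i] := ltnP i (size r); last by rewrite nth_default //; exact: in_ideal0.
exists (fun j => (j == i)%:R); rewrite (bigD1 (Ordinal lt_i)) //= eqxx mul1r big1 ?addr0 //.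
by move=> j; rewrite -val_eqE /= => /negPf ->; rewrite mul0r.
Qed.

Lemma in_ideal_trans r r' p :
  (forall i, (i < size r)%N -> in_ideal r' r`_i) -> in_ideal r p -> in_ideal r' p.
Proof.
move=> H [q ->]; apply: in_ideal_sum => i; apply: in_idealM; exact: H.
Qed.

Lemma in_ideal_mkseq_le (f : nat -> R) m n p : (m <= n)%N ->
  in_ideal (mkseq f m) p -> in_ideal (mkseq f n) p.
Proof.
move=> le_mn; apply: in_ideal_trans => i; rewrite size_mkseq => lt_i.
rewrite nth_mkseq // -(nth_mkseq 0 f (leq_trans lt_i le_mn)); exact: in_ideal_nth.
Qed.

End Noetherian.

Lemma noetherian_field (F : fieldType) : noetherian F.
Proof.
move=> f; have [f0|nf0] := eqVneq (f 0%N) 0.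
  by exists 0%N, (fun=> 0); rewrite big_ord0.
exists 1%N, (fun=> f 1%N / f 0%N).
by rewrite big_ord1 /= divfK.
Qed.

Section HilbertBasis.
Variables (R : comNzRingType) (noethR : noetherian R).

(** Hilbert's basis theorem. At each stage choose, in the ideal of all the [f n] but outside the
    ideal of the previous choices, an element of least degree. A relation between the leading
    coefficients would then lower the degree of one of them. *)
Lemma noetherian_poly : noetherian {poly R}.
Proof.
move=> f; apply: contrapT => /forallNP nf.
pose I p := exists n, in_ideal (mkseq f n) p.
have If n : I (f n).
  exists n.+1; have := in_ideal_nth (mkseq f n.+1) n.
  by rewrite nth_mkseq.
have I_cand (g : seq {poly R}) : (forall i, I g`_i) ->
    exists p, I p /\ ~ in_ideal g p.
  move=> Ig; apply: contrapT => /forallNP ng.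
  have [M HM] : exists M, forall i, (i < size g)%N -> in_ideal (mkseq f M) g`_i.
    have [n Hn] := choice Ig.
    exists (\max_(i < size g) n i) => i lt_i.
    apply: in_ideal_mkseq_le (Hn i).
    exact: (leq_bigmax (Ordinal lt_i)).
  apply: (nf M); apply: (in_ideal_trans HM).
  by apply: contrapT => nfM; apply: (ng (f M)); split; [exact: If|exact: nfM].
have next_ex (g : seq {poly R}) : exists p, (forall i, I g`_i) ->
    [/\ I p, ~ in_ideal g p &
        forall q, I q -> ~ in_ideal g q -> (size p <= size q)%N].
  have [Ig|nIg] := pselect (forall i, I g`_i); last by exists 0.
  have [p0 [Ip0 np0]] := I_cand g Ig.
  have exn : exists n, `[< exists p, [/\ I p, ~ in_ideal g p & size p = n] >].
    by exists (size p0); apply/asboolP; exists p0.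
  case: (ex_minnP exn) => n /asboolP[p [Ip np <-]] minp.
  exists p => _; split=> // q Iq nq; apply: minp; apply/asboolP; by exists q.
have [next nextP] := choice next_ex.
pose gs := fix gs n := if n is n'.+1 then rcons (gs n') (next (gs n')) else [::].
pose g n := next (gs n).
have gsE n : gs n = mkseq g n.
  by elim: n => //= n IH; rewrite {1}IH mkseqS.
have Igs n : forall i, I (gs n)`_i.
  elim: n => [|n IH] i; first by rewrite nth_nil; exists 0%N; exact: in_ideal0.
  rewrite /= nth_rcons; case: ifP => // _; case: ifP => _.
    by have [] := nextP _ IH.
  exists 0%N; exact: in_ideal0.
have gP n : [/\ I (g n), ~ in_ideal (mkseq g n) (g n) &
    forall q, I q -> ~ in_ideal (mkseq g n) q -> (size (g n) <= size q)%N].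
  by rewrite -gsE; apply: nextP.
have I_add p q : I p -> I q -> I (p + q).
  move=> [m Hm] [n Hn]; exists (maxn m n).
  by apply: in_idealD; [move: Hm | move: Hn]; apply: in_ideal_mkseq_le;
    rewrite ?leq_maxl ?leq_maxr.
have I_mul c p : I p -> I (c * p) by move=> [m Hm]; exists m; apply: in_idealM.
have gsize m n : (m <= n)%N -> (size (g m) <= size (g n))%N.
  move=> le_mn; have [_ _] := gP m; apply; first by have [] := gP n.
  have [_ nn _] := gP n => Hm; apply: nn; exact: in_ideal_mkseq_le Hm.
have [N [u uE]] := noethR (fun n => lead_coef (g n)).
rewrite size_mkseq in uE.
(* The relation [uE] between leading coefficients cancels the top term of [g N]. The difference is
   still in the ideal and outside that of the earlier choices, so its smaller degree contradicts the
   choice of [g N]. *)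
pose p := g N - \sum_(k < N) (u k)%:P * 'X^(size (g N) - size (g k)) * g k.
have gN0 : g N != 0.
  apply/eqP => g0; have [_ nn _] := gP N; apply: nn; rewrite g0; exact: in_ideal0.
have np : ~ in_ideal (mkseq g N) p.
  move=> Hp; have [_ nn _] := gP N; apply: nn.
  rewrite -[g N](subrK (\sum_(k < N) (u k)%:P * 'X^(size (g N) - size (g k)) * g k)).
  apply: in_idealD => //; apply: in_ideal_sum => k; apply: in_idealM.
  by rewrite -(nth_mkseq 0 g (ltn_ord k)); exact: in_ideal_nth.
have Ip : I p.
  apply: (I_add); first by have [] := gP N.
  rewrite -mulN1r; apply: (I_mul).
  elim: (index_enum _) => [|k s IHs]; first by rewrite big_nil; exists 0%N; exact: in_ideal0.
  by rewrite big_cons; apply: I_add => //; apply: I_mul; have [] := gP k.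
have [_ _ /(_ p Ip np)] := gP N.
apply/negP; rewrite -ltnNge.
have szp : (size p <= size (g N))%N.
  rewrite (leq_trans (size_polyD _ _)) // geq_max leqnn size_polyN /=.
  apply: (big_ind (fun q : {poly R} => (size q <= size (g N))%N)).
  - by rewrite size_poly0.
  - by move=> x y Hx Hy; rewrite (leq_trans (size_polyD _ _)) // geq_max Hx.
  move=> k _; rewrite -mulrA mul_polyC (leq_trans (size_scale_leq _ _)) //.
  rewrite (leq_trans (size_polyMleq _ _)) // size_polyXn /= subnK //.
  exact: gsize (ltnW (ltn_ord k)).
rewrite ltn_neqAle szp andbT; apply/eqP => Esz.
have : lead_coef p = 0.
  rewrite lead_coefE Esz coefB coef_sum -lead_coefE uE.
  apply/eqP; rewrite subr_eq0; apply/eqP; apply: eq_bigr => k _.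
  rewrite nth_mkseq //= -mulrA coefCM mulrC mulrC; congr (_ * _).
  have le_k := gsize _ _ (ltnW (ltn_ord k)).
  have gk0 : (0 < size (g k))%N.
    rewrite lt0n size_poly_eq0; apply/eqP => g0; have [_ nn _] := gP k.
    by apply: nn; rewrite g0; exact: in_ideal0.
  rewrite coefXnM ltnNge.
  have -> : (size (g N) - size (g k) <= (size (g N)).-1)%N.
    by rewrite -ltnS prednK ?(leq_trans gk0) // ltn_subrL gk0 (leq_trans gk0).
  by rewrite /= lead_coefE; congr (_`_ _); move: le_k gk0; move: (size _) (size _) => a b; lia.
move/eqP; rewrite lead_coef_eq0 => /eqP p0; apply: np; rewrite p0; exact: in_ideal0.
Qed.

End HilbertBasis.

(** * Algebras of functions *)

Section SubalgebraTheory.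
Variables (C : numClosedFieldType) (X : Type).
Implicit Types (B E : set (X -> C)) (f g : X -> C).

Lemma algebra_generated_sub E : E `<=` algebra_generated E.
Proof. by move=> f Ef B [_]; exact. Qed.

Lemma algebra_generated_min E B : is_subalgebra B -> E `<=` B ->
  algebra_generated E `<=` B.
Proof. by move=> subB EB f; apply. Qed.

Lemma algebra_generated_subalgebra E : is_subalgebra (algebra_generated E).
Proof.
split=> [c B [[Bc _ _] _]|f g Hf Hg B BE|f g Hf Hg B BE]; first exact: Bc.
- by have [[_ BD _] _] := BE; apply: BD; [exact: Hf | exact: Hg].
- by have [[_ _ BM] _] := BE; apply: BM; [exact: Hf | exact: Hg].
Qed.

Variable B : set (X -> C).
Hypothesis subB : is_subalgebra B.

Lemma subalg_cst c : B (fun=> c). Proof. by have [] := subB. Qed.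

Lemma subalgD f g : B f -> B g -> B (fun x => f x + g x).
Proof. by have [_ BD _] := subB; exact: BD. Qed.

Lemma subalgM f g : B f -> B g -> B (fun x => f x * g x).
Proof. by have [_ _ BM] := subB; exact: BM. Qed.

Lemma subalgZ c f : B f -> B (fun x => c * f x).
Proof. by move=> Bf; apply: subalgM => //; exact: subalg_cst. Qed.

Lemma subalgN f : B f -> B (fun x => - f x).
Proof.
by move=> Bf; under eq_fun do rewrite -mulN1r; exact: subalgZ.
Qed.

Lemma subalgB f g : B f -> B g -> B (fun x => f x - g x).
Proof. by move=> Bf Bg; apply: subalgD => //; exact: subalgN. Qed.

Lemma subalg_sum (I : Type) (r : seq I) (P : pred I) (F : I -> X -> C) :
  (forall i, P i -> B (F i)) -> B (fun x => \sum_(i <- r | P i) F i x).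
Proof.
move=> BF; elim: r => [|i r IH].
  by under eq_fun do rewrite big_nil; exact: subalg_cst.
under eq_fun do rewrite big_cons; case: (boolP (P i)) => // Pi.
by apply: subalgD => //; exact: BF.
Qed.

Lemma subalg_prod (I : Type) (r : seq I) (P : pred I) (F : I -> X -> C) :
  (forall i, P i -> B (F i)) -> B (fun x => \prod_(i <- r | P i) F i x).
Proof.
move=> BF; elim: r => [|i r IH].
  by under eq_fun do rewrite big_nil; exact: subalg_cst.
under eq_fun do rewrite big_cons; case: (boolP (P i)) => // Pi.
by apply: subalgM => //; exact: BF.
Qed.

Lemma subalgX f n : B f -> B (fun x => f x ^+ n).
Proof.
move=> Bf; elim: n => [|n IH]; first by under eq_fun do rewrite expr0; exact: subalg_cst.
by under eq_fun do rewrite exprS; exact: subalgM.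
Qed.

Lemma subalg_det n (M : X -> 'M[C]_n) :
  (forall i j, B (fun x => M x i j)) -> B (fun x => \det (M x)).
Proof.
move=> BM; rewrite /determinant; apply: subalg_sum => s _; apply: subalgM.
  exact: subalg_cst.
by apply: subalg_prod => i _.
Qed.

Lemma subalg_adj n (M : X -> 'M[C]_n) :
  (forall i j, B (fun x => M x i j)) -> forall i j, B (fun x => (\adj (M x)) i j).
Proof.
move=> BM i j; under eq_fun do rewrite mxE /cofactor.
apply: subalgM; first exact: subalg_cst.
by apply: subalg_det => k l; under eq_fun do rewrite !mxE.
Qed.

Lemma subalg_mulmx m n p (M : X -> 'M[C]_(m, n)) (N : X -> 'M[C]_(n, p)) :
  (forall i j, B (fun x => M x i j)) -> (forall i j, B (fun x => N x i j)) ->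
  forall i j, B (fun x => (M x *m N x) i j).
Proof.
move=> BM BN i j; under eq_fun do rewrite mxE.
by apply: subalg_sum => k _; exact: subalgM.
Qed.

End SubalgebraTheory.

Section PolynomialTower.
Variable F : fieldType.

(** Several variables are added one at a time, so that the one-variable basis theorem applies by
    induction. *)
Fixpoint poly_tower n : comNzRingType :=
  if n is m.+1 then {poly poly_tower m} else F.

Lemma poly_tower_noetherian n : noetherian (poly_tower n).
Proof.
by elim: n => [|n IH]; [exact: noetherian_field | exact: noetherian_poly].
Qed.

Fixpoint tower_eval (v : nat -> F) n : {rmorphism poly_tower n -> F} :=
  match n return {rmorphism poly_tower n -> F} with
  | 0 => idfun
  | m.+1 => horner_eval (v m) \o map_poly (tower_eval v m)
  end.

Lemma tower_evalS v n (P : poly_tower n.+1) :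
  tower_eval v n.+1 P = (map_poly (tower_eval v n) P).[v n].
Proof. by []. Qed.

Lemma tower_cst n c : exists P, forall v, tower_eval v n P = c.
Proof.
elim: n => [|n [P HP]]; first by exists c.
by exists P%:P => v; rewrite tower_evalS map_polyC hornerC; exact: HP.
Qed.

Lemma tower_var n i : (i < n)%N -> exists P, forall v, tower_eval v n P = v i.
Proof.
elim: n => // n IH; rewrite ltnS leq_eqVlt => /orP[/eqP ->|/IH[P HP]].
  by exists 'X => v; rewrite tower_evalS map_polyX hornerX.
by exists P%:P => v; rewrite tower_evalS map_polyC hornerC; exact: HP.
Qed.

End PolynomialTower.

Section FinitelyGenerated.
Variables (C : numClosedFieldType) (X : Type).

Lemma tower_eval_subalgebra (B : set (X -> C)) (a : nat -> X -> C) n P :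
  is_subalgebra B -> (forall i, (i < n)%N -> B (a i)) ->
  B (fun x => tower_eval (fun i => a i x) n P).
Proof.
move=> subB; elim: n P => [|n IH] P Ba; first exact: subalg_cst.
have -> : (fun x => tower_eval (fun i => a i x) n.+1 P) =
    fun x => \sum_(i < size P) tower_eval (fun i => a i x) n P`_i * a n x ^+ i.
  apply: funext => x; rewrite tower_evalS (@horner_coef_wide _ (size P)).
    by apply: eq_bigr => i _; rewrite coef_map.
  exact: size_poly.
apply: subalg_sum => // i _; apply: subalgM => //.
  by apply: IH => j lt_j; apply: Ba; rewrite ltnS ltnW.
by apply: subalgX => //; exact: Ba.
Qed.

Lemma algebra_generated_eval (s : seq (X -> C)) f :
  algebra_generated [set` s] f ->
  exists P, forall x, f x = tower_eval (fun i => nth (fun=> 0) s i x) (size s) P.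
Proof.
move: f; apply: algebra_generated_min.
  split=> [c|f g [P HP] [Q HQ]|f g [P HP] [Q HQ]].
  - by have [P HP] := tower_cst (size s) c; exists P.
  - by exists (P + Q) => x; rewrite rmorphD HP HQ.
  - by exists (P * Q) => x; rewrite rmorphM HP HQ.
move=> f /= fs; have lt_i : (index f s < size s)%N by rewrite index_mem.
have [P HP] := tower_var C lt_i.
by exists P => x; rewrite HP nth_index.
Qed.

(** A finitely generated algebra of functions is a quotient of a polynomial tower: lift the
    sequence, take a relation there and evaluate it. *)
Lemma fingen_noetherian (E : set (X -> C)) (f : nat -> X -> C) :
  finite_set E -> (forall n, algebra_generated E (f n)) ->
  exists N (q : nat -> X -> C), (forall k, algebra_generated E (q k)) /\
    forall x, f N x = \sum_(k < N) q k x * f k x.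
Proof.
move=> /finite_seqP[s ->] Hf.
have [P HP] := choice (fun n => algebra_generated_eval (Hf n)).
have [N [u uE]] := poly_tower_noetherian P.
exists N, (fun k x => tower_eval (fun i => nth (fun=> 0) s i x) (size s) (u k)); split.
  move=> k; apply: tower_eval_subalgebra; first exact: algebra_generated_subalgebra.
  by move=> i lt_i; apply: algebra_generated_sub => /=; exact: mem_nth.
move=> x; rewrite HP uE size_mkseq rmorph_sum; apply: eq_bigr => k _.
by rewrite rmorphM nth_mkseq // HP.
Qed.

End FinitelyGenerated.

Lemma polyP_eval (C : numFieldType) (p q : {poly C}) :
  (forall t, p.[t] = q.[t]) -> p = q.
Proof.
move=> H; apply/eqP; rewrite -subr_eq0; apply/eqP; apply: contrapT => /eqP nz.
pose r := [seq i%:R | i <- iota 0 (size (p - q))] : seq C.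
have ur : uniq r.
  by rewrite map_inj_uniq ?iota_uniq // => i j /eqP; rewrite eqr_nat => /eqP.
have ar : all (root (p - q)) r.
  by apply/allP => t _; rewrite rootE hornerD hornerN H subrr.
by have := max_poly_roots nz ar ur; rewrite size_map size_iota ltnn.
Qed.

(** * Krull's intersection theorem at a point *)

Section Krull.
Variables (C : numClosedFieldType) (X : Type) (E : set (X -> C)) (x0 : X).
Hypothesis finE : finite_set E.
Let A := algebra_generated E.
Let subA : is_subalgebra A := algebra_generated_subalgebra E.

(** The n-th power of the maximal ideal m of [x0]. The power m^(n+1) is the least additive set
    containing the products of m and m^n; in this impredicative form a membership hypothesis is its
    own induction principle. *)
Fixpoint max_ideal_pow n : set (X -> C) :=
  if n is m.+1 then
    [set f | forall P : set (X -> C), P (fun=> 0) ->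
      (forall f g, P f -> P g -> P (fun x => f x + g x)) ->
      (forall a b, A a -> a x0 = 0 -> max_ideal_pow m b -> P (fun x => a x * b x)) ->
      P f]
  else A.

Lemma max_ideal_pow0 n : max_ideal_pow n (fun=> 0).
Proof. by case: n => [|n]; [exact: (subalg_cst subA) | move=> P]. Qed.

Lemma max_ideal_powD n f g : max_ideal_pow n f -> max_ideal_pow n g ->
  max_ideal_pow n (fun x => f x + g x).
Proof.
case: n => [|n]; first exact: (subalgD subA).
by move=> Hf Hg P P0 PD PM; apply: (PD); [apply: Hf | apply: Hg].
Qed.

Lemma max_ideal_powS n a b : A a -> a x0 = 0 -> max_ideal_pow n b ->
  max_ideal_pow n.+1 (fun x => a x * b x).
Proof. by move=> Aa a0 Hb P P0 PD; apply. Qed.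

Lemma max_ideal_pow_sum n (I : Type) (r : seq I) (F : I -> X -> C) :
  (forall i, max_ideal_pow n (F i)) -> max_ideal_pow n (fun x => \sum_(i <- r) F i x).
Proof.
move=> HF; elim: r => [|i r IH].
  by under eq_fun do rewrite big_nil; exact: max_ideal_pow0.
by under eq_fun do rewrite big_cons; exact: max_ideal_powD.
Qed.

Lemma max_ideal_powM n a f : A a -> max_ideal_pow n f ->
  max_ideal_pow n (fun x => a x * f x).
Proof.
move=> Aa; elim: n f => [|n IH] f; first exact: (subalgM subA).
move=> Hf; apply: (Hf (fun f => max_ideal_pow n.+1 (fun x => a x * f x))).
- by rewrite (_ : (fun x => _) = fun=> 0) ?funeqE => [|x]; [exact: max_ideal_pow0 | rewrite mulr0].
- move=> g h Hg Hh.
  rewrite (_ : (fun x => _) = fun x => a x * g x + a x * h x); first exact: max_ideal_powD.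
  by apply: funext => x; rewrite mulrDr.
- move=> b c Ab b0 Hc.
  rewrite (_ : (fun x => _) = fun x => b x * (a x * c x)).
    by apply: max_ideal_powS => //; exact: IH.
  by apply: funext => x; rewrite mulrCA.
Qed.

Lemma max_ideal_pow1 f : A f -> f x0 = 0 -> max_ideal_pow 1 f.
Proof.
move=> Af f0; have -> : f = (fun x => f x * 1) by apply: funext => x; rewrite mulr1.
by apply: max_ideal_powS => //; exact: (subalg_cst subA).
Qed.

Lemma max_ideal_powSn n f : max_ideal_pow n.+1 f -> max_ideal_pow n f.
Proof.
move=> Hf; apply: Hf; [exact: max_ideal_pow0 | exact: max_ideal_powD |].
by move=> a b Aa _; exact: max_ideal_powM.
Qed.

Lemma max_ideal_powA n f : max_ideal_pow n f -> A f.
Proof. by elim: n => // n IH /max_ideal_powSn/IH. Qed.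

Lemma max_ideal_powMM m n f g : max_ideal_pow m f -> max_ideal_pow n g ->
  max_ideal_pow (m + n) (fun x => f x * g x).
Proof.
move=> Hf Hg; elim: m f Hf => [|m IH] f; first by move=> Af; exact: max_ideal_powM.
move=> Hf; rewrite addSn; apply: (Hf (fun f => max_ideal_pow (m + n).+1 (fun x => f x * g x))).
- by rewrite (_ : (fun x => _) = fun=> 0) ?funeqE => [|x]; [exact: max_ideal_pow0 | rewrite mul0r].
- move=> h k Hh Hk.
  rewrite (_ : (fun x => _) = fun x => h x * g x + k x * g x); first exact: max_ideal_powD.
  by apply: funext => x; rewrite mulrDl.
- move=> b c Ab b0 Hc.
  rewrite (_ : (fun x => _) = fun x => b x * (c x * g x)).
    by apply: max_ideal_powS => //; exact: IH.
  by apply: funext => x; rewrite mulrA.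
Qed.

(** The Rees algebra of m, realised as functions on [X * C] whose second coordinate is the parameter
    T. The generators e and (e - e(x0)) T are finite in number, which makes it noetherian. *)
Let rees : set (X * C -> C) := algebra_generated
  ([set F | exists2 e, E e & F = fun p => e p.1] `|`
   [set F | exists2 e, E e & F = fun p => (e p.1 - e x0) * p.2]).

Let sub_rees : is_subalgebra rees := algebra_generated_subalgebra _.

Let fin_rees : finite_set
  ([set F | exists2 e, E e & F = fun p : X * C => e p.1] `|`
   [set F | exists2 e, E e & F = fun p => (e p.1 - e x0) * p.2]).
Proof.
rewrite finite_setU; split.
  apply: (@sub_finite_set _ _ [set (fun p => e p.1) | e in E]).
    by move=> _ [e Ee ->]; exists e.
  exact: finite_image.
apply: (@sub_finite_set _ _ [set (fun p => (e p.1 - e x0) * p.2) | e in E]).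
  by move=> _ [e Ee ->]; exists e.
exact: finite_image.
Qed.

Let rees_fst f : A f -> rees (fun p => f p.1).
Proof.
move: f; apply: algebra_generated_min.
  split=> [c|f g|f g]; [exact: (subalg_cst sub_rees)|exact: (subalgD sub_rees)|exact: (subalgM sub_rees)].
by move=> e Ee; apply: algebra_generated_sub; left; exists e.
Qed.

Let rees_shift f : A f -> rees (fun p => (f p.1 - f x0) * p.2).
Proof.
move=> Af; suff : A f /\ rees (fun p => (f p.1 - f x0) * p.2) by case.
move: f Af; apply: algebra_generated_min.
  split=> [c|f g [Af Rf] [Ag Rg]|f g [Af Rf] [Ag Rg]].
  - split; first exact: (subalg_cst subA).
    by under eq_fun do rewrite subrr mul0r; exact: (subalg_cst sub_rees).
  - split; first exact: (subalgD subA).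
    have -> : (fun p : X * C => (f p.1 + g p.1 - (f x0 + g x0)) * p.2) =
      fun p => (f p.1 - f x0) * p.2 + (g p.1 - g x0) * p.2.
      by apply: funext => p; ring.
    exact: (subalgD sub_rees).
  - split; first exact: (subalgM subA).
    have -> : (fun p : X * C => (f p.1 * g p.1 - (f x0 * g x0)) * p.2) =
      fun p => (f p.1 - f x0) * p.2 * g p.1 + f x0 * ((g p.1 - g x0) * p.2).
      by apply: funext => p; ring.
    apply: (subalgD sub_rees); last exact: (subalgZ sub_rees).
    by apply: (subalgM sub_rees) => //; exact: rees_fst.
move=> e Ee; split; first exact: algebra_generated_sub.
by apply: algebra_generated_sub; right; exists e.
Qed.

Let rees_pow n f : max_ideal_pow n f -> rees (fun p => f p.1 * p.2 ^+ n).
Proof.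
elim: n f => [|n IH] f /=.
  by move=> Af; under eq_fun do rewrite expr0 mulr1; exact: rees_fst.
move=> Hf; apply: (Hf (fun f => rees (fun p => f p.1 * p.2 ^+ n.+1))).
- by under eq_fun do rewrite mul0r; exact: (subalg_cst sub_rees).
- by move=> g h Hg Hh; under eq_fun do rewrite mulrDl; exact: (subalgD sub_rees).
move=> a b Aa a0 Hb.
have -> : (fun p : X * C => a p.1 * b p.1 * p.2 ^+ n.+1) =
    fun p => ((a p.1 - a x0) * p.2) * (b p.1 * p.2 ^+ n).
  by apply: funext => p; rewrite a0 exprS; ring.
by apply: (subalgM sub_rees); [exact: rees_shift | exact: IH].
Qed.

(** The vanishing at [x0] of the coefficients of positive degree in T is the only trace of the
    grading that the intersection theorem uses. *)
Let rees_coef F : rees F -> exists P : X -> {poly C},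
  [/\ forall j, A (fun x => (P x)`_j), forall j, (P x0)`_j.+1 = 0 &
      forall x t, F (x, t) = (P x).[t]].
Proof.
move: F; apply: algebra_generated_min.
  split=> [c|F H [P [P1 P2 P3]] [Q [Q1 Q2 Q3]]|F H [P [P1 P2 P3]] [Q [Q1 Q2 Q3]]].
  - exists (fun=> c%:P); split=> [j|j|x t].
    + by under eq_fun do rewrite coefC; exact: (subalg_cst subA).
    + by rewrite coefC.
    + by rewrite hornerC.
  - exists (fun x => P x + Q x); split=> [j|j|x t].
    + by under eq_fun do rewrite coefD; exact: (subalgD subA).
    + by rewrite coefD P2 Q2 addr0.
    + by rewrite hornerD P3 Q3.
  - exists (fun x => P x * Q x); split=> [j|j|x t].
    + under eq_fun do rewrite coefM; apply: (subalg_sum subA) => // i _; exact: (subalgM subA).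
    + rewrite coefM big1 // => -[[|i] lt_i] _ /=; last by rewrite P2 mul0r.
      by rewrite subn0 Q2 mulr0.
    + by rewrite hornerM P3 Q3.
move=> F [[e Ee ->]|[e Ee ->]].
- exists (fun x => (e x)%:P); split=> [j|j|x t].
  + case: j => [|j]; under eq_fun do rewrite coefC /=; last exact: (subalg_cst subA).
    exact: algebra_generated_sub.
  + by rewrite coefC.
  + by rewrite hornerC.
- exists (fun x => (e x - e x0)%:P * 'X); split=> [j|j|x t].
  + case: j => [|[|j]]; under eq_fun do rewrite coefMX coefC /=;
      try exact: (subalg_cst subA).
    by apply: (subalgB subA); [exact: algebra_generated_sub | exact: (subalg_cst subA)].
  + by rewrite coefMX coefC /=; case: ifP => // _; rewrite subrr.
  + by rewrite hornerM hornerC hornerX.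
Qed.

(* The ideal of the Rees algebra generated by all f T^n is finitely generated. *)
Lemma krull_intersection f : (forall n, max_ideal_pow n f) ->
  exists a, [/\ A a, a x0 = 0 & forall x, f x = a x * f x].
Proof.
move=> Hf.
have [N [q [Rq qE]]] := fingen_noetherian fin_rees (fun n => rees_pow (Hf n)).
have [P HP] := choice (fun k => rees_coef (Rq k)).
(* Compare the coefficients of T^N in f T^N = \sum_k q_k f T^k. They involve the coefficient of q_k
   in degree N - k, which is positive because k < N, so it vanishes at [x0]. *)
exists (fun x => \sum_(k < N) (P k x)`_(N - k)); split.
- by apply: (subalg_sum subA) => // k _; have [PA _ _] := HP k.
- rewrite big1 // => k _; have [_ P0 _] := HP k.
  by have := P0 (N - k.+1)%N; rewrite subnSK.
move=> x.
have /(congr1 (fun p : {poly C} => p`_N)) : (f x)%:P * 'X^N = \sum_(k < N) P k x * (f x)%:P * 'X^k.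
  apply: polyP_eval => t; rewrite hornerM hornerC hornerXn.
  rewrite (qE (x, t)) horner_sum; apply: eq_bigr => k _.
  by have [_ _ ->] := HP k; rewrite /= !hornerM hornerC hornerXn mulrA.
rewrite coefMXn ltnn subnn coefC eqxx => {1}->.
rewrite coef_sum mulr_suml; apply: eq_bigr => k _.
by rewrite coefMXn ltnNge (ltnW (ltn_ord k)) /= [_ * _%:P]mulrC coefCM mulrC.
Qed.

End Krull.

(** * Point derivations and the density of a connected group *)

Section PointDerivations.
Variables (C : numClosedFieldType) (G : affineGroup C).
Local Notation A := (coord_ring G).

Lemma coord_ring_subalgebra : is_subalgebra A.
Proof.
by have [E [_ ->]] := coord_ring_fingen G; exact: algebra_generated_subalgebra.
Qed.
Local Notation subA := coord_ring_subalgebra.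

Lemma coord_ring_left f a : A f -> A (fun x => f (a * x)%g).
Proof.
move=> /coord_ring_mul[n [p [q [Apq fE]]]].
rewrite (_ : (fun x => _) = fun x => \sum_(i < n) p i a * q i x); last exact: funext.
by apply: (subalg_sum subA) => i _; apply: (subalgZ subA); have [] := Apq i.
Qed.

Lemma coord_ring_right f a : A f -> A (fun x => f (x * a)%g).
Proof.
move=> /coord_ring_mul[n [p [q [Apq fE]]]].
rewrite (_ : (fun x => _) = fun x => \sum_(i < n) q i a * p i x).
  by apply: (subalg_sum subA) => i _; apply: (subalgZ subA); have [] := Apq i.
by apply: funext => x; rewrite fE; apply: eq_bigr => i _; rewrite mulrC.
Qed.

Section OneDerivation.
Variable X : (G -> C) -> C.
Hypothesis lieX : lie X.

Lemma lie0 : X (fun=> 0) = 0.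
Proof.
have [lin _] := lieX; have A0 := subalg_cst subA 0.
rewrite -[RHS](addNr (X (fun=> 0))) -mulN1r -(lin (-1) _ _ A0 A0).
by congr X; apply: funext => x; rewrite mulr0 addr0.
Qed.

Lemma lieD f g : A f -> A g -> X (fun x => f x + g x) = X f + X g.
Proof.
move=> Af Ag; have [lin _] := lieX; have := lin 1 _ _ Af Ag; rewrite mul1r => <-.
by congr X; apply: funext => x; rewrite mul1r.
Qed.

Lemma lieZ c f : A f -> X (fun x => c * f x) = c * X f.
Proof.
move=> Af; have [lin _] := lieX; have := lin c _ _ Af (subalg_cst subA 0).
by rewrite lie0 addr0 => <-; congr X; apply: funext => x; rewrite addr0.
Qed.

Lemma lieM f g : A f -> A g -> X (fun x => f x * g x) = f 1%g * X g + X f * g 1%g.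
Proof. by have [_] := lieX; exact. Qed.

Lemma lie_sum (I : Type) (r : seq I) (F : I -> G -> C) : (forall i, A (F i)) ->
  X (fun x => \sum_(i <- r) F i x) = \sum_(i <- r) X (F i).
Proof.
move=> AF; elim: r => [|i r IH].
  by under eq_fun do rewrite big_nil; rewrite big_nil lie0.
under eq_fun do rewrite big_cons; rewrite big_cons lieD ?IH //.
exact: (subalg_sum subA).
Qed.

Lemma lie_cst c : X (fun=> c) = 0.
Proof.
have A1 := subalg_cst subA 1.
have X1 : X (fun=> 1) = 0.
  have := lieM A1 A1; rewrite !(mul1r, mulr1).
  by move/eqP; rewrite -[X in X == _]addr0 (can_eq (addKr _)) eq_sym => /eqP.
rewrite (_ : (fun=> c) = fun x => c * 1); first by rewrite lieZ // X1 mulr0.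
by apply: funext => x; rewrite mulr1.
Qed.

Lemma left_inv_coord f : A f -> A (left_inv X f).
Proof.
move=> /coord_ring_mul[n [p [q [Apq fE]]]].
rewrite (_ : left_inv X f = fun x => \sum_(i < n) X (q i) * p i x).
  by apply: (subalg_sum subA) => i _; apply: (subalgZ subA); have [] := Apq i.
apply: funext => x; rewrite /left_inv; under eq_fun do rewrite fE.
rewrite lie_sum => [|i]; last by apply: (subalgZ subA); have [] := Apq i.
by apply: eq_bigr => i _; have [_ Aq] := Apq i; rewrite lieZ // mulrC.
Qed.

Lemma left_invD f g : A f -> A g ->
  left_inv X (fun x => f x + g x) = fun x => left_inv X f x + left_inv X g x.
Proof.
by move=> Af Ag; apply: funext => x; rewrite /left_inv lieD //; exact: coord_ring_left.
Qed.

Lemma left_invZ c f : A f ->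
  left_inv X (fun x => c * f x) = fun x => c * left_inv X f x.
Proof.
by move=> Af; apply: funext => x; rewrite /left_inv lieZ //; exact: coord_ring_left.
Qed.

Lemma left_invM f g : A f -> A g ->
  left_inv X (fun x => f x * g x) = fun x => f x * left_inv X g x + left_inv X f x * g x.
Proof.
move=> Af Ag; apply: funext => x; rewrite /left_inv lieM ?mulg1 //; exact: coord_ring_left.
Qed.

End OneDerivation.

Lemma left_inv_left (X : (G -> C) -> C) f a : left_inv X (fun x => f (a * x)%g) = fun x => left_inv X f (a * x)%g.
Proof.
apply: funext => x; rewrite /left_inv; congr X; apply: funext => y.
by rewrite mulgA.
Qed.

Lemma left_inv_bracket (X Y : (G -> C) -> C) f : left_inv (bracket X Y) f =
  fun x => left_inv X (left_inv Y f) x - left_inv Y (left_inv X f) x.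
Proof.
by apply: funext => x; rewrite {1}/left_inv /bracket !left_inv_left.
Qed.

Lemma left_inv_at1 (X : (G -> C) -> C) f : left_inv X f 1%g = X f.
Proof. by rewrite /left_inv; under eq_fun do rewrite mul1g. Qed.

End PointDerivations.

Notation coord_subalg := (coord_ring_subalgebra _).

Section CotangentBasis.
Variables (C : numClosedFieldType) (G : affineGroup C) (E : set (G -> C)).
Hypothesis finE : finite_set E.
Hypothesis AE : coord_ring G = algebra_generated E.
Local Notation A := (coord_ring G).
Local Notation mpow := (max_ideal_pow E 1%g).

Let spans_mod r (x : 'I_r -> G -> C) :=
  (forall i, A (x i) /\ x i 1%g = 0) /\
  forall f, A f -> exists l : 'I_r -> C,
    mpow 2 (fun y => f y - f 1%g - \sum_i l i * x i y).

Let A_mpow n f : mpow n f -> A f.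
Proof. by rewrite AE; exact: max_ideal_powA. Qed.

Let A_mpowM n a f : A a -> mpow n f -> mpow n (fun x => a x * f x).
Proof. by rewrite AE; exact: max_ideal_powM. Qed.

Let A_mpow1 f : A f -> f 1%g = 0 -> mpow 1 f.
Proof. by rewrite AE; exact: max_ideal_pow1. Qed.

Let A_mpowS n a b : A a -> a 1%g = 0 -> mpow n b -> mpow n.+1 (fun x => a x * b x).
Proof. by rewrite AE; exact: max_ideal_powS. Qed.

Let mpowB n f g : mpow n f -> mpow n g -> mpow n (fun x => f x - g x).
Proof.
move=> Hf Hg; apply: max_ideal_powD => //; under eq_fun do rewrite -mulN1r.
exact: (A_mpowM (subalg_cst coord_subalg _) Hg).
Qed.

Let spans_ex : exists r (x : 'I_r -> G -> C), spans_mod x.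
Proof.
have /finite_seqP[s Es] := finE.
pose x (i : 'I_(size s)) y := nth (fun=> 0) s i y - nth (fun=> 0) s i 1%g.
have As i : (i < size s)%N -> A (nth (fun=> 0) s i).
  by move=> lt_i; rewrite AE Es; apply: algebra_generated_sub => /=; exact: mem_nth.
exists (size s), x; split=> [i|f].
  split; last by rewrite /x subrr.
  by apply: (subalgB coord_subalg); [exact: As | exact: (subalg_cst coord_subalg)].
move=> Af; suff : A f /\ exists l : 'I_(size s) -> C,
    mpow 2 (fun y => f y - f 1%g - \sum_i l i * x i y) by case.
move: f Af; rewrite {1}AE; apply: algebra_generated_min.
  split=> [c|f g [Af [l Hl]] [Ag [k Hk]]|f g [Af [l Hl]] [Ag [k Hk]]].
  - split; first exact: (subalg_cst coord_subalg).
    exists (fun=> 0); rewrite (_ : (fun y => _) = fun=> 0); first exact: max_ideal_pow0.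
    by apply: funext => y; rewrite subrr sub0r big1 ?oppr0 // => i _; rewrite mul0r.
  - split; first exact: (subalgD coord_subalg).
    exists (fun i => l i + k i); have := max_ideal_powD Hl Hk; congr (mpow 2 _).
    apply: funext => y; rewrite [in RHS](eq_bigr (fun i => l i * x i y + k i * x i y)).
      by rewrite big_split /=; ring.
    by move=> i _; rewrite mulrDl.
  - split; first exact: (subalgM coord_subalg).
    exists (fun i => l i * g 1%g + f 1%g * k i).
    have H1 := A_mpowM (subalg_cst coord_subalg (g 1%g)) Hl.
    have H2 := A_mpowM (subalg_cst coord_subalg (f 1%g)) Hk.
    have H3 : mpow 2 (fun y => (f y - f 1%g) * (g y - g 1%g)).
      apply: A_mpowS; rewrite ?subrr //; first by apply: (subalgB coord_subalg) => //; exact: (subalg_cst coord_subalg).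
      apply: A_mpow1; rewrite ?subrr //; by apply: (subalgB coord_subalg) => //; exact: (subalg_cst coord_subalg).
    have := max_ideal_powD H3 (max_ideal_powD H1 H2); congr (mpow 2 _).
    apply: funext => y.
    rewrite [in RHS](eq_bigr (fun i => g 1%g * (l i * x i y) + f 1%g * (k i * x i y))).
      by rewrite big_split /= -!mulr_sumr; ring.
    by move=> i _; ring.
move=> e Ee; split; first by rewrite AE; exact: algebra_generated_sub.
have es : e \in s by move: Ee; rewrite Es.
have lt_e : (index e s < size s)%N by rewrite index_mem.
exists (fun i => (i == Ordinal lt_e)%:R).
rewrite (_ : (fun y => _) = fun=> 0); first exact: max_ideal_pow0.
apply: funext => y; rewrite (bigD1 (Ordinal lt_e)) //= eqxx mul1r big1.
  by rewrite addr0 /x /= nth_index // subrr.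
by move=> i /negPf ->; rewrite mul0r.
Qed.

(** A spanning family of m / m^2 of least size is a basis. Its coordinate functions are determined
    modulo m^2; by this uniqueness they are linear and satisfy Leibniz' rule, hence are point
    derivations. *)
Lemma cotangent_basis : exists r (x : 'I_r -> G -> C) (X : 'I_r -> (G -> C) -> C),
  [/\ forall i, A (x i) /\ x i 1%g = 0, forall i, lie (X i) &
   forall f, A f -> mpow 2 (fun y => f y - f 1%g - \sum_i X i f * x i y)].
Proof.
have exr : exists r, `[< exists x : 'I_r -> G -> C, spans_mod x >].
  by have [r [x Hx]] := spans_ex; exists r; apply/asboolP; exists x.
case: (ex_minnP exr) => -[|r] /asboolP[x [x0 xP]] minr.
  exists 0%N, x, (fun=> fun=> 0); split=> // [[]//|f Af].
  have [l] := xP f Af; congr (mpow 2 _).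
  by apply: funext => y; rewrite !big_ord0.
have indep (l : 'I_r.+1 -> C) : mpow 2 (fun y => \sum_i l i * x i y) -> forall i, l i = 0.
  move=> Hl j; apply/eqP; apply: contrapT => /negP nz.
  suff : (r.+1 <= r)%N by rewrite ltnn.
  apply: minr; apply/asboolP; exists (x \o lift j); split=> [i|f Af]; first exact: x0.
  have [k Hk] := xP f Af.
  exists (fun i => k (lift j i) - k j / l j * l (lift j i)).
  have := max_ideal_powD Hk (A_mpowM (subalg_cst coord_subalg (k j / l j)) Hl).
  congr (mpow 2 _); apply: funext => y /=.
  rewrite !(bigD1_ord j) //=.
  rewrite [in RHS](eq_bigr (fun i => k (lift j i) * x (lift j i) y
      - k j / l j * (l (lift j i) * x (lift j i) y))) => [|i _]; last by ring.
  by rewrite sumrB -mulr_sumr; field.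
have [l lP] : exists l : (G -> C) -> 'I_r.+1 -> C,
   forall f, A f -> mpow 2 (fun y => f y - f 1%g - \sum_i l f i * x i y).
  have /choice[l lP] : forall f, exists l : 'I_r.+1 -> C, A f ->
      mpow 2 (fun y => f y - f 1%g - \sum_i l i * x i y).
    move=> f; have [Af|nAf] := pselect (A f); last by exists (fun=> 0).
    by have [l Hl] := xP f Af; exists l.
  by exists l.
have uniq_l f k : A f -> mpow 2 (fun y => f y - f 1%g - \sum_i k i * x i y) -> k = l f.
  move=> Af Hk; apply: funext => i; apply/eqP; rewrite -subr_eq0; apply/eqP; move: i.
  apply: indep; have := mpowB (lP f Af) Hk; congr (mpow 2 _).
  apply: funext => y; rewrite [in RHS](eq_bigr (fun i => k i * x i y - l f i * x i y)) => [|i _].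
    by rewrite sumrB; ring.
  by rewrite mulrBl.
exists r.+1, x, (fun i f => l f i); split=> // i; split=> [c f g Af Ag|f g Af Ag].
  have AD : A (fun x => c * f x + g x).
    by apply: (subalgD coord_subalg) => //; exact: (subalgZ coord_subalg).
  rewrite -(uniq_l _ (fun i => c * l f i + l g i) AD) //.
  have := max_ideal_powD (A_mpowM (subalg_cst coord_subalg c) (lP f Af)) (lP g Ag).
  congr (mpow 2 _); apply: funext => y.
  rewrite [in RHS](eq_bigr (fun i => c * (l f i * x i y) + l g i * x i y)) => [|j _]; last by ring.
  by rewrite big_split /= -mulr_sumr; ring.
have AM : A (fun x => f x * g x) by exact: (subalgM coord_subalg).
rewrite -(uniq_l _ (fun i => f 1%g * l g i + l f i * g 1%g) AM) //.
have H1 := A_mpowM (subalg_cst coord_subalg (g 1%g)) (lP f Af).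
have H2 := A_mpowM (subalg_cst coord_subalg (f 1%g)) (lP g Ag).
have H3 : mpow 2 (fun y => (f y - f 1%g) * (g y - g 1%g)).
  apply: A_mpowS; rewrite ?subrr //; first by apply: (subalgB coord_subalg) => //; exact: (subalg_cst coord_subalg).
  apply: A_mpow1; rewrite ?subrr //; by apply: (subalgB coord_subalg) => //; exact: (subalg_cst coord_subalg).
have := max_ideal_powD H3 (max_ideal_powD H1 H2); congr (mpow 2 _).
apply: funext => y.
rewrite [in RHS](eq_bigr (fun i => g 1%g * (l f i * x i y) + f 1%g * (l g i * x i y))).
  by rewrite big_split /= -!mulr_sumr; ring.
by move=> j _; ring.
Qed.

End CotangentBasis.

(** * Functions that vanish to infinite order at the identity *)

Section IdentityPrinciple.
Variables (C : numClosedFieldType) (G : affineGroup C).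
Variables (I : Type) (X : I -> (G -> C) -> C).
Hypothesis lieX : forall i, lie (X i).
Hypothesis genX : forall L : set ((G -> C) -> C), lie_subalgebra L ->
  (forall i, L (X i)) -> forall Y, lie Y -> L Y.
Local Notation A := (coord_ring G).
Local Notation subA := (coord_ring_subalgebra G).

Definition deriv_word (w : seq I) (f : G -> C) : G -> C :=
  foldr (fun i => left_inv (X i)) f w.

Lemma deriv_word_coord w f : A f -> A (deriv_word w f).
Proof. by move=> Af; elim: w => //= i w; exact: left_inv_coord. Qed.

Lemma deriv_word_rcons w i f :
  deriv_word (rcons w i) f = deriv_word w (left_inv (X i) f).
Proof. exact: foldr_rcons. Qed.

Lemma deriv_wordD w f g : A f -> A g ->
  deriv_word w (fun x => f x + g x) = fun x => deriv_word w f x + deriv_word w g x.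
Proof.
move=> Af Ag; elim: w => //= i w ->.
by rewrite left_invD //; exact: deriv_word_coord.
Qed.

Lemma deriv_wordZ w c f : A f ->
  deriv_word w (fun x => c * f x) = fun x => c * deriv_word w f x.
Proof.
move=> Af; elim: w => //= i w ->.
by rewrite left_invZ //; exact: deriv_word_coord.
Qed.

Lemma deriv_word_left w f a :
  deriv_word w (fun x => f (a * x)%g) = fun x => deriv_word w f (a * x)%g.
Proof. by elim: w => //= i w ->; rewrite left_inv_left. Qed.

(** Vanishing to infinite order at 1, tested along words in the given generators only. *)
Let flat f := A f /\ forall w, deriv_word w f 1%g = 0.

Let flatD f g : flat f -> flat g -> flat (fun x => f x + g x).
Proof.
move=> [Af f0] [Ag g0]; split; first exact: (subalgD subA).
by move=> w; rewrite deriv_wordD // f0 g0 addr0.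
Qed.

Let flatZ c f : flat f -> flat (fun x => c * f x).
Proof.
move=> [Af f0]; split; first exact: (subalgZ subA).
by move=> w; rewrite deriv_wordZ // f0 mulr0.
Qed.

Let flat_gen i f : flat f -> flat (left_inv (X i) f).
Proof.
move=> [Af f0]; split; first exact: left_inv_coord.
by move=> w; rewrite -deriv_word_rcons.
Qed.

(** The derivations that preserve flatness form a Lie subalgebra containing the generators, so
    [genX] reaches all of Lie(G). *)
Let flat_lie Y f : lie Y -> flat f -> flat (left_inv Y f).
Proof.
move=> lieY; move: f; apply: (genX (L := fun Y => forall f, flat f -> flat (left_inv Y f))) lieY => //.
split=> [f Ff|c Y1 Z HY HZ f Ff|Y1 Z HY HZ f Ff|Y1 Z YZ HY f Ff].
- have := flatZ 0 Ff; congr flat; apply: funext => x.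
  by rewrite mul0r.
- by have := flatD (flatZ c (HY f Ff)) (HZ f Ff).
- rewrite left_inv_bracket.
  have := flatD (HY _ (HZ f Ff)) (flatZ (-1) (HZ _ (HY f Ff))); congr flat.
  by apply: funext => x; rewrite mulN1r.
- have := HY f Ff; congr flat; apply: funext => x; apply: YZ.
  by apply: coord_ring_left; have [] := Ff.
Qed.

Variable E : set (G -> C).
Hypothesis finE : finite_set E.
Hypothesis AE : A = algebra_generated E.
Local Notation mpow := (max_ideal_pow E 1%g).

(* Euler's identity: the operator \sum_i x_i X_i acts on m^n / m^(n+1) as n. *)
Let flat_mpow n f : flat f -> mpow n f.
Proof.
have [r [x [Y [x0 lieY xY]]]] := cotangent_basis finE AE.
have euler k g : mpow k g ->
    mpow k.+1 (fun y => k%:R * g y - \sum_i x i y * left_inv (Y i) g y).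
  elim: k g => [|k IH] g.
    move=> Hg; have Ag : A g by rewrite AE; exact: Hg.
    apply: max_ideal_pow1; rewrite -?AE.
      apply: (subalgB subA); first exact: (subalgZ subA).
      by apply: (subalg_sum subA) => i _; apply: (subalgM subA);
        [have [] := x0 i | exact: left_inv_coord].
    rewrite mul0r big1 ?subr0 // => i _.
    by have [_ ->] := x0 i; rewrite mul0r.
  move=> Hg; suff : A g /\ mpow k.+2 (fun y => k.+1%:R * g y -
     \sum_i x i y * left_inv (Y i) g y) by case.
  apply: (Hg (fun g => A g /\ mpow k.+2 (fun y => k.+1%:R * g y -
     \sum_i x i y * left_inv (Y i) g y))).
  - split; first exact: (subalg_cst subA).
    rewrite (_ : (fun y => _) = fun=> 0); first exact: max_ideal_pow0.
    apply: funext => y; rewrite mulr0 big1 ?subr0 // => i _.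
    by rewrite /left_inv lie0 // mulr0.
  - move=> f1 f2 [A1 H1] [A2 H2]; split; first exact: (subalgD subA).
    have := max_ideal_powD H1 H2; congr (mpow _ _); apply: funext => y.
    rewrite [in RHS](eq_bigr (fun i => x i y * left_inv (Y i) f1 y +
      x i y * left_inv (Y i) f2 y)) => [|i _].
      by rewrite big_split /=; ring.
    by rewrite left_invD // mulrDr.
  move=> a b Aa a0 Hb; have Ab : A b by rewrite AE; exact: max_ideal_powA Hb.
  rewrite -AE in Aa; split; first exact: (subalgM subA).
  have Hab : mpow 2 (fun y => a y - \sum_i x i y * left_inv (Y i) a y).
    have Ha := xY a Aa.
    have H2 : mpow 2 (fun y => \sum_i (- x i y) * (left_inv (Y i) a y - left_inv (Y i) a 1%g)).
      apply: max_ideal_pow_sum => i; have [Ax xi0] := x0 i.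
      apply: max_ideal_powS; rewrite -?AE ?xi0 ?oppr0 //; first exact: (subalgN subA).
      apply: max_ideal_pow1; rewrite -?AE ?subrr //.
      by apply: (subalgB subA); [exact: left_inv_coord | exact: (subalg_cst subA)].
    have := max_ideal_powD Ha H2; congr (mpow _ _); apply: funext => y.
    rewrite a0 subr0.
    rewrite [X in _ + X](eq_bigr (fun i => Y i a * x i y - x i y * left_inv (Y i) a y)).
      by rewrite sumrB; ring.
    by move=> i _; rewrite left_inv_at1; ring.
  have T1 := @max_ideal_powS _ _ E 1%g k.+1 a _ (eq_ind _ (fun s : set _ => s a) Aa _ AE) a0 (IH b Hb).
  have T2 := max_ideal_powMM Hab Hb.
  have := max_ideal_powD T1 T2; congr (mpow _ _); apply: funext => y.
  rewrite [in RHS](eq_bigr (fun i => a y * (x i y * left_inv (Y i) b y) +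
      x i y * left_inv (Y i) a y * b y)) => [|i _].
    by rewrite big_split /= -mulr_sumr -mulr_suml -natr1; ring.
  by rewrite left_invM //; ring.
elim: n f => [|n IH] f Ff.
  have [Af _] := Ff; have : algebra_generated E f by rewrite -AE.
  exact.
(* Euler's identity has the factor 0 on m^0, so the first power is treated directly. Afterwards [f]
   and its derivatives lie in m^(n+1) by induction, the sum in the identity lies in m^(n+2), and the
   factor n+1 is invertible in characteristic 0. *)
case: n IH => [|n] IH.
  by apply: max_ideal_pow1; have [Af f0] := Ff; [rewrite -AE | exact: (f0 [::])].
have H1 := euler _ _ (IH f Ff).
have H2 : mpow n.+2 (fun y => \sum_i x i y * left_inv (Y i) f y).
  apply: max_ideal_pow_sum => i; have [Ax xi0] := x0 i.
  by apply: max_ideal_powS; rewrite -?AE //; apply: IH; exact: flat_lie.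
have := max_ideal_powM (a := fun=> n.+1%:R^-1) _ (max_ideal_powD H1 H2).
rewrite -AE => /(_ (subalg_cst subA _)); congr (mpow _ _); apply: funext => y.
by rewrite subrK mulKf // pnatr_eq0.
Qed.

Hypothesis connG : connected_group G.

(** The points where [f] is flat form a closed set. Its complement is closed as well: by Krull's
    theorem, near a flat point [f] vanishes identically on a principal open set. Since 1 is a flat
    point, connectedness gives every point. *)
Lemma flat_eq0_ f : A f -> (forall w, deriv_word w f 1%g = 0) -> forall x, f x = 0.
Proof.
move=> Af f0.
pose Z1 := [set x : G | forall w, deriv_word w f x = 0].
have closedZ1 : zariski_closed Z1.
  exists [set g | exists w, g = deriv_word w f]; split.
    by move=> _ [w ->]; exact: deriv_word_coord.
  apply/seteqP; split=> x /= Hx => [_ [w ->]|w]; first exact: Hx.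
  by apply: Hx; exists w.
have localZ1 x : Z1 x -> exists a, [/\ A a, a 1%g = 0 &
    forall y w, a y != 1 -> deriv_word w f (x * y)%g = 0].
  move=> Zx; have Fx : flat (fun y => f (x * y)%g).
    split; first exact: coord_ring_left.
    by move=> w; rewrite deriv_word_left mulg1.
  have [a [Aa a0 aE]] := krull_intersection finE (fun n => flat_mpow n Fx).
  rewrite -AE in Aa; exists a; split=> // y w ay1.
  (* Krull's theorem gives (1 - a) f = 0 for the translated function. Differentiating, a power of 1
     - a kills each iterated derivative; the exponent doubles every time, to absorb the second term
     of Leibniz' rule. *)
  have : exists n, forall z, (1 - a z) ^+ n * deriv_word w (fun y => f (x * y)%g) z = 0.
    elim: w => [|i w [n IHn]].
      by exists 1%N => z; rewrite expr1 mulrBl mul1r /= -aE subrr.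
    have A1a : A (fun z => (1 - a z) ^+ n).
      by apply: (subalgX subA); apply: (subalgB subA) => //; exact: (subalg_cst subA).
    have Agw : A (deriv_word w (fun y => f (x * y)%g)).
      by apply: deriv_word_coord; exact: coord_ring_left.
    exists (n + n)%N => z /=.
    have := left_invM (lieX i) A1a Agw => /(congr1 (fun h => h z)).
    rewrite (_ : (fun z => _ * deriv_word _ _ z) = fun=> 0); last exact: funext.
    rewrite [in X in X -> _]/left_inv lie0 // -/(left_inv (X i) _ z) => /esym E0.
    have := congr1 (fun t => (1 - a z) ^+ n * t) E0; rewrite mulr0 mulrDr mulrA -exprD.
    by rewrite [X in _ + X]mulrCA IHn mulr0 addr0.
  move=> [n /(_ y)]; rewrite deriv_word_left => /eqP; rewrite mulf_eq0 expf_eq0 subr_eq0.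
  by rewrite eq_sym (negPf ay1) andbF => /eqP.
have closedZ2 : zariski_closed (~` Z1).
  have /choice[a aP] : forall x : G, exists a, Z1 x -> [/\ A a, a 1%g = 0 &
      forall y w, a y != 1 -> deriv_word w f (x * y)%g = 0].
    move=> x; have [/localZ1[a Ha]|nZ] := pselect (Z1 x); first by exists a.
    by exists (fun=> 0).
  exists [set g | exists2 x, Z1 x & g = fun y => 1 - a x (x^-1 * y)%g]; split.
    move=> _ [x Zx ->]; have [Aa _ _] := aP x Zx.
    by apply: (subalgB subA); [exact: (subalg_cst subA) | exact: coord_ring_left].
  apply/seteqP; split=> y /=.
    move=> nZ _ [x Zx ->]; apply/eqP; rewrite subr_eq0 eq_sym; apply: contrapT => /negP ne1.
    apply: nZ => w; have [_ _ H] := aP x Zx.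
    by have := H _ w ne1; rewrite mulgA mulgV mul1g.
  move=> H Zy; have := H _ (ex_intro2 _ _ y Zy erefl).
  have [_ a1 _] := aP y Zy; rewrite mulVg a1 subr0 => /eqP.
  by rewrite oner_eq0.
have := connG closedZ1 closedZ2; rewrite setUCr setICr setI0 => /(_ _ _) [] //.
- by move=> H x; exact: (H x Logic.I [::]).
- by move=> /(_ 1%g Logic.I); case.
Qed.

End IdentityPrinciple.

Lemma flat_eq0 (C : numClosedFieldType) (G : affineGroup C) (I : Type)
    (X : I -> (G -> C) -> C) :
  (forall i, lie (X i)) ->
  (forall L : set ((G -> C) -> C), lie_subalgebra L ->
     (forall i, L (X i)) -> forall Y, lie Y -> L Y) ->
  connected_group G ->
  forall f, coord_ring G f -> (forall w, deriv_word X w f 1%g = 0) ->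
  forall x, f x = 0.
Proof.
move=> lieX genX connG; have [E [finE AE]] := coord_ring_fingen G.
exact: (flat_eq0_ lieX genX finE AE connG).
Qed.

(** * Rational representations *)

Section IndependentFunctions.
Variables (C : fieldType) (X : Type).

(** Choose points for which the evaluation matrix has the largest rank. A relation between its rows
    persists when any further point is added, as the rank cannot grow; it would then hold
    everywhere, so the rows are independent and the matrix has a right inverse. *)
Lemma indep_functions_points n (p : 'I_n -> X -> C) :
  (forall l : 'rV[C]_n, (forall x, \sum_i l 0 i * p i x = 0) -> l = 0) ->
  exists m (z : 'I_m -> X) (N : 'M[C]_(m, n)),
    (\matrix_(i, j) p i (z j)) *m N = 1%:M.
Proof.
move=> indep.
pose rk r := `[< exists m (z : 'I_m -> X), \rank (\matrix_(i < n, j < m) p i (z j)) = r >].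
have ex_rk : exists r, rk r.
  exists 0%N; apply/asboolP; exists 0%N, (fun i : 'I_0 => match i with Ordinal _ H => False_rect X (notF H) end).
  by apply/eqP; rewrite mxrank_eq0; apply/eqP/matrixP => i [].
have bnd r : rk r -> (r <= n)%N.
  by move=> /asboolP[m [z <-]]; exact: rank_leq_row.
case: (ex_maxnP ex_rk bnd) => r /asboolP[m [z zr]] maxr.
set M := \matrix_(i, j) _ in zr.
suff /row_freeP[N MN] : row_free M by exists m, z, N.
rewrite -kermx_eq0; apply: contrapT => /negP nz.
have [l lM l0] : exists2 l : 'rV_n, l *m M = 0 & l != 0.
  have [i ri] : exists i, row i (kermx M) != 0.
    apply: contrapT => /forallNP H; case/negP: nz; apply/eqP/row_matrixP => i.
    by rewrite row0; apply/eqP; apply: contrapT => /negP; exact: H.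
  by exists (row i (kermx M)) => //; rewrite -row_mul mulmx_ker row0.
case/eqP: l0; apply: indep => x.
pose z' (j : 'I_(m + 1)) := match split j with inl j => z j | inr _ => x end.
pose M' := \matrix_(i < n, j < m + 1) p i (z' j).
have M'E : M' = row_mx M (\col_i p i x).
  apply/matrixP => i j; rewrite !mxE /z'; case: split => k; by rewrite !mxE.
have leM' : (\rank M' <= \rank M)%N.
  by rewrite zr; apply: maxr; apply/asboolP; exists (m + 1)%N, z'.
have lM' : l *m M' = 0.
  have sub : (kermx M' <= kermx M)%MS.
    apply/sub_kermxP; have := mulmx_ker M'; rewrite {2}M'E mul_mx_row.
    by move=> /(congr1 lsubmx); rewrite row_mxKl => ->; apply/matrixP => i j; rewrite !mxE.
  have eqk : (kermx M <= kermx M')%MS.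
    by rewrite -(mxrank_leqif_sup sub) eqn_leq mxrankS //= !mxrank_ker leq_sub2l.
  by apply/sub_kermxP; apply: submx_trans eqk; exact/sub_kermxP.
have := congr1 (fun v : 'rV_(m + 1) => v 0 (rshift m ord0)) lM'.
rewrite !mxE => H; rewrite -[RHS]H; apply: eq_bigr => i _.
by rewrite !mxE /z' -/(unsplit (inr ord0)) unsplitK.
Qed.

End IndependentFunctions.

Section Representations.
Variables (C : numClosedFieldType) (G : affineGroup C).
Local Notation A := (coord_ring G).
Local Notation subA := (coord_ring_subalgebra G).

Definition matrix_coefs n (rho : G -> 'M[C]_n) : set (G -> C) :=
  [set f | exists i j, f = fun x => rho x i j].

(** Take a decomposition with the fewest terms: a linear relation among the left or the right
    factors would allow one term to be eliminated. *)
Lemma coord_ring_coproduct f : A f -> exists n (p q : 'I_n -> G -> C),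
  [/\ forall i, A (p i) /\ A (q i),
      forall x y, f (x * y)%g = \sum_i p i x * q i y,
      forall l : 'rV[C]_n, (forall x, \sum_i l 0 i * p i x = 0) -> l = 0 &
      forall l : 'rV[C]_n, (forall x, \sum_i l 0 i * q i x = 0) -> l = 0].
Proof.
move=> Af.
pose cop n := `[< exists p q : 'I_n -> G -> C, (forall i, A (p i) /\ A (q i)) /\
   forall x y, f (x * y)%g = \sum_i p i x * q i y >].
have ex_cop : exists n, cop n.
  by have [n [p [q H]]] := coord_ring_mul Af; exists n; apply/asboolP; exists p, q.
case: (ex_minnP ex_cop) => n /asboolP[p [q [Apq fE]]] minn.
exists n, p, q; case: n p q Apq fE minn => [|n] p q Apq fE minn.
  by split=> // l _; apply/matrixP => ? [].
split=> // l Hl; apply/eqP; apply: contrapT => /negP /rV0Pn[j lj].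
- suff : (n.+1 <= n)%N by rewrite ltnn.
  apply: minn; apply/asboolP; exists (p \o lift j), (fun i x => q (lift j i) x - l 0 (lift j i) / l 0 j * q j x).
  split=> [i|x y].
    split; first by have [] := Apq (lift j i).
    apply: (subalgB subA); first by have [] := Apq (lift j i).
    by apply: (subalgZ subA); have [] := Apq j.
  rewrite fE (bigD1_ord j) //=; have := Hl x; rewrite (bigD1_ord j) //= => H.
  have -> : p j x = - \sum_i l 0 (lift j i) / l 0 j * p (lift j i) x.
    apply: (mulfI lj); rewrite mulrN mulr_sumr; apply/eqP; rewrite -addr_eq0; apply/eqP.
    by rewrite -[RHS]H; congr (_ + _); apply: eq_bigr => i _; field.
  rewrite mulNr mulr_suml -sumrN -big_split; apply: eq_bigr => i _ /=; ring.
- suff : (n.+1 <= n)%N by rewrite ltnn.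
  apply: minn; apply/asboolP; exists (fun i x => p (lift j i) x - l 0 (lift j i) / l 0 j * p j x), (q \o lift j).
  split=> [i|x y].
    split; last by have [] := Apq (lift j i).
    apply: (subalgB subA); first by have [] := Apq (lift j i).
    by apply: (subalgZ subA); have [] := Apq j.
  rewrite fE (bigD1_ord j) //=; have := Hl y; rewrite (bigD1_ord j) //= => H.
  have -> : q j y = - \sum_i l 0 (lift j i) / l 0 j * q (lift j i) y.
    apply: (mulfI lj); rewrite mulrN mulr_sumr; apply/eqP; rewrite -addr_eq0; apply/eqP.
    by rewrite -[RHS]H; congr (_ + _); apply: eq_bigr => i _; field.
  rewrite mulrN mulr_sumr -sumrN -big_split; apply: eq_bigr => i _ /=; ring.
Qed.

(** The left factors of a shortest coproduct span the space of right translates of [f], which is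
    finite-dimensional; right translation on it is the representation. *)
Lemma coord_ring_rep f : A f -> exists n (rho : G -> 'M[C]_n) (xi : 'rV_n) (v : 'cV_n),
  rational_rep rho /\ forall x, f x = (xi *m rho x *m v) 0 0.
Proof.
move=> Af; have [n [p [q [Apq fE pind qind]]]] := coord_ring_coproduct Af.
have [m [z [N zN]]] := indep_functions_points qind.
(* [N] inverts the evaluation of the right factors at the points [z]. It recovers each p_i from
   right translates of [f], whence the matrix of translation by [y] in the family p. *)
pose r y := \matrix_(j < n, i < n) \sum_k q j (y * z k)%g * N k i.
have pr x y i : p i (x * y)%g = \sum_j p j x * r y j i.
  have H k : \sum_j p j (x * y)%g * q j (z k) = \sum_j p j x * q j (y * z k)%g.
    by rewrite -!fE mulgA.
  have : (\row_j p j (x * y)%g) *m (\matrix_(i, j) q i (z j)) *m N =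
      (\row_k \sum_j p j x * q j (y * z k)%g) *m N.
    congr (_ *m _); apply/rowP => k; rewrite !mxE -H; apply: eq_bigr => j _.
    by rewrite !mxE.
  rewrite -mulmxA zN mulmx1 => /rowP/(_ i); rewrite !mxE => ->.
  under [RHS]eq_bigr do rewrite mxE mulr_sumr.
  rewrite exchange_big; apply: eq_bigr => k _; rewrite mxE mulr_suml.
  by apply: eq_bigr => j _; rewrite mulrA.
exists n, r, (\row_j p j 1%g), (\col_i q i 1%g); split.
  split.
  - apply/matrixP => j i; rewrite !mxE; have /matrixP/(_ j i) := zN; rewrite !mxE => <-.
    by apply: eq_bigr => k _; rewrite mxE mul1g.
  - move=> y y'; apply/matrixP => j i; apply/eqP; rewrite -subr_eq0; apply/eqP.
    have /rowP/(_ j) : (\row_j (r (y * y')%g j i - (r y *m r y') j i)) = 0.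
      apply: pind => x; under eq_bigr do rewrite mxE mulrBl.
      rewrite sumrB; apply/eqP; rewrite subr_eq0; apply/eqP.
      have := pr x (y * y')%g i; rewrite mulgA pr => /esym H.
      under eq_bigr do rewrite mulrC; rewrite H.
      under eq_bigr do rewrite pr mulr_suml.
      rewrite exchange_big; apply: eq_bigr => k _; rewrite mxE mulrC mulr_sumr.
      by apply: eq_bigr => l _; rewrite mulrA.
    by rewrite !mxE.
  - move=> j i; under eq_fun do rewrite mxE.
    apply: (subalg_sum subA) => k _; under eq_fun do rewrite mulrC.
    by apply: (subalgZ subA); apply: coord_ring_right; have [] := Apq j.
move=> x; rewrite -{1}[x]mulg1 fE mxE; apply: eq_bigr => i _; rewrite !mxE; congr (_ * _).
by rewrite -{1}[x]mul1g pr; apply: eq_bigr => j _; rewrite [(\row__ _) _ _]mxE.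
Qed.

Lemma rational_rep_sum n m (r1 : G -> 'M[C]_n) (r2 : G -> 'M[C]_m) :
  rational_rep r1 -> rational_rep r2 ->
  rational_rep (fun x => block_mx (r1 x) 0 0 (r2 x)).
Proof.
move=> [r11 r1M r1A] [r21 r2M r2A]; split.
- by rewrite r11 r21 -scalar_mx_block.
- by move=> x y; rewrite mulmx_block !mulmx0 !mul0mx !addr0 add0r r1M r2M.
- move=> i j; rewrite -(splitK i) -(splitK j).
  by case: split => a; case: split => b /=; [under eq_fun do rewrite block_mxEul | under eq_fun do rewrite block_mxEur mxE | under eq_fun do rewrite block_mxEdl mxE| under eq_fun do rewrite block_mxEdr] => //; exact: (subalg_cst subA).
Qed.

Lemma rational_rep_conj n (r : G -> 'M[C]_n) (P : 'M[C]_n) : P \in unitmx ->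
  rational_rep r -> rational_rep (fun x => P *m r x *m invmx P).
Proof.
move=> uP [r1 rM rA]; split.
- by rewrite r1 mulmx1 mulmxV.
- by move=> x y; rewrite rM -!mulmxA mulKmx.
- move=> i j; apply: (subalg_mulmx subA) => k l; last exact: (subalg_cst subA).
  by apply: (subalg_mulmx subA) => // a b; exact: (subalg_cst subA).
Qed.

(** Faithfulness in the strong sense of a closed immersion, as the coordinate ring and the Lie
    algebra both have to be recovered from the matrix coefficients. *)
Definition faithful_rep n (rho : G -> 'M[C]_n) :=
  A = algebra_generated (matrix_coefs rho).

Lemma faithful_rep_ex : exists n (rho : G -> 'M[C]_n), rational_rep rho /\ faithful_rep rho.
Proof.
have [E [/finite_seqP[s ->] AE]] := coord_ring_fingen G.
have As f : f \in s -> A f by move=> fs; rewrite AE; exact: algebra_generated_sub.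
have [n [rho [rat sub]]] : exists n (rho : G -> 'M[C]_n), rational_rep rho /\
    forall f, f \in s -> algebra_generated (matrix_coefs rho) f.
  elim: s As {AE} => [|f s IH] As.
    exists 0%N, (fun=> 1%:M); split=> //; split=> // [x y|[]//].
    by rewrite mulmx1.
  have [|n [r1 [rat1 H1]]] := IH.
    by move=> g gs; apply: As; rewrite inE gs orbT.
  have [m [r2 [xi [v [rat2 fE]]]]] := coord_ring_rep (As f (mem_head _ _)).
  exists (n + m)%N, (fun x => block_mx (r1 x) 0 0 (r2 x)); split.
    exact: rational_rep_sum.
  have subB := algebra_generated_subalgebra (matrix_coefs (fun x => block_mx (r1 x) 0 0 (r2 x))).
  move=> g; rewrite inE => /orP[/eqP ->|/H1].
    rewrite (_ : f = fun x => \sum_j (\sum_k xi 0 k * r2 x k j) * v j 0).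
      apply: (subalg_sum subB) => j _; apply: (subalgM subB); last exact: (subalg_cst subB).
      apply: (subalg_sum subB) => k _; apply: (subalgZ subB).
      apply: algebra_generated_sub; exists (rshift n k), (rshift n j).
      by apply: funext => x; rewrite block_mxEdr.
    by apply: funext => x; rewrite fE mxE; apply: eq_bigr => j _; rewrite mxE.
  move: g; apply: algebra_generated_min => // _ [i [j ->]].
  apply: algebra_generated_sub; exists (lshift m i), (lshift m j).
  by apply: funext => x; rewrite block_mxEul.
exists n, rho; split=> //; rewrite /faithful_rep; apply/seteqP; split.
  rewrite AE; apply: algebra_generated_min => //; exact: algebra_generated_subalgebra.
apply: algebra_generated_min; first exact: subA.
by move=> _ [i [j ->]]; have [_ _] := rat.
Qed.

Section Differential.
Variables (n : nat) (rho : G -> 'M[C]_n).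
Hypothesis rat : rational_rep rho.

Lemma left_inv_rep X i j : lie X ->
  left_inv X (fun x => rho x i j) = fun x => (rho x *m drep rho X) i j.
Proof.
move=> lieX; have [_ rM rA] := rat; apply: funext => x; rewrite /left_inv.
rewrite (_ : (fun y => _) = fun y => \sum_k rho x i k * rho y k j).
  rewrite lie_sum // => [|k]; last exact: (subalgZ subA).
  by rewrite mxE; apply: eq_bigr => k _; rewrite lieZ // mxE.
by apply: funext => y; rewrite rM mxE.
Qed.

Lemma drep_left_inv X Y i j : lie X -> lie Y ->
  X (left_inv Y (fun x => rho x i j)) = (drep rho X *m drep rho Y) i j.
Proof.
move=> lieX lieY; have [_ rM rA] := rat; rewrite left_inv_rep //.
rewrite (_ : (fun x => _) = fun y => \sum_k drep rho Y k j * rho y i k).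
  rewrite lie_sum // => [|k]; last exact: (subalgZ subA).
  by rewrite mxE; apply: eq_bigr => k _; rewrite lieZ // mulrC [in RHS]mxE.
by apply: funext => y; rewrite mxE; apply: eq_bigr => k _; rewrite mulrC.
Qed.

Lemma drep_bracket X Y : lie X -> lie Y ->
  drep rho (bracket X Y) = drep rho X *m drep rho Y - drep rho Y *m drep rho X.
Proof.
by move=> lieX lieY; apply/matrixP => i j; rewrite [LHS]mxE /bracket !drep_left_inv // !mxE.
Qed.

Lemma drep_eq X Y : lie_eq X Y -> drep rho X = drep rho Y.
Proof. by move=> XY; apply/matrixP => i j; rewrite !mxE; apply: XY; have [] := rat. Qed.

Lemma iter_left_inv_rep X k i j : lie X ->
  iter k (left_inv X) (fun x => rho x i j) 1%g = (drep rho X ^+ k) i j.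
Proof.
move=> lieX; have [r1 rM rA] := rat.
suff -> : iter k (left_inv X) (fun x => rho x i j) = fun x => (rho x *m drep rho X ^+ k) i j.
  by rewrite r1 mul1mx.
elim: k => [|k IH] /=; first by apply: funext => x; rewrite expr0 mulmx1.
rewrite IH; apply: funext => x; rewrite /left_inv.
rewrite (_ : (fun y => _) = fun y => \sum_l (drep rho X ^+ k) l j * rho (x * y)%g i l).
  rewrite lie_sum // => [|l]; last by apply: (subalgZ subA); exact: (coord_ring_left (f := fun z => rho z i l) x (rA i l)).
  rewrite exprS mulmxA mxE; apply: eq_bigr => l _; rewrite lieZ //; last exact: (coord_ring_left (f := fun z => rho z i l) x (rA i l)).
  have /(congr1 (fun f => f x)) := left_inv_rep i l lieX; rewrite /left_inv => ->.
  by rewrite mulrC.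
by apply: funext => y; rewrite mxE; apply: eq_bigr => l _; rewrite mulrC.
Qed.

Lemma faithful_lie X : faithful_rep rho -> lie X -> drep rho X = 0 ->
  forall f, A f -> X f = 0.
Proof.
move=> faith lieX X0 f Af; suff : A f /\ X f = 0 by case.
move: f Af; rewrite {1}faith; apply: algebra_generated_min.
  split=> [c|f g [Af f0] [Ag g0]|f g [Af f0] [Ag g0]].
  - by split; [exact: (subalg_cst subA) | exact: lie_cst].
  - by split; [exact: (subalgD subA) | rewrite lieD // f0 g0 addr0].
  - by split; [exact: (subalgM subA) | rewrite lieM // f0 g0 mulr0 mul0r addr0].
move=> _ [i [j ->]]; split; first by have [] := rat.
by have /matrixP/(_ i j) := X0; rewrite !mxE.
Qed.

Lemma faithful_inj x y : faithful_rep rho -> rho x = rho y -> x = y.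
Proof.
move=> faith xy; apply: coord_ring_separates => f; rewrite faith; move: f.
apply: algebra_generated_min; last by move=> _ [i [j ->]]; rewrite xy.
by split=> // f g fE gE; rewrite fE gE.
Qed.

Lemma rep_inv x : rho x *m rho (x^-1)%g = 1%:M.
Proof. by have [r1 rM _] := rat; rewrite -rM mulgV. Qed.

Lemma rep_unit x : rho x \in unitmx.
Proof. by case/mulmx1_unit: (rep_inv x). Qed.

Lemma rep_invmx x : rho (x^-1)%g = invmx (rho x).
Proof. by rewrite -[LHS]mul1mx -(mulVmx (rep_unit x)) -mulmxA rep_inv mulmx1. Qed.

End Differential.

End Representations.

(** * Nilpotent matrices and exponentials *)

Section LinearSubsets.
Variables (C : numClosedFieldType) (V : lmodType C).

Definition linear_set (P : set V) := P 0 /\ forall c u v, P u -> P v -> P (c *: u + v).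

Variable P : set V.
Hypothesis linP : linear_set P.

Lemma linear_setD u v : P u -> P v -> P (u + v).
Proof. by move=> Pu Pv; have [_ H] := linP; have := H 1 u v Pu Pv; rewrite scale1r. Qed.

Lemma linear_setZ c u : P u -> P (c *: u).
Proof. by move=> Pu; have [P0 H] := linP; have := H c u 0 Pu P0; rewrite addr0. Qed.

Lemma linear_setB u v : P u -> P v -> P (u - v).
Proof. by move=> Pu Pv; apply: linear_setD => //; rewrite -scaleN1r; exact: linear_setZ. Qed.

Lemma linear_set_sum (I : Type) (r : seq I) (Q : pred I) (F : I -> V) :
  (forall i, Q i -> P (F i)) -> P (\sum_(i <- r | Q i) F i).
Proof.
move=> PF; elim/big_ind: _ => //; [by have [] := linP | exact: linear_setD].
Qed.

(** The nodes are 1, ..., N, which avoids 0: the curves to be sampled are often defined for non-zero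
    parameters only. *)
Lemma vandermonde_dual N (j0 : 'I_N) : exists c t : 'I_N -> C,
  (forall k, t k != 0) /\
  forall j : 'I_N, \sum_k c k * t k ^+ j = (j == j0)%:R.
Proof.
pose V0 := Vandermonde N (\row_(k < N) (k.+1%:R : C)).
have V0u : V0 \in unitmx.
  rewrite unitmxE unitfE det_Vandermonde; apply/prodf_neq0 => i _; apply/prodf_neq0 => j lt_ij.
  by rewrite !mxE subr_eq0 eqr_nat eqSS gtn_eqF.
exists (fun k => invmx V0 k j0), (fun k => k.+1%:R); split=> [k|j].
  by rewrite pnatr_eq0.
have /matrixP/(_ j j0) := mulmxV V0u; rewrite !mxE => <-.
by apply: eq_bigr => k _; rewrite !mxE mulrC.
Qed.

(** Interpolation expresses each coefficient through finitely many values of the curve. This is how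
    differentiation of one-parameter groups is carried out throughout. *)
Lemma linear_set_coef N (v : 'I_N -> V) :
  (forall t : C, t != 0 -> P (\sum_(j < N) t ^+ j *: v j)) -> forall j, P (v j).
Proof.
move=> H j0; have [c [t [t0 ct]]] := vandermonde_dual j0.
have -> : v j0 = \sum_k c k *: \sum_(j < N) t k ^+ j *: v j.
  under eq_bigr do rewrite scaler_sumr; rewrite exchange_big /=.
  rewrite (eq_bigr (fun j => (j == j0)%:R *: v j)) => [|j _]; last first.
    by under eq_bigr do rewrite scalerA; rewrite -scaler_suml ct.
  rewrite (bigD1 j0) //= eqxx scale1r [X in _ + X]big1 ?addr0 // => j /negPf ->.
  by rewrite scale0r.
by apply: linear_set_sum => k _; apply: linear_setZ; exact: H.
Qed.

End LinearSubsets.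

Section MatrixExponential.
Variable C : numClosedFieldType.

Definition nilpotent_mx n (M : 'M[C]_n) := exists N, M ^+ N = 0.

Definition mexp_upto n N (M : 'M[C]_n) : 'M[C]_n := \sum_(k < N) k`!%:R^-1 *: M ^+ k.

(* Junk value when M is not nilpotent. *)
Definition mexp n (M : 'M[C]_n) : 'M[C]_n :=
  if pselect (nilpotent_mx M) is left H then mexp_upto (projT1 (cid H)) M else 1%:M.

Lemma nilpotent_le n (M : 'M[C]_n) N k : M ^+ N = 0 -> (N <= k)%N -> M ^+ k = 0.
Proof. by move=> MN /subnK <-; rewrite exprD MN mulr0. Qed.

Lemma mexp_upto_le n (M : 'M[C]_n) N N' : M ^+ N = 0 -> (N <= N')%N ->
  mexp_upto N' M = mexp_upto N M.
Proof.
move=> MN le; rewrite /mexp_upto -(subnKC le) big_split_ord /=.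
rewrite [X in _ + X]big1 ?addr0 // => i _.
by rewrite (nilpotent_le MN) ?scaler0 //= leq_addr.
Qed.

Lemma mexpE n (M : 'M[C]_n) N : M ^+ N = 0 -> mexp M = mexp_upto N M.
Proof.
move=> MN; rewrite /mexp; case: pselect => [H|[]]; last by exists N.
move: (projT2 (cid H)); move: (projT1 _) => N' MN'.
by rewrite -(mexp_upto_le MN (leq_maxl N N')) (mexp_upto_le MN' (leq_maxr N N')).
Qed.

Lemma mx_exprZ n (M : 'M[C]_n) c k : (c *: M) ^+ k = c ^+ k *: M ^+ k.
Proof.
elim: k => [|k IH]; first by rewrite !expr0 scale1r.
by rewrite !exprS IH -[LHS]scalemxAl -[X in _ *: X]scalemxAr scalerA.
Qed.

Lemma nilpotentZ n (M : 'M[C]_n) c : nilpotent_mx M -> nilpotent_mx (c *: M).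
Proof. by move=> [N MN]; exists N; rewrite mx_exprZ MN scaler0. Qed.

Lemma mexp_scale n (M : 'M[C]_n) N t : M ^+ N = 0 ->
  mexp (t *: M) = \sum_(k < N) t ^+ k *: (k`!%:R^-1 *: M ^+ k).
Proof.
move=> MN; rewrite (@mexpE _ _ N); last by rewrite mx_exprZ MN scaler0.
by apply: eq_bigr => k _; rewrite mx_exprZ !scalerA mulrC.
Qed.

Lemma mexp0 n : mexp (0 : 'M[C]_n) = 1%:M.
Proof.
rewrite (@mexpE _ _ 1) ?expr1 // /mexp_upto big_ord1 fact0 invr1 scale1r.
by rewrite expr0.
Qed.

Lemma mexp_intertwine n m (A : 'M[C]_(m, n)) (M : 'M[C]_n) (M' : 'M[C]_m) :
  nilpotent_mx M -> nilpotent_mx M' -> A *m M = M' *m A ->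
  A *m mexp M = mexp M' *m A.
Proof.
move=> [N MN] [N' MN'] AM.
rewrite (mexpE (nilpotent_le MN (leq_maxl N N'))) (mexpE (nilpotent_le MN' (leq_maxr N N'))).
rewrite /mexp_upto mulmx_sumr mulmx_suml; apply: eq_bigr => k _.
rewrite -scalemxAr -scalemxAl; congr (_ *: _).
elim: (k : nat) => [|j IH]; first by rewrite !expr0 mulmx1 mul1mx.
by rewrite !exprS mulmxA AM -mulmxA IH mulmxA.
Qed.

Lemma mexp_comm n (A B : 'M[C]_n) : nilpotent_mx A -> nilpotent_mx B ->
  A *m B = B *m A -> nilpotent_mx (A + B) /\ mexp (A + B) = mexp A *m mexp B.
Proof.
move=> [N AN] [N' BN] AB.
have cAB : GRing.comm A B by exact: AB.
have T0 j i : (N <= j)%N || (N' <= i)%N -> A ^+ j * B ^+ i = 0.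
  by case/orP => H; [rewrite (nilpotent_le AN H) mul0r | rewrite (nilpotent_le BN H) mulr0].
have nil : (A + B) ^+ (N + N') = 0.
  rewrite exprDn_comm // big1 // => i _; rewrite T0 ?mul0rn //.
  by have := ltn_ord i; case: (leqP N' i); rewrite ?orbT // orbF; lia.
split; first by exists (N + N')%N.
rewrite (mexpE AN) (mexpE BN) (mexpE nil) /mexp_upto mulmx_suml.
pose T j i := (j`!%:R^-1 * i`!%:R^-1) *: (A ^+ j * B ^+ i).
transitivity (\sum_(0 <= k < N + N') \sum_(0 <= i < N + N' | (i <= k)%N) T (k - i)%N i).
  rewrite big_mkord; apply: eq_bigr => k _; rewrite exprDn_comm // scaler_sumr.
  rewrite -(big_mkord xpredT (fun i => k`!%:R^-1 *: (A ^+ (k - i) * B ^+ i *+ 'C(k, i)))).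
  rewrite (@big_cat_nat _ _ _ k.+1 0 (N + N')) //= [X in _ = _ + X]big_nat_cond.
  rewrite [X in _ = _ + X]big1 => [|i]; last by case/andP => /andP[H _]; rewrite leqNgt H.
  rewrite addr0 big_nat_cond [in RHS]big_nat_cond; apply: eq_big => i.
    by rewrite andbT; case: (ltnP i k.+1) => //; rewrite ?ltnS => ->; rewrite ?andbT.
  case/andP => /andP[_]; rewrite ltnS => le_ik _; rewrite /T -scaler_nat scalerA; congr (_ *: _).
  have fk : (k`!%:R : C) != 0 by rewrite pnatr_eq0 -lt0n fact_gt0.
  apply: (mulfI fk); rewrite mulVKf // -(bin_fact le_ik) !natrM.
  have f1 : (i`!%:R : C) != 0 by rewrite pnatr_eq0 -lt0n fact_gt0.
  have f2 : ((k - i)`!%:R : C) != 0 by rewrite pnatr_eq0 -lt0n fact_gt0.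
  by field; rewrite f1 f2.
rewrite (exchange_big_dep_nat xpredT) //=.
transitivity (\sum_(0 <= i < N + N') \sum_(0 <= j < N) T j i).
  rewrite !big_nat; apply: eq_bigr => i /andP[_ lt_i].
  case: (leqP N' i) => Hi.
    rewrite [LHS]big1 ?[RHS]big1 // => j _; rewrite /T T0 ?scaler0 ?Hi ?orbT //.
  rewrite (@big_cat_nat _ _ _ i 0 (N + N')) //=; last exact: ltnW.
  rewrite [X in X + _]big_nat_cond big1 => [|j /andP[/andP[_ H]]]; last by rewrite leqNgt H.
  rewrite add0r big_nat_cond -[in X in \sum_(X <= _ < _ | _) _](add0n i) big_addn.
  rewrite (@big_cat_nat _ _ _ N 0 (N + N' - i)) //=; last by lia.
  rewrite [X in _ + X]big1_seq => [|j /andP[_]]; last first.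
    by rewrite mem_index_iota addnK => /andP[H _]; rewrite /T T0 ?scaler0 ?H.
  rewrite addr0 big_nat_cond [RHS]big_nat_cond; apply: eq_big => j; last by rewrite addnK.
  by rewrite leq_addl !andbT; case: ltnP => //= Hj; lia.
rewrite (@big_cat_nat _ _ _ N' 0 (N + N')) //=; last exact: leq_addl.
rewrite [X in _ + X]big1_seq => [|i /andP[_]]; last first.
  by rewrite mem_index_iota => /andP[H _]; rewrite big1 // => j _; rewrite /T T0 ?scaler0 ?H ?orbT.
rewrite addr0 exchange_big_nat /= big_mkord; apply: eq_bigr => j _.
rewrite big_mkord mulmx_sumr; apply: eq_bigr => i _.
by rewrite /T -scalemxAr -scalemxAl scalerA mulrC.
Qed.

Lemma nilpotentN n (M : 'M[C]_n) : nilpotent_mx M -> nilpotent_mx (- M).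
Proof. by rewrite -scaleN1r; exact: nilpotentZ. Qed.

Lemma mexpN n (M : 'M[C]_n) : nilpotent_mx M -> mexp M *m mexp (- M) = 1%:M.
Proof.
move=> nM; have cM : M *m - M = - M *m M by rewrite mulmxN mulNmx.
by have [_ <-] := mexp_comm nM (nilpotentN nM) cM; rewrite subrr mexp0.
Qed.

Definition mxad n (A X : 'M[C]_n) : 'M[C]_n := A *m X - X *m A.

(** Left multiplication by [A] and right multiplication by [- A] are commuting nilpotent operators
    on matrices whose sum is ad A, so exp(ad A) is the product of their exponentials. *)
Lemma mexp_conj n (A X : 'M[C]_n) : nilpotent_mx A ->
  exists K, iter K (mxad A) X = 0 /\
  mexp A *m X *m mexp (- A) = \sum_(k < K) k`!%:R^-1 *: iter k (mxad A) X.
Proof.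
move=> nA.
pose L := lin_mx (mulmx A : 'M[C]_n -> 'M_n); pose R := lin_mx (mulmxr (- A) : 'M[C]_n -> 'M_n).
have LX k Y : mxvec Y *m L ^+ k = mxvec (A ^+ k *m Y).
  elim: k Y => [|k IH] Y; first by rewrite !expr0 mul1mx mulmx1.
  by rewrite exprS mulmxA mul_vec_lin IH /= mulmxA exprSr.
have RX k Y : mxvec Y *m R ^+ k = mxvec (Y *m (- A) ^+ k).
  elim: k Y => [|k IH] Y; first by rewrite !expr0 !mulmx1.
  by rewrite exprS mulmxA mul_vec_lin IH /= -mulmxA exprS.
have row_ext (M M' : 'M[C]_(n * n)) : (forall Y, mxvec Y *m M = mxvec Y *m M') -> M = M'.
  by move=> H; apply/row_matrixP => i; rewrite -[M]mul1mx -[M']mul1mx !row_mul -[row i 1%:M]vec_mxK.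
have nL : nilpotent_mx L.
  case: nA => N AN; exists N; apply: row_ext => Y.
  by rewrite LX AN mul0mx linear0 mulmx0.
have nR : nilpotent_mx R.
  case: (nilpotentN nA) => N AN; exists N; apply: row_ext => Y.
  by rewrite RX AN mulmx0 linear0 mulmx0.
have cLR : L *m R = R *m L.
  apply: row_ext => Y; have := LX 1%N; have := RX 1%N; rewrite !expr1 => H1 H2.
  by rewrite !mulmxA H2 H1 H1 H2 mulmxA.
have [[K LRK] LRE] := mexp_comm nL nR cLR.
have adX k Y : mxvec Y *m (L + R) ^+ k = mxvec (iter k (mxad A) Y).
  elim: k Y => [|k IH] Y; first by rewrite expr0 mulmx1.
  rewrite iterSr exprS mulmxA mulmxDr !mul_vec_lin -linearD IH; congr (mxvec (iter _ _ _)).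
  by rewrite /= mulmxN.
exists K; split.
  by apply: (can_inj mxvecK); rewrite -adX LRK mulmx0 linear0.
apply: (can_inj mxvecK); rewrite linear_sum /=.
have mexpX M (f : nat -> 'M[C]_n -> 'M[C]_n) Y : (forall k Y, mxvec Y *m M ^+ k = mxvec (f k Y)) ->
   forall N, M ^+ N = 0 -> mxvec Y *m mexp M = mxvec (\sum_(k < N) k`!%:R^-1 *: f k Y).
  move=> Mf N MN; rewrite (mexpE MN) mulmx_sumr linear_sum; apply: eq_bigr => k _.
  by rewrite -scalemxAr Mf linearZ.
transitivity (mxvec X *m (mexp L *m mexp R)).
  have [N AN] := nA; have [N' AN'] := nilpotentN nA.
  have LN : L ^+ N = 0 by apply: row_ext => Y; rewrite LX AN mul0mx linear0 mulmx0.
  have RN : R ^+ N' = 0 by apply: row_ext => Y; rewrite RX AN' mulmx0 linear0 mulmx0.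
  rewrite mulmxA (mexpX _ _ _ LX _ LN) (mexpX _ _ _ RX _ RN); congr mxvec.
  rewrite (mexpE AN) (mexpE AN') /mexp_upto mulmx_sumr; apply: eq_bigr => k _.
  rewrite -scalemxAr; congr (_ *: (_ *m _)); rewrite mulmx_suml.
  by apply: eq_bigr => j _; rewrite -scalemxAl.
by rewrite -LRE (mexpX _ _ _ adX _ LRK) linear_sum.
Qed.

Lemma mexp_conj_stable n (A : 'M[C]_n) (P : set 'M[C]_n) : nilpotent_mx A ->
  linear_set P -> (forall X, P X -> P (mxad A X)) ->
  forall X, P X -> P (mexp A *m X *m mexp (- A)).
Proof.
move=> nA linP PA X PX; have [K [_ ->]] := mexp_conj X nA.
apply: (linear_set_sum linP) => k _; apply: (linear_setZ linP).
by elim: (k : nat) => //= j; exact: PA.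
Qed.

End MatrixExponential.

(** * Chevalley relations and root subgroups *)

Section ChevalleyMatrices.
Variables (C : numClosedFieldType) (S : finType) (a : S -> S -> int).

Record chevalley_mx n (E F H : S -> 'M[C]_n) : Prop := ChevalleyMx {
  cm_hh : forall s t, mxad (H s) (H t) = 0;
  cm_ef : forall s t, mxad (E s) (F t) = if s == t then H s else 0;
  cm_he : forall s t, mxad (H s) (E t) = (a s t)%:~R *: E t;
  cm_hf : forall s t, mxad (H s) (F t) = - (a s t)%:~R *: F t;
  cm_nilE : forall s, nilpotent_mx (E s);
  cm_nilF : forall s, nilpotent_mx (F s)
}.

Lemma mxadC n (X Y : 'M[C]_n) : mxad X Y = - mxad Y X.
Proof. by rewrite /mxad opprB. Qed.

Lemma mxadDr n (X Y Z : 'M[C]_n) : mxad X (Y + Z) = mxad X Y + mxad X Z.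
Proof. by rewrite /mxad mulmxDr mulmxDl opprD addrACA. Qed.

Lemma mxadZr n c (X Y : 'M[C]_n) : mxad X (c *: Y) = c *: mxad X Y.
Proof. by rewrite /mxad -scalemxAr -scalemxAl scalerBr. Qed.

Lemma mxadZl n c (X Y : 'M[C]_n) : mxad (c *: X) Y = c *: mxad X Y.
Proof. by rewrite mxadC mxadZr -scalerN -mxadC. Qed.

Lemma mxad0r n (X : 'M[C]_n) : mxad X 0 = 0.
Proof. by rewrite /mxad mulmx0 mul0mx subr0. Qed.

Lemma mxadNl n (X Y : 'M[C]_n) : mxad (- X) Y = - mxad X Y.
Proof. by rewrite -scaleN1r mxadZl scaleN1r. Qed.

Lemma mxadxx n (X : 'M[C]_n) : mxad X X = 0.
Proof. by rewrite /mxad subrr. Qed.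

Lemma mxad_jacobi n (X Y Z : 'M[C]_n) :
  mxad X (mxad Y Z) = mxad (mxad X Y) Z + mxad Y (mxad X Z).
Proof.
rewrite /mxad !(mulmxBl, mulmxBr) !mulmxA.
move: (X *m Y *m Z) (X *m Z *m Y) (Y *m Z *m X) (Z *m Y *m X) (Y *m X *m Z) (Z *m X *m Y) => p1 p2 p3 p4 p5 p6.
by apply/matrixP => i j; rewrite !mxE; ring.
Qed.

Lemma mexp_conj1 n (X Y Z : 'M[C]_n) : nilpotent_mx X ->
  mxad X Y = Z -> mxad X Z = 0 -> mexp X *m Y *m mexp (- X) = Y + Z.
Proof.
move=> nX XY XZ; have [K [K0 ->]] := mexp_conj Y nX.
have it k : iter k.+2 (mxad X) Y = 0.
  by elim: k => [|k IH]; rewrite iterS ?IH ?mxad0r //= XY XZ.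
have -> : \sum_(k < K) k`!%:R^-1 *: iter k (mxad X) Y =
    \sum_(k < K + 2) k`!%:R^-1 *: iter k (mxad X) Y.
  rewrite big_split_ord /= [X in _ + X]big1 ?addr0 // => i _ /=.
  suff -> : iter (K + i) (mxad X) Y = 0 by rewrite scaler0.
  by elim: (i : nat) => [|j IH]; rewrite ?addn0 ?addnS //= IH mxad0r.
rewrite addnC big_split_ord /= [X in _ + X]big1 ?addr0 => [|i _]; last by have := it i => /= ->; rewrite scaler0.
by rewrite !big_ord_recl big_ord0 /= !fact0 !invr1 !scale1r addr0 /= XY.
Qed.

Lemma mexp_conj2 n (X Y Z T : 'M[C]_n) : nilpotent_mx X ->
  mxad X Y = Z -> mxad X Z = T -> mxad X T = 0 ->
  mexp X *m Y *m mexp (- X) = Y + Z + 2^-1 *: T.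
Proof.
move=> nX XY XZ XT; have [K [K0 ->]] := mexp_conj Y nX.
have it k : iter k.+3 (mxad X) Y = 0.
  by elim: k => [|k IH]; rewrite iterS ?IH ?mxad0r //= XY XZ XT.
have -> : \sum_(k < K) k`!%:R^-1 *: iter k (mxad X) Y =
    \sum_(k < K + 3) k`!%:R^-1 *: iter k (mxad X) Y.
  rewrite big_split_ord /= [X in _ + X]big1 ?addr0 // => i _ /=.
  suff -> : iter (K + i) (mxad X) Y = 0 by rewrite scaler0.
  by elim: (i : nat) => [|j IH]; rewrite ?addn0 ?addnS //= IH mxad0r.
rewrite addnC big_split_ord /= [X in _ + X]big1 ?addr0 => [|i _]; last by have := it i => /= ->; rewrite scaler0.
by rewrite !big_ord_recl big_ord0 /= !fact0 !invr1 !scale1r addr0 /= XY XZ addrA.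
Qed.

Section OneRep.
Variables (n : nat) (E F H : S -> 'M[C]_n).
Hypothesis cm : chevalley_mx E F H.
Hypothesis a_diag : forall s, a s s = 2.

(** The factorisation of the matrix with rows (0, -1) and (1, 0) into upper, lower and upper
    unipotents with parameters -1, 1, -1. *)
Definition rbar_mx s : 'M[C]_n := mexp (- E s) *m mexp (F s) *m mexp (- E s).

(** [H t] is moved through the three exponentials in turn. All the series stop after at most two
    brackets, the longest being exp(-F) E exp(F) = E + H - F. *)
Lemma rbar_mx_weyl s t :
  H t *m rbar_mx s = rbar_mx s *m (H t - (a t s)%:~R *: H s).
Proof.
have nE := cm_nilE cm s; have nF := cm_nilF cm s.
have nE' := nilpotentN nE; have nF' := nilpotentN nF.
have [hh ef he hf _ _] := cm.
have HE u : mexp (E s) *m H u *m mexp (- E s) = H u - (a u s)%:~R *: E s.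
  apply: mexp_conj1 => //; first by rewrite mxadC he.
  by rewrite -scaleN1r mxadZr mxadZr mxadxx !scaler0.
have HF u : mexp (- F s) *m H u *m mexp (F s) = H u - (a u s)%:~R *: F s.
  rewrite -{2}[F s]opprK; apply: mexp_conj1 => //.
    by rewrite mxadNl -mxadC hf scaleNr.
  by rewrite mxadNl -scaleNr mxadZr mxadxx scaler0 oppr0.
have EF : mexp (- F s) *m E s *m mexp (F s) = E s + H s - F s.
  rewrite -{2}[F s]opprK (@mexp_conj2 _ _ _ (H s) (- 2 *: F s)) //.
  - by rewrite scalerA mulrN mulVf ?pnatr_eq0 // scaleN1r.
  - by rewrite mxadNl -mxadC ef eqxx.
  - by rewrite mxadNl -mxadC hf a_diag.
  - by rewrite mxadZr mxadNl mxadxx oppr0 scaler0.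
have EE : mexp (E s) *m E s *m mexp (- E s) = E s.
  by rewrite (@mexp_conj1 _ _ _ 0) ?addr0 ?mxadxx ?mxad0r.
have mexpN' (u : 'M[C]_n) : nilpotent_mx u -> mexp (- u) *m mexp u = 1%:M.
  by move=> nu; rewrite -{2}[u]opprK mexpN //; exact: nilpotentN.
have K (u X Y : 'M[C]_n) : mexp u *m X *m mexp (- u) = Y -> nilpotent_mx u -> X *m mexp (- u) = mexp (- u) *m Y.
  by move=> <- nu; rewrite !mulmxA mexpN' ?mul1mx.
have K' (u X Y : 'M[C]_n) : mexp (- u) *m X *m mexp u = Y -> nilpotent_mx u -> X *m mexp u = mexp u *m Y.
  by move=> <- nu; rewrite !mulmxA mexpN ?mul1mx.
rewrite /rbar_mx !mulmxA (K _ _ _ (HE t)) // -!mulmxA; congr (_ *m _).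
rewrite [LHS]mulmxA mulmxBl (K' _ _ _ (HF t)) // -scalemxAl (K' _ _ _ EF) //.
rewrite scalemxAr -mulmxBr -!mulmxA; congr (_ *m _).
rewrite (_ : H t - _ - _ = (H t - (a t s)%:~R *: H s) - (a t s)%:~R *: E s); last first.
  by apply/matrixP => i j; rewrite !mxE; ring.
rewrite mulmxBl mulmxBl -!scalemxAl (K _ _ _ (HE t)) // (K _ _ _ (HE s)) // (K _ _ _ EE) // a_diag.
rewrite !scalemxAr -!mulmxBr; congr (_ *m _).
by apply/matrixP => i j; rewrite !mxE; ring.
Qed.

End OneRep.

End ChevalleyMatrices.

Section ChevalleyRep.
Variables (C : numClosedFieldType) (G : affineGroup C) (S : finType).
Variable D : chevalley_data G S.
Local Notation A := (coord_ring G).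
Local Notation subA := (coord_ring_subalgebra G).

Definition gen_ef (b : bool) s := if b then gen_e D s else gen_f D s.

Definition root_elt (b : bool) s (t : C) : G :=
  gen_phi D s (if b then mx2 1 t 0 1 else mx2 1 0 t 1).

Definition word_elt (w : seq (bool * S * C)) : G :=
  foldr (fun p g => root_elt p.1.1 p.1.2 p.2 * g)%g 1%g w.

Lemma word_elt_cat w w' : word_elt (w ++ w') = (word_elt w * word_elt w')%g.
Proof. by elim: w => [|p w IH] /=; rewrite ?mul1g // IH mulgA. Qed.

Lemma det_mx2 (x y z t : C) : \det (mx2 x y z t) = x * t - y * z.
Proof.
rewrite (expand_det_row _ ord0) !big_ord_recl big_ord0 !mxE /= /cofactor !det_mx11 !mxE /=.
by rewrite addr0 expr0 mul1r expr1 mulN1r mulrN.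
Qed.

Lemma mulmx_mx2 (x y z t x' y' z' t' : C) : mx2 x y z t *m mx2 x' y' z' t' =
  mx2 (x * x' + y * z') (x * y' + y * t') (z * x' + t * z') (z * y' + t * t').
Proof.
apply/matrixP => i j; rewrite !mxE big_ord_recl big_ord1 !mxE /=.
by case: ifP; case: ifP.
Qed.

Lemma mx2_1 : mx2 1 0 0 1 = 1%:M :> 'M[C]_2.
Proof.
by apply/matrixP => i j; rewrite !mxE; case: i => [[|[]]] //=; case: j => [[|[]]].
Qed.

Lemma gen_phi1 s : gen_phi D s 1%:M = 1%g.
Proof.
have := @gen_phiM _ _ _ D s 1%:M 1%:M (det1 _ _) (det1 _ _); rewrite mulmx1.
by move=> /(congr1 (fun g => (g * (gen_phi D s 1%:M)^-1)%g)); rewrite -mulgA mulgV mulg1.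
Qed.

Lemma root_elt_V b s t : (root_elt b s t)^-1%g = root_elt b s (- t).
Proof.
have E : (root_elt b s t * root_elt b s (- t))%g = 1%g.
  rewrite /root_elt -gen_phiM; try by case: b; rewrite det_mx2 !(mul0r, mulr0, mulr1, subr0).
  rewrite -(gen_phi1 s); congr gen_phi; case: b; rewrite mulmx_mx2 -mx2_1;
    by rewrite !(mul0r, mulr0, mulr1, mul1r, addr0, add0r, addNr, addrN).
by apply/eqP; rewrite -(inj_eq (can_inj (mulKg (root_elt b s t)))) mulgV E.
Qed.

Lemma gen_ef_lie b s : lie (gen_ef b s).
Proof. by have [? ? ?] := gen_lie D s; case: b. Qed.

Section Rep.
Variables (n : nat) (rho : G -> 'M[C]_n).
Hypothesis rat : rational_rep rho.

Lemma root_elt_exp b s t :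
  is_exp (fun f => t * gen_ef b s f) (root_elt b s t).
Proof. by case: b; [exact: gen_phi_e | exact: gen_phi_f]. Qed.

Lemma lie_scale (X : (G -> C) -> C) c : lie X -> lie (fun f => c * X f).
Proof.
move=> [lX mX]; split=> [d f g Af Ag|f g Af Ag]; first by rewrite lX //; ring.
by rewrite mX //; ring.
Qed.

Lemma drep_scale (X : (G -> C) -> C) c : drep rho (fun f => c * X f) = c *: drep rho X.
Proof. by apply/matrixP => i j; rewrite !mxE. Qed.

(** [is_exp], applied to each matrix coefficient, yields both the nilpotency of the differential and
    the exponential formula. Its bound depends on the coefficient, so the largest one is taken. *)
Lemma rep_root_elt_ b s t : exists N, (t *: drep rho (gen_ef b s)) ^+ N = 0 /\
  rho (root_elt b s t) = mexp_upto N (t *: drep rho (gen_ef b s)).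
Proof.
have [r1 rM rA] := rat.
have ex := root_elt_exp b s t.
have /choice[N HN] : forall p : 'I_n * 'I_n, exists N, (forall k, (N <= k)%N ->
    ((t *: drep rho (gen_ef b s)) ^+ k) p.1 p.2 = 0) /\
    rho (root_elt b s t) p.1 p.2 = (mexp_upto N (t *: drep rho (gen_ef b s))) p.1 p.2.
  move=> [i j] /=; have [N [N0 NE]] := ex _ (rA i j); exists N; split=> [k Nk|].
    rewrite -(N0 k Nk) iter_left_inv_rep ?drep_scale //.
    by apply: lie_scale; exact: gen_ef_lie.
  rewrite NE /mexp_upto summxE; apply: eq_bigr => k _; rewrite mxE; congr (_ * _).
  rewrite iter_left_inv_rep ?drep_scale //.
  by apply: lie_scale; exact: gen_ef_lie.
pose K := \max_p N p.
have K0 : (t *: drep rho (gen_ef b s)) ^+ K = 0.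
  apply/matrixP => i j; have [H _] := HN (i, j); rewrite H ?mxE //.
  exact: (leq_bigmax (i, j)).
exists K; split=> //; apply/matrixP => i j; have [H ->] := HN (i, j).
have le : (N (i, j) <= K)%N by exact: (leq_bigmax (i, j)).
rewrite /mexp_upto -(subnKC le) big_split_ord /= [in RHS]mxE [X in _ = _ + X]summxE.
by rewrite [X in _ + X]big1 ?addr0 // => k _; rewrite mxE H ?mulr0 // leq_addr.
Qed.

Lemma rep_nilpotent b s : nilpotent_mx (drep rho (gen_ef b s)).
Proof. by have [N [H _]] := rep_root_elt_ b s 1; exists N; rewrite scale1r in H. Qed.

Lemma rep_root_elt b s t : rho (root_elt b s t) = mexp (t *: drep rho (gen_ef b s)).
Proof. by have [N [H ->]] := rep_root_elt_ b s t; rewrite (mexpE H). Qed.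

Lemma drep_chevalley : chevalley_mx (cartan D) (fun s => drep rho (gen_e D s))
  (fun s => drep rho (gen_f D s)) (fun s => drep rho (gen_h D s)).
Proof.
have lieE s : lie (gen_e D s) by have [] := gen_lie D s.
have lieF s : lie (gen_f D s) by have [] := gen_lie D s.
have lieH s : lie (gen_h D s) by have [] := gen_lie D s.
split=> s => [t|t|t|t||]; rewrite ?/mxad -?drep_bracket //.
- by rewrite (drep_eq rat (gen_hh D s t)); apply/matrixP => i j; rewrite !mxE.
- by rewrite (drep_eq rat (Defs.gen_ef D s t)); case: eqP => _; apply/matrixP => i j; rewrite !mxE.
- by rewrite (drep_eq rat (gen_he D s t)); apply/matrixP => i j; rewrite !mxE.
- by rewrite (drep_eq rat (gen_hf D s t)); apply/matrixP => i j; rewrite !mxE.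
- exact: (rep_nilpotent true).
- exact: (rep_nilpotent false).
Qed.

Lemma rep_stable_gen m (P : set 'M[C]_(n, m)) b s : linear_set P ->
  (forall t u, P u -> P (rho (root_elt b s t) *m u)) ->
  forall u, P u -> P (drep rho (gen_ef b s) *m u).
Proof.
move=> linP Pst u Pu; have [N NE] := rep_nilpotent b s.
have H := nilpotent_le NE (leq_addr 2 N).
have lt1 : (1 < N + 2)%N by rewrite addn2.
have := @linear_set_coef _ _ P linP (N + 2) (fun k => (k`!%:R^-1 *: drep rho (gen_ef b s) ^+ k) *m u) _ (Ordinal lt1).
rewrite /= expr1 invr1 scale1r; apply=> t _.
have := Pst t u Pu; rewrite rep_root_elt (mexp_scale _ H) mulmx_suml.
rewrite (eq_bigr (fun k : 'I_(N + 2) =>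
  t ^+ k *: ((k`!%:R^-1 *: drep rho (gen_ef b s) ^+ k) *m u))) // => k _.
by rewrite [RHS]scalemxAl.
Qed.

Lemma rep_rbar s : rho (rbar D s) =
  rbar_mx (fun s => drep rho (gen_e D s)) (fun s => drep rho (gen_f D s)) s.
Proof.
have -> : rbar D s = (root_elt true s (-1) * root_elt false s 1 * root_elt true s (-1))%g.
  rewrite /rbar /root_elt -!gen_phiM ?det_mulmx ?det_mx2 ?(mul0r, mulr0, mulr1, subr0) //.
  congr gen_phi; rewrite !mulmx_mx2.
  by rewrite !(mul0r, mulr0, mulr1, mul1r, addr0, add0r, addNr, addrN, mulN1r).
have [r1 rM rA] := rat; rewrite !rM !rep_root_elt /rbar_mx !scaleN1r scale1r.
by [].
Qed.

End Rep.

Definition chev_gen (i : bool * S + S) : (G -> C) -> C :=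
  match i with inl p => gen_ef p.1 p.2 | inr s => gen_h D s end.

Lemma deriv_word_coef n (rho : G -> 'M[C]_n) (rat : rational_rep rho)
  (I : Type) (X : I -> (G -> C) -> C) w (xi : 'rV_n) (v : 'cV_n) :
  (forall i, lie (X i)) ->
  deriv_word X w (fun x => (xi *m rho x *m v) 0 0) =
  fun x => (xi *m rho x *m foldr (fun i => mulmx (drep rho (X i))) v w) 0 0.
Proof.
move=> lieX; have [r1 rM rA] := rat.
elim: w => [|i w IH] //=; rewrite -/(deriv_word X w _) IH; apply: funext => x.
set u := foldr _ _ _; rewrite /left_inv.
rewrite (_ : (fun y => _) = fun y => \sum_j \sum_k (xi 0 k * u j 0) * rho (x * y)%g k j).
  rewrite lie_sum // => [|j]; last first.
    by apply: (subalg_sum subA) => k _; apply: (subalgZ subA); exact: (coord_ring_left (f := fun z => rho z k j) x (rA k j)).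
  rewrite mulmxA mxE.
  have L j k : X i (fun y => rho (x * y)%g k j) = (rho x *m drep rho (X i)) k j.
    by have /(congr1 (fun f => f x)) := left_inv_rep rat k j (lieX i).
  apply: eq_bigr => j _; rewrite -mulmxA mxE mulr_suml lie_sum // => [|k]; last first.
    by apply: (subalgZ subA); exact: (coord_ring_left (f := fun z => rho z k j) x (rA k j)).
  apply: eq_bigr => k _; rewrite lieZ // ?L; first by ring.
  exact: (coord_ring_left (f := fun z => rho z k j) x (rA k j)).
apply: funext => y; rewrite mxE; apply: eq_bigr => j _; rewrite mxE mulr_suml.
by apply: eq_bigr => k _; ring.
Qed.

Hypothesis connG : connected_group G.

Lemma chev_flat_eq0 f : A f -> (forall w, deriv_word chev_gen w f 1%g = 0) -> forall x, f x = 0.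
Proof.
apply: flat_eq0 => //.
  by move=> [[b s]|s] /=; [exact: gen_ef_lie | have [] := gen_lie D s].
move=> L subL HL X lieX; apply: (gen_generate subL) => // s; split.
- exact: (HL (inl (true, s))).
- exact: (HL (inl (false, s))).
- exact: (HL (inr s)).
Qed.

(** The iterated derivatives at 1 of this coefficient pair [xi] with vectors obtained from [v] by
    the generators. These stay in [P], so the function is flat at 1. *)
Lemma stable_flat n (rho : G -> 'M[C]_n) (P : set 'cV[C]_n) (xi : 'rV_n) v :
  rational_rep rho -> linear_set P ->
  (forall b s u, P u -> P (drep rho (gen_ef b s) *m u)) ->
  P v -> (forall u, P u -> (xi *m u) 0 0 = 0) ->
  forall x, (xi *m rho x *m v) 0 0 = 0.
Proof.
move=> rat linP Pgen Pv Pxi; have [r1 rM rA] := rat.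
apply: (chev_flat_eq0 (f := fun x => (xi *m rho x *m v) 0 0)).
  rewrite (_ : (fun x => _) = fun x => \sum_j (\sum_k xi 0 k * rho x k j) * v j 0).
    apply: (subalg_sum subA) => j _; apply: (subalgM subA); last exact: (subalg_cst subA).
    by apply: (subalg_sum subA) => k _; exact: (subalgZ subA).
  by apply: funext => x; rewrite mxE; apply: eq_bigr => j _; rewrite mxE.
move=> w; rewrite deriv_word_coef //; last first.
  by move=> [[b s]|s] /=; [exact: gen_ef_lie | have [] := gen_lie D s].
rewrite r1 mulmx1; apply: Pxi; elim: w => [|[[b s]|s] w IH] //=; first exact: Pgen.
have /(cm_ef)/(_ s s) := drep_chevalley rat; rewrite eqxx => <-; rewrite /mxad mulmxBl -!mulmxA.
by apply: (linear_setB linP); [apply: (Pgen true); exact: (Pgen false) | apply: (Pgen false); exact: (Pgen true)].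
Qed.

(** Write [f] as a coefficient of a representation. The vectors that [xi] kills after every word
    form a subspace stable under root elements, hence under their differentials, and [stable_flat]
    applies to it. *)
Lemma word_dense f : A f -> (forall w, f (word_elt w) = 0) -> forall x, f x = 0.
Proof.
move=> Af f0; have [n [rho [xi [v [rat fE]]]]] := coord_ring_rep Af.
have [r1 rM rA] := rat.
suff H x : (xi *m rho x *m v) 0 0 = 0 by move=> x; rewrite fE.
pose P := [set u : 'cV[C]_n | forall w, (xi *m rho (word_elt w) *m u) 0 0 = 0].
have linP : linear_set P.
  split=> [w|c u u' Pu Pu' w] /=; first by rewrite mulmx0 mxE.
  by rewrite mulmxDr -scalemxAr mxE [X in X + _]mxE Pu Pu' mulr0 addr0.
apply: (stable_flat (P := P)) => //.
- move=> b s; apply: (rep_stable_gen rat linP) => t u Pu w.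
  have := Pu (w ++ [:: (b, s, t)]); rewrite word_elt_cat rM /= mulg1.
  by rewrite !mulmxA.
- by move=> w; rewrite -fE.
- by move=> u /(_ [::]) /=; rewrite r1 mulmx1.
Qed.

Lemma word_dense_eq f g : A f -> A g -> (forall w, f (word_elt w) = g (word_elt w)) ->
  forall x, f x = g x.
Proof.
move=> Af Ag fg x; apply/eqP; rewrite -subr_eq0; apply/eqP.
apply: (word_dense (f := fun x => f x - g x)); first exact: (subalgB subA).
by move=> w; rewrite fg subrr.
Qed.

End ChevalleyRep.

(** * The torus and weights *)

Section Torus.
Variables (C : numClosedFieldType) (G : affineGroup C) (S : finType).
Variable D : chevalley_data G S.
Local Notation A := (coord_ring G).
Local Notation subA := (coord_ring_subalgebra G).

Definition tor_elt s (t : C) : G := gen_phi D s (mx2 t 0 0 t^-1).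

Lemma det_tor (t : C) : t != 0 -> \det (mx2 t 0 0 t^-1) = 1.
Proof. by move=> t0; rewrite det_mx2 mulfV // mul0r subr0. Qed.

Lemma tor_eltM s t u : t != 0 -> u != 0 -> tor_elt s (t * u) = (tor_elt s t * tor_elt s u)%g.
Proof.
move=> t0 u0; rewrite /tor_elt -gen_phiM ?det_tor //; congr gen_phi.
by rewrite mulmx_mx2 !(mul0r, mulr0, addr0, add0r) invfM.
Qed.

Lemma tor_elt1 s : tor_elt s 1 = 1%g.
Proof. by rewrite /tor_elt invr1 mx2_1 gen_phi1. Qed.

Lemma tor_root_elt s t u : t != 0 ->
  (tor_elt s t * root_elt D true s u)%g = (root_elt D true s (t ^+ 2 * u) * tor_elt s t)%g.
Proof.
move=> t0; rewrite /tor_elt /root_elt -!gen_phiM ?det_tor //;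
  rewrite ?det_mx2 ?(mul0r, mulr0, mulr1, subr0) //.
congr gen_phi; rewrite !mulmx_mx2 !(mul0r, mulr0, addr0, add0r, mulr1, mul1r).
by congr (mx2 _ _ _ _); field.
Qed.

Lemma root_elt_swap s a b : 1 + a * b != 0 -> let c := 1 + a * b in
  (root_elt D true s a * root_elt D false s b)%g =
  (root_elt D false s (b / c) * tor_elt s c * root_elt D true s (a / c))%g.
Proof.
move=> c0 c; rewrite /tor_elt /root_elt -!gen_phiM ?det_mulmx ?det_tor //;
  rewrite ?det_mx2 ?(mul0r, mulr0, mulr1, subr0) //.
congr gen_phi; rewrite !mulmx_mx2 !(mul0r, mulr0, addr0, add0r, mulr1, mul1r).
by congr (mx2 _ _ _ _); rewrite /c; field.
Qed.

Lemma tor_laurent s f : A f -> exists N (p : {poly C}), forall t, t != 0 ->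
  f (tor_elt s t) = t ^- N * p.[t].
Proof.
move=> Af; have [q qalg fE] := gen_phi_morphism D s Af.
suff [N [p H]] : exists N (p : {poly C}), forall t, t != 0 ->
    q (mx2 t 0 0 t^-1) = t ^- N * p.[t].
  by exists N, p => t t0; rewrite /tor_elt fE ?det_tor // H.
move: q qalg {fE}; apply: algebra_generated_min.
  split=> [c|f1 f2 [N1 [p1 H1]] [N2 [p2 H2]]|f1 f2 [N1 [p1 H1]] [N2 [p2 H2]]].
  - by exists 0%N, c%:P => t _; rewrite expr0 invr1 mul1r hornerC.
  - exists (N1 + N2)%N, (p1 * 'X^N2 + p2 * 'X^N1) => t t0.
    rewrite H1 // H2 // hornerD !hornerM !hornerXn exprD.
    by field; rewrite !expf_neq0.
  - exists (N1 + N2)%N, (p1 * p2) => t t0.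
    rewrite H1 // H2 // hornerM exprD.
    by field; rewrite !expf_neq0.
move=> _ [i [j ->]].
exists 1%N, (if i == 0 then if j == 0 then 'X^2 else 0 else if j == 0 then 0 else 1) => t t0.
rewrite mxE expr1; case: eqP => _; case: eqP => _; rewrite ?horner0 ?mulr0 ?hornerC ?mulr1 //.
by rewrite hornerXn expr2 mulKf.
Qed.

Section Rep.
Variables (n : nat) (rho : G -> 'M[C]_n).
Hypothesis rat : rational_rep rho.
Local Notation E s := (drep rho (gen_e D s)).
Local Notation F s := (drep rho (gen_f D s)).
Local Notation H s := (drep rho (gen_h D s)).

Lemma rep_tor_laurent s : exists N K (M : 'I_K -> 'M[C]_n), forall t, t != 0 ->
  rho (tor_elt s t) = t ^- N *: \sum_(k < K) t ^+ k *: M k.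
Proof.
have [r1 rM rA] := rat.
have /choice[f Hf] : forall ij : 'I_n * 'I_n, exists Np : nat * {poly C}, forall t, t != 0 ->
    rho (tor_elt s t) ij.1 ij.2 = t ^- Np.1 * Np.2.[t].
  by move=> [i j]; have [N [p Hp]] := tor_laurent s (rA i j); exists (N, p).
pose N := \max_ij (f ij).1.
pose P ij := (f ij).2 * 'X^(N - (f ij).1).
pose K := \max_ij size (P ij).
exists N, K, (fun k => \matrix_(i, j) (P (i, j))`_k) => t t0; apply/matrixP => i j.
rewrite mxE summxE (eq_bigr (fun k : 'I_K => (P (i, j))`_k * t ^+ k)) => [|k _]; last first.
  by rewrite !mxE mulrC.
rewrite -horner_coef_wide; last exact: (leq_bigmax (i, j)).
rewrite (Hf (i, j)) // hornerM hornerXn.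
have le : ((f (i, j)).1 <= N)%N by exact: (leq_bigmax (i, j)).
rewrite -{1}(subnKC le) exprD; field.
by rewrite !expf_neq0.
Qed.

(** Compare the coefficients of u^j in h(t) x(u) v = x(t^2 u) h(t) v. *)
Lemma tor_weight_pow s (m : int) v j :
  (forall t, t != 0 -> rho (tor_elt s t) *m v = t ^ m *: v) ->
  forall t, t != 0 -> rho (tor_elt s t) *m (E s ^+ j *m v) = t ^ (m + 2 * j%:Z) *: (E s ^+ j *m v) :> 'cV_n.
Proof.
move=> Hv t t0; have [r1 rM rA] := rat.
have [N NE] := rep_nilpotent D rat true s; rewrite /= in NE.
have H1 := nilpotent_le NE (leq_addr j.+1 N).
pose P := [set u : 'cV[C]_n | u = 0].
have linP : linear_set P by split=> // c u v' -> ->; rewrite scaler0 addr0.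
have ltj : (j < N + j.+1)%N by rewrite addnS ltnS leq_addl.
have := @linear_set_coef _ _ P linP (N + j.+1) (fun k => k`!%:R^-1 *:
  (rho (tor_elt s t) *m (E s ^+ k *m v) - t ^ (m + 2 * k%:Z) *: (E s ^+ k *m v))) _ (Ordinal ltj).
move=> /(_ _)/eqP; rewrite /= scaler_eq0 invr_eq0 pnatr_eq0 gtn_eqF ?fact_gt0 //=.
rewrite subr_eq0 => H0; apply/eqP; apply: H0 => u _ /=.
have := congr1 rho (tor_root_elt s u t0); rewrite !rM !(rep_root_elt D rat) /=.
rewrite !(mexp_scale _ H1) => /(congr1 (mulmx^~ v)).
rewrite -[in RHS]mulmxA Hv // -scalemxAr !mulmx_suml mulmx_sumr mulmx_suml => Es.
rewrite (eq_bigr (fun k : 'I_(N + j.+1) => rho (tor_elt s t) *m (u ^+ k *: (k`!%:R^-1 *: E s ^+ k)) *m v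
   - t ^ m *: ((t ^+ 2 * u) ^+ k *: (k`!%:R^-1 *: E s ^+ k) *m v))) => [|k _].
  by rewrite sumrB Es scaler_sumr subrr.
rewrite -!scalemxAr -!scalemxAl -mulmxA scalerBr scalerBr; congr (_ - _).
rewrite !scalerA; congr (_ *: _).
have -> : t ^ (m + 2 * k%:Z) = t ^ m * t ^+ (2 * k) by rewrite expfzDr // -PoszM.
by rewrite exprMn -exprM; ring.
Qed.

Let coef_lin_pow (b : C) e : ((1 + b *: 'X) ^+ e)`_0 = 1 /\ ((1 + b *: 'X) ^+ e)`_1 = e%:R * b.
Proof.
elim: e => [|e [IH0 IH1]]; first by rewrite expr0 !coef1 mul0r.
rewrite exprS !coefM !big_ord_recl !big_ord0 /= /bump /= IH0 IH1.
rewrite !coefD !coef1 !coefZ !coefX /= -natr1; split; ring.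
Qed.

Let coefM1 (p q : {poly C}) : (p * q)`_1 = p`_0 * q`_1 + p`_1 * q`_0.
Proof. by rewrite coefM !big_ord_recl big_ord0 addr0. Qed.

Let coef1_sum N (c : nat -> C) : (\sum_(i < N.+2) c i *: 'X^i)`_1 = c 1%N.
Proof.
rewrite coef_sum big_ord_recl big_ord_recl big1 => [|j _]; last by rewrite coefZ coefXn /= mulr0.
by rewrite !coefZ !coefXn /= mulr0 mulr1 add0r addr0.
Qed.

Let coef0_sum N (c : nat -> C) : (\sum_(i < N.+2) c i *: 'X^i)`_0 = c 0%N.
Proof.
rewrite coef_sum big_ord_recl big1 => [|j _]; last by rewrite coefZ coefXn /= mulr0.
by rewrite !coefZ !coefXn /= mulr1 addr0.
Qed.

(* Compare coefficients in x(a) y(b) = y(b/c) h(c) x(a/c), c = 1 + ab, to first order in a and b. *)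
Lemma tor_weight_h s (m : int) (v : 'cV_n) :
  (forall t, t != 0 -> rho (tor_elt s t) *m v = t ^ m *: v) -> H s *m v = m%:~R *: v.
Proof.
move=> Hv; have [r1 rM rA] := rat.
have [N [NE NF]] : exists N, E s ^+ N.+2 = 0 /\ F s ^+ N.+2 = 0.
  have [N1 H1] := rep_nilpotent D rat true s; have [N2 H2] := rep_nilpotent D rat false s.
  by exists (N1 + N2)%N; split; [apply: (nilpotent_le H1) | apply: (nilpotent_le H2)]; lia.
have scaleE (c d : C) (X : 'M[C]_n) (u : 'cV[C]_n) r : (c *: (d *: X) *m u) r 0 = c * d * (X *m u) r 0.
  by rewrite -!scalemxAl [LHS]mxE [X in _ * X]mxE mulrA.
(* [M] moves all exponents m + j - i into the positive integers. After multiplication by (1 + ab)^M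
   the identity is polynomial in a and b, and it also holds where 1 + ab vanishes, both sides being
   0 there. *)
pose M := (`|m| + N.+3)%N.
pose e (i j : nat) := absz (M%:Z + m + j%:Z - i%:Z)%R.
have eE i j : (i < N.+2)%N -> (e i j)%:Z = M%:Z + m + j%:Z - i%:Z /\ (0 < e i j)%N.
  by rewrite /e /M => lt_i; lia.
have main (a b : C) r : (1 + a * b) ^+ M * (mexp (a *: E s) *m (mexp (b *: F s) *m v)) r 0 =
   \sum_(i < N.+2) \sum_(j < N.+2) (b ^+ i * a ^+ j * (1 + a * b) ^+ e i j / (i`!%:R * j`!%:R)) *
      (F s ^+ i *m (E s ^+ j *m v)) r 0.
  have [c0|c0] := eqVneq (1 + a * b) 0.
    rewrite c0 expr0n /M addnS /= mul0r big1 // => i _; rewrite big1 // => j _.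
    have [_] := eE i j (ltn_ord i); rewrite expr0n; case: (e i j) => // k _ /=.
    by rewrite mulr0 !mul0r.
  have := congr1 rho (root_elt_swap s c0); rewrite /= !rM !(rep_root_elt D rat) /=.
  move=> /(congr1 (mulmx^~ v)); rewrite -!mulmxA => ->.
  set c := 1 + a * b in c0 *.
  rewrite (mexp_scale _ NF) (mexp_scale (a / c) NE) mulmx_suml summxE mulr_sumr.
  apply: eq_bigr => i _; rewrite mulmx_suml mulmx_sumr mulmx_sumr summxE mulr_sumr.
  apply: eq_bigr => j _.
  rewrite -!scalemxAl -!scalemxAr (tor_weight_pow j Hv c0) -!scalemxAr.
  rewrite [in LHS]mxE [in LHS]mxE [in LHS]mxE [in LHS]mxE [in LHS]mxE !mulrA; congr (_ * _).
  have [eij _] := eE i j (ltn_ord i).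
  have -> : c ^+ e i j = c ^+ M * c ^ (m + 2 * j%:Z) * c ^- j * c ^- i.
    rewrite -[c ^+ e i j]/(c ^ (e i j)%:Z) eij -[c ^+ M]/(c ^ M%:Z).
    rewrite !exprnN -!expfzDr //; congr (c ^ _); lia.
  rewrite !exprMn !exprVn.
  move: (c ^ (m + 2 * j%:Z)) => z.
  have f1 : (i`!%:R : C) != 0 by rewrite pnatr_eq0 -lt0n fact_gt0.
  have f2 : (j`!%:R : C) != 0 by rewrite pnatr_eq0 -lt0n fact_gt0.
  by field; rewrite f1 f2 !expf_neq0.
(* The coefficient of a, for fixed b. *)
have step1 (b : C) r :
   \sum_(i < N.+2) b ^+ i / i`!%:R * (E s *m (F s ^+ i *m v)) r 0 +
   M%:R * b * \sum_(i < N.+2) b ^+ i / i`!%:R * (F s ^+ i *m v) r 0 =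
   \sum_(i < N.+2) b ^+ i / i`!%:R * ((F s ^+ i *m (E s *m v)) r 0 + (e i 0%N)%:R * b * (F s ^+ i *m v) r 0).
  pose y := mexp (b *: F s) *m v.
  have yE r' : y r' 0 = \sum_(i < N.+2) b ^+ i / i`!%:R * (F s ^+ i *m v) r' 0.
    rewrite /y (mexp_scale _ NF) mulmx_suml summxE; apply: eq_bigr => i _.
    by rewrite scaleE.
  have EyE : (E s *m y) r 0 = \sum_(i < N.+2) b ^+ i / i`!%:R * (E s *m (F s ^+ i *m v)) r 0.
    rewrite mxE; under eq_bigr do rewrite yE mulr_sumr.
    rewrite exchange_big; apply: eq_bigr => i _; rewrite [in RHS]mxE mulr_sumr.
    by apply: eq_bigr => k _; ring.
  rewrite -EyE -yE.
  have : (1 + b *: 'X) ^+ M * \sum_(j < N.+2) ((E s ^+ j *m y) r 0 / j`!%:R) *: 'X^j =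
      \sum_(i < N.+2) \sum_(j < N.+2) (b ^+ i / (i`!%:R * j`!%:R) * (F s ^+ i *m (E s ^+ j *m v)) r 0)
         *: 'X^j * (1 + b *: 'X) ^+ e i j.
    apply: polyP_eval => a; have := main a b r; rewrite -/y (mexp_scale _ NE) mulmx_suml summxE.
    have lin : (1 + b *: 'X).[a] = 1 + a * b by rewrite hornerD hornerZ hornerX hornerC mulrC.
    rewrite hornerM horner_exp lin horner_sum => H1.
    rewrite (eq_bigr (fun i : 'I_N.+2 => (a ^+ i *: (i`!%:R^-1 *: E s ^+ i) *m y) r 0)); last first.
      by move=> j _; rewrite hornerZ hornerXn scaleE; ring.
    rewrite H1.
    rewrite horner_sum; apply: eq_bigr => i _; rewrite horner_sum; apply: eq_bigr => j _.
    by rewrite hornerM hornerZ hornerXn horner_exp lin; ring.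
  move=> /(congr1 (fun p : {poly C} => p`_1)).
  have [M0 M1] := coef_lin_pow b M.
  rewrite coefM1 M0 M1 (coef1_sum _ (fun j => (E s ^+ j *m y) r 0 / j`!%:R)).
  rewrite (coef0_sum _ (fun j => (E s ^+ j *m y) r 0 / j`!%:R)).
  rewrite expr1 expr0 mul1mx fact0 !divr1 mul1r => ->; rewrite coef_sum.
  apply: eq_bigr => i _; rewrite coef_sum big_ord_recl big_ord_recl big1 => [|j _]; last first.
    by rewrite -scalerAl coefZ coefXnM /= mulr0.
  have [e0 e1] := coef_lin_pow b (e i 0%N); have [e0' _] := coef_lin_pow b (e i 1%N).
  rewrite -!scalerAl !coefZ !coefXnM /= e1 e0' expr0 expr1 mul1mx fact0.
  have f1 : (i`!%:R : C) != 0 by rewrite pnatr_eq0 -lt0n fact_gt0.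
  by rewrite (_ : (bump 0 0)`! = 1%N) //; field; rewrite f1.
(* The coefficient of b in the previous identity. It says [E, F] v = m v, with [M] added on both
   sides. *)
have step2 r : (E s *m (F s *m v)) r 0 + M%:R * v r 0 = (F s *m (E s *m v)) r 0 + (e 0%N 0%N)%:R * v r 0.
  have : \sum_(i < N.+2) ((E s *m (F s ^+ i *m v)) r 0 / i`!%:R) *: 'X^i +
     (M%:R *: 'X) * \sum_(i < N.+2) ((F s ^+ i *m v) r 0 / i`!%:R) *: 'X^i =
     \sum_(i < N.+2) ((F s ^+ i *m (E s *m v)) r 0 / i`!%:R) *: 'X^i +
     \sum_(i < N.+2) ((e i 0%N)%:R * (F s ^+ i *m v) r 0 / i`!%:R) *: 'X^(i.+1).
    apply: polyP_eval => b; have := step1 b r; rewrite !hornerD !hornerM hornerZ hornerX !horner_sum => H1.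
    rewrite (eq_bigr (fun i : 'I_N.+2 => b ^+ i / i`!%:R * (E s *m (F s ^+ i *m v)) r 0)); last first.
      by move=> i _; rewrite hornerZ hornerXn; ring.
    rewrite [X in _ + _ * X](eq_bigr (fun i : 'I_N.+2 => b ^+ i / i`!%:R * (F s ^+ i *m v) r 0)); last first.
      by move=> i _; rewrite hornerZ hornerXn; ring.
    rewrite H1.
    rewrite -big_split; apply: eq_bigr => i _ /=; rewrite !hornerZ !hornerXn exprS; ring.
  move=> /(congr1 (fun p : {poly C} => p`_1)).
  rewrite !coefD coefM1 !coefZ !coefX /=.
  rewrite (coef1_sum _ (fun i => (E s *m (F s ^+ i *m v)) r 0 / i`!%:R)).
  rewrite (coef1_sum _ (fun i => (F s ^+ i *m (E s *m v)) r 0 / i`!%:R)).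
  rewrite (coef0_sum _ (fun i => (F s ^+ i *m v) r 0 / i`!%:R)).
  rewrite [X in _ = _ + X](_ : _ = (e 0%N 0%N)%:R * v r 0); last first.
    rewrite coef_sum big_ord_recl big1 => [|j _]; last by rewrite coefZ coefXn /= mulr0.
    by rewrite coefZ coefXn /= mulr1 addr0 expr0 mul1mx divr1.
  by rewrite !expr1 !expr0 !mul1mx !divr1 mulr0 mul0r add0r mulr1.
have := cm_ef (drep_chevalley D rat) s s; rewrite eqxx => <-; apply/colP => r.
rewrite /mxad mulmxBl -!mulmxA mxE [X in _ + X]mxE [in RHS]mxE.
have := step2 r; have [e00 _] := eE 0%N 0%N isT.
have shift0 (x y : nat) : x%:Z = y%:Z + m + 0%N%:Z - 0%N%:Z -> x%:Z = y%:Z + m by lia.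
have -> : (e 0%N 0%N)%:R = M%:R + m%:~R :> C.
  by rewrite -[(e _ _)%:R]/((e 0%N 0%N)%:Z%:~R) (shift0 _ _ e00) rmorphD.
move: ((E s *m _) r 0) ((F s *m _) r 0) => p q Hpq.
have -> : p = q + m%:~R * v r 0 by apply: (addIr (M%:R * v r 0)); rewrite Hpq; ring.
by ring.
Qed.

End Rep.
End Torus.

(** * Bases of integral weight vectors *)

Section WeightBasis.
Variables (C : numClosedFieldType) (G : affineGroup C) (S : finType).
Variable D : chevalley_data G S.
Local Notation A := (coord_ring G).
Local Notation subA := (coord_ring_subalgebra G).

Definition weight_rep n (rho : G -> 'M[C]_n) (wt : 'I_n -> S -> int) : Prop :=
  (forall s, drep rho (gen_h D s) = diag_mx (\row_i (wt i s)%:~R)) /\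
  (forall s t, t != 0 -> rho (tor_elt D s t) = diag_mx (\row_i t ^ wt i s)).

Lemma drep_conj n (rho : G -> 'M[C]_n) (P : 'M[C]_n) X : rational_rep rho -> lie X ->
  drep (fun x => P *m rho x *m invmx P) X = P *m drep rho X *m invmx P.
Proof.
move=> rat lieX; have [r1 rM rA] := rat; apply/matrixP => i j; rewrite mxE.
rewrite (_ : (fun x => _) = fun x => \sum_l \sum_k (P i k * invmx P l j) * rho x k l).
  rewrite lie_sum // => [|l]; last by apply: (subalg_sum subA) => k _; exact: (subalgZ subA).
  rewrite mxE; apply: eq_bigr => l _; rewrite lie_sum // => [|k]; last exact: (subalgZ subA).
  by rewrite mxE mulr_suml; apply: eq_bigr => k _; rewrite lieZ // mxE; ring.
apply: funext => x; rewrite mxE; apply: eq_bigr => l _; rewrite mxE mulr_suml.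
by apply: eq_bigr => k _; ring.
Qed.

Section TorusProjections.
Variables (n : nat) (rho : G -> 'M[C]_n).
Hypothesis rat : rational_rep rho.
Local Notation H s := (drep rho (gen_h D s)).

Let eq0_lin m p : linear_set [set u : 'M[C]_(m, p) | u = 0].
Proof. by split=> // c u v -> ->; rewrite scaler0 addr0. Qed.

(** The Laurent coefficients of a homomorphism from the multiplicative group are orthogonal
    idempotents with sum 1: the projections onto its isotypic components. The pole order [N] shifts
    the index to the actual exponent. *)
Lemma tor_projections s : exists N K (M : 'I_K -> 'M[C]_n),
  [/\ \sum_k M k = 1%:M,
      forall k l, M k *m M l = if k == l then M l else 0,
      forall k : 'I_K, H s *m M k = (k%:Z - N%:Z)%:~R *: M k &
      forall t, t != 0 -> rho (tor_elt D s t) = \sum_(k < K) t ^ (k%:Z - N%:Z) *: M k].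
Proof.
have [r1 rM rA] := rat.
have [N [K [M ME]]] := rep_tor_laurent D rat s; exists N, K, M.
have ME' t : t != 0 -> rho (tor_elt D s t) = \sum_(k < K) t ^ (k%:Z - N%:Z) *: M k.
  move=> t0; rewrite ME // scaler_sumr; apply: eq_bigr => k _.
  by rewrite scalerA expfzDr // -exprnN mulrC.
have P1 u (k : 'I_K) : u != 0 -> rho (tor_elt D s u) *m M k = u ^ (k%:Z - N%:Z) *: M k.
  move=> u0; apply/eqP; rewrite -subr_eq0; apply/eqP.
  apply: (@linear_set_coef _ _ _ (eq0_lin n n) K
    (fun k => rho (tor_elt D s u) *m M k - u ^ (k%:Z - N%:Z) *: M k)) => t t0 /=.
  have ut0 : u * t != 0 by rewrite mulf_neq0.
  have := ME _ ut0; rewrite tor_eltM // rM [X in _ *m X]ME // -scalemxAr mulmx_sumr => E1.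
  have tN : t ^- N != 0 by rewrite invr_neq0 ?expf_neq0.
  apply: (scalerI tN); rewrite scaler0.
  under eq_bigr do rewrite scalerBr scalemxAr.
  rewrite sumrB scalerBr E1 exprMn invfM mulrC -scalerA; apply/eqP; rewrite subr_eq0; apply/eqP.
  congr (_ *: _); rewrite scaler_sumr; apply: eq_bigr => l _.
  by rewrite !scalerA expfzDr // -exprnN -exprnP exprMn; congr (_ *: _); ring.
have P2 : \sum_k M k = 1%:M.
  have := ME' 1 (oner_neq0 _); rewrite tor_elt1 r1 => ->.
  by apply: eq_bigr => k _; rewrite exp1rz scale1r.
split=> // [k l|k].
- have := @linear_set_coef _ _ _ (eq0_lin n n) K (fun k => M k *m M l - if k == l then M l else 0) _ k.
  move=> /= H0; apply/eqP; rewrite -subr_eq0; apply/eqP; apply: H0 => t t0.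
  have := P1 t l t0; rewrite ME // -scalemxAl mulmx_suml expfzDr // -exprnN mulrC -scalerA.
  have tN : t ^- N != 0 by rewrite invr_neq0 ?expf_neq0.
  move=> /(scalerI tN) E1; under eq_bigr do rewrite scalerBr scalemxAl.
  rewrite sumrB E1 (bigD1 l) //= eqxx big1 ?addr0 ?subrr // => j /negPf ->.
  by rewrite scaler0.
- apply/matrixP => i j; have := @tor_weight_h _ _ _ D _ _ rat s (k%:Z - N%:Z) (col j (M k)).
  move=> H0.
  have /colP/(_ i) : H s *m col j (M k) = (k%:Z - N%:Z)%:~R *: col j (M k).
    apply: H0 => t t0; rewrite colE mulmxA P1 // -scalemxAl.
    by [].
  by rewrite colE mulmxA -colE [LHS]mxE => ->; rewrite -colE !mxE.
Qed.

(** The projections diagonalise each [H s] with integer eigenvalues, and the [H s] commute. In a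
    common eigenbasis the projections themselves become diagonal, so the torus elements take the
    same exponents. *)
Lemma weight_basis : exists (P : 'M[C]_n) (wt : 'I_n -> S -> int),
  P \in unitmx /\ weight_rep (fun x => P *m rho x *m invmx P) wt.
Proof.
have [r1 rM rA] := rat.
have lieH s : lie (gen_h D s) by have [] := gen_lie D s.
have diagH s : diagonalizable (H s).
  have [N [K [M [M1 MM HM _]]]] := tor_projections s.
  apply/diagonalizablePeigen.
  exists [seq ((k : 'I_K)%:Z - N%:Z)%:~R | k <- enum 'I_K].
    rewrite map_inj_uniq ?enum_uniq // => k l /intr_inj /addIr.
    by move=> [] /val_inj.
  apply/eqmxP; rewrite submx1 /= -M1 big_map big_enum /=.
  apply: summx_sub => k _; apply: (sumsmx_sup k) => //.
  apply/eigenspaceP; rewrite -[H s]mulmx1 -M1 mulmx_sumr mulmx_sumr.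
  rewrite (bigD1 k) //= HM -scalemxAr MM eqxx big1 ?addr0 // => l nl.
  by rewrite HM -scalemxAr MM eq_sym (negPf nl) scaler0.
have [P uP /allP Pdiag] : codiagonalizable [seq H s | s <- enum S].
  apply/codiagonalizableP; split.
    move=> _ _ /mapP[s _ ->] /mapP[t _ ->]; apply/eqP; rewrite -subr_eq0; apply/eqP.
    exact: (cm_hh (drep_chevalley D rat)).
  by move=> _ /mapP[s _ ->].
have HP s : exists d, P *m H s *m invmx P = diag_mx d.
  have /Pdiag /= : H s \in [seq H s | s <- enum S] by apply: map_f; rewrite mem_enum.
  move=> /(diagonalizable_forP (H s) uP) Hd; exists (\row_i (P *m H s *m invmx P) i i);
    apply/matrixP => i j; rewrite [RHS]mxE; case: eqVneq => [->|nij]; [by rewrite mulr1n [RHS]mxE | by rewrite mulr0n Hd].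
have /choice[d dE] := HP.
have key s : exists w : 'I_n -> int, (forall i, d s 0 i = (w i)%:~R) /\
    forall t, t != 0 -> P *m rho (tor_elt D s t) *m invmx P = diag_mx (\row_i t ^ w i).
  have [N [K [M [M1 MM HM torE]]]] := tor_projections s.
  pose M' k := P *m M k *m invmx P.
  have M'1 : \sum_k M' k = 1%:M.
    by rewrite -mulmx_suml -mulmx_sumr M1 mulmx1 mulmxV.
  have HM' (k : 'I_K) i j : M' k i j != 0 -> d s 0 i = (k%:Z - N%:Z)%:~R.
    move=> nz; apply: (mulIf nz).
    have : diag_mx (d s) *m M' k = (k%:Z - N%:Z)%:~R *: M' k.
      rewrite -dE /M' -!mulmxA mulKmx // (mulmxA (H s)) HM.
      by rewrite -scalemxAl -scalemxAr.
    by move=> /matrixP/(_ i j); rewrite mul_diag_mx !mxE.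
  have /choice[w wE] : forall i, exists k : 'I_K, d s 0 i = (k%:Z - N%:Z)%:~R.
    move=> i; have [k nz] : exists k, M' k i i != 0.
      apply: contrapT => /forallNP H0.
      have /matrixP/(_ i i) := M'1; rewrite summxE big1 => [|k _]; last first.
        by apply/eqP; apply: contrapT => /negP; exact: H0.
      by rewrite mxE eqxx => /eqP; rewrite eq_sym oner_eq0.
    by exists k; exact: HM' nz.
  have M'E k i j : M' k i j = (k == w i)%:R * (i == j)%:R.
    have M'0 l : l != w i -> M' l i j = 0.
      move=> nl; apply/eqP; apply: contrapT => /negP /HM'; rewrite wE => /intr_inj /addIr [] /val_inj E.
      by rewrite E eqxx in nl.
    have [->|/M'0 ->] := eqVneq k (w i); last by rewrite mul0r.
    have /matrixP/(_ i j) := M'1; rewrite summxE (bigD1 (w i)) //= big1 => [|l]; last exact: M'0.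
    by rewrite addr0 mul1r => ->; rewrite mxE.
  exists (fun i => (w i)%:Z - N%:Z); split=> // t t0.
  rewrite torE // mulmx_sumr mulmx_suml; apply/matrixP => i j; rewrite summxE.
  rewrite (eq_bigr (fun k : 'I_K => t ^ (k%:Z - N%:Z) * M' k i j)) => [|k _]; last first.
    by rewrite -scalemxAr -scalemxAl mxE.
  rewrite (bigD1 (w i)) //= M'E eqxx mul1r big1 => [|k nk]; last by rewrite M'E (negPf nk) mul0r mulr0.
  by rewrite !mxE addr0 mulr_natr.
have /choice[w wE] := key.
exists P, (fun i s => w s i); split=> //; split=> [s|s t t0]; last by have [_ ->] := wE s.
rewrite drep_conj // dE; congr diag_mx; apply/rowP => i; rewrite mxE.
by have [-> _] := wE s.
Qed.

End TorusProjections.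
End WeightBasis.

(** * Positive definite Cartan matrices *)

Section PositiveCartan.
Variables (S : finType) (a : S -> S -> int).

(** [K] is a Gram matrix of the coroots: [a t s] is 2 (h_t, h_s) / (h_s, h_s). It can be integral
    because it will be the trace form of a representation with integral weights. *)
Definition posdef_cartan := exists K : S -> S -> int,
  [/\ forall s t, K s t = K t s,
      forall s t, K s t * 2 = a t s * K s s &
      forall y : S -> rat, (exists s, y s != 0) ->
        0 < \sum_s \sum_t y s * y t * (K s t)%:~R].

Hypothesis pd : posdef_cartan.

Lemma posdef_form : exists d : S -> rat, (forall s, 0 < d s) /\
  forall z : S -> rat, (exists s, z s != 0) ->
    0 < \sum_s d s * z s * (\sum_t (a s t)%:~R * z t).
Proof.
have [K [Ksym Ka Kpos]] := pd.
have Kss s : 0 < (K s s)%:~R :> rat.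
  have := Kpos (fun t => (t == s)%:R) (ex_intro _ s _); rewrite eqxx oner_eq0 => /(_ isT).
  rewrite (bigD1 s) //= [X in _ + X]big1 => [|t /negPf ts]; last first.
    by rewrite big1 // => u _; rewrite ts !mul0r.
  rewrite addr0 (bigD1 s) //= big1 => [|t /negPf ts]; last by rewrite ts mulr0 mul0r.
  by rewrite eqxx !mul1r addr0.
exists (fun s => (K s s)%:~R^-1); split=> [s|z [s0 zs0]]; first by rewrite invr_gt0.
have ex0 : exists s, z s / (K s s)%:~R != 0.
  by exists s0; rewrite mulf_neq0 // invr_neq0 // gt_eqF.
rewrite (_ : \sum_s _ = 2 * \sum_s \sum_t (z s / (K s s)%:~R) * (z t / (K t t)%:~R) * (K s t)%:~R).
  by rewrite pmulr_rgt0 // (Kpos _ ex0).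
rewrite mulr_sumr; apply: eq_bigr => s _.
rewrite !mulr_sumr; apply: eq_bigr => t _.
have := congr1 (fun x : int => x%:~R : rat) (Ka t s); rewrite /= !rmorphM /= => E.
rewrite (_ : (a s t)%:~R = (K t s)%:~R * 2%:~R / (K t t)%:~R); last by rewrite E mulfK // gt_eqF.
by rewrite Ksym; field; rewrite !gt_eqF.
Qed.

(** The form at [n] is a positive sum of terms d_s n_s (a n)_s, so one of them is positive. In root
    language, a non-zero sum of simple roots pairs positively with the coroot of one of them; this
    lowers heights and excludes antidominant sums. *)
Lemma posdef_root (n : S -> nat) : (exists s, n s != 0%N) ->
  exists s, (0 < n s)%N /\ 0 < \sum_t a s t * (n t)%:Z.
Proof.
move=> [s0 ns0]; have [d [d0 dpos]] := posdef_form.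
have := dpos (fun s => (n s)%:R) (ex_intro _ s0 _); rewrite pnatr_eq0 => /(_ ns0) H.
apply: contrapT => /forallNP H0; move: H; apply/negP; rewrite -leNgt; apply: sumr_le0 => s _.
have [->|ns] := posnP (n s); first by rewrite mulr0 mul0r.
have := H0 s; rewrite ns => /not_andP[//|/negP]; rewrite -leNgt => le0.
rewrite mulr_ge0_le0 ?mulr_ge0 ?(ltW (d0 s)) ?ler0n //.
rewrite -(ler_int rat) in le0; apply: le_trans le0; rewrite rmorph_sum /=.
by rewrite le_eqVlt; apply/orP; left; apply/eqP; apply: eq_bigr => t _; rewrite rmorphM.
Qed.

Lemma cartan_inj (z : S -> rat) : (forall s, \sum_t (a s t)%:~R * z t = 0) -> forall s, z s = 0.
Proof.
move=> Hz s; apply/eqP; apply: contrapT => /negP zs.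
have [d [d0 dpos]] := posdef_form; have := dpos z (ex_intro _ s zs).
by rewrite big1 ?ltxx // => t _; rewrite Hz mulr0.
Qed.

Let ffun_solve (M : S -> S -> rat) :
  (forall z : S -> rat, (forall s, \sum_t M s t * z t = 0) -> forall s, z s = 0) ->
  forall b : S -> rat, exists z : S -> rat, forall s, \sum_t M s t * z t = b s.
Proof.
move=> inj b; pose n := #|S|.
pose A := \matrix_(i < n, j < n) M (enum_val j) (enum_val i).
have sumE (F : S -> rat) : \sum_t F t = \sum_(i < n) F (enum_val i).
  by rewrite (big_enum_val (A := predT)).
have uA : A \in unitmx.
  rewrite -row_free_unit -kermx_eq0; apply/eqP/row_matrixP => i; rewrite row0.
  set v := row i _; have vA : v *m A = 0 by rewrite -row_mul mulmx_ker row0.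
  apply/rowP => j; rewrite [RHS]mxE -(enum_valK j).
  apply: (inj (fun s => v 0 (enum_rank s))) => s; rewrite sumE.
  have /rowP/(_ (enum_rank s)) := vA; rewrite !mxE => E; rewrite -[RHS]E.
  by apply: eq_bigr => k _; rewrite !mxE enum_rankK enum_valK mulrC.
exists (fun s => (\row_i b (enum_val i) *m invmx A) 0 (enum_rank s)) => s.
have /rowP/(_ (enum_rank s)) : \row_i b (enum_val i) *m invmx A *m A = \row_i b (enum_val i).
  by rewrite mulmxKV.
rewrite mxE [in RHS]mxE enum_rankK => <-; rewrite sumE.
by apply: eq_bigr => k _; rewrite enum_valK mulrC [A _ _]mxE enum_rankK.
Qed.

Lemma cartan_solve (b : S -> rat) : exists z, forall s, \sum_t (a s t)%:~R * z t = b s.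
Proof. by apply: ffun_solve; exact: cartan_inj. Qed.

Lemma cartan_solveT (b : S -> rat) : exists z, forall t, \sum_s (a s t)%:~R * z s = b t.
Proof.
apply: (ffun_solve (M := fun t s => (a s t)%:~R)) => z Hz s0; apply/eqP; apply: contrapT => /negP zs.
have [K [Ksym Ka Kpos]] := pd; have := Kpos z (ex_intro _ s0 zs).
rewrite exchange_big /= big1 ?ltxx // => t _.
apply/eqP; rewrite -(inj_eq (mulIf (_ : (2%:R : rat) != 0))) ?pnatr_eq0 // mul0r mulr_suml; apply/eqP.
transitivity (z t * (K t t)%:~R * \sum_s (a s t)%:~R * z s); last by rewrite Hz mulr0.
rewrite mulr_sumr; apply: eq_bigr => s _.
have := congr1 (fun x : int => x%:~R : rat) (Ka t s); rewrite /= !rmorphM /= => E.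
rewrite (Ksym s t); transitivity (z s * z t * ((K t s)%:~R * 2)); first by ring.
by rewrite E; ring.
Qed.

End PositiveCartan.

Section EigenSeparation.
Variables (C : numClosedFieldType) (V : lmodType C) (T : Type) (hop : T -> V -> V).
Hypothesis hop_lin : forall t c u v, hop t (c *: u + v) = c *: hop t u + hop t v.
Variable K : set V.
Hypothesis linK : linear_set K.
Hypothesis stK : forall t u, K u -> K (hop t u).

Let hopZ t c u : hop t (c *: u) = c *: hop t u.
Proof.
have h0 : hop t 0 = 0.
  by have := hop_lin t (-1) 0 0; rewrite !scaleN1r !oppr0 addr0 addNr.
by rewrite -[c *: u]addr0 hop_lin h0 addr0.
Qed.

Let hopD t u v : hop t (u + v) = hop t u + hop t v.
Proof. by have := hop_lin t 1 u v; rewrite !scale1r. Qed.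

Lemma eigen_separation (I : Type) (r : seq I) (X : I -> V) (beta : I -> T -> C) (b : T -> C) (Y : V) :
  (forall t, hop t Y = b t *: Y) ->
  (forall i t, hop t (X i) = beta i t *: X i) ->
  (forall i, X i = 0 \/ exists t, beta i t != b t) ->
  K (Y + \sum_(i <- r) X i) -> K Y.
Proof.
elim: r X Y => [|i r IH] X Y hY hX ne; first by rewrite big_nil addr0.
rewrite big_cons => KY.
have [Xi0|[t nt]] := ne i; first by apply: (IH X) => //; rewrite Xi0 add0r in KY.
have sumh : hop t (\sum_(j <- r) X j) = \sum_(j <- r) beta j t *: X j.
  elim: (r) => [|j r' IHr]; last by rewrite !big_cons hopD IHr hX.
  by rewrite !big_nil -(scale0r 0) hopZ !scale0r.
have : K ((b t - beta i t) *: Y + \sum_(j <- r) (beta j t - beta i t) *: X j).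
  have := linear_setB linK (stK t KY) (linear_setZ linK (beta i t) KY).
  rewrite !hopD hY hX sumh !scalerDr.
  rewrite scalerBl; under [in X in _ -> K (_ + X)]eq_bigr do rewrite scalerBl.
  rewrite sumrB -scaler_sumr opprD opprD.
  congr (K _); rewrite addrACA [in X in _ + X]addrACA subrr add0r.
  by [].
move=> /(IH (fun j => (beta j t - beta i t) *: X j)) H.
have KbY : K ((b t - beta i t) *: Y).
  apply: H => [u|j u|j].
  - by rewrite hopZ hY !scalerA mulrC.
  - by rewrite hopZ hX !scalerA mulrC.
  - by have [->|H] := ne j; [left; rewrite scaler0 | right].
have nz : b t - beta i t != 0 by rewrite subr_eq0 eq_sym.
by rewrite -[Y]scale1r -(mulVf nz) -scalerA; exact: (linear_setZ linK).
Qed.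

End EigenSeparation.

(** * Lie algebras with Chevalley generators *)

Section LieRelations.
Variables (C : numClosedFieldType) (S : finType) (a : S -> S -> int).
Variables (V : lmodType C) (br : V -> V -> V).

(** Brackets on an abstract space, because the same arguments serve single matrices and pairs of
    matrices. *)
Record lie_bracket : Prop := LieBracket {
  br_lin : forall x c u v, br x (c *: u + v) = c *: br x u + br x v;
  br_anti : forall x y, br x y = - br y x;
  br_jacobi : forall x y z, br x (br y z) = br (br x y) z + br y (br x z)
}.

Record chevalley_elts (e f h : S -> V) : Prop := ChevalleyElts {
  ce_hh : forall s t, br (h s) (h t) = 0;
  ce_ef : forall s t, br (e s) (f t) = if s == t then h s else 0;
  ce_he : forall s t, br (h s) (e t) = (a s t)%:~R *: e t;
  ce_hf : forall s t, br (h s) (f t) = - (a s t)%:~R *: f t;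
  ce_nile : forall s x, exists k, iter k (br (e s)) x = 0;
  ce_nilf : forall s x, exists k, iter k (br (f s)) x = 0
}.

(** The Chevalley involution: every statement about the positive half transfers to the negative
    one. *)
Lemma chevalley_elts_opp e f h : lie_bracket -> chevalley_elts e f h ->
  chevalley_elts f e (fun s => - h s).
Proof.
move=> [lin anti jac] [hh ef he hf ne nf].
have N x y : br (- x) y = - br x y.
  have Nr z u : br z (- u) = - br z u.
    have := lin z (-1) u 0; rewrite !addr0 scaleN1r => ->.
    have := lin z (-1) 0 0; rewrite !scaleN1r !oppr0 addr0 addNr => ->.
    by rewrite addr0.
  by rewrite anti Nr -anti.
split=> // s t; rewrite ?N.
- by rewrite anti N hh !oppr0.
- by rewrite anti ef eq_sym; case: eqP => [->|]; rewrite ?oppr0.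
- by rewrite hf scaleNr opprK.
- by rewrite he scaleNr.
Qed.

End LieRelations.

Section NestedBrackets.
Variables (C : numClosedFieldType) (S : finType) (a : S -> S -> int).
Variables (V : lmodType C) (br : V -> V -> V) (e f h : S -> V).
Hypothesis lieV : lie_bracket br.
Hypothesis ce : chevalley_elts a br e f h.
Hypothesis a_diag : forall s, a s s = 2.
Hypothesis pd : posdef_cartan a.

Lemma br0 x : br x 0 = 0.
Proof. by have := br_lin lieV x (-1) 0 0; rewrite !scaleN1r !oppr0 addr0 addNr. Qed.

Lemma brD x u v : br x (u + v) = br x u + br x v.
Proof. by have := br_lin lieV x 1 u v; rewrite !scale1r. Qed.

Lemma brZ x c u : br x (c *: u) = c *: br x u.
Proof. by have := br_lin lieV x c u 0; rewrite !addr0 br0 addr0. Qed.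

Lemma brDl x y z : br (x + y) z = br x z + br y z.
Proof. by rewrite (br_anti lieV) brD opprD -!(br_anti lieV). Qed.

Lemma brZl c x y : br (c *: x) y = c *: br x y.
Proof. by rewrite (br_anti lieV) brZ -scalerN -(br_anti lieV). Qed.

Lemma br0l x : br 0 x = 0.
Proof. by rewrite (br_anti lieV) br0 oppr0. Qed.

Lemma br_sum x (I : Type) (r : seq I) (P : pred I) (F : I -> V) :
  br x (\sum_(i <- r | P i) F i) = \sum_(i <- r | P i) br x (F i).
Proof. by apply: (big_morph (br x) (brD x) (br0 x)). Qed.

Fixpoint nest (g : S -> V) (w : seq S) : V :=
  match w with
  | [::] => 0
  | [:: s] => g s
  | s :: w' => br (g s) (nest g w')
  end.

Lemma nest_cons g s w : w != [::] -> nest g (s :: w) = br (g s) (nest g w).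
Proof. by case: w. Qed.

Definition word_wt (w : seq S) (s : S) : int := \sum_(t <- w) a s t.

Lemma br_h_nest s w : br (h s) (nest e w) = (word_wt w s)%:~R *: nest e w.
Proof.
elim: w => [|t w IH]; first by rewrite br0 scaler0.
case: w IH => [|u w] IH; first by rewrite /= (ce_he ce) /word_wt big_seq1.
rewrite [nest e (t :: _)]nest_cons // (br_jacobi lieV) IH (ce_he ce) brZ brZl -scalerDl.
by rewrite /word_wt [in RHS]big_cons rmorphD.
Qed.

(** The string e^k v ends since e is locally nilpotent. At its last non-zero term v_k, applying f to
    e v_k = 0 leaves (k + 1)(m + k) = 0, so m = - k. *)
Lemma lowest_weight_le0 s v (m : int) :
  v != 0 -> br (f s) v = 0 -> br (h s) v = m%:~R *: v -> m <= 0.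
Proof.
move=> v0 fv hv; pose vk k := iter k (br (e s)) v.
have hk k : br (h s) (vk k) = (m + 2 * k%:Z)%:~R *: vk k.
  elim: k => [|k IH]; first by rewrite /= mulr0 addr0.
  rewrite /= (br_jacobi lieV) (ce_he ce) a_diag -/(vk k) IH brZ brZl -scalerDl -rmorphD.
  by congr (_%:~R *: _); lia.
have fk k : br (f s) (vk k.+1) = - (k.+1%:Z * (m + k%:Z))%:~R *: vk k.
  elim: k => [|k IH].
    rewrite /= (br_jacobi lieV) fv br0 addr0 (br_anti lieV (f s)) (ce_ef ce) eqxx.
    by rewrite -[- h s]scaleN1r brZl hv scalerA mulN1r; congr (- _%:~R *: _); lia.
  rewrite [vk k.+2]/= -/(vk k.+1) (br_jacobi lieV) IH brZ.
  rewrite -![br (e s) (vk k)]/(vk k.+1).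
  rewrite (br_anti lieV (f s)) (ce_ef ce) eqxx -[- h s]scaleN1r brZl hk scalerA mulN1r -scalerDl.
  by rewrite -opprD -rmorphD; congr (- _%:~R *: _); lia.
have [k0 k00] := ce_nile ce s v.
have exk : exists k, vk k == 0 by exists k0; apply/eqP.
case: (ex_minnP exk) => -[|k] /eqP vk0 mink; first by rewrite [vk 0%N]/= in vk0; rewrite vk0 eqxx in v0.
have := fk k; rewrite vk0 br0 => /esym /eqP; rewrite scaler_eq0 oppr_eq0 intr_eq0.
case/orP => [|vk1]; first by rewrite mulf_eq0 => /orP[//|/eqP]; lia.
by have := mink k vk1; rewrite ltnn.
Qed.

Definition nest_sum (g : S -> V) (r : seq (C * seq S)) : V := \sum_(p <- r) p.1 *: nest g p.2.

Definition nonempty_words (r : seq (C * seq S)) := all (fun p => p.2 != [::]) r.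

(** Split off the terms of one weight. This part is again killed by all the [f s], because different
    weights cannot cancel; were it non-zero, its weight would be antidominant by sl_2 theory,
    whereas it is a non-empty sum of simple roots. *)
Lemma no_lowest_nest r : nonempty_words r ->
  (forall s, br (f s) (nest_sum e r) = 0) -> nest_sum e r = 0.
Proof.
elim: {r}(size r).+1 {-2}r (ltnSn (size r)) => // N IH [|p r] szr ne fX.
  by rewrite /nest_sum big_nil.
set X := nest_sum e _ in fX *.
pose same (q : C * seq S) := [forall s, word_wt q.2 s == word_wt p.2 s].
pose Xb := \sum_(q <- p :: r | same q) q.1 *: nest e q.2.
pose r' := [seq q <- p :: r | ~~ same q].
have XE : X = Xb + nest_sum e r' by rewrite /X /nest_sum (bigID same) big_filter.
have hXb s : br (h s) Xb = (word_wt p.2 s)%:~R *: Xb.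
  rewrite /Xb br_sum scaler_sumr; apply: eq_bigr => q /forallP/(_ s)/eqP <-.
  by rewrite brZ br_h_nest !scalerA mulrC.
have fXb s : br (f s) Xb = 0.
  have eig t x (b : C) : br (h t) x = b *: x -> br (h t) (br (f s) x) = (b - (a t s)%:~R) *: br (f s) x.
    by move=> hx; rewrite (br_jacobi lieV) (ce_hf ce) hx brZ brZl -scalerDl addrC.
  have lin0 : linear_set [set u : V | u = 0] by split=> // c u v -> ->; rewrite scaler0 addr0.
  apply: (@eigen_separation _ _ _ (fun t => br (h t)) (fun t c u v => br_lin lieV (h t) c u v)
     _ lin0 _ _ (p :: r) (fun q => if same q then 0 else br (f s) (q.1 *: nest e q.2))
     (fun q t => (word_wt q.2 t)%:~R - (a t s)%:~R) (fun t => (word_wt p.2 t)%:~R - (a t s)%:~R)).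
  - by move=> t u /= ->; rewrite br0.
  - by move=> t; apply: eig; exact: hXb.
  - move=> q t; case: ifP => _; first by rewrite br0 scaler0.
    by apply: eig; rewrite brZ br_h_nest !scalerA mulrC.
  - move=> q; case: ifPn => [_|/forallPn[t nt]]; [by left | right; exists t].
    by rewrite (inj_eq (addIr _)) (inj_eq intr_inj).
  - rewrite /= -[RHS](fX s) XE brD; congr (_ + _); rewrite /nest_sum br_sum big_filter.
    rewrite [RHS]big_mkcond; apply: eq_bigr => q _.
    by case: (same q).
have Xb0 : Xb = 0.
  apply/eqP; apply: contrapT => /negP nz.
  have le0 s : word_wt p.2 s <= 0 by apply: (lowest_weight_le0 nz (fXb s)); exact: hXb.
  have [] := @posdef_root _ _ pd (fun s => count_mem s p.2).
    have : p.2 != [::] by case/andP: ne.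
    by case: (p.2) => // s w _; exists s; rewrite /= eqxx.
  move=> s [_]; apply/negP; rewrite -leNgt; have := le0 s; rewrite /word_wt.
  rewrite (_ : \sum_(t <- p.2) a s t = \sum_t a s t * (count_mem t p.2)%:Z) //.
  elim: (p.2) => [|u w IHw]; first by rewrite big_nil big1 // => t _; rewrite mulr0.
  rewrite big_cons IHw [in RHS](bigD1 u) //= eqxx PoszD mulrDr mulr1 -addrA; congr (_ + _).
  rewrite [LHS](bigD1 u) //=; congr (_ + _); apply: eq_bigr => t nt.
  by rewrite eq_sym (negPf nt) add0n.
rewrite XE Xb0 add0r; apply: IH.
- rewrite /r' /= (_ : same p) /=; last by apply/forallP.
  by rewrite -ltnS (leq_ltn_trans _ szr) //= ltnS size_filter count_size.
- by move: ne; rewrite /nonempty_words /r' !all_filter; apply: sub_all => q Hq; apply/implyP.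
- by move=> s; rewrite -(fX s) XE Xb0 add0r.
Qed.

Definition Lp (g : S -> V) k : set V := [set X | exists r : seq (C * seq S),
  all (fun p => size p.2 == k) r /\ X = nest_sum g r].

Lemma Lp_linear g k : linear_set (Lp g k).
Proof.
split=> [|c _ _ [r1 [s1 ->]] [r2 [s2 ->]]]; first by exists [::]; rewrite /nest_sum big_nil.
exists ([seq (c * p.1, p.2) | p <- r1] ++ r2); rewrite all_cat s2 andbT all_map; split=> //.
rewrite /nest_sum big_cat big_map scaler_sumr; congr (_ + _).
by apply: eq_bigr => p _; rewrite scalerA.
Qed.

Lemma Lp_nest g w : Lp g (size w) (nest g w).
Proof. by exists [:: (1, w)]; rewrite /= eqxx /nest_sum big_seq1 scale1r. Qed.

Lemma Lp_ind g k (P : set V) : linear_set P ->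
  (forall w, size w = k -> P (nest g w)) -> Lp g k `<=` P.
Proof.
move=> linP H _ [r [/allP sz ->]]; rewrite /nest_sum big_seq.
by apply: (linear_set_sum linP) => p pr; apply: (linear_setZ linP); apply: H; apply/eqP/sz.
Qed.

Lemma br_preim_linear x (P : set V) : linear_set P -> linear_set [set u | P (br x u)].
Proof.
move=> [P0 PD]; split=> /= [|c u v Pu Pv]; first by rewrite br0.
by rewrite (br_lin lieV); exact: PD.
Qed.

Lemma br_e_Lp s k X : (0 < k)%N -> Lp e k X -> Lp e k.+1 (br (e s) X).
Proof.
move=> k0; move: X; apply: (@Lp_ind e k [set u | Lp e k.+1 (br (e s) u)]); first by apply: br_preim_linear; exact: Lp_linear.
move=> w wk /=; rewrite -nest_cons; last by rewrite -size_eq0 wk -lt0n.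
by rewrite -wk; exact: (Lp_nest e (s :: w)).
Qed.

Lemma br_h_Lp s k X : Lp e k X -> Lp e k (br (h s) X).
Proof.
move: X; apply: (@Lp_ind e k [set u | Lp e k (br (h s) u)]); first by apply: br_preim_linear; exact: Lp_linear.
by move=> w <- /=; rewrite br_h_nest; apply: (linear_setZ (Lp_linear _ _)); exact: Lp_nest.
Qed.

Definition hspan : set V := [set X | exists z : S -> C, X = \sum_s z s *: h s].

Lemma hspan_linear : linear_set hspan.
Proof.
split=> [|c _ _ [z1 ->] [z2 ->]].
  by exists (fun=> 0); rewrite big1 // => s _; rewrite scale0r.
exists (fun s => c * z1 s + z2 s); rewrite scaler_sumr -big_split; apply: eq_bigr => s _ /=.
by rewrite scalerA -scalerDl.
Qed.

Lemma hspan_h s : hspan (h s).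
Proof.
exists (fun t => (t == s)%:R); rewrite (bigD1 s) //= eqxx scale1r big1 ?addr0 // => t /negPf ->.
by rewrite scale0r.
Qed.

Lemma br_f_Lp1 s X : Lp e 1%N X -> hspan (br (f s) X).
Proof.
move: X; apply: (@Lp_ind e 1%N [set u | hspan (br (f s) u)]); first by apply: br_preim_linear; exact: hspan_linear.
case=> // t [|//] _ /=; rewrite (br_anti lieV) (ce_ef ce).
rewrite -scaleN1r; apply: (linear_setZ hspan_linear).
by case: ifP => _; [exact: hspan_h | have [] := hspan_linear].
Qed.

Lemma br_e_hspan s X : hspan X -> Lp e 1%N (br (e s) X).
Proof.
move=> [z ->]; rewrite br_sum; apply: (linear_set_sum (Lp_linear _ _)) => t _.
rewrite brZ (br_anti lieV) (ce_he ce) -scalerN; apply: (linear_setZ (Lp_linear _ _)).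
apply: (linear_setZ (Lp_linear _ _)); rewrite -scaleN1r.
by apply: (linear_setZ (Lp_linear _ _)); exact: (Lp_nest e [:: s]).
Qed.

Lemma br_f_Lp s k X : Lp e k.+2 X -> Lp e k.+1 (br (f s) X).
Proof.
move: X; apply: (@Lp_ind e k.+2 [set u | Lp e k.+1 (br (f s) u)]); first by apply: br_preim_linear; exact: Lp_linear.
elim: k => [|k IH] [|t w] // [wk]; rewrite /= -/(nest e (t :: w)).
  have w0 : w != [::] by rewrite -size_eq0 wk.
  rewrite nest_cons // (br_jacobi lieV); apply: (linear_setD (Lp_linear _ _)).
    rewrite (br_anti lieV (f s)) (ce_ef ce) -[- _]scaleN1r brZl; apply: (linear_setZ (Lp_linear _ _)).
    case: ifP => _; last by rewrite br0l; have [] := Lp_linear e 1%N.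
    by apply: br_h_Lp; rewrite -wk; exact: Lp_nest.
  by apply: br_e_hspan; apply: br_f_Lp1; rewrite -wk; exact: Lp_nest.
have w0 : w != [::] by rewrite -size_eq0 wk.
rewrite nest_cons // (br_jacobi lieV); apply: (linear_setD (Lp_linear _ _)).
  rewrite (br_anti lieV (f s)) (ce_ef ce) -[- _]scaleN1r brZl; apply: (linear_setZ (Lp_linear _ _)).
  case: ifP => _; last by rewrite br0l; have [] := Lp_linear e k.+2.
  by apply: br_h_Lp; rewrite -wk; exact: Lp_nest.
by apply: br_e_Lp => //; apply: IH.
Qed.

Variable K : set V.
Hypothesis fK : forall s X, K X -> K (br (f s) X).
Hypothesis hK : forall z : S -> C, K (\sum_s z s *: h s) -> forall s, z s = 0.

(** Bracketing with an [f s] lowers the height and stays in [K], down to the Cartan part, where [K]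
    is trivial. So all these brackets vanish by induction and [no_lowest_nest] applies. *)
Lemma Lp_kernel k X : (0 < k)%N -> Lp e k X -> K X -> X = 0.
Proof.
case: k => // k _; elim: k X => [|k IH] X LX KX.
  have [r [sz XE]] := LX; rewrite XE; apply: no_lowest_nest.
    by apply: sub_all sz => p; rewrite -size_eq0 => /eqP ->.
  move=> s; rewrite -XE; have [z zE] := br_f_Lp1 s LX.
  have := fK s KX; rewrite zE => /hK z0; rewrite big1 // => t _.
  by rewrite z0 scale0r.
have [r [sz XE]] := LX; rewrite XE; apply: no_lowest_nest.
  by apply: sub_all sz => p; rewrite -size_eq0 => /eqP ->.
by move=> s; rewrite -XE; apply: IH; [exact: br_f_Lp | exact: fK].
Qed.

End NestedBrackets.

Section TriangularSpan.
Variables (C : numClosedFieldType) (S : finType) (a : S -> S -> int).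
Variables (V : lmodType C) (br : V -> V -> V).
Hypothesis lieV : lie_bracket br.
Hypothesis a_diag : forall s, a s s = 2.
Hypothesis pd : posdef_cartan a.

(** The triangular form of the generated Lie algebra. The sum is not claimed to be direct; what
    replaces directness is [Lall_kernel]. *)
Definition Lall (e f h : S -> V) : set V := [set X | exists (z : S -> C) r r',
  [/\ nonempty_words r, nonempty_words r' &
      X = \sum_s z s *: h s + nest_sum br e r + nest_sum br f r']].

Lemma nest_sum_cat g (r r' : seq (C * seq S)) :
  nest_sum br g (r ++ r') = nest_sum br g r + nest_sum br g r'.
Proof. by rewrite /nest_sum big_cat. Qed.

Lemma nest_sum_scale g c (r : seq (C * seq S)) :
  nest_sum br g [seq (c * p.1, p.2) | p <- r] = c *: nest_sum br g r.
Proof.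
by rewrite /nest_sum big_map scaler_sumr; apply: eq_bigr => p _; rewrite scalerA.
Qed.

Lemma Lall_linear e f h : linear_set (Lall e f h).
Proof.
split=> [|c _ _ [z1 [r1 [r1' [n1 n1' ->]]]] [z2 [r2 [r2' [n2 n2' ->]]]]].
  exists (fun=> 0), [::], [::]; split=> //; rewrite /nest_sum !big_nil !addr0.
  by rewrite big1 // => s _; rewrite scale0r.
exists (fun s => c * z1 s + z2 s), ([seq (c * p.1, p.2) | p <- r1] ++ r2),
  ([seq (c * p.1, p.2) | p <- r1'] ++ r2').
rewrite /nonempty_words !all_cat !all_map; split; try exact/andP.
rewrite !nest_sum_cat !nest_sum_scale !scalerDr scaler_sumr.
rewrite [in RHS](eq_bigr (fun s => c *: (z1 s *: h s) + z2 s *: h s)) => [|s _].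
  by rewrite big_split /= addrACA; congr (_ + _); rewrite addrACA.
by rewrite scalerA scalerDl.
Qed.

Lemma Lall_opp e f h : Lall e f h `<=` Lall f e (fun s => - h s).
Proof.
move=> _ [z [r [r' [n n' ->]]]]; exists (fun s => - z s), r', r; split=> //.
by rewrite addrAC; congr (_ + _ + _); apply: eq_bigr => s _; rewrite scalerN scaleNr opprK.
Qed.

Lemma Lall_oppE e f h : Lall f e (fun s => - h s) = Lall e f h.
Proof.
apply/seteqP; split; last exact: Lall_opp.
have := @Lall_opp f e (fun s => - h s); rewrite (_ : (fun s => - - h s) = h) //.
by apply: funext => s; rewrite opprK.
Qed.

Lemma Lp_Lall e f h k : (0 < k)%N -> Lp br e k `<=` Lall e f h.
Proof.
move=> k0 _ [r [sz ->]]; exists (fun=> 0), r, [::]; split=> //.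
  by apply: sub_all sz => p; rewrite -size_eq0 => /eqP ->; rewrite -lt0n.
rewrite [nest_sum br f _]big_nil addr0 [X in X + _]big1 ?add0r // => s _.
by rewrite scale0r.
Qed.

Lemma hspan_Lall e f h : hspan h `<=` Lall e f h.
Proof.
move=> _ [z ->]; exists z, [::], [::]; split=> //.
by rewrite /nest_sum !big_nil !addr0.
Qed.

Lemma hspan_opp (h : S -> V) X : hspan (fun s => - h s) X -> hspan h X.
Proof.
move=> [z ->]; exists (fun s => - z s); apply: eq_bigr => s _.
by rewrite scalerN scaleNr.
Qed.

Section Half.
Variables (e f h : S -> V).
Hypothesis ce : chevalley_elts a br e f h.
Let ce' := chevalley_elts_opp lieV ce.

Lemma Lall_e s X : Lall e f h X -> Lall e f h (br (e s) X).
Proof.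
have linL := Lall_linear e f h.
move=> [z [r [r' [n n' ->]]]]; rewrite !(brD lieV); apply: (linear_setD linL); first apply: (linear_setD linL).
- by apply: (@Lp_Lall _ _ _ 1%N) => //; apply: (br_e_hspan lieV ce); exists z.
- rewrite /nest_sum (br_sum lieV) big_seq; apply: (linear_set_sum linL) => p pr.
  rewrite (brZ lieV); apply: (linear_setZ linL); have /allP/(_ p pr) ne := n.
  rewrite -nest_cons //; apply: (@Lp_Lall _ _ _ ((size p.2).+1)) => //.
  exact: (Lp_nest br e (s :: p.2)).
- rewrite /nest_sum (br_sum lieV) big_seq; apply: (linear_set_sum linL) => p pr.
  rewrite (brZ lieV); apply: (linear_setZ linL); have /allP/(_ p pr) := n'.
  have := Lp_nest br f p.2; case: (p.2) => // t [|u w] HL _.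
    apply: hspan_Lall; apply: hspan_opp; exact: (br_f_Lp1 lieV ce' s HL).
  rewrite -Lall_oppE; apply: (@Lp_Lall _ _ _ ((size w).+1)) => //.
  exact: (br_f_Lp lieV ce' s HL).
Qed.

Lemma Lall_h s X : Lall e f h X -> Lall e f h (br (h s) X).
Proof.
have linL := Lall_linear e f h.
move=> [z [r [r' [n n' ->]]]]; rewrite !(brD lieV); apply: (linear_setD linL); first apply: (linear_setD linL).
- rewrite (br_sum lieV) big1; first by have [] := linL.
  by move=> t _; rewrite (brZ lieV) (ce_hh ce) scaler0.
- rewrite /nest_sum (br_sum lieV) big_seq; apply: (linear_set_sum linL) => p pr.
  rewrite (brZ lieV) (br_h_nest lieV ce) scalerA; apply: (linear_setZ linL).
  have /allP/(_ p pr) ne := n.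
  by apply: (@Lp_Lall _ _ _ (size p.2)); [rewrite lt0n size_eq0 | exact: Lp_nest].
- rewrite /nest_sum (br_sum lieV) big_seq; apply: (linear_set_sum linL) => p pr.
  rewrite (brZ lieV); have := br_h_nest lieV ce' s p.2.
  rewrite -scaleN1r (brZl lieV) scaleN1r => /eqP; rewrite eqr_oppLR => /eqP ->.
  rewrite -scaleN1r !scalerA; apply: (linear_setZ linL); rewrite -Lall_oppE.
  have /allP/(_ p pr) ne := n'.
  by apply: (@Lp_Lall _ _ _ (size p.2)); [rewrite lt0n size_eq0 | exact: Lp_nest].
Qed.

Variable K : set V.
Hypothesis linK : linear_set K.
Hypothesis eK : forall s X, K X -> K (br (e s) X).
Hypothesis fK : forall s X, K X -> K (br (f s) X).
Hypothesis hK : forall s X, K X -> K (br (h s) X).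
Hypothesis hK0 : forall z : S -> C, K (\sum_s z s *: h s) -> forall s, z s = 0.

Lemma height_separation z r r' k : (0 < k)%N ->
  K (\sum_s z s *: h s + nest_sum br e r + nest_sum br f r') ->
  \sum_(q <- r | size q.2 == k) q.1 *: nest br e q.2 = 0.
Proof.
move=> k0 KX; set Y := LHS.
suff KY : K Y.
  apply: (Lp_kernel lieV ce a_diag pd fK hK0 k0 _ KY).
  exists [seq q <- r | size q.2 == k]; rewrite filter_all; split=> //.
  by rewrite /Y /nest_sum big_filter.
(* [h0] is the half sum of the positive coroots. All simple roots take the value 1 on it, so ad h0
   measures height and separates the components of a sum. *)
have [c cE] := cartan_solveT pd (fun=> 1).
pose h0 := \sum_s ratr (c s) *: h s.
have wtE w : \sum_s ratr (c s) * (word_wt a w s)%:~R = (size w)%:R :> C.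
  rewrite /word_wt; elim: w => [|t w IH]; first by rewrite big1 // => s _; rewrite big_nil mulr0.
  rewrite (eq_bigr (fun s => ratr ((a s t)%:~R * c s) + ratr (c s) * (\sum_(j <- w) a s j)%:~R)) => [|s _].
    by rewrite big_split /= IH -rmorph_sum cE rmorph1 -natr1 addrC.
  by rewrite big_cons rmorphD mulrDr rmorphM /= ratr_int mulrC.
have h0e w : br h0 (nest br e w) = (size w)%:R *: nest br e w.
  rewrite -wtE scaler_suml /h0 (br_anti lieV) (br_sum lieV) -sumrN; apply: eq_bigr => s _.
  by rewrite (brZ lieV) -scalerN -(br_anti lieV) (br_h_nest lieV ce) scalerA.
have h0f w : br h0 (nest br f w) = - (size w)%:R *: nest br f w.
  rewrite scaleNr -wtE scaler_suml /h0 (br_anti lieV) (br_sum lieV); congr (- _); apply: eq_bigr => s _.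
  rewrite (brZ lieV) -[RHS]scalerA; congr (_ *: _); have := br_h_nest lieV ce' s w.
  by rewrite -[- h s]scaleN1r (brZl lieV) scaleN1r -(br_anti lieV).
have h0h t : br h0 (h t) = 0.
  rewrite /h0 (br_anti lieV) (br_sum lieV) big1 ?oppr0 // => s _.
  by rewrite (brZ lieV) (ce_hh ce) scaler0.
pose X (i : option (bool * (C * seq S))) := match i with
  | None => \sum_s z s *: h s
  | Some (true, q) => if size q.2 == k then 0 else q.1 *: nest br e q.2
  | Some (false, q) => q.1 *: nest br f q.2 end.
pose beta (i : option (bool * (C * seq S))) (_ : unit) : C := match i with
  | None => 0 | Some (true, q) => (size q.2)%:R | Some (false, q) => - (size q.2)%:R end.
apply: (@eigen_separation _ _ unit (fun _ => br h0) (fun _ => br_lin lieV h0) K linK _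
  _ (None :: [seq Some (true, q) | q <- r] ++ [seq Some (false, q) | q <- r']) X beta (fun=> k%:R)).
- move=> _ u Ku; rewrite /h0 (br_anti lieV) (br_sum lieV) -sumrN.
  apply: (linear_set_sum linK) => s _; rewrite (brZ lieV) -scalerN -(br_anti lieV).
  by apply: (linear_setZ linK); exact: hK.
- move=> _; rewrite /Y (br_sum lieV) scaler_sumr; apply: eq_bigr => q /eqP qk.
  by rewrite (brZ lieV) h0e qk !scalerA mulrC.
- move=> [[[] q]|] _ /=; last 1 first.
  + rewrite scale0r (br_sum lieV) big1 // => s _; by rewrite (brZ lieV) h0h scaler0.
  + case: ifP => _; first by rewrite (br0 lieV) scaler0.
    by rewrite (brZ lieV) h0e !scalerA mulrC.
  + by rewrite (brZ lieV) h0f !scalerA mulrC.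
- move=> [[[] q]|] /=.
  + by case: ifPn => [_|nk]; [left | right; exists tt; rewrite eqr_nat].
  + right; exists tt; rewrite eqr_oppLR -subr_eq0 opprK -natrD pnatr_eq0 addn_eq0.
    by rewrite [(k == 0)%N]gtn_eqF // andbF.
  + by right; exists tt; rewrite eq_sym pnatr_eq0 -lt0n.
rewrite big_cons big_cat !big_map /=.
move: KX; congr (K _); rewrite addrA [Y + _]addrC -!addrA; congr (_ + _); rewrite addrA; congr (_ + _).
rewrite /Y /nest_sum [RHS]addrC (bigID (fun q => size q.2 == k)) /= addrC; congr (_ + _).
rewrite [LHS]big_mkcond; apply: eq_bigr => q _.
by case: eqP.
Qed.

End Half.

Variables (e f h : S -> V).
Hypothesis ce : chevalley_elts a br e f h.
Let ce' := chevalley_elts_opp lieV ce.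

Lemma Lall_f s X : Lall e f h X -> Lall e f h (br (f s) X).
Proof. by rewrite -Lall_oppE; exact: (Lall_e ce'). Qed.

Lemma Lall_gens s : [/\ Lall e f h (e s), Lall e f h (f s) & Lall e f h (h s)].
Proof.
split; last by apply: hspan_Lall; exact: hspan_h.
  by apply: (@Lp_Lall _ _ _ 1%N) => //; exact: (Lp_nest br e [:: s]).
by rewrite -Lall_oppE; apply: (@Lp_Lall _ _ _ 1%N) => //; exact: (Lp_nest br f [:: s]).
Qed.

Variable K : set V.
Hypothesis linK : linear_set K.
Hypothesis eK : forall s X, K X -> K (br (e s) X).
Hypothesis fK : forall s X, K X -> K (br (f s) X).
Hypothesis hK : forall s X, K X -> K (br (h s) X).
Hypothesis hK0 : forall z : S -> C, K (\sum_s z s *: h s) -> forall s, z s = 0.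

Let nest_sum_eq0 (g : S -> V) (r : seq (C * seq S)) : nonempty_words r ->
  (forall k, (0 < k)%N -> \sum_(q <- r | size q.2 == k) q.1 *: nest br g q.2 = 0) -> nest_sum br g r = 0.
Proof.
elim: {r}(size r).+1 {-2}r (ltnSn (size r)) => // N IH [|p r] szr ne H.
  by rewrite /nest_sum big_nil.
rewrite /nest_sum (bigID (fun q => size q.2 == size p.2)) /= H ?add0r; last first.
  by rewrite lt0n size_eq0; case/andP: ne.
rewrite -big_filter; apply: IH => [||k k0].
- by rewrite /= eqxx /= -ltnS (leq_ltn_trans _ szr) //= ltnS size_filter count_size.
- by move: ne; rewrite /nonempty_words !all_filter; apply: sub_all => q Hq; apply/implyP.
rewrite big_filter_cond; have [->|nk] := eqVneq k (size p.2).
  by rewrite big1 // => q /andP[/negPf ->].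
rewrite -[RHS](H k k0); apply: eq_bigl => q; case: eqP => //= ->.
by rewrite eq_sym (negPf nk).
Qed.

(** The components of each height lie in [K] by [height_separation] and vanish by [Lp_kernel], the
    negative ones through the involution; then [hK0] disposes of the Cartan component. This is the
    principle that an ideal avoiding the Cartan subalgebra is zero, and it is used for transfer,
    irreducibility and non-degeneracy. *)
Theorem Lall_kernel X : Lall e f h X -> K X -> X = 0.
Proof.
move=> [z [r [r' [n n' ->]]]] KX.
have r0 : nest_sum br e r = 0.
  apply: nest_sum_eq0 => // k k0; exact: (height_separation ce linK fK hK hK0 k0 KX).
have r'0 : nest_sum br f r' = 0.
  apply: nest_sum_eq0 => // k k0.
  apply: (@height_separation f e (fun s => - h s) ce' K linK eK _ _ (fun s => - z s) r' r k k0).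
  - move=> s Y KY; rewrite -scaleN1r (brZl lieV); apply: (linear_setZ linK); exact: hK.
  - move=> z' Hz' s; apply/eqP; rewrite -oppr_eq0; apply/eqP; move: s; apply: hK0.
    by move: Hz'; congr (K _); apply: eq_bigr => s _; rewrite scalerN scaleNr.
  - move: KX; congr (K _); rewrite addrAC; congr (_ + _ + _); apply: eq_bigr => s _.
    by rewrite scalerN scaleNr opprK.
move: KX; rewrite r0 r'0 !addr0 => /hK0 z0; rewrite big1 // => s _.
by rewrite z0 scale0r.
Qed.

End TriangularSpan.

(** * Transfer between representations *)

Section FiniteDimension.
Variable C : numClosedFieldType.

Lemma linear_set_vspace (vT : vectType C) (P : set vT) : linear_set P ->
  exists U : {vspace vT}, forall x, (x \in U) <-> P x.
Proof.
move=> linP.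
pose ok d := `[< exists U : {vspace vT}, (forall x, x \in U -> P x) /\ \dim U = d >].
have ex0 : exists d, ok d.
  exists 0%N; apply/asboolP; exists 0%VS; split; last exact: dimv0.
  by move=> x; rewrite memv0 => /eqP ->; have [] := linP.
have bnd d : ok d -> (d <= \dim {:vT})%N.
  by move=> /asboolP[U [_ <-]]; apply: dimvS; exact: subvf.
case: (ex_maxnP ex0 bnd) => d /asboolP[U [UP <-]] maxd.
exists U => x; split=> [|Px]; first exact: UP.
apply: contrapT => /negP xU.
have : (\dim (U + <[x]>)%VS <= \dim U)%N.
  apply: maxd; apply/asboolP; exists (U + <[x]>)%VS; split=> // y.
  move=> /memv_addP[u uU [v /vlineP[c ->] ->]].
  by apply: (linear_setD linP); [exact: UP | exact: (linear_setZ linP)].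
rewrite leqNgt => /negP; apply.
have := dimv_leqif_sup (addvSl U <[x]>%VS) => -[_ /esym]; rewrite ltn_neqAle dimvS ?addvSl // andbT.
move=> H; apply/negP => /eqP E; move: H; rewrite E eqxx => /subvP/(_ x).
by rewrite (negPf xU) memvE addvSr => /(_ isT).
Qed.

Lemma linear_set_graph (U W : vectType C) (P : set (U * W)) : linear_set P ->
  (forall y, P (0, y) -> y = 0) ->
  exists Psi : {linear U -> W}, forall x, P x -> Psi x.1 = x.2.
Proof.
move=> linP inj; have [T HT] := linear_set_vspace linP.
pose p1 := linfun (fst : U * W -> U); pose p2 := linfun (snd : U * W -> W).
pose g := (p1 \o projv T)%VF.
exists (p2 \o projv T \o g^-1)%VF => x Px.
have xT : x \in T by apply/HT.
have gx : g x = x.1 by rewrite comp_lfunE projv_id // lfunE.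
set z := projv T ((g^-1)%VF x.1).
have zT : z \in T by rewrite -[T]limg_proj memv_img ?memvf.
have z1 : z.1 = x.1.
  have : g ((g^-1)%VF x.1) = x.1 by apply: limg_lfunVK; rewrite -gx memv_img ?memvf.
  by rewrite comp_lfunE lfunE.
rewrite /= !comp_lfunE -/z lfunE /=.
have Pzx : P (0, z.2 - x.2).
  have : P (z - x) by apply: (linear_setB linP) => //; apply/HT.
  by rewrite -[z - x]/((z.1 - x.1, z.2 - x.2) : U * W) z1 subrr.
by apply/eqP; rewrite -subr_eq0; apply/eqP; exact: inj Pzx.
Qed.

End FiniteDimension.

Section PairTransfer.
Variables (C : numClosedFieldType) (S : finType) (a : S -> S -> int).
Hypothesis a_diag : forall s, a s s = 2.
Hypothesis pd : posdef_cartan a.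
Variables (n m : nat).

Definition pair_br (x y : 'M[C]_n * 'M[C]_m) : 'M[C]_n * 'M[C]_m :=
  (mxad x.1 y.1, mxad x.2 y.2).

Lemma pair_lie : lie_bracket pair_br.
Proof.
split=> [x c u v|x y|x y z]; rewrite /pair_br /=.
- by rewrite !mxadDr !mxadZr.
- by rewrite mxadC [X in (_, X)]mxadC.
- by rewrite mxad_jacobi [X in (_, X)]mxad_jacobi.
Qed.

Variables (E F H : S -> 'M[C]_n) (E' F' H' : S -> 'M[C]_m).
Hypothesis cm : chevalley_mx a E F H.
Hypothesis cm' : chevalley_mx a E' F' H'.

Definition pair_e s := (E s, E' s).
Definition pair_f s := (F s, F' s).
Definition pair_h s := (H s, H' s).

Let pair_nil (A : 'M[C]_n) (A' : 'M[C]_m) (X : 'M[C]_n * 'M[C]_m) :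
  nilpotent_mx A -> nilpotent_mx A' -> exists k, iter k (pair_br (A, A')) X = 0.
Proof.
move=> nA nA'; have [K [K0 _]] := mexp_conj X.1 nA; have [K' [K0' _]] := mexp_conj X.2 nA'.
have it k : iter k (pair_br (A, A')) X = (iter k (mxad A) X.1, iter k (mxad A') X.2).
  by elim: k => [|k /= ->] //; case: X {K0 K0'}.
have ge0 p (B Y : 'M[C]_p) j i : iter j (mxad B) Y = 0 -> iter (i + j) (mxad B) Y = 0.
  by move=> H0; rewrite iterD H0; elim: i => //= i ->; rewrite mxad0r.
by exists (K' + K)%N; rewrite it ge0 // addnC ge0.
Qed.

Lemma pair_chevalley : chevalley_elts a pair_br pair_e pair_f pair_h.
Proof.
have [hh ef he hf nE nF] := cm; have [hh' ef' he' hf' nE' nF'] := cm'.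
split=> s; rewrite /pair_br /pair_e /pair_f /pair_h.
- by move=> t; rewrite hh hh'.
- by move=> t; rewrite ef ef'; case: ifP.
- by move=> t; rewrite he he'.
- by move=> t; rewrite hf hf'.
- by move=> x; exact: pair_nil.
- by move=> x; exact: pair_nil.
Qed.

(** The Lie algebra generated by pairs of corresponding generators. To be a graph, it must contain
    no pair with only its first component zero. *)
Definition pairL : set ('M[C]_n * 'M[C]_m) := Lall pair_br pair_e pair_f pair_h.

Hypothesis Hfree : forall z : S -> C, \sum_s z s *: H s = 0 -> forall s, z s = 0.

(** The pairs with first component 0 are stable under all brackets, and they avoid the Cartan part
    because the [H s] are independent: [Lall_kernel] applies. *)
Lemma pairL_inj y : pairL (0, y) -> y = 0.
Proof.
move=> Ly; pose K := [set x : 'M[C]_n * 'M[C]_m | x.1 = 0].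
have linK : linear_set K.
  by split=> // c [u u'] [v v']; rewrite /K /= => -> ->; rewrite scaler0 addr0.
have stK x : forall X, K X -> K (pair_br x X) by move=> [X X']; rewrite /K /= => ->; rewrite mxad0r.
have hK0 (z : S -> C) : K (\sum_s z s *: pair_h s) -> forall s, z s = 0.
  rewrite /K /= => H0; apply: Hfree; rewrite -[RHS]H0.
  by rewrite (big_morph fst (fun _ _ => erefl) erefl).
have := Lall_kernel pair_lie a_diag pd pair_chevalley linK (fun s => stK _) (fun s => stK _) (fun s => stK _) hK0 Ly erefl.
by case.
Qed.

(** [Psi] is the Lie algebra homomorphism from the first representation to the second, extended
    arbitrarily from the image of the Lie algebra to all matrices. Linearity is what lets it carry
    regular functions. *)
Lemma rep_transfer : exists Psi : {linear 'M[C]_n -> 'M[C]_m},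
  forall x, pairL x -> Psi x.1 = x.2.
Proof.
apply: linear_set_graph; first exact: Lall_linear.
exact: pairL_inj.
Qed.

Lemma pairL_conj (b : bool) s t x : pairL x ->
  let A := if b then E s else F s in let A' := if b then E' s else F' s in
  pairL (mexp (t *: A) *m x.1 *m mexp (- (t *: A)), mexp (t *: A') *m x.2 *m mexp (- (t *: A'))).
Proof.
move=> Lx A A'.
have nA : nilpotent_mx (t *: A).
  by apply: nilpotentZ; rewrite /A; case: (b); [exact: (cm_nilE cm) | exact: (cm_nilF cm)].
have nA' : nilpotent_mx (t *: A').
  by apply: nilpotentZ; rewrite /A'; case: (b); [exact: (cm_nilE cm') | exact: (cm_nilF cm')].
have linL : linear_set pairL by exact: Lall_linear.
have stL y : pairL y -> pairL (pair_br (t *: A, t *: A') y).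
  move=> Ly; have : pairL (t *: pair_br (A, A') y).
    apply: (linear_setZ linL); rewrite /A /A'; case: (b).
      exact: (Lall_e pair_lie pair_chevalley s Ly).
    exact: (Lall_f pair_lie pair_chevalley s Ly).
  by rewrite /pair_br /= !mxadZl.
have [K [K0 ->]] := mexp_conj x.1 nA; have [K' [K0' ->]] := mexp_conj x.2 nA'.
have itL k : pairL (iter k (mxad (t *: A)) x.1, iter k (mxad (t *: A')) x.2).
  by elim: k => [|k IH]; [case: (x) Lx | exact: (stL _ IH)].
have ext p (B Y : 'M[C]_p) j i : iter j (mxad B) Y = 0 ->
    \sum_(k < j) k`!%:R^-1 *: iter k (mxad B) Y = \sum_(k < j + i) k`!%:R^-1 *: iter k (mxad B) Y.
  move=> H0; rewrite big_split_ord /= [X in _ + X]big1 ?addr0 // => k _.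
  suff -> : iter (j + k) (mxad B) Y = 0 by rewrite scaler0.
  by rewrite addnC iterD H0; elim: (k : nat) => //= l ->; rewrite mxad0r.
rewrite (ext _ _ _ _ K' K0) (ext _ _ _ _ K K0') [(K' + K)%N]addnC.
have -> : (\sum_(k < K + K') k`!%:R^-1 *: iter k (mxad (t *: A)) x.1,
   \sum_(k < K + K') k`!%:R^-1 *: iter k (mxad (t *: A')) x.2) =
   \sum_(k < K + K') k`!%:R^-1 *: (iter k (mxad (t *: A)) x.1, iter k (mxad (t *: A')) x.2).
  rewrite [RHS]surjective_pairing; congr (_, _).
    by rewrite (big_morph fst (fun _ _ => erefl) erefl).
  by rewrite (big_morph snd (fun _ _ => erefl) erefl).
by apply: (linear_set_sum linL) => k _; apply: (linear_setZ linL).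
Qed.

End PairTransfer.

Section PosdefFromRep.
Variables (C : numClosedFieldType) (G : affineGroup C) (S : finType).
Variable D : chevalley_data G S.

Lemma lie_lincomb (z : S -> C) : lie (fun f => \sum_s z s * gen_h D s f).
Proof.
have lieH s : lie (gen_h D s) by have [] := gen_lie D s.
split=> [c f g Af Ag|f g Af Ag].
  rewrite mulr_sumr -big_split; apply: eq_bigr => s _ /=.
  by have [-> // _] := lieH s; ring.
rewrite mulr_sumr mulr_suml -big_split; apply: eq_bigr => s _ /=.
by have [_ -> //] := lieH s; ring.
Qed.

Lemma faithful_h_free n (rho : G -> 'M[C]_n) : rational_rep rho -> faithful_rep rho ->
  forall z : S -> C, \sum_s z s *: drep rho (gen_h D s) = 0 -> forall s, z s = 0.
Proof.
move=> rat faith z z0; apply: (@gen_h_free _ _ _ D) => f Af.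
apply: (faithful_lie rat faith (lie_lincomb z)) => //.
rewrite -[RHS]z0; apply/matrixP => i j; rewrite mxE summxE.
by apply: eq_bigr => s _; rewrite !mxE.
Qed.

Lemma faithful_conj n (rho : G -> 'M[C]_n) P : P \in unitmx ->
  rational_rep rho -> faithful_rep rho -> faithful_rep (fun x => P *m rho x *m invmx P).
Proof.
move=> uP rat faith; apply/seteqP; split; last first.
  apply: algebra_generated_min; first exact: coord_ring_subalgebra.
  by move=> _ [i [j ->]]; have [_ _] := rational_rep_conj uP rat.
have subB := algebra_generated_subalgebra (matrix_coefs (fun x : G => P *m rho x *m invmx P)).
rewrite {1}faith; apply: algebra_generated_min => // _ [i [j ->]].
rewrite (_ : (fun x => _) = fun x => (invmx P *m (P *m rho x *m invmx P) *m P) i j).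
  apply: (subalg_mulmx subB) => k l; last exact: (subalg_cst subB).
  apply: (subalg_mulmx subB) => k' l'; first exact: (subalg_cst subB).
  by apply: algebra_generated_sub; exists k', l'.
by apply: funext => x; rewrite !mulmxA mulVmx // mul1mx mulmxKV.
Qed.

(* The trace form of a faithful representation, restricted to the integral weights. *)
Theorem cartan_posdef : posdef_cartan (cartan D).
Proof.
have [n [rho0 [rat0 faith0]]] := faithful_rep_ex G.
have [P [wt [uP [wtH _]]]] := weight_basis D rat0.
set rho := (fun x => _) in wtH.
have rat : rational_rep rho by exact: rational_rep_conj.
have faith : faithful_rep rho by exact: faithful_conj.
have [hh ef he hf _ _] := drep_chevalley D rat.
pose K s t := \sum_i wt i s * wt i t.
have KE s t : (K s t)%:~R = \tr (drep rho (gen_h D s) *m drep rho (gen_h D t)) :> C.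
  rewrite !wtH mulmx_diag /mxtrace rmorph_sum; apply: eq_bigr => i _.
  by rewrite !mxE eqxx mulr1n rmorphM.
exists K; split=> [s t|s t|y [s0 ys0]].
- by apply: eq_bigr => i _; rewrite mulrC.
(* Invariance of the trace under brackets gives K s u = (a u s) tr(E_s F_s). The case u = s
   identifies this trace as half of K s s. *)
- have key u : (K s u)%:~R = (cartan D u s)%:~R * \tr (drep rho (gen_e D s) *m drep rho (gen_f D s)) :> C.
    have := ef s s; rewrite eqxx => ehf; rewrite KE -ehf /mxad mulmxBl linearB /=.
    rewrite -mulmxA -[X in _ - \tr X]mulmxA [X in _ - X]mxtrace_mulC -mulmxA -linearB /= -mulmxBr.
    rewrite (_ : _ - _ = (cartan D u s)%:~R *: drep rho (gen_f D s)); first by rewrite -scalemxAr linearZ.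
    by have := hf u s; rewrite mxadC /mxad scaleNr => /oppr_inj.
  apply: (@intr_inj C); rewrite !rmorphM /= !key.
  by have [-> _ _] := cartanP D; ring.
(* The form is a sum of squares indexed by the weights. If it vanishes, the combination of the h_s
   with coefficients y is zero in a faithful representation, which the independence of the h_s
   forbids. *)
- have E0 : \sum_s \sum_t y s * y t * (K s t)%:~R = \sum_i (\sum_s y s * (wt i s)%:~R) ^+ 2.
    rewrite (eq_bigr (fun s => \sum_i \sum_t (y s * (wt i s)%:~R) * (y t * (wt i t)%:~R))) => [|s _].
      rewrite exchange_big; apply: eq_bigr => i _.
      by rewrite expr2 mulr_suml; apply: eq_bigr => s _; rewrite mulr_sumr.
    rewrite exchange_big; apply: eq_bigr => t _; rewrite rmorph_sum mulr_sumr.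
    by apply: eq_bigr => i _; rewrite rmorphM /=; ring.
  rewrite E0 lt_neqAle sumr_ge0 ?andbT => [|i _]; last exact: sqr_ge0.
  apply/negP => /eqP /esym /eqP; rewrite psumr_eq0 => [/allP Hy|i _]; last exact: sqr_ge0.
  have : ratr (y s0) = 0 :> C.
    apply: (faithful_h_free rat faith (z := fun s => ratr (y s))).
    apply/matrixP => i j; rewrite summxE [RHS]mxE.
    have [->|nij] := eqVneq i j; last first.
      by rewrite big1 // => s _; rewrite wtH !mxE (negPf nij) mulr0n mulr0.
    have /Hy : j \in index_enum _ by rewrite mem_index_enum.
    rewrite /= sqrf_eq0 => /eqP/(congr1 (@ratr C)); rewrite rmorph0 rmorph_sum => Ej; rewrite -[RHS]Ej.
    by apply: eq_bigr => s _; rewrite wtH !mxE eqxx mulr1n rmorphM /= ratr_int.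
  by move/eqP; rewrite fmorph_eq0 (negPf ys0).
Qed.

End PosdefFromRep.

(** * The big cell *)

Section Span.
Variables (C : numClosedFieldType) (V : lmodType C).

Definition lspan (T : set V) : set V :=
  [set u | forall L, linear_set L -> T `<=` L -> L u].

Lemma lspan_linear T : linear_set (lspan T).
Proof.
split=> [L [L0 _] _ //|c u v Hu Hv L linL TL]; have [_ LD] := linL.
by apply: LD; [exact: Hu | exact: Hv].
Qed.

Lemma lspan_sub T : T `<=` lspan T.
Proof. by move=> u Tu L _; exact. Qed.

Lemma lspan_min T L : linear_set L -> T `<=` L -> lspan T `<=` L.
Proof. by move=> linL TL u; exact. Qed.

End Span.

Section BigCell.
Variables (C : numClosedFieldType) (G : affineGroup C) (S : finType).
Variable D : chevalley_data G S.
Local Notation A := (coord_ring G).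
Local Notation subA := (coord_ring_subalgebra G).

Definition unip_elt (b : bool) (w : seq (S * C)) : G :=
  word_elt D [seq (b, p.1, p.2) | p <- w].

Lemma unip_elt_cat b w w' : unip_elt b (w ++ w') = (unip_elt b w * unip_elt b w')%g.
Proof. by rewrite /unip_elt map_cat word_elt_cat. Qed.

Definition torus_elt (t : S -> C) : G :=
  foldr (fun s g => tor_elt D s (t s) * g)%g 1%g (enum S).

Definition cell_elt y t z : G := (unip_elt false y * torus_elt t * unip_elt true z)%g.

Lemma torus_elt1 : torus_elt (fun=> 1) = 1%g.
Proof. by rewrite /torus_elt; elim: (enum S) => //= s r ->; rewrite tor_elt1 mulg1. Qed.

Section WeightRep.
Variables (n : nat) (rho : G -> 'M[C]_n) (wt : 'I_n -> S -> int).
Hypothesis rat : rational_rep rho.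
Hypothesis wr : weight_rep D rho wt.

Definition torus_char (t : S -> C) i : C := \prod_s t s ^ wt i s.

Lemma rep_torus t : (forall s, t s != 0) -> rho (torus_elt t) = diag_mx (\row_i torus_char t i).
Proof.
move=> t0; have [r1 rM rA] := rat; have [_ wT] := wr.
rewrite /torus_char /torus_elt.
have -> : (\row_i \prod_s t s ^ wt i s) = \row_i \prod_(s <- enum S) t s ^ wt i s.
  by apply/rowP => i; rewrite !mxE big_enum.
elim: (enum S) => [|s r IH] /=.
  by rewrite r1; apply/matrixP => i j; rewrite !mxE big_nil.
rewrite rM IH wT // mulmx_diag; congr diag_mx; apply/rowP => i.
by rewrite !mxE big_cons.
Qed.

Lemma weight_cancel (a b c : int) (x : C) :
  x != 0 -> a%:~R * x - x * b%:~R = c%:~R * x -> a = b + c.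
Proof.
move=> x0; rewrite [x * _]mulrC -mulrBl => /(mulIf x0)/eqP.
by rewrite -rmorphB /= eqr_int => /eqP <-; rewrite addrC subrK.
Qed.

Lemma gen_e_weight s k l : drep rho (gen_e D s) k l != 0 ->
  forall t, wt k t = wt l t + cartan D t s.
Proof.
move=> nz t; have /matrixP/(_ k l) := cm_he (drep_chevalley D rat) t s.
have [wH _] := wr; rewrite wH /mxad mul_diag_mx mul_mx_diag !mxE in nz * => /(weight_cancel nz).
by [].
Qed.

Lemma gen_f_weight s k l : drep rho (gen_f D s) k l != 0 ->
  forall t, wt k t = wt l t - cartan D t s.
Proof.
move=> nz t; have /matrixP/(_ k l) := cm_hf (drep_chevalley D rat) t s.
have [wH _] := wr; rewrite wH /mxad mul_diag_mx mul_mx_diag !mxE -rmorphN in nz * => /(weight_cancel nz).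
by [].
Qed.

Lemma torus_gen_e s t : (forall u, t u != 0) -> exists2 c, c != 0 &
  drep rho (gen_e D s) *m rho (torus_elt t) = c *: (rho (torus_elt t) *m drep rho (gen_e D s)).
Proof.
move=> t0; exists (\prod_u t u ^ (- cartan D u s)).
  by apply/prodf_neq0 => u _; rewrite expfz_neq0.
rewrite rep_torus //; apply/matrixP => k l; rewrite mul_mx_diag mxE [RHS]mxE mul_diag_mx [in RHS]mxE.
rewrite (mxE _ _ 0) (mxE _ _ 0 k).
have [->|nz] := eqVneq (drep rho (gen_e D s) k l) 0; first by rewrite !mulr0 mul0r.
rewrite mulrA mulrC; congr (_ * _); rewrite /torus_char -big_split; apply: eq_bigr => u _ /=.
by rewrite (gen_e_weight nz) -expfzDr // addrC addrK.
Qed.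

Lemma torus_tor s t u : u != 0 -> (forall v, t v != 0) ->
  rho (tor_elt D s u) *m rho (torus_elt t) = rho (torus_elt (fun v => if v == s then u * t v else t v)).
Proof.
move=> u0 t0; have [_ wT] := wr; rewrite wT // !rep_torus // => [|v]; last first.
  by case: ifP => _ //; rewrite mulf_neq0.
rewrite mulmx_diag; congr diag_mx; apply/rowP => i; rewrite !mxE /torus_char.
rewrite [in RHS](bigD1 s) //= eqxx [in LHS](bigD1 s) //= expfzMl mulrA; congr (_ * _).
by apply: eq_bigr => v /negPf ->.
Qed.

Lemma tor_stable_h s (P : set 'cV[C]_n) : linear_set P ->
  (forall u v, u != 0 -> P v -> P (rho (tor_elt D s u) *m v)) ->
  forall v, P v -> P (drep rho (gen_h D s) *m v).
Proof.
move=> linP Pst v Pv; have [N [K [M [M1 MM HM torE]]]] := tor_projections D rat s.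
have PM k : P (M k *m v).
  apply: (@linear_set_coef _ _ P linP K (fun k => M k *m v)) => t t0.
  have := linear_setZ linP (t ^+ N) (Pst t v t0 Pv).
  rewrite torE // mulmx_suml scaler_sumr; under eq_bigr do rewrite -scalemxAl scalerA.
  rewrite (eq_bigr (fun k : 'I_K => t ^+ k *: (M k *m v))) // => j _.
  congr (_ *: _); rewrite -[t ^+ N]/(t ^ N%:Z) -expfzDr //; by rewrite addrC subrK.
rewrite -[v]mul1mx -M1 mulmx_suml mulmx_sumr; apply: (linear_set_sum linP) => k _.
by rewrite mulmxA HM -scalemxAl; apply: (linear_setZ linP).
Qed.

End WeightRep.

Hypothesis connG : connected_group G.

(** The group version of U(g) = U(n-) U(h) U(n+). Starting from the span of the torus translates of
    the upper unipotent orbit of [v], close up under the f's. The result is stable under the e's and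
    h's too, since these commute past the f's up to terms already present; so [stable_flat]
    applies. *)
Lemma cell_dense f : A f ->
  (forall y t z, (forall s, t s != 0) -> f (cell_elt y t z) = 0) -> forall x, f x = 0.
Proof.
move=> Af f0; have [n [rho0 [xi0 [v0 [rat0 fE0]]]]] := coord_ring_rep Af.
have [P [wt [uP wr]]] := weight_basis D rat0; set rho := (fun x => _) in wr.
have rat : rational_rep rho by exact: rational_rep_conj.
have [xi [v fE]] : exists (xi : 'rV[C]_n) (v : 'cV[C]_n), forall x, f x = (xi *m rho x *m v) 0 0.
  exists (xi0 *m invmx P), (P *m v0) => x.
  by rewrite fE0 /rho !mulmxA mulmxKV // mulmxKV.
have [r1 rM rA] := rat.
pose Z := lspan [set u : 'cV[C]_n | exists z, u = rho (unip_elt true z) *m v].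
pose N1 := lspan [set u : 'cV[C]_n | exists t w, [/\ forall s, t s != 0, Z w & u = rho (torus_elt t) *m w]].
(* The smallest subspace containing [N1] and stable under the f's; its impredicative form supplies
   the inductions in [HM] and [EM]. *)
pose M := [set u : 'cV[C]_n | forall L, linear_set L -> N1 `<=` L ->
   (forall s w, L w -> L (drep rho (gen_f D s) *m w)) -> L u].
have linZ : linear_set Z by exact: lspan_linear.
have linN : linear_set N1 by exact: lspan_linear.
have linM : linear_set M.
  split=> [L [L0 _] _ _ //|c u w Mu Mw L linL NL FL]; have [_ LD] := linL.
  by apply: LD; [exact: Mu | exact: Mw].
have NM : N1 `<=` M by move=> u Nu L _ NL _; exact: NL.
have FM s u : M u -> M (drep rho (gen_f D s) *m u).
  by move=> Mu L linL NL FL; apply: (FL); exact: Mu.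
have lin_pre m (X : 'M[C]_(m, n)) (L : set 'cV[C]_m) : linear_set L -> linear_set [set u : 'cV_n | L (X *m u)].
  move=> [L0 LD]; split=> /= [|c u w Lu Lw]; first by rewrite mulmx0.
  by rewrite mulmxDr -scalemxAr; exact: LD.
have EZ s u : Z u -> Z (drep rho (gen_e D s) *m u).
  apply: (rep_stable_gen (b := true) rat linZ) => t; apply: lspan_min; first exact: lin_pre.
  move=> _ [z ->]; apply: lspan_sub; exists ((s, t) :: z).
  by rewrite -[_ :: z]cat1s unip_elt_cat rM {2}/unip_elt /= mulg1 mulmxA.
have EN s u : N1 u -> N1 (drep rho (gen_e D s) *m u).
  move: u; apply: lspan_min; first exact: lin_pre.
  move=> _ [t [w [t0 Zw ->]]]; have [c c0 cE] := torus_gen_e rat wr s t0.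
  rewrite /= mulmxA cE -scalemxAl -mulmxA; apply: (linear_setZ linN).
  by apply: lspan_sub; exists t, (drep rho (gen_e D s) *m w); split=> //; exact: EZ.
have HN s u : N1 u -> N1 (drep rho (gen_h D s) *m u).
  apply: (tor_stable_h rat linN) => c; move=> w c0; move: w; apply: lspan_min; first exact: lin_pre.
  move=> _ [t [w [t0 Zw ->]]]; apply: lspan_sub.
  exists (fun v => if v == s then c * t v else t v), w; split=> //.
    by move=> v'; case: ifP => _ //; rewrite mulf_neq0.
  by rewrite mulmxA (torus_tor rat wr).
have [hh ef he hf _ _] := drep_chevalley D rat.
have HM s u : M u -> M (drep rho (gen_h D s) *m u).
  move=> Mu; suff : M u /\ forall s, M (drep rho (gen_h D s) *m u) by case.
  apply: (Mu [set u | M u /\ forall s, M (drep rho (gen_h D s) *m u)]).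
  - split=> [|c u1 u2 [Mu1 H1] [Mu2 H2]].
      by split=> [|s']; rewrite ?mulmx0; have [] := linM.
    split=> [|s']; first by have [_] := linM; exact.
    by rewrite mulmxDr -scalemxAr; have [_] := linM; exact.
  - by move=> w Nw; split=> [|s']; apply: NM => //; exact: HN.
  - move=> t w [Mw Hw]; split=> [|s']; first exact: FM.
    rewrite mulmxA (_ : _ *m _ = drep rho (gen_f D t) *m drep rho (gen_h D s') - (cartan D s' t)%:~R *: drep rho (gen_f D t)).
      rewrite mulmxBl -mulmxA -scalemxAl; apply: (linear_setB linM); first exact: FM.
      by apply: (linear_setZ linM); exact: FM.
    by have := hf s' t; rewrite /mxad scaleNr => /eqP; rewrite subr_eq => /eqP ->; rewrite addrC.
have EM s u : M u -> M (drep rho (gen_e D s) *m u).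
  move=> Mu; suff : M u /\ forall s, M (drep rho (gen_e D s) *m u) by case.
  apply: (Mu [set u | M u /\ forall s, M (drep rho (gen_e D s) *m u)]).
  - split=> [|c u1 u2 [Mu1 H1] [Mu2 H2]].
      by split=> [|s']; rewrite ?mulmx0; have [] := linM.
    split=> [|s']; first by have [_] := linM; exact.
    by rewrite mulmxDr -scalemxAr; have [_] := linM; exact.
  - by move=> w Nw; split=> [|s']; apply: NM => //; exact: EN.
  - move=> t w [Mw Hw]; split=> [|s']; first exact: FM.
    rewrite mulmxA (_ : _ *m _ = drep rho (gen_f D t) *m drep rho (gen_e D s') + (if s' == t then drep rho (gen_h D s') else 0)).
      rewrite mulmxDl -mulmxA; apply: (linear_setD linM); first exact: FM.
      by case: ifP => _; [exact: HM | rewrite mul0mx; have [] := linM].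
    by have := ef s' t; rewrite /mxad => /eqP; rewrite subr_eq => /eqP ->; rewrite addrC.
have vM : M v.
  apply: NM; apply: lspan_sub; exists (fun=> 1), v; split=> [s||]; first exact: oner_neq0.
    by apply: lspan_sub; exists [::]; rewrite r1 mul1mx.
  by rewrite torus_elt1 r1 mul1mx.
have EFM b s u : M u -> M (drep rho (gen_ef D b s) *m u) by case: b; [exact: EM | exact: FM].
suff xiM u : M u -> (xi *m u) 0 0 = 0.
  by move=> x; rewrite fE; exact: (stable_flat connG rat linM EFM vM xiM).
move=> Mu.
pose L := [set u : 'cV[C]_n | forall y, (xi *m rho (unip_elt false y) *m u) 0 0 = 0].
suff : L u by move=> /(_ [::]); rewrite r1 mulmx1.
have linL : linear_set L.
  split=> [y|c u1 u2 L1 L2 y] /=; first by rewrite mulmx0 mxE.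
  by rewrite mulmxDr -scalemxAr mxE [X in X + _]mxE L1 L2 mulr0 addr0.
apply: Mu => //.
  apply: lspan_min => // _ [t [w [t0 Zw ->]]] y; move: w Zw.
  apply: (@lspan_min _ _ _ [set w : 'cV[C]_n | (xi *m rho (unip_elt false y) *m (rho (torus_elt t) *m w)) 0 0 = 0]).
    split=> /= [|c u1 u2 L1 L2]; first by rewrite !mulmx0 mxE.
    by rewrite !mulmxDr -!scalemxAr mxE [X in X + _]mxE L1 L2 mulr0 addr0.
  move=> _ [z ->] /=; rewrite -[RHS](f0 y t z t0) fE /cell_elt !rM !mulmxA.
  by [].
move=> s; apply: (rep_stable_gen (b := false) rat linL) => t w Lw y.
have := Lw (y ++ [:: (s, t)]); rewrite unip_elt_cat rM {2}/unip_elt /= mulg1.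
by rewrite !mulmxA.
Qed.

End BigCell.

(** * Triangular factorisation over the big cell *)

Section Unitriangular.
Variables (C : numClosedFieldType) (n : nat).
Implicit Types (ht : 'I_n -> rat) (M N : 'M[C]_n).

(** Triangularity is measured by a height instead of the order of the indices: a weight basis is not
    sorted, and distinct vectors of equal height have no entry between them. *)
Definition upper ht M := forall k l, ~~ (ht l < ht k) -> M k l = (k == l)%:R.

Lemma upper1 ht : upper ht 1%:M.
Proof. by move=> k l _; rewrite mxE. Qed.

Lemma upperM ht M N : upper ht M -> upper ht N -> upper ht (M *m N).
Proof.
move=> uM uN k l kl; rewrite mxE (bigD1 k) //= uM ?ltxx // eqxx mul1r uN // big1 ?addr0 // => j jk.
have [jlk|jlk] := boolP (ht j < ht k); last by rewrite uM // eq_sym (negPf jk) mul0r.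
rewrite -leNgt in kl; have jl := lt_le_trans jlk kl.
rewrite uN; last by rewrite -leNgt ltW.
by case: eqP jl => [->|]; rewrite ?ltxx // mulr0.
Qed.

Lemma upper_mexp ht M : nilpotent_mx M -> (forall k l, M k l != 0 -> ht l < ht k) ->
  upper ht (mexp M).
Proof.
move=> [N MN] sM k l kl; rewrite (mexpE (nilpotent_le MN (leqnSn N))) /mexp_upto.
have sX j : forall k l, ~~ (ht l < ht k) -> (M ^+ j.+1) k l = 0.
  elim: j => [|j IH] k' l' kl'; first by apply/eqP; apply: contraNT kl' => /sM.
  rewrite exprS -[M * _]/(M *m _) mxE big1 // => i _.
  have [->|/sM ik] := eqVneq (M k' i) 0; first by rewrite mul0r.
  rewrite IH ?mulr0 //; rewrite -leNgt in kl'; by rewrite -leNgt ltW // (lt_le_trans ik kl').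
rewrite big_ord_recl mxE summxE big1 ?addr0 => [|i _].
  by rewrite expr0 fact0 invr1 scale1r mxE.
by rewrite mxE sX // mulr0.
Qed.

Lemma height_ind ht (P : 'I_n -> Prop) :
  (forall k, (forall j, ht k < ht j -> P j) -> P k) -> forall k, P k.
Proof.
move=> HP k; have [m] := ubnP #|[set j | ht k < ht j]%SET|.
elim: m k => // m IH k lm; apply: HP => j kj; apply: IH.
rewrite ltnS in lm; apply: leq_trans lm; apply: proper_card; apply/properP; split.
  by apply/fintype.subsetP => i; rewrite !inE; exact: lt_trans.
by exists j; rewrite !inE ?kj ?ltxx.
Qed.

End Unitriangular.

Section LocalAlgebra.
Variables (C : numClosedFieldType) (X : Type) (L : set (X -> C)).
Hypothesis subL : is_subalgebra L.
Hypothesis invL : forall F, L F -> (forall x, F x != 0) -> L (fun x => (F x)^-1).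

Lemma local_div (P Q F : X -> C) : L P -> L Q -> (forall x, P x != 0) ->
  (forall x, P x * F x = Q x) -> L F.
Proof.
move=> LP LQ P0 PF; rewrite (_ : F = fun x => (P x)^-1 * Q x).
  by apply: (subalgM subL) => //; exact: invL.
by apply: funext => x; rewrite -PF mulKf.
Qed.

Lemma local_expz F (m : int) : L F -> (forall x, F x != 0) -> L (fun x => F x ^ m).
Proof.
move=> LF F0; case: m => m; first exact: (subalgX subL).
rewrite (_ : (fun x => _) = fun x => (F x ^+ m.+1)^-1) //.
by apply: invL => [|x]; [exact: (subalgX subL) | rewrite expf_neq0].
Qed.

Lemma local_invmx n (M : X -> 'M[C]_n) : (forall x, M x \in unitmx) ->
  (forall i j, L (fun x => M x i j)) -> forall i j, L (fun x => invmx (M x) i j).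
Proof.
move=> uM LM i j; rewrite (_ : (fun x => _) = fun x => (\det (M x))^-1 * (\adj (M x)) i j).
  apply: (subalgM subL); last exact: (subalg_adj subL).
  apply: invL => [|x]; first exact: (subalg_det subL).
  by have := uM x; rewrite unitmxE unitfE.
by apply: funext => x; rewrite /invmx uM mxE.
Qed.

(** Downward induction on height, as in Gaussian elimination. An entry of the product in row or
    column k is the wanted unknown times a pivot, plus terms through strictly greater heights that
    are already known; only pivots are divided by. *)
Lemma local_LU n (ht : 'I_n -> rat) (Lo U : X -> 'M[C]_n) (d : X -> 'rV[C]_n) :
  (forall x, upper (fun i => - ht i) (Lo x)) -> (forall x, upper ht (U x)) ->
  (forall x k, d x 0 k != 0) ->
  (forall i j, L (fun x => (Lo x *m diag_mx (d x) *m U x) i j)) ->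
  forall k, [/\ L (fun x => d x 0 k), forall i, L (fun x => Lo x i k)
              & forall j, L (fun x => U x k j)].
Proof.
move=> uLo uU d0 LM; apply: (@height_ind _ ht) => k IH.
have uLo' x i j : ~~ (ht i < ht j) -> Lo x i j = (i == j)%:R.
  by move=> h; apply: uLo; rewrite ltrN2.
pose R i j x := \sum_(l | ht k < ht l) Lo x i l * d x 0 l * U x l j.
have LR i j : L (R i j).
  apply: (subalg_sum subL) => l /IH [Ld LL LU].
  by apply: (subalgM subL) => //; apply: (subalgM subL).
have ME x i j : ht i <= ht k -> ht j <= ht k -> (i == k) || (j == k) ->
    (Lo x *m diag_mx (d x) *m U x) i j = Lo x i k * d x 0 k * U x k j + R i j x.
  move=> ik jk ijk; rewrite mxE (bigD1 k) //= mul_mx_diag mxE; congr (_ + _).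
  rewrite /R (bigID (fun l => ht k < ht l)) /= [X in _ + X]big1 ?addr0 => [|l /andP[lk kl]].
    apply: eq_big => [l|l _]; last by rewrite mxE.
    by case: eqP => //= ->; rewrite ltxx.
  rewrite -leNgt in kl; rewrite mxE.
  case/orP: ijk => /eqP ?; subst.
    by rewrite uLo' ?ltNge ?kl // eq_sym (negPf lk) !mul0r.
  by rewrite uU ?ltNge ?kl // (negPf lk) mulr0.
have Lkk x : Lo x k k = 1 by rewrite uLo' ?ltxx // eqxx.
have Ukk x : U x k k = 1 by rewrite uU ?ltxx // eqxx.
have Ld : L (fun x => d x 0 k).
  rewrite (_ : (fun x => _) = fun x => (Lo x *m diag_mx (d x) *m U x) k k - R k k x).
    exact: (subalgB subL).
  by apply: funext => x; rewrite ME ?eqxx // Lkk Ukk mul1r mulr1 addrK.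
split=> // i.
  have [ik|ik] := boolP (ht i < ht k); last first.
    rewrite (_ : (fun x => _) = fun=> (i == k)%:R); first exact: subalg_cst.
    by apply: funext => x; rewrite uLo'.
  apply: (local_div Ld (Q := fun x => (Lo x *m diag_mx (d x) *m U x) i k - R i k x)) => //.
    exact: (subalgB subL).
  by move=> x; rewrite ME ?eqxx ?orbT // ?ltW // Ukk mulr1 addrK mulrC.
have [ik|ik] := boolP (ht i < ht k); last first.
  rewrite (_ : (fun x => _) = fun=> (k == i)%:R); first exact: subalg_cst.
  by apply: funext => x; rewrite uU.
apply: (local_div Ld (Q := fun x => (Lo x *m diag_mx (d x) *m U x) k i - R k i x)) => //.
  exact: (subalgB subL).
by move=> x; rewrite ME ?eqxx // ?ltW // Lkk mul1r addrK.
Qed.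

(** A unipotent matrix is recovered from the way it moves the grading element. With Y = V H U - H
    one has U Y = [H, U], whose entry (k, l) is (ht k - ht l) times that of U. As Y is strictly
    triangular this is a recursion, with non-zero constants to divide by. *)
Lemma local_unip n (ht : 'I_n -> rat) (U V : X -> 'M[C]_n) :
  let H := diag_mx (\row_i ratr (ht i)) in
  (forall x, upper ht (U x)) -> (forall x, upper ht (V x)) -> (forall x, U x *m V x = 1%:M) ->
  (forall i j, L (fun x => (V x *m H *m U x - H) i j)) ->
  forall i j, L (fun x => U x i j).
Proof.
move=> H uU uV UV LY i j; move: j i; apply: (@height_ind _ ht) => l IH k.
pose Y x := V x *m H *m U x - H.
have [lk|lk] := boolP (ht l < ht k); last first.
  rewrite (_ : (fun x => _) = fun=> (k == l)%:R); first exact: subalg_cst.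
  by apply: funext => x; rewrite uU.
have UY x : U x *m Y x = H *m U x - U x *m H by rewrite mulmxBr !mulmxA UV mul1mx.
have UYE x i j : (U x *m Y x) i j = ratr (ht i - ht j) * U x i j.
  by rewrite UY mul_diag_mx mul_mx_diag !mxE rmorphB mulrBl [U x i j * _]mulrC.
have Y0 x j : ~~ (ht l < ht j) -> Y x j l = 0.
  move=> lj; have VU : V x *m U x = 1%:M by exact: mulmx1C.
  rewrite -[Y x]mul1mx -VU -mulmxA mxE big1 // => i _; rewrite UYE.
  have [li|li] := boolP (ht l < ht i); last first.
    by rewrite uU //; case: eqP => [->|_]; rewrite ?subrr ?rmorph0 ?mul0r !mulr0.
  rewrite uV; last by rewrite -leNgt in lj; rewrite -leNgt ltW // (le_lt_trans lj).
  case: eqP li => [<-|_ _]; first by rewrite (negPf lj).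
  by rewrite mul0r.
apply: (@local_div (fun=> ratr (ht k - ht l)) (fun x => \sum_(j | ht l < ht j) U x k j * Y x j l)).
- exact: subalg_cst.
- by apply: (subalg_sum subL) => j lj; apply: (subalgM subL); [exact: IH | exact: LY].
- by move=> _; rewrite fmorph_eq0 subr_eq0 gt_eqF.
move=> x; rewrite -UYE mxE (bigID (fun j => ht l < ht j)) /= [X in _ + X]big1 ?addr0 // => j /Y0 ->.
by rewrite mulr0.
Qed.

End LocalAlgebra.

Lemma prod_expz (F : fieldType) (x : F) n (m : 'I_n -> int) : x != 0 ->
  x ^ (\sum_i m i) = \prod_i x ^ m i.
Proof.
move=> x0; apply: (big_morph (fun k : int => x ^ k)) => // k l.
by rewrite expfzDr.
Qed.

Section LUGeneration.
Variables (C : numClosedFieldType) (G : affineGroup C) (S : finType).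
Variable D : chevalley_data G S.
Hypothesis connG : connected_group G.
Local Notation A := (coord_ring G).
Local Notation subA := (coord_ring_subalgebra G).

(** The determinant is a one-dimensional representation, in which a nilpotent differential is zero.
    It is therefore trivial on root elements, and words are dense. *)
Lemma rep_det1 n (rho : G -> 'M[C]_n) : rational_rep rho -> forall x, \det (rho x) = 1.
Proof.
move=> rat; have [r1 rM rA] := rat.
pose chi x : 'M[C]_1 := (\det (rho x))%:M.
have ratc : rational_rep chi.
  split=> [|x y|i j]; first by rewrite /chi r1 det1.
    by rewrite /chi rM det_mulmx scalar_mxM.
  rewrite (_ : (fun x => _) = fun x => \det (rho x)); first exact: (subalg_det subA).
  by apply: funext => x; rewrite /chi !ord1 mxE eqxx mulr1n.
have mx11 (M : 'M[C]_1) : nilpotent_mx M -> M = 0.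
  move=> [N MN]; rewrite [M]mx11_scalar in MN *; set c := M 0 0 in MN *.
  have : c ^+ N = 0.
    have -> : c ^+ N = (c%:M ^+ N : 'M[C]_1) 0 0.
      elim: N {MN} => [|N IH]; first by rewrite !expr0 mxE.
      by rewrite !exprS IH -[c%:M * _]/(c%:M *m _) mul_scalar_mx [in RHS]mxE.
    by rewrite MN mxE.
  by move=> /eqP; rewrite expf_eq0 => /andP[_ /eqP ->]; rewrite -scalemx1 scale0r.
have chiw w : chi (word_elt D w) = 1%:M.
  have [c1 cM _] := ratc; elim: w => [|p w IH] //=.
  rewrite cM IH mulmx1 rep_root_elt // (mx11 _ (rep_nilpotent D ratc _ _)) scaler0 mexp0 //.
apply: (word_dense_eq connG (D := D)) => [||w]; first exact: (subalg_det subA).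
  exact: (subalg_cst subA).
by have /matrixP/(_ 0 0) := chiw w; rewrite /chi !mxE eqxx !mulr1n.
Qed.

Definition unip_inv (w : seq (S * C)) := rev [seq (p.1, - p.2) | p <- w].

Lemma unip_invE b w : unip_elt D b (unip_inv w) = ((unip_elt D b w)^-1)%g.
Proof.
rewrite /unip_inv; elim: w => [|p w IH] /=; first by rewrite /unip_elt /= invg1.
rewrite rev_cons -cats1 unip_elt_cat IH {2 3}/unip_elt /= invgM mulg1 root_elt_V //.
Qed.

Section Heights.
Variable c : S -> rat.
Hypothesis cP : forall t, \sum_s (cartan D s t)%:~R * c s = 1.

(** The value of a weight on the grading element, up to sign. The sign makes the e's raise the
    height for [b] true and the f's for [b] false, so that both unipotent groups count as upper
    triangular. *)
Definition height n (wt : 'I_n -> S -> int) (b : bool) i : rat :=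
  (if b then 1 else -1) * \sum_s c s * (wt i s)%:~R.

Lemma height_gen n (rho : G -> 'M[C]_n) wt b s k l : rational_rep rho -> weight_rep D rho wt ->
  drep rho (gen_ef D b s) k l != 0 -> height wt b l < height wt b k.
Proof.
move=> rat wr nz; rewrite -subr_gt0 /height -mulrBr -sumrB.
have cE : \sum_i c i * (cartan D i s)%:~R = 1.
  by rewrite -[RHS](cP s); apply: eq_bigr => i _; rewrite mulrC.
case: b nz => [/(gen_e_weight rat wr)|/(gen_f_weight rat wr)] nz.
  rewrite (eq_bigr (fun i => c i * (cartan D i s)%:~R)) ?cE ?mulr1 // => i _.
  by rewrite nz rmorphD /= mulrDr addrC addKr.
rewrite (eq_bigr (fun i => - (c i * (cartan D i s)%:~R))) ?sumrN ?cE ?mulrNN ?mulr1 // => i _.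
by rewrite nz rmorphB /= mulrBr addrC addKr.
Qed.

Lemma unip_upper n (rho : G -> 'M[C]_n) wt b w : rational_rep rho -> weight_rep D rho wt ->
  upper (height wt b) (rho (unip_elt D b w)).
Proof.
move=> rat wr; have [r1 rM rA] := rat.
elim: w => [|p w IH]; first by rewrite r1; exact: upper1.
rewrite -cat1s unip_elt_cat rM; apply: upperM => //.
rewrite /unip_elt /= mulg1 rep_root_elt //; apply: upper_mexp.
  by apply: nilpotentZ; exact: rep_nilpotent.
move=> k l; rewrite mxE mulf_eq0 negb_or => /andP[_]; exact: height_gen.
Qed.

Lemma height_negb n (wt : 'I_n -> S -> int) : height wt false = fun i => - height wt true i.
Proof. by apply: funext => i; rewrite /height mulN1r mul1r. Qed.

Lemma pairL_word n m (rV : G -> 'M[C]_n) (rW : G -> 'M[C]_m) w x :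
  rational_rep rV -> rational_rep rW ->
  let PL := pairL (fun s => drep rV (gen_e D s)) (fun s => drep rV (gen_f D s)) (fun s => drep rV (gen_h D s))
    (fun s => drep rW (gen_e D s)) (fun s => drep rW (gen_f D s)) (fun s => drep rW (gen_h D s)) in
  let g := word_elt D w in
  PL x -> PL (rV g *m x.1 *m rV (g^-1)%g, rW g *m x.2 *m rW (g^-1)%g).
Proof.
move=> ratV ratW PL; have [v1 vM vA] := ratV; have [w1 wM wA] := ratW.
move=> g Lx; rewrite {}/g; elim: w => [|p w IH] /=.
  by rewrite invg1 v1 w1 !mul1mx !mulmx1; case: (x) Lx.
have := @pairL_conj _ _ _ _ _ _ _ _ _ _ _ (drep_chevalley D ratV) (drep_chevalley D ratW)
   p.1.1 p.1.2 p.2 _ IH.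
rewrite invgM !vM !wM root_elt_V !rep_root_elt // /= !mulmxA !scaleNr.
by rewrite /gen_ef; case: (p.1.1); apply.
Qed.

Section FromLattice.
Variables (n : nat) (rV : G -> 'M[C]_n) (wt : 'I_n -> S -> int).
Hypothesis ratV : rational_rep rV.
Hypothesis wrV : weight_rep D rV wt.
Hypothesis latV : forall s, exists z : 'I_n -> int, forall t, \sum_i z i * wt i t = (s == t)%:R.

Local Notation B := (algebra_generated (matrix_coefs rV)).
Local Notation subB := (algebra_generated_subalgebra (matrix_coefs rV)).

Let X := (seq (S * C) * {t : S -> C | forall s, t s != 0} * seq (S * C))%type.
Let cell (x : X) : G := cell_elt D x.1.1 (sval x.1.2) x.2.
(** The local ring at 1, seen in the parameters of the big cell: quotients of elements of [B] whose
    denominator does not vanish at 1. The quotient is written multiplicatively, as the denominator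
    may vanish elsewhere. *)
Let L : set (X -> C) := [set F | exists b d, [/\ B b, B d, d 1%g != 0 &
  forall x, d (cell x) * F x = b (cell x)]].

Let t1 : {t : S -> C | forall s, t s != 0} :=
  exist (fun t : S -> C => forall s, t s != 0) (fun=> 1) (fun=> oner_neq0 C).
Let x0 : X := ([::], t1, [::]).

Let cell0 : cell x0 = 1%g.
Proof. by rewrite /cell /cell_elt /= torus_elt1 /unip_elt /= !mulg1. Qed.

Let subL : is_subalgebra L.
Proof.
split=> [k|F1 F2|F1 F2].
- exists (fun=> k), (fun=> 1); split=> [|||x]; rewrite ?mul1r ?oner_neq0 //; exact: (subalg_cst subB).
- move=> [b1 [d1 [Bb1 Bd1 d10 E1]]] [b2 [d2 [Bb2 Bd2 d20 E2]]].
  exists (fun x => b1 x * d2 x + d1 x * b2 x), (fun x => d1 x * d2 x); split.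
  + by apply: (subalgD subB); apply: (subalgM subB).
  + exact: (subalgM subB).
  + by rewrite mulf_neq0.
  + by move=> x; rewrite -E1 -E2; ring.
- move=> [b1 [d1 [Bb1 Bd1 d10 E1]]] [b2 [d2 [Bb2 Bd2 d20 E2]]].
  exists (fun x => b1 x * b2 x), (fun x => d1 x * d2 x); split.
  + exact: (subalgM subB).
  + exact: (subalgM subB).
  + by rewrite mulf_neq0.
  + by move=> x; rewrite -E1 -E2; ring.
Qed.

(** The value of [F] at [x0], the parameter of the identity, is non-zero; hence so is that of the
    numerator at 1, and the fraction can be inverted. *)
Let invL F : L F -> (forall x, F x != 0) -> L (fun x => (F x)^-1).
Proof.
move=> [b [d [Bb Bd d0 E]]] F0; exists d, b; split=> // [|x].
  by rewrite -cell0 -E cell0 mulf_neq0.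
by rewrite -E mulfK.
Qed.

Let LB b : B b -> L (b \o cell).
Proof.
move=> Bb; exists b, (fun=> 1); split=> // [||x]; rewrite ?oner_neq0 ?mul1r //.
exact: (subalg_cst subB).
Qed.

Let tx (x : X) : forall s, sval x.1.2 s != 0. Proof. by case: x => [[y [t t0]] z]. Qed.

Let cellE m (rW : G -> 'M[C]_m) wtW x : rational_rep rW -> weight_rep D rW wtW ->
  rW (cell x) = rW (unip_elt D false x.1.1) *m diag_mx (\row_i torus_char wtW (sval x.1.2) i)
    *m rW (unip_elt D true x.2).
Proof.
move=> ratW wrW; have [_ rM _] := ratW.
by rewrite /cell /cell_elt !rM (rep_torus ratW wrW).
Qed.

Let char0 m (wtW : 'I_m -> S -> int) (x : X) k : torus_char wtW (sval x.1.2) k != 0.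
Proof. by apply/prodf_neq0 => s _; rewrite expfz_neq0 // tx. Qed.

Let LU_V k : [/\ L (fun x => torus_char wt (sval x.1.2) k),
   forall i, L (fun x => rV (unip_elt D false x.1.1) i k)
   & forall j, L (fun x => rV (unip_elt D true x.2) k j)].
Proof.
have := @local_LU _ _ _ subL invL n (height wt true) (fun x => rV (unip_elt D false x.1.1))
  (fun x => rV (unip_elt D true x.2)) (fun x => \row_i torus_char wt (sval x.1.2) i).
case/(_ _ _ _ _ k).
- by move=> x; rewrite -height_negb; exact: unip_upper.
- by move=> x; exact: unip_upper.
- by move=> x i; rewrite mxE.
- move=> i j; rewrite (_ : (fun x => _) = (fun g => rV g i j) \o cell).
    by apply: LB; apply: algebra_generated_sub; exists i, j.
  by apply: funext => x /=; rewrite (cellE _ ratV wrV).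
move=> Ld LL LU; split=> //.
by rewrite (_ : (fun x => _) = fun x : X => (\row_i torus_char wt (sval x.1.2) i) 0 k) //; apply: funext => x; rewrite mxE.
Qed.

(** Here the weights must span the weight lattice: writing the s-th fundamental weight as an
    integral combination of weights makes the torus coordinate a Laurent monomial in the pivots. *)
Let L_coord s : L (fun x => sval x.1.2 s).
Proof.
have [z zP] := latV s.
rewrite (_ : (fun x => _) = fun x : X => \prod_i torus_char wt (sval x.1.2) i ^ z i).
  by apply: (subalg_prod subL) => i _; apply: local_expz => //; have [] := LU_V i.
apply: funext => x; rewrite /torus_char.
rewrite (eq_bigr (fun i => \prod_t sval x.1.2 t ^ (z i * wt i t))) => [|i _]; last first.
  rewrite (big_morph (fun y => y ^ z i) (fun a b => expfzMl a b _) (exp1rz C (z i))).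
  by apply: eq_bigr => t _; rewrite exprz_exp mulrC.
rewrite exchange_big /= (eq_bigr (fun t => sval x.1.2 t ^ (s == t)%:R)) => [|t _]; last first.
  by rewrite -prod_expz // zP.
rewrite (bigD1 s) //= eqxx expr1z big1 ?mulr1 // => t ts.
by rewrite eq_sym (negPf ts) expr0z.
Qed.

Let L_cell m (rW : G -> 'M[C]_m) wtW : rational_rep rW -> weight_rep D rW wtW ->
  forall i j, L (fun x => rW (cell x) i j).
Proof.
move=> ratW wrW; have [w1 wM wA] := ratW; have [v1 vM vA] := ratV.
have Hfree (z : S -> C) : \sum_s z s *: drep rV (gen_h D s) = 0 -> forall s, z s = 0.
  move=> z0 s; have [k kP] := latV s; have [wH _] := wrV.
  have z0i i : \sum_t z t * (wt i t)%:~R = 0.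
    have /matrixP/(_ i i) := z0; rewrite summxE mxE => z0i; rewrite -[RHS]z0i; apply: eq_bigr => t _.
    by rewrite wH !mxE eqxx mulr1n.
  have : \sum_i (k i)%:~R * \sum_t z t * (wt i t)%:~R = 0.
    by rewrite big1 // => i _; rewrite z0i mulr0.
  rewrite (eq_bigr (fun i => \sum_t z t * (k i * wt i t)%:~R)) => [|i _]; last first.
    by rewrite mulr_sumr; apply: eq_bigr => t _; rewrite rmorphM /= mulrCA.
  rewrite exchange_big /= (bigD1 s) //= -mulr_sumr -rmorph_sum kP /= eqxx mulr1.
  rewrite big1 ?addr0 // => t ts; rewrite -mulr_sumr -rmorph_sum kP /= eq_sym (negPf ts) mulr0 //.
have a_diag s : cartan D s s = 2 by have [] := cartanP D.
have [Psi PsiP] := rep_transfer a_diag (cartan_posdef D) (drep_chevalley D ratV) (drep_chevalley D ratW) Hfree.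
(* The pair of grading elements, conjugated by the unipotent word, stays in [pairL]. So [Psi]
   carries u^-1 H u - H from [rV] to [rW], and [local_unip] recovers the matrix of u in [rW]. *)
have Lunip b (wd : X -> seq (S * C)) :
    (forall i j, L (fun x => rV (unip_elt D b (wd x)) i j)) ->
    forall i j, L (fun x => rW (unip_elt D b (wd x)) i j).
  move=> LV.
  pose hc s : C := ratr ((if b then 1 else -1) * c s).
  have HE p (r : G -> 'M[C]_p) w : weight_rep D r w ->
      \sum_s hc s *: drep r (gen_h D s) = diag_mx (\row_i ratr (height w b i)).
    move=> [wH _]; apply/matrixP => i j; rewrite summxE !mxE.
    under eq_bigr do rewrite wH !mxE.
    have [->|ij] := eqVneq i j; last by rewrite big1 // => s _; rewrite mulr0n mulr0.
    rewrite mulr1n /height rmorphM rmorph_sum mulr_sumr; apply: eq_bigr => s _.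
    by rewrite mulr1n /hc rmorphM mulrA rmorphM /= ratr_int mulrA.
  set PL := pairL _ _ _ _ _ _ in PsiP.
  have linPL : linear_set PL by exact: Lall_linear.
  have PH : PL (diag_mx (\row_i ratr (height wt b i)), diag_mx (\row_i ratr (height wtW b i))).
    rewrite -(HE _ _ _ wrV) -(HE _ _ _ wrW).
    rewrite (_ : (_, _) = \sum_s hc s *: (drep rV (gen_h D s), drep rW (gen_h D s))); last first.
      rewrite [RHS]surjective_pairing; congr (_, _).
        by rewrite (big_morph fst (fun _ _ => erefl) erefl).
      by rewrite (big_morph snd (fun _ _ => erefl) erefl).
    apply: (linear_set_sum linPL) => s _; apply: (linear_setZ linPL).
    by have [_ _] := Lall_gens (@pair_br C n m) (pair_e (fun s => drep rV (gen_e D s)) (fun s => drep rW (gen_e D s))) (pair_f (fun s => drep rV (gen_f D s)) (fun s => drep rW (gen_f D s))) (pair_h (fun s => drep rV (gen_h D s)) (fun s => drep rW (gen_h D s))) s.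
  pose u x := unip_elt D b (wd x).
  pose HV : 'M[C]_n := diag_mx (\row_i ratr (height wt b i)).
  pose HW : 'M[C]_m := diag_mx (\row_i ratr (height wtW b i)).
  have PY x : Psi (rV ((u x)^-1)%g *m HV *m rV (u x) - HV) = rW ((u x)^-1)%g *m HW *m rW (u x) - HW.
    apply: (PsiP (_, _)); have := linear_setB linPL (pairL_word [seq (b, p.1, p.2) | p <- unip_inv (wd x)] ratV ratW PH) PH.
    by rewrite -/(unip_elt D b (unip_inv (wd x))) unip_invE invgK.
  apply: (@local_unip _ _ _ subL invL m (height wtW b) _ (fun x => rW ((u x)^-1)%g)).
  - by move=> x; exact: unip_upper.
  - by move=> x; rewrite /u -unip_invE; exact: unip_upper.
  - by move=> x; exact: rep_inv.
  move=> i j; rewrite (_ : (fun x => _) = fun x =>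
     \sum_k \sum_l (rV ((u x)^-1)%g *m HV *m rV (u x) - HV) k l * Psi (delta_mx k l) i j); last first.
    apply: funext => x; rewrite -PY {1}(matrix_sum_delta (_ - HV)) linear_sum summxE; apply: eq_bigr => k _.
    by rewrite linear_sum summxE; apply: eq_bigr => l _; rewrite linearZ mxE.
  apply: (subalg_sum subL) => k _; apply: (subalg_sum subL) => l _.
  apply: (subalgM subL); last exact: (subalg_cst subL).
  rewrite (_ : (fun x => _) = fun x => (invmx (rV (u x)) *m HV *m rV (u x)) k l - HV k l); last first.
    by apply: funext => x; rewrite rep_invmx // mxE [X in _ + X]mxE.
  apply: (subalgB subL); last exact: (subalg_cst subL).
  apply: (subalg_mulmx subL) => // k' l'; apply: (subalg_mulmx subL) => [k1 l1|k1 l1].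
    by apply: local_invmx => // x; exact: rep_unit.
  exact: (subalg_cst subL).
move=> i j; rewrite (_ : (fun x => _) = fun x => (rW (unip_elt D false x.1.1) *m diag_mx (\row_i torus_char wtW (sval x.1.2) i)
    *m rW (unip_elt D true x.2)) i j); last by apply: funext => x; rewrite (cellE _ ratW wrW).
apply: (subalg_mulmx subL) => k l.
  apply: (subalg_mulmx subL) => k' l'.
    by apply: (Lunip false (fun x => x.1.1)) => i' j'; have [_ + _] := LU_V j'; apply.
  rewrite (_ : (fun x => _) = fun x : X => torus_char wtW (sval x.1.2) k' * (k' == l')%:R); last first.
    by apply: funext => x; rewrite !mxE mulr_natr; case: eqP => [->|].
  apply: (subalgM subL); last exact: (subalg_cst subL).
  by apply: (subalg_prod subL) => s _; apply: local_expz => // x; exact: tx.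
by apply: (Lunip true (fun x => x.2)) => i' j'; have [_ _ +] := LU_V i'; apply.
Qed.

Let BA : B `<=` A.
Proof.
apply: algebra_generated_min; first exact: subA.
by move=> f [i [j ->]]; have [_ _] := ratV.
Qed.

Let B_left f g : B f -> B (fun x => f (g * x)%g).
Proof.
apply: (@algebra_generated_min _ _ _ [set f | B (fun x => f (g * x)%g)]).
  split=> /= [k|f1 f2|f1 f2]; [exact: (subalg_cst subB) | exact: (subalgD subB) | exact: (subalgM subB)].
move=> _ [i [j ->]] /=; have [_ rM _] := ratV.
rewrite (_ : (fun x => _) = fun x => \sum_k rV g i k * rV x k j).
  apply: (subalg_sum subB) => k _; apply: (subalgZ subB); apply: algebra_generated_sub; by exists k, j.
by apply: funext => x; rewrite rM mxE.
Qed.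

Let B_right f g : B f -> B (fun x => f (x * g)%g).
Proof.
apply: (@algebra_generated_min _ _ _ [set f | B (fun x => f (x * g)%g)]).
  split=> /= [k|f1 f2|f1 f2]; [exact: (subalg_cst subB) | exact: (subalgD subB) | exact: (subalgM subB)].
move=> _ [i [j ->]] /=; have [_ rM _] := ratV.
rewrite (_ : (fun x => _) = fun x => \sum_k rV x i k * rV g k j).
  apply: (subalg_sum subB) => k _; apply: (subalgM subB); last exact: (subalg_cst subB).
  by apply: algebra_generated_sub; exists i, k.
by apply: funext => x; rewrite rM mxE.
Qed.

Let B_inv f : B f -> B (fun x => f (x^-1)%g).
Proof.
apply: (@algebra_generated_min _ _ _ [set f | B (fun x => f (x^-1)%g)]).
  split=> /= [k|f1 f2|f1 f2]; [exact: (subalg_cst subB) | exact: (subalgD subB) | exact: (subalgM subB)].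
move=> _ [i [j ->]] /=.
rewrite (_ : (fun x => _) = fun x => (\adj (rV x)) i j).
  by apply: (subalg_adj subB) => k l; apply: algebra_generated_sub; exists k, l.
by apply: funext => x; rewrite rep_invmx // /invmx rep_unit // rep_det1 // invr1 scale1r.
Qed.

(** [I] is the ideal of common denominators of the coefficients of [rW]. It contains an element not
    vanishing at 1, by the big cell, and is stable under right translation; it remains to see that
    it contains a non-zero constant. *)
Let coef_B m (rW : G -> 'M[C]_m) wtW : rational_rep rW -> weight_rep D rW wtW ->
  forall i j, B (fun x => rW x i j).
Proof.
move=> ratW wrW; have [w1 wM wA] := ratW.
pose I : set (G -> C) := [set d | B d /\ forall i j, B (fun x => d x * rW x i j)].
have ID f g : I f -> I g -> I (fun x => f x + g x).
  move=> [Bf If] [Bg Ig]; split=> [|i j]; first exact: (subalgD subB).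
  rewrite (_ : (fun x => _) = fun x => f x * rW x i j + g x * rW x i j); first exact: (subalgD subB).
  by apply: funext => x; rewrite mulrDl.
have IM f g : B f -> I g -> I (fun x => f x * g x).
  move=> Bf [Bg Ig]; split=> [|i j]; first exact: (subalgM subB).
  rewrite (_ : (fun x => _) = fun x => f x * (g x * rW x i j)); first exact: (subalgM subB).
  by apply: funext => x; rewrite mulrA.
have I0 : I (fun=> 0).
  split=> [|i j]; first exact: (subalg_cst subB).
  rewrite (_ : (fun x => _) = fun=> 0); first exact: (subalg_cst subB).
  by apply: funext => x; rewrite mul0r.
have Isum (T : Type) (r : seq T) (F : T -> G -> C) : (forall k, I (F k)) -> I (fun x => \sum_(k <- r) F k x).
  move=> IF; elim: r => [|k r IH]; first by under eq_fun do rewrite big_nil.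
  rewrite (_ : (fun x => _) = fun x => F k x + \sum_(k <- r) F k x); first exact: ID.
  by apply: funext => x; rewrite big_cons.
have Iright f g : I f -> I (fun x => f (x * g)%g).
  move=> [Bf If]; split=> [|i j]; first exact: B_right.
  rewrite (_ : (fun x => _) = fun x => \sum_k f (x * g)%g * rW (x * g)%g i k * rW (g^-1)%g k j).
    apply: (subalg_sum subB) => k _; apply: (subalgM subB); last exact: (subalg_cst subB).
    exact: B_right (If i k).
  apply: funext => x; have -> : rW x i j = (rW (x * g)%g *m rW (g^-1)%g) i j by rewrite -wM mulgK.
  rewrite mxE mulr_sumr.
  by apply: eq_bigr => k _; rewrite mulrA.
have [d Id d1] : exists2 d, I d & d 1%g != 0.
  have dij i j : exists d, [/\ B d, d 1%g != 0 & B (fun x => d x * rW x i j)].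
    have [b [d [Bb Bd d0 E]]] := L_cell ratW wrW i j; exists d; split=> //.
    rewrite (_ : (fun x => _) = b) //; apply: funext => x; apply/eqP; rewrite -subr_eq0; apply/eqP.
    move: x; apply: (cell_dense connG (D := D)).
      apply: (subalgB subA); last exact: BA.
      by apply: (subalgM subA); [exact: BA | exact: wA].
    by move=> y t z t0; rewrite (E (y, exist _ t t0, z)) subrr.
  have [d dP] := choice (fun p : 'I_m * 'I_m => dij p.1 p.2).
  exists (fun x => \prod_p d p x); last by apply/prodf_neq0 => p _; have [] := dP p.
  split=> [|i j]; first by apply: (subalg_prod subB) => p _; have [] := dP p.
  rewrite (_ : (fun x => _) = fun x => (\prod_(p | p != (i, j)) d p x) * (d (i, j) x * rW x i j)).
    apply: (subalgM subB); last by have [] := dP (i, j).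
    by apply: (subalg_prod subB) => p _; have [] := dP p.
  by apply: funext => x; rewrite (bigD1 (i, j)) //= [in RHS]mulrA; congr (_ * _); rewrite mulrC.
have [Bd _] := Id.
have [k [p [q [_ dE pfree qfree]]]] := coord_ring_coproduct (BA Bd).
have Ip i : I (p i).
  have [l [z [N zN]]] := indep_functions_points qfree.
  rewrite (_ : p i = fun x => \sum_j N j i * d (x * z j)%g).
    by apply: (Isum _ (index_enum _)) => j; apply: IM; [exact: (subalg_cst subB) | exact: Iright].
  apply: funext => x; under eq_bigr do rewrite dE mulr_sumr.
  rewrite exchange_big /= (eq_bigr (fun i' => p i' x * (i' == i)%:R)) => [|i' _].
    by rewrite (bigD1 i) //= eqxx mulr1 big1 ?addr0 // => i' /negPf ->; rewrite mulr0.
  have /matrixP/(_ i' i) := zN; rewrite !mxE => <-; rewrite mulr_sumr; apply: eq_bigr => j _.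
  by rewrite mxE; ring.
have Bq i : B (q i).
  have [l [z [N zN]]] := indep_functions_points pfree.
  rewrite (_ : q i = fun x => \sum_j N j i * d (z j * x)%g).
    by apply: (subalg_sum subB) => j _; apply: (subalgZ subB); exact: B_left.
  apply: funext => x; under eq_bigr do rewrite dE mulr_sumr.
  rewrite exchange_big /= (eq_bigr (fun i' => q i' x * (i' == i)%:R)) => [|i' _].
    by rewrite (bigD1 i) //= eqxx mulr1 big1 ?addr0 // => i' /negPf ->; rewrite mulr0.
  have /matrixP/(_ i' i) := zN; rewrite !mxE => <-; rewrite mulr_sumr; apply: eq_bigr => j _.
  by rewrite mxE; ring.
(* Expand d(x x^-1) by the coproduct. The left factors are combinations of right translates of [d],
   hence lie in [I]; the right factors lie in [B], which inversion preserves. The sum is the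
   constant d(1), and it lies in [I]. *)
have I1 : I (fun=> d 1%g).
  rewrite (_ : (fun=> _) = fun x => \sum_i q i (x^-1)%g * p i x).
    by apply: (Isum _ (index_enum _)) => i; apply: IM => //; exact: B_inv.
  by apply: funext => x; rewrite -(mulgV x) dE; apply: eq_bigr => i _; rewrite mulrC.
move=> i j; rewrite (_ : (fun x => _) = fun x => (d 1%g)^-1 * (d 1%g * rW x i j)).
  by apply: (subalgZ subB); have [_] := I1; apply.
by apply: funext => x; rewrite mulKf.
Qed.

Theorem lattice_faithful : faithful_rep rV.
Proof.
apply/seteqP; split=> // f Af.
have [m [rho [xi [v [rat fE]]]]] := coord_ring_rep Af.
have [P [w [uP wr]]] := weight_basis D rat.
have BC := coef_B (rational_rep_conj uP rat) wr.
rewrite (_ : f = fun x => \sum_j \sum_i (xi *m invmx P) 0 i * (P *m rho x *m invmx P) i j * (P *m v) j 0).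
  apply: (subalg_sum subB) => j _; apply: (subalg_sum subB) => i _.
  apply: (subalgM subB); last exact: (subalg_cst subB).
  by apply: (subalgZ subB).
apply: funext => x; rewrite fE.
have -> : xi *m rho x *m v = xi *m invmx P *m (P *m rho x *m invmx P) *m (P *m v).
  by rewrite !mulmxA mulmxKV // mulmxKV.
by rewrite mxE; apply: eq_bigr => j _; rewrite mxE mulr_suml.
Qed.

End FromLattice.
End Heights.

End LUGeneration.

(** * Closures of matrix subgroups over an affine group *)

Section ProductAlgebra.
Variables (C : numClosedFieldType) (G : affineGroup C) (m : nat).
Local Notation A := (coord_ring G).
Local Notation T := (G * 'M[C]_m)%type.

Definition prod_alg : set (T -> C) := algebra_generated
  [set q : T -> C | (exists2 f, A f & q = fun y : T => f y.1) \/ exists i j, q = fun y : T => y.2 i j].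

Lemma prod_subalgebra : is_subalgebra prod_alg.
Proof. exact: algebra_generated_subalgebra. Qed.
Local Notation subP := prod_subalgebra.

Lemma prod_alg_fst f : A f -> prod_alg (fun y => f y.1).
Proof. by move=> Af; apply: algebra_generated_sub; left; exists f. Qed.

Lemma prod_alg_entry i j : prod_alg (fun y : T => y.2 i j).
Proof. by apply: algebra_generated_sub; right; exists i, j. Qed.

Lemma prod_alg_comp (phi : T -> T) :
  (forall f, A f -> prod_alg (fun y => f (phi y).1)) ->
  (forall i j, prod_alg (fun y => (phi y).2 i j)) ->
  forall q, prod_alg q -> prod_alg (fun y => q (phi y)).
Proof.
move=> H1 H2; apply: (@algebra_generated_min _ _ _ [set q | prod_alg (fun y => q (phi y))]).
  split=> /= [k|f g|f g]; [exact: (subalg_cst subP) | exact: (subalgD subP) | exact: (subalgM subP)].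
by move=> q [[f Af ->]|[i [j ->]]]; [exact: H1 | exact: H2].
Qed.

Definition pmul (y z : T) : T := ((y.1 * z.1)%g, y.2 *m z.2).
Definition pinv (y : T) : T := ((y.1^-1)%g, \adj y.2).

Lemma prod_alg_left y q : prod_alg q -> prod_alg (fun z => q (pmul y z)).
Proof.
apply: prod_alg_comp => [f Af|i j] /=.
  by apply: (@prod_alg_fst (fun x => f (y.1 * x)%g)); exact: coord_ring_left.
apply: (subalg_mulmx subP) => k l; [exact: (subalg_cst subP) | exact: prod_alg_entry].
Qed.

Lemma prod_alg_right y q : prod_alg q -> prod_alg (fun z => q (pmul z y)).
Proof.
apply: prod_alg_comp => [f Af|i j] /=.
  by apply: (@prod_alg_fst (fun x => f (x * y.1)%g)); exact: coord_ring_right.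
apply: (subalg_mulmx subP) => k l; [exact: prod_alg_entry | exact: (subalg_cst subP)].
Qed.

Lemma prod_alg_inv q : prod_alg q -> prod_alg (fun z => q (pinv z)).
Proof.
apply: prod_alg_comp => [f Af|i j] /=.
  by apply: (@prod_alg_fst (fun x => f (x^-1)%g)); exact: coord_ring_inv.
apply: (subalg_adj subP) => k l; exact: prod_alg_entry.
Qed.

Lemma prod_alg_coproduct q : prod_alg q -> exists (I : finType) (p p' : I -> T -> C),
  (forall i, prod_alg (p i) /\ prod_alg (p' i)) /\
  forall y z, q (pmul y z) = \sum_i p i y * p' i z.
Proof.
pose R := [set q | exists (I : finType) (p p' : I -> T -> C),
  (forall i, prod_alg (p i) /\ prod_alg (p' i)) /\
  forall y z, q (pmul y z) = \sum_i p i y * p' i z].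
apply: (@algebra_generated_min _ _ _ R); first split.
- move=> k; exists unit, (fun _ _ => k), (fun _ _ => 1); split=> [i|y z].
    by split; exact: (subalg_cst subP).
  by rewrite (bigD1 tt) //= big1 ?addr0 ?mulr1 // => -[].
- move=> f g [I [p [p' [Pp fE]]]] [J [r [r' [Pr gE]]]].
  exists (I + J)%type, (fun k => match k with inl i => p i | inr j => r j end),
    (fun k => match k with inl i => p' i | inr j => r' j end); split=> [[i|j]|y z] //.
  by rewrite fE gE big_sumType.
- move=> f g [I [p [p' [Pp fE]]]] [J [r [r' [Pr gE]]]].
  exists (I * J)%type, (fun k y => p k.1 y * r k.2 y), (fun k y => p' k.1 y * r' k.2 y); split=> [k|y z].
    have [? ?] := Pp k.1; have [? ?] := Pr k.2; by split; exact: (subalgM subP).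
  rewrite fE gE mulr_suml (eq_bigr (fun i => \sum_j p i y * r j y * (p' i z * r' j z))) => [|i _].
    by rewrite pair_big.
  by rewrite mulr_sumr; apply: eq_bigr => j _; ring.
- move=> q' [[f Af ->]|[i [j ->]]].
    have [n [p [p' [App fE]]]] := coord_ring_mul Af.
    exists 'I_n, (fun i y => p i y.1), (fun i y => p' i y.1); split=> [i|y z]; last exact: fE.
    by have [? ?] := App i; split; exact: prod_alg_fst.
  exists 'I_m, (fun k (y : T) => y.2 i k), (fun k (y : T) => y.2 k j); split=> [k|y z]; last by rewrite mxE.
  by split; exact: prod_alg_entry.
Qed.

(** The matrix part has determinant 1, so that inverses are adjugates: inversion is then polynomial
    and extends to the closure. *)
Record mx_subgroup := MxSubgroup {
  ms_set : set T;
  ms_1 : ms_set (1%g, 1%:M);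
  ms_M : forall y z, ms_set y -> ms_set z -> ms_set (pmul y z);
  ms_V : forall y, ms_set y -> exists2 M, ms_set ((y.1^-1)%g, M) & y.2 *m M = 1%:M;
  ms_det : forall y, ms_set y -> \det y.2 = 1
}.

Section Closure.
Variable Gam : mx_subgroup.

Definition pclosure : set T :=
  [set y | forall q, prod_alg q -> (forall g, ms_set Gam g -> q g = 0) -> q y = 0].

Lemma pclosure_sub y : ms_set Gam y -> pclosure y. Proof. by move=> Gy q _; exact. Qed.

Lemma pclosure_det y : pclosure y -> \det y.2 = 1.
Proof.
move=> cy; apply/eqP; rewrite -subr_eq0; apply/eqP; apply: (cy (fun y => \det y.2 - 1)).
  apply: (subalgB subP); last exact: (subalg_cst subP).
  by apply: (subalg_det subP) => i j; exact: prod_alg_entry.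
by move=> g Gg; rewrite (ms_det Gg) subrr.
Qed.

(** The usual two steps: an element of the subgroup times one of the closure is in the closure, and
    then the left factor may vary over the closure as well. *)
Lemma pclosure_mul y z : pclosure y -> pclosure z -> pclosure (pmul y z).
Proof.
move=> cy cz q Pq q0; apply: (cy (fun y => q (pmul y z))); first exact: prod_alg_right.
move=> g Gg; apply: (cz (fun z => q (pmul g z))); first exact: prod_alg_left.
by move=> h Gh; apply: q0; apply: ms_M.
Qed.

Lemma adj_det1 (M N : 'M[C]_m) : \det M = 1 -> M *m N = 1%:M -> N = \adj M.
Proof.
move=> d1 MN; have aM : \adj M *m M = 1%:M by rewrite mul_adj_mx d1.
by rewrite -[N]mul1mx -aM -mulmxA MN mulmx1.
Qed.

Lemma pclosure_inv y : pclosure y -> pclosure (pinv y).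
Proof.
move=> cy q Pq q0; apply: (cy (fun y => q (pinv y))); first exact: prod_alg_inv.
move=> g Gg; apply: q0; have [M GM gM] := ms_V Gg.
by rewrite /pinv -(adj_det1 (ms_det Gg) gM).
Qed.

Record closure_pts := ClosurePts { cp_val :> T; cp_P : pclosure cp_val }.

Lemma cp_val_inj : injective cp_val.
Proof. by case=> y Py [z Pz] /= E; subst z; rewrite (Prop_irrelevance Py Pz). Qed.

HB.instance Definition _ := gen_eqMixin closure_pts.
HB.instance Definition _ := gen_choiceMixin closure_pts.

Definition cp_one := ClosurePts (pclosure_sub (ms_1 Gam)).
Definition cp_mul (y z : closure_pts) := ClosurePts (pclosure_mul (cp_P y) (cp_P z)).
Definition cp_inv (y : closure_pts) := ClosurePts (pclosure_inv (cp_P y)).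

Lemma cp_mulA : associative cp_mul.
Proof. by move=> x y z; apply: cp_val_inj; rewrite /= /pmul /= mulgA mulmxA. Qed.
Lemma cp_mul1 : left_id cp_one cp_mul.
Proof. by case=> -[x M] P; apply: cp_val_inj; rewrite /= /pmul /= mul1g mul1mx. Qed.
Lemma cp_mul1r : right_id cp_one cp_mul.
Proof. by case=> -[x M] P; apply: cp_val_inj; rewrite /= /pmul /= mulg1 mulmx1. Qed.
Lemma cp_mulV : left_inverse cp_one cp_inv cp_mul.
Proof.
by case=> -[x M] P; apply: cp_val_inj; rewrite /= /pmul /= mulVg mul_adj_mx (pclosure_det P).
Qed.
Lemma cp_mulrV : right_inverse cp_one cp_inv cp_mul.
Proof.
by case=> -[x M] P; apply: cp_val_inj; rewrite /= /pmul /= mulgV mul_mx_adj (pclosure_det P).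
Qed.

HB.instance Definition _ := isGroup.Build closure_pts cp_mulA cp_mul1 cp_mul1r cp_mulV cp_mulrV.

Definition closure_ring : set (closure_pts -> C) :=
  [set b | exists2 q, prod_alg q & b = fun y => q (cp_val y)].

Lemma closure_ring_subalgebra : is_subalgebra closure_ring.
Proof.
split=> [c|f g [q Pq ->] [r Pr ->]|f g [q Pq ->] [r Pr ->]].
- by exists (fun=> c) => //; exact: (subalg_cst subP).
- by exists (fun y => q y + r y) => //; exact: (subalgD subP).
- by exists (fun y => q y * r y) => //; exact: (subalgM subP).
Qed.

Lemma closure_ring_fingen : exists E, finite_set E /\ closure_ring = algebra_generated E.
Proof.
have [E0 [finE AE]] := coord_ring_fingen G.
pose E1 : set (closure_pts -> C) := ((fun f (y : closure_pts) => f (cp_val y).1) @` E0) `|`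
  ((fun (p : 'I_m * 'I_m) (y : closure_pts) => (cp_val y).2 p.1 p.2) @` setT).
exists E1; split.
  rewrite finite_setU; split; apply: finite_image => //; exact: finite_finpred.
have subE := algebra_generated_subalgebra E1.
apply/seteqP; split=> [b [q Pq ->]|].
  move: q Pq; apply: (@algebra_generated_min _ _ _ [set q | algebra_generated E1 (fun y => q (cp_val y))]).
    split=> /= [c|f g|f g]; [exact: (subalg_cst subE) | exact: (subalgD subE) | exact: (subalgM subE)].
  move=> q [[f + ->]|[i [j ->]]] /=; last first.
    by apply: algebra_generated_sub; right; exists (i, j).
  rewrite AE; move: f; apply: (@algebra_generated_min _ _ _
    [set f | algebra_generated E1 (fun y => f (cp_val y).1)]).
    split=> /= [c|f g|f g]; [exact: (subalg_cst subE) | exact: (subalgD subE) | exact: (subalgM subE)].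
  by move=> f Ef; apply: algebra_generated_sub; left; exists f.
apply: algebra_generated_min; first exact: closure_ring_subalgebra.
move=> b [[f Ef <-]|[[i j] _ <-]].
  by exists (fun y => f y.1) => //; apply: prod_alg_fst; rewrite AE; exact: algebra_generated_sub.
by exists (fun y : T => y.2 i j) => //; exact: prod_alg_entry.
Qed.

Lemma closure_ring_separates x y : (forall f, closure_ring f -> f x = f y) -> x = y.
Proof.
move=> H; apply: cp_val_inj; rewrite [LHS]surjective_pairing [RHS]surjective_pairing; congr (_, _).
  apply: coord_ring_separates => f Af; apply: (H (fun y => f (cp_val y).1)).
  by exists (fun y => f y.1) => //; exact: prod_alg_fst.
apply/matrixP => i j; apply: (H (fun y => (cp_val y).2 i j)).
by exists (fun y : T => y.2 i j) => //; exact: prod_alg_entry.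
Qed.

(** A character restricts to one of the coordinate ring of [G], hence to a point, and its values on
    the entries form a matrix. This pair is in the closure, since a function vanishing on the
    subgroup is already zero in the ring. *)
Lemma closure_ring_points (chi : (closure_pts -> C) -> C) :
  (forall c, chi (fun=> c) = c) ->
  (forall f g, closure_ring f -> closure_ring g -> chi (fun x => f x + g x) = chi f + chi g) ->
  (forall f g, closure_ring f -> closure_ring g -> chi (fun x => f x * g x) = chi f * chi g) ->
  exists x, forall f, closure_ring f -> chi f = f x.
Proof.
move=> chiC chiD chiM.
have Rf f : A f -> closure_ring (fun y => f (cp_val y).1).
  by move=> Af; exists (fun y => f y.1) => //; exact: prod_alg_fst.
have [x xP] : exists x, forall f, A f -> chi (fun y => f (cp_val y).1) = f x.
  apply: (coord_ring_points (chi := fun f => chi (fun y => f (cp_val y).1))) => [c|f g Af Ag|f g Af Ag].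
  - exact: chiC.
  - by apply: chiD; exact: Rf.
  - by apply: chiM; exact: Rf.
pose M : 'M[C]_m := \matrix_(i, j) chi (fun y => (cp_val y).2 i j).
have chiE q : prod_alg q -> chi (fun y => q (cp_val y)) = q (x, M).
  move=> Pq; suff [] : prod_alg q /\ chi (fun y => q (cp_val y)) = q (x, M) by [].
  move: q Pq; apply: (@algebra_generated_min _ _ _ [set q | prod_alg q /\ chi (fun y => q (cp_val y)) = q (x, M)]).
    split=> /= [c|f g [Pf fE] [Pg gE]|f g [Pf fE] [Pg gE]].
    + by split; [exact: (subalg_cst subP) | exact: chiC].
    + split; first exact: (subalgD subP).
      by rewrite -fE -gE chiD //; [exists f | exists g].
    + split; first exact: (subalgM subP).
      by rewrite -fE -gE chiM //; [exists f | exists g].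
  move=> q [[f Af ->]|[i [j ->]]] /=; first by split; [exact: prod_alg_fst | exact: xP].
  by split; [exact: prod_alg_entry | rewrite mxE].
have cM : pclosure (x, M).
  move=> q Pq q0; rewrite -chiE // (_ : (fun y => _) = fun=> 0) //.
  by apply: funext => -[y Py] /=; exact: Py.
by exists (ClosurePts cM) => f [q Pq ->]; rewrite chiE.
Qed.

Lemma closure_ring_mul f : closure_ring f -> exists n (p q : 'I_n -> closure_pts -> C),
  (forall i, closure_ring (p i) /\ closure_ring (q i)) /\
  forall x y, f (x * y)%g = \sum_(i < n) p i x * q i y.
Proof.
case=> q Pq ->; have [I [p [p' [Pp qE]]]] := prod_alg_coproduct Pq.
exists #|I|, (fun i y => p (enum_val i) (cp_val y)), (fun i y => p' (enum_val i) (cp_val y)).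
split=> [i|x y].
  by have [? ?] := Pp (enum_val i); split; [exists (p (enum_val i)) | exists (p' (enum_val i))].
rewrite -[cp_val (x * y)%g]/(pmul (cp_val x) (cp_val y)) qE.
by rewrite (reindex (@enum_val I predT)) //; exact: onW_bij (enum_val_bij I).
Qed.

Lemma closure_ring_inv f : closure_ring f -> closure_ring (fun x => f (x^-1)%g).
Proof.
by case=> q Pq ->; exists (fun y => q (pinv y)) => //; exact: prod_alg_inv.
Qed.

Definition closure_group : affineGroup C := AffineGroup closure_ring_fingen
  closure_ring_separates closure_ring_points closure_ring_mul closure_ring_inv.

End Closure.
End ProductAlgebra.

(** * Integrating representations on a simply connected group *)

Section MexpDet.
Variable C : numClosedFieldType.

Lemma mexp_notnil n (M : 'M[C]_n) : ~ nilpotent_mx M -> mexp M = 1%:M.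
Proof. by rewrite /mexp; case: pselect. Qed.

Lemma mexp_inv n (M : 'M[C]_n) : mexp M *m mexp (- M) = 1%:M.
Proof.
have [nM|nM] := pselect (nilpotent_mx M); first exact: mexpN.
rewrite !mexp_notnil ?mulmx1 //.
by move=> /nilpotentN; rewrite opprK.
Qed.

Definition poly_path n (M : C -> 'M[C]_n) :=
  exists P : 'M[{poly C}]_n, forall t, M t = map_mx (horner_eval t) P.

Lemma poly_path_mexp n (M : 'M[C]_n) : poly_path (fun t => mexp (t *: M)).
Proof.
(* Default value: if [M] is not nilpotent, neither is t M for t non-zero, so the curve is constantly
   1. *)
have [[N MN]|nM] := pselect (nilpotent_mx M); last first.
  exists 1%:M => t; rewrite map_mx1.
  have [->|t0] := eqVneq t 0; first by rewrite scale0r mexp0.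
  rewrite mexp_notnil // => /(nilpotentZ t^-1); rewrite scalerA mulVf // scale1r; exact: nM.
exists (\sum_(k < N) 'X^k *: map_mx polyC (k`!%:R^-1 *: M ^+ k)) => t.
rewrite (mexp_scale _ MN) map_mx_sum; apply: eq_bigr => k _.
apply/matrixP => i j; rewrite !mxE -[RHS]/(horner _ t) hornerM hornerXn hornerC mulrA /=; by [].
Qed.

Lemma poly_path1 n : poly_path (fun=> 1%:M : 'M[C]_n).
Proof. by exists 1%:M => t; rewrite map_mx1. Qed.

Lemma poly_pathM n (M N : C -> 'M[C]_n) : poly_path M -> poly_path N ->
  poly_path (fun t => M t *m N t).
Proof. by move=> [P PE] [Q QE]; exists (P *m Q) => t; rewrite PE QE map_mxM. Qed.

(** The determinant of exp(t M) is a polynomial in t without zeros, hence constant, and its value at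
    0 is 1. *)
Lemma det_mexp n (M : 'M[C]_n) : \det (mexp M) = 1.
Proof.
have [P PE] := poly_path_mexp M; pose p := \det P.
have pE t : \det (mexp (t *: M)) = p.[t].
  by rewrite PE -[p.[t]]/(horner_eval t p) -det_map_mx.
have p0 t : p.[t] != 0.
  rewrite -pE; apply/eqP => d0; have := congr1 determinant (mexp_inv (t *: M)).
  by rewrite det_mulmx d0 mul0r det1 => /eqP; rewrite eq_sym oner_eq0.
have /eqP/size_poly1P[c _ pc] : size p = 1%N.
  by apply/eqP; apply/negPn/negP => /closed_rootP[t]; rewrite /root (negPf (p0 t)).
have := pE 0; have := pE 1; rewrite pc !hornerC scale1r scale0r mexp0 det1 => -> //.
Qed.

End MexpDet.

Section WordMatrices.
Variables (C : numClosedFieldType) (S : finType).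
Local Notation word := (seq (bool * S * C)).

Definition winv (w : word) : word := rev [seq (p.1, - p.2) | p <- w].
(** A polynomial curve from the trivial element, at t = 0, to the element of [w], at t = 1. It is
    the source of connectedness. *)
Definition wscale (t : C) (w : word) : word := [seq (p.1, t * p.2) | p <- w].

Lemma wscale1 w : wscale 1 w = w.
Proof. by elim: w => //= -[p c] w ->; rewrite mul1r. Qed.

Section OneModule.
Variables (m : nat) (E F : S -> 'M[C]_m).

Definition word_mx (w : word) : 'M[C]_m := foldr (fun p M =>
  mexp (p.2 *: (if p.1.1 then E p.1.2 else F p.1.2)) *m M) 1%:M w.

Lemma word_mx_cat w w' : word_mx (w ++ w') = word_mx w *m word_mx w'.
Proof. by elim: w => [|p w IH] /=; rewrite ?mul1mx // IH mulmxA. Qed.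

Lemma word_mx_inv w : word_mx w *m word_mx (winv w) = 1%:M.
Proof.
rewrite /winv; elim: w => [|p w IH] /=; first by rewrite mulmx1.
rewrite rev_cons -cats1 word_mx_cat -mulmxA (mulmxA (word_mx w)) IH mul1mx /= mulmx1.
by rewrite scaleNr mexp_inv.
Qed.

Lemma word_mx_det w : \det (word_mx w) = 1.
Proof. by elim: w => [|p w IH] /=; rewrite ?det1 // det_mulmx det_mexp IH mulr1. Qed.

Lemma word_mx_path w : poly_path (fun t => word_mx (wscale t w)).
Proof.
elim: w => [|p w IH] /=; first exact: poly_path1.
apply: (poly_pathM (M := fun t => mexp (_ *: _))) IH.
set X := (if _ then _ else _); have [P PE] := poly_path_mexp (p.2 *: X).
by exists P => t; rewrite -PE scalerA.
Qed.

End OneModule.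

Lemma pairL_word_mx (a : S -> S -> int) n m (E F H : S -> 'M[C]_n) (E' F' H' : S -> 'M[C]_m) w x :
  chevalley_mx a E F H -> chevalley_mx a E' F' H' -> pairL E F H E' F' H' x ->
  pairL E F H E' F' H' (word_mx E F w *m x.1 *m word_mx E F (winv w),
                        word_mx E' F' w *m x.2 *m word_mx E' F' (winv w)).
Proof.
move=> cm cm' Lx; rewrite /winv; elim: w => [|p w IH] /=.
  by rewrite !mul1mx !mulmx1; case: (x) Lx.
have := pairL_conj cm cm' p.1.1 p.1.2 p.2 IH.
by rewrite rev_cons -cats1 !word_mx_cat /= !mulmx1 !mulmxA !scaleNr.
Qed.

End WordMatrices.

Section WordGroup.
Variables (C : numClosedFieldType) (G : affineGroup C) (S : finType).
Variable D : chevalley_data G S.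

Lemma word_elt_inv w : word_elt D (winv w) = ((word_elt D w)^-1)%g.
Proof.
rewrite /winv; elim: w => [|p w IH] /=; first by rewrite invg1.
by rewrite rev_cons -cats1 word_elt_cat IH /= invgM mulg1 root_elt_V.
Qed.

Lemma rep_word n (rho : G -> 'M[C]_n) w : rational_rep rho ->
  rho (word_elt D w) = word_mx (fun s => drep rho (gen_e D s)) (fun s => drep rho (gen_f D s)) w.
Proof.
move=> rat; have [r1 rM _] := rat; elim: w => [|p w IH] //=.
by rewrite rM IH rep_root_elt // /gen_ef; case: p.1.1.
Qed.

Variables (m : nat) (E F : S -> 'M[C]_m).

Definition word_pairs : set (G * 'M[C]_m) := [set y | exists w, y = (word_elt D w, word_mx E F w)].

Lemma word_pairs1 : word_pairs (1%g, 1%:M). Proof. by exists [::]. Qed.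

Lemma word_pairsM y z : word_pairs y -> word_pairs z -> word_pairs (pmul y z).
Proof. by move=> [w ->] [w' ->]; exists (w ++ w'); rewrite word_elt_cat word_mx_cat. Qed.

Lemma word_pairsV y : word_pairs y -> exists2 M, word_pairs ((y.1^-1)%g, M) & y.2 *m M = 1%:M.
Proof.
move=> [w ->]; exists (word_mx E F (winv w)); last exact: word_mx_inv.
by exists (winv w); rewrite word_elt_inv.
Qed.

Lemma word_pairs_det y : word_pairs y -> \det y.2 = 1.
Proof. by move=> [w ->]; exact: word_mx_det. Qed.

Definition word_group := MxSubgroup word_pairs1 word_pairsM word_pairsV word_pairs_det.

Lemma poly_path_alg (q : G * 'M[C]_m -> C) w : prod_alg q ->
  exists p : {poly C}, forall t, q (word_elt D (wscale t w), word_mx E F (wscale t w)) = p.[t].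
Proof.
move: q; apply: (@algebra_generated_min _ _ _ [set q | exists p : {poly C}, forall t,
  q (word_elt D (wscale t w), word_mx E F (wscale t w)) = p.[t]]).
  split=> /= [c|f g [p pE] [r rE]|f g [p pE] [r rE]].
  - by exists c%:P => t; rewrite hornerC.
  - by exists (p + r) => t; rewrite pE rE hornerD.
  - by exists (p * r) => t; rewrite pE rE hornerM.
move=> q [[f Af ->]|[i [j ->]]] /=.
  have [n [rho [xi [v [rat fE]]]]] := coord_ring_rep Af.
  have [P PE] := word_mx_path (fun s => drep rho (gen_e D s)) (fun s => drep rho (gen_f D s)) w.
  exists ((map_mx polyC xi *m P *m map_mx polyC v) 0 0) => t.
  rewrite fE rep_word // PE.
  transitivity (map_mx (horner_eval t) (map_mx polyC xi *m P *m map_mx polyC v) 0 0); last by rewrite mxE.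
  rewrite !map_mxM; congr ((_ *m _ *m _) 0 0); apply/matrixP => k l;
    by rewrite !mxE -[RHS]/(horner _ t) hornerC.
have [P PE] := word_mx_path E F w; exists (P i j) => t.
by rewrite PE mxE.
Qed.

(** On the curve that scales a word, a closed set holds identically or only at roots of a non-zero
    polynomial. Of two closed sets covering the group, one therefore contains the whole curve; if
    they are disjoint it is the one containing 1. Thus one of them contains all words, and being
    closed it is everything. *)
Lemma word_group_connected : connected_group (closure_group word_group).
Proof.
move=> Z1 Z2 cZ1 cZ2 cov disj.
pose H := closure_group word_group.
have closed_all (Z : set H) w : zariski_closed Z ->
    (forall t, Z (ClosurePts (pclosure_sub (Gam := word_group) (ex_intro _ (wscale t w) erefl)))) \/
    exists2 p : {poly C}, p != 0 & forall t, Z (ClosurePts (pclosure_sub (Gam := word_group) (ex_intro _ (wscale t w) erefl))) -> p.[t] = 0.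
  move=> [I [IH ->]].
  have [allp|/existsNP[f /not_implyP[If nz]]] := pselect (forall f, I f -> forall t,
     f (ClosurePts (pclosure_sub (Gam := word_group) (ex_intro _ (wscale t w) erefl))) = 0).
    by left=> t f If; exact: allp.
  right; have [q Pq fE] := IH f If; have [p pE] := poly_path_alg w Pq.
  exists p => [|t Zt]; last by have := Zt f If; rewrite fE /= pE.
  apply/eqP => p0; apply: nz => t; by rewrite fE /= pE p0 horner0.
have w0 w : ClosurePts (pclosure_sub (Gam := word_group) (ex_intro _ (wscale 0 w) erefl)) = 1%g :> H.
  apply: cp_val_inj => /=; congr (_, _).
    elim: w => //= p w ->; rewrite mul0r mulg1.
    by rewrite /root_elt; case: p.1.1; rewrite mx2_1 gen_phi1.
  by elim: w => //= p w ->; rewrite mul0r scale0r mexp0 mul1mx.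
have [Z [cZ Zsub Z1in Zstep]] : exists Z : set H, [/\ zariski_closed Z, Z `<=` Z1 \/ Z `<=` Z2, Z 1%g &
   forall w, Z (ClosurePts (pclosure_sub (Gam := word_group) (ex_intro _ w erefl)))].
  have step (Z Z' : set H) w : zariski_closed Z -> zariski_closed Z' -> setT `<=` Z `|` Z' ->
      setT `&` (Z `&` Z') = set0 -> Z 1%g ->
      Z (ClosurePts (pclosure_sub (Gam := word_group) (ex_intro _ w erefl))).
    move=> cZ cZ' covZ disZ Z1g.
    have [allZ|[p p0 pZ]] := closed_all Z w cZ.
      by have := allZ 1; rewrite wscale1; congr Z; apply: cp_val_inj; rewrite /= wscale1.
    have [allZ'|[p' p0' pZ']] := closed_all Z' w cZ'.
      have : (setT `&` (Z `&` Z')) 1%g by split=> //; split=> //; rewrite -(w0 w).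
      by rewrite disZ.
    have : p * p' = 0.
      apply: polyP_eval => t; rewrite hornerM horner0; apply/eqP; rewrite mulf_eq0; apply/orP.
      by have [/pZ ->|/pZ' ->] := covZ _ (I : setT (ClosurePts (pclosure_sub (Gam := word_group) (ex_intro _ (wscale t w) erefl)))); [left | right].
    by move/eqP; rewrite mulf_eq0 (negPf p0) (negPf p0').
  have [Z1g|Z2g] := cov 1%g I.
    by exists Z1; split=> //; [left | move=> w; exact: (step Z1 Z2)].
  exists Z2; split=> //; first by right.
  by move=> w; apply: (step Z2 Z1) => //; [rewrite setUC | rewrite (setIC Z2)].
have allZ : Z = setT.
  have [J [JH ZE]] := cZ; rewrite ZE; apply/seteqP; split=> // y _ f Jf.
  have [q Pq fE] := JH f Jf; rewrite fE; apply: (cp_P y) => // g [w ->].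
  by have := Zstep w; rewrite ZE => /(_ f Jf); rewrite fE.
by rewrite allZ in Zsub.
Qed.

End WordGroup.

Lemma closed_prim_root (C : numClosedFieldType) n : (0 < n)%N ->
  exists z : C, n.-primitive_root z.
Proof.
move=> n0; have [r rE] := closed_field_poly_normal ('X^n - 1 : {poly C}).
have lc : lead_coef ('X^n - 1 : {poly C}) = 1 by apply/eqP; exact: monic_Xn_sub_1.
rewrite lc scale1r in rE.
have szr : size r = n.
  by apply/eqP; rewrite -eqSS -(size_prod_XsubC r id) -rE size_XnsubC.
have rn : all n.-unity_root r.
  by apply/allP => z zr; rewrite /root_of_unity rE root_prod_XsubC.
have ur : uniq r.
  by rewrite -separable_prod_XsubC -rE separable_Xn_sub_1 // pnatr_eq0 -lt0n.
have /hasP[z _ zP] : has n.-primitive_root r by apply: has_prim_root; rewrite ?szr.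
by exists z.
Qed.

(** Absolute irreducibility of the module, in the form needed to lift matrix units. *)
Definition mx_generated (C : numClosedFieldType) (S : Type) m (E F : S -> 'M[C]_m) :=
  forall Q : set 'M[C]_m, linear_set Q -> Q 1%:M ->
    (forall X Y, Q X -> Q Y -> Q (X *m Y)) -> (forall s, Q (E s) /\ Q (F s)) ->
    forall X, Q X.

Lemma central_scalar (R : comNzRingType) n (M : 'M[R]_n) : (0 < n)%N ->
  (forall X, X *m M = M *m X) -> exists c, M = c%:M.
Proof.
move=> n0 com; pose o := Ordinal n0; exists (M o o).
have E a b k l : (k == a)%:R * M b l = M k a * (l == b)%:R.
  have /matrixP/(_ k l) := com (delta_mx a b); rewrite !mxE (bigD1 b) //= mxE eqxx andbT.
  rewrite big1 ?addr0 => [->|j jb]; last by rewrite mxE (negPf jb) andbF mul0r.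
  rewrite (bigD1 a) //= mxE eqxx big1 ?addr0 // => j ja; by rewrite mxE (negPf ja) mulr0.
apply/matrixP => i j; rewrite mxE.
have := E o i o j; rewrite eqxx mul1r => ->; rewrite eq_sym; case: eqP => _; by rewrite ?mulr1 ?mulr0.
Qed.

(** * The finite cover of the group defined by a module *)

Section Cover.
Variables (C : numClosedFieldType) (G : affineGroup C) (S : finType).
Variable D : chevalley_data G S.
Hypothesis connG : connected_group G.
Variables (m : nat) (E F H : S -> 'M[C]_m).
Hypothesis m0 : (0 < m)%N.
Hypothesis cm : chevalley_mx (cartan D) E F H.
Hypothesis genEF : mx_generated E F.
Local Notation A := (coord_ring G).
Local Notation subA := (coord_ring_subalgebra G).
Local Notation subP := (prod_subalgebra G m).
Local Notation T := (G * 'M[C]_m)%type.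
Local Notation Gam := (word_group D E F).

(** Conjugation by [word_mx E F w] depends only on the group element of [w], even if the matrix does
    not; [U a b x] is the conjugate of a matrix unit by any lift of x. It is regular in x: for
    matrices of the Lie algebra by transfer from a faithful representation, and then for all since
    they generate the matrix algebra. *)
Lemma unit_lifts : exists U : 'I_m -> 'I_m -> G -> 'M[C]_m,
  (forall a b i j, A (fun x => U a b x i j)) /\
  forall a b w, U a b (word_elt D w) *m word_mx E F w = word_mx E F w *m delta_mx a b.
Proof.
pose Q : set 'M[C]_m := [set X | exists Th : G -> 'M[C]_m, (forall i j, A (fun x => Th x i j)) /\
  forall w, Th (word_elt D w) *m word_mx E F w = word_mx E F w *m X].
have QA : forall X, Q X.
  apply: genEF.
  - split=> [|c X Y [Xh [AX XE]] [Yh [AY YE]]].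
      exists (fun=> 0); split=> [i j|w]; last by rewrite mul0mx mulmx0.
      rewrite (_ : (fun x => _) = fun=> 0); first exact: (subalg_cst subA).
      by apply: funext => x; rewrite mxE.
    exists (fun x => c *: Xh x + Yh x); split=> [i j|w]; last first.
      by rewrite mulmxDl mulmxDr -scalemxAl -scalemxAr XE YE.
    rewrite (_ : (fun x => _) = fun x => c * Xh x i j + Yh x i j).
      by apply: (subalgD subA) => //; exact: (subalgZ subA).
    by apply: funext => x; rewrite !mxE.
  - exists (fun=> 1%:M); split=> [i j|w]; last by rewrite mul1mx mulmx1.
    exact: (subalg_cst subA).
  - move=> X Y [Xh [AX XE]] [Yh [AY YE]]; exists (fun x => Xh x *m Yh x); split=> [i j|w].
      exact: (subalg_mulmx subA).
    by rewrite -mulmxA YE mulmxA XE mulmxA.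
  have [n [rho [rat faith]]] := faithful_rep_ex G.
  have a_diag s : cartan D s s = 2 by have [] := cartanP D.
  have cmF := drep_chevalley D rat.
  have [Psi PsiP] := rep_transfer a_diag (cartan_posdef D) cmF cm (faithful_h_free rat faith).
  have lift X0 X : pairL (fun s => drep rho (gen_e D s)) (fun s => drep rho (gen_f D s))
      (fun s => drep rho (gen_h D s)) E F H (X0, X) -> Q X.
    move=> PX; exists (fun x => Psi (rho x *m X0 *m rho (x^-1)%g)); split=> [i j|w].
      rewrite (_ : (fun x => _) = fun x =>
         \sum_k \sum_l (rho x *m X0 *m rho (x^-1)%g) k l * Psi (delta_mx k l) i j); last first.
        apply: funext => x; rewrite {1}(matrix_sum_delta (_ *m _)) linear_sum summxE; apply: eq_bigr => k _.
        by rewrite linear_sum summxE; apply: eq_bigr => l _; rewrite linearZ mxE.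
      have [_ _ rA] := rat.
      apply: (subalg_sum subA) => k _; apply: (subalg_sum subA) => l _.
      apply: (subalgM subA); last exact: (subalg_cst subA).
      apply: (subalg_mulmx subA) => [i1 j1|i1 j1]; last exact: (coord_ring_inv (rA _ _)).
      apply: (subalg_mulmx subA) => [i2 j2|i2 j2]; [exact: rA | exact: (subalg_cst subA)].
    have := PsiP _ (pairL_word_mx w cmF cm PX); rewrite /= -!rep_word // word_elt_inv => ->.
    by rewrite -!mulmxA (mulmx1C (word_mx_inv E F w)) mulmx1.
  have gensP s := Lall_gens (@pair_br C n m) (pair_e (fun s => drep rho (gen_e D s)) E)
     (pair_f (fun s => drep rho (gen_f D s)) F) (pair_h (fun s => drep rho (gen_h D s)) H) s.
  by move=> s; have [Pe Pf _] := gensP s; split; [exact: lift Pe | exact: lift Pf].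
have [U0 UP] := choice (fun p : 'I_m * 'I_m => QA (delta_mx p.1 p.2)).
exists (fun a b => U0 (a, b)); split=> [a b|a b w]; have [] := UP (a, b); first by [].
by move=> _; exact.
Qed.

Section Lifts.
Variable U : 'I_m -> 'I_m -> G -> 'M[C]_m.
Hypothesis UA : forall a b i j, A (fun x => U a b x i j).
Hypothesis UE : forall a b w, U a b (word_elt D w) *m word_mx E F w = word_mx E F w *m delta_mx a b.

(** The matrices of determinant 1 that induce the prescribed conjugation above a point. Two of them
    over the same point differ by an m-th root of unity. *)
Definition lift_pairs : set T := [set y | \det y.2 = 1 /\
  forall a b, U a b y.1 *m y.2 = y.2 *m delta_mx a b].

Lemma closure_lift y : pclosure Gam y -> lift_pairs y.
Proof.
move=> cy; split=> [|a b]; first exact: pclosure_det cy.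
apply/eqP; rewrite -subr_eq0; apply/eqP/matrixP => i j.
rewrite mxE [X in _ + X]mxE [RHS]mxE.
apply: (cy (fun y => (U a b y.1 *m y.2) i j - (y.2 *m delta_mx a b) i j)).
  apply: (subalgB subP); apply: (subalg_mulmx subP) => k l; try exact: prod_alg_entry.
    by apply: (@prod_alg_fst _ _ _ (fun x => U a b x k l)).
  exact: (subalg_cst subP).
by move=> _ [w ->] /=; rewrite UE subrr.
Qed.

Lemma unit_liftM a b c d x : U a b x *m U c d x = (b == c)%:R *: U a d x.
Proof.
apply/matrixP => i j; move: x; apply: (word_dense_eq connG (D := D)).
- exact: (subalg_mulmx subA).
- rewrite (_ : (fun x => _) = fun x => (b == c)%:R * U a d x i j); first exact: (subalgZ subA).
  by apply: funext => x; rewrite mxE.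
move=> w; have UV p q : U p q (word_elt D w) = word_mx E F w *m delta_mx p q *m word_mx E F (winv w).
  by rewrite -UE -mulmxA word_mx_inv mulmx1.
congr (fun_of_matrix _ i j); rewrite !UV -!mulmxA (mulmxA (word_mx E F (winv w))).
rewrite (mulmx1C (word_mx_inv E F w)) mul1mx !mulmxA -(mulmxA _ (delta_mx a b)).
rewrite mul_delta_mx_cond; case: eqP => _; first by rewrite !mulr1n scale1r.
by rewrite !mulr0n scale0r mulmx0 mul0mx.
Qed.

Lemma unit_lift_sum x : \sum_a U a a x = 1%:M.
Proof.
apply/matrixP => i j; move: x; apply: (word_dense_eq connG (D := D)).
- rewrite (_ : (fun x => _) = fun x => \sum_a U a a x i j); first exact: (subalg_sum subA).
  by apply: funext => x; rewrite summxE.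
- exact: (subalg_cst subA).
move=> w; congr (fun_of_matrix _ i j).
have UV p q : U p q (word_elt D w) = word_mx E F w *m delta_mx p q *m word_mx E F (winv w).
  by rewrite -UE -mulmxA word_mx_inv mulmx1.
under eq_bigr do rewrite UV; rewrite -mulmx_suml -mulmx_sumr.
have -> : \sum_a delta_mx a a = 1%:M :> 'M[C]_m.
  apply/matrixP => k l; rewrite summxE (bigD1 k) //= !mxE eqxx /= big1 ?addr0 => [|a ak].
    by rewrite eq_sym.
  by rewrite mxE eq_sym (negPf ak).
by rewrite mulmx1 word_mx_inv.
Qed.

(** Skolem-Noether made explicit: the [U a b x] are a system of matrix units, so the vectors
    [U j o x *m v], for a suitable [v], are the columns of a matrix conjugating the standard units
    to them. *)
Lemma lift_ex x : exists M, lift_pairs (x, M).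
Proof.
pose o : 'I_m := Ordinal m0.
have [v v0] : exists v : 'cV[C]_m, U o o x *m v != 0.
  apply/not_existsP => H0; have Uo : U o o x = 0.
    apply/matrixP => i j; have /negP/negPn/eqP/matrixP/(_ i 0) := H0 (delta_mx j 0).
    by rewrite -colE !mxE.
  have : (1%:M : 'M[C]_m) = 0.
    rewrite -(unit_lift_sum x) big1 // => a _.
    by rewrite -[U a a x]scale1r -[1]/((o == o)%:R : C) -unit_liftM -[U a o x]scale1r -[1]/((o == o)%:R : C) -unit_liftM Uo mulmx0 mul0mx.
  by move/matrixP/(_ o o); rewrite !mxE eqxx => /eqP; rewrite oner_eq0.
pose M : 'M[C]_m := \matrix_(i, j) (U j o x *m v) i 0.
have ME a b : U a b x *m M = M *m delta_mx a b.
  have colM j : col j M = U j o x *m v by apply/colP => i; rewrite !mxE.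
  apply/matrixP => i j; have -> : (U a b x *m M) i j = (U a b x *m col j M) i 0.
    by rewrite !mxE; apply: eq_bigr => k _; rewrite !mxE.
  rewrite colM mulmxA unit_liftM -scalemxAl mxE [RHS]mxE (bigD1 a) //= !mxE eqxx /=.
  rewrite [X in _ + X]big1 ?addr0 => [|k ka]; last by rewrite [X in _ * X]mxE (negPf ka) mulr0.
  by rewrite mulrC [b == j]eq_sym.
have uM : M \in unitmx.
  rewrite -row_full_unit -cokermx_eq0; apply/eqP/matrixP => j k; rewrite [RHS]mxE.
  have := mulmx_coker M => Mk.
  have /matrixP : U o j x *m (M *m cokermx M) = 0 by rewrite Mk mulmx0.
  rewrite mulmxA ME -mulmxA => MD.
  have [i Mio] : exists i, (U o o x *m v) i 0 != 0.
    apply/not_existsP => H0; move/eqP: v0; apply; apply/colP => i.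
    by have /negP/negPn/eqP -> := H0 i; rewrite mxE.
  have := MD i k; rewrite [RHS]mxE mxE (bigD1 o) //= big1 ?addr0 => [|l lo]; last first.
    rewrite [X in _ * X]mxE big1 ?mulr0 // => l' _; by rewrite mxE (negPf lo) mul0r.
  rewrite [X in X * _]mxE [X in _ * X]mxE (bigD1 j) //= big1 ?addr0 => [|l lj]; last first.
    by rewrite mxE (negPf lj) andbF mul0r.
  by rewrite [delta_mx _ _ _ _]mxE !eqxx mul1r => /eqP; rewrite mulf_eq0 (negPf Mio) => /eqP.
have d0 : \det M != 0 by rewrite -unitfE -unitmxE.
(* Conjugation does not see scalars, so the determinant can be normalised to 1. *)
pose c := m.-root (\det M)^-1.
exists (c *: M); split=> [|a b] /=; last by rewrite -scalemxAl -scalemxAr ME.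
by rewrite detZ rootCK // mulVf.
Qed.

Variable z : C.
Hypothesis zP : m.-primitive_root z.
Definition zact k (y : T) : T := (y.1, z ^+ k *: y.2).

Definition mono (r : seq ('I_m * 'I_m)) (y : T) : C := \prod_(p <- r) y.2 p.1 p.2.

Lemma mono_zact r k y : mono r (zact k y) = z ^+ (k * size r) * mono r y.
Proof.
rewrite /mono; elim: r => [|p r IH]; first by rewrite !big_nil muln0 expr0 mulr1.
by rewrite !big_cons IH /= mxE mulnS exprD; ring.
Qed.

(** Multiply the monomial by the determinant of the inverse matrix, which is 1, and expand. Each
    factor becomes an entry of M times an entry of M^-1, which is an entry of some [U a b x]. *)
Lemma mono_base r : size r = m -> exists2 f, A f & forall y, lift_pairs y -> mono r y = f y.1.
Proof.
move=> szr; pose r_ (a : 'I_m) := nth (a, a) r a.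
exists (fun x => \sum_(s : 'S_m) (-1) ^+ s * \prod_a U (r_ a).2 a x (r_ a).1 (s a)).
  apply: (subalg_sum subA) => s _; apply: (subalgZ subA); apply: (subalg_prod subA) => a _.
  exact: UA.
move=> [x M] [/= d1 ME].
have MN : M *m \adj M = 1%:M by rewrite mul_mx_adj d1.
have dN : \det (\adj M) = 1 by have := congr1 determinant MN; rewrite det_mulmx d1 mul1r det1.
have UN a b : U a b x = M *m delta_mx a b *m \adj M by rewrite -ME -mulmxA MN mulmx1.
have -> : mono r (x, M) = mono r (x, M) * \det (\adj M) by rewrite dN mulr1.
rewrite mulr_sumr; apply: eq_bigr => s _; rewrite mulrCA; congr (_ * _).
have -> : mono r (x, M) = \prod_a M (r_ a).1 (r_ a).2.
  case: r szr @r_ => [|p0 r'] szr r_; first by exfalso; move: m0; rewrite -szr.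
  rewrite /mono (big_nth p0) szr big_mkord; apply: eq_bigr => a _.
  by rewrite /r_ (set_nth_default (a, a)) // szr.
rewrite -big_split; apply: eq_bigr => a _ /=; rewrite UN [RHS]mxE (bigD1 a) //= big1 ?addr0 => [|k ka].
  rewrite [(M *m _) _ _]mxE (bigD1 (r_ a).2) //= big1 ?addr0 => [|k ka].
    by rewrite [delta_mx _ _ _ _]mxE !eqxx mulr1.
  by rewrite [delta_mx _ _ _ _]mxE (negPf ka) mulr0.
by rewrite [(M *m _) _ _]mxE big1 ?mul0r // => l _; rewrite [delta_mx _ _ _ _]mxE (negPf ka) andbF mulr0.
Qed.

Lemma mono_desc r : (m %| size r)%N -> exists2 f, A f & forall y, lift_pairs y -> mono r y = f y.1.
Proof.
case/dvdnP=> l; elim: l r => [|l IH] r szr.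
  exists (fun=> 1); first exact: (subalg_cst subA).
  by move=> y _; rewrite (size0nil szr) /mono big_nil.
have [f Af fE] : exists2 f, A f & forall y, lift_pairs y -> mono (take m r) y = f y.1.
  by apply: mono_base; rewrite size_take szr mulSn; case: l {IH szr} => [|l]; rewrite ?addn0 ?ltnn // -[X in (X < _)%N]addn0 ltn_add2l muln_gt0 m0.
have [g Ag gE] : exists2 f, A f & forall y, lift_pairs y -> mono (drop m r) y = f y.1.
  by apply: IH; rewrite size_drop szr mulSn addKn.
exists (fun x => f x * g x); first exact: (subalgM subA).
by move=> y Yy; rewrite -fE // -gE // /mono -big_cat cat_take_drop.
Qed.

(** Averaging over the m-th roots of unity kills the monomials whose degree in the matrix entries is
    not divisible by m; the others are functions on [G] by [mono_desc]. *)
Lemma average_desc q : prod_alg q -> exists2 f, A f &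
  forall y, lift_pairs y -> \sum_(k < m) q (zact k y) = f y.1.
Proof.
(* The free monomial factor makes the property stable under multiplication by a matrix entry, which
   the induction on the generation of [q] requires. *)
pose R := [set q : T -> C | forall r, exists2 f, A f & forall y, lift_pairs y ->
  \sum_(k < m) q (zact k y) * mono r (zact k y) = f y.1].
have R1 : R (fun=> 1).
  move=> r; have zs y : \sum_(k < m) 1 * mono r (zact k y) = (\sum_(k < m) (z ^+ size r) ^+ k) * mono r y.
    by rewrite mulr_suml; apply: eq_bigr => k _; rewrite mul1r mono_zact -exprM mulnC.
  have [mr|mr] := boolP (m %| size r)%N.
    have [f Af fE] := mono_desc mr.
    exists (fun x => (\sum_(k < m) (z ^+ size r) ^+ k) * f x); first exact: (subalgZ subA).
    by move=> y Yy; rewrite zs fE.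
  exists (fun=> 0); first exact: (subalg_cst subA).
  move=> y _; rewrite zs; suff -> : \sum_(k < m) (z ^+ size r) ^+ k = 0 by rewrite mul0r.
  have zr : z ^+ size r - 1 != 0 by rewrite subr_eq0 -(prim_order_dvd zP).
  apply: (mulfI zr); rewrite mulr0 -subrX1 -exprM mulnC exprM (prim_expr_order zP) expr1n subrr //.
have RD q1 q2 : R q1 -> R q2 -> R (fun y => q1 y + q2 y).
  move=> R1' R2' r; have [f Af fE] := R1' r; have [g Ag gE] := R2' r.
  exists (fun x => f x + g x); first exact: (subalgD subA).
  by move=> y Yy; rewrite -fE // -gE // -big_split; apply: eq_bigr => k _; rewrite mulrDl.
have RZ c q1 : R q1 -> R (fun y => c * q1 y).
  move=> R1' r; have [f Af fE] := R1' r.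
  exists (fun x => c * f x); first exact: (subalgZ subA).
  by move=> y Yy; rewrite -fE // mulr_sumr; apply: eq_bigr => k _; rewrite mulrA.
move=> Pq; suff Rq : R q.
  have [f Af fE] := Rq [::]; exists f => // y Yy; rewrite -fE //; apply: eq_bigr => k _.
  by rewrite /mono big_nil mulr1.
suff NR : forall q', R q' -> R (fun y => q y * q' y).
  by have := NR _ R1; congr R; apply: funext => y; rewrite mulr1.
move: q Pq; apply: (@algebra_generated_min _ _ _ [set q | forall q', R q' -> R (fun y => q y * q' y)]).
  split=> /= [c q' /(RZ c) //|f g Nf Ng q' Rq'|f g Nf Ng q' Rq'].
    have := RD _ _ (Nf _ Rq') (Ng _ Rq'); congr R; apply: funext => y; by rewrite mulrDl.
  have := Nf _ (Ng _ Rq'); congr R; apply: funext => y; by rewrite mulrA.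
move=> q [[f Af ->]|[i [j ->]]] q' Rq' r.
  have [g Ag gE] := Rq' r; exists (fun x => f x * g x); first exact: (subalgM subA).
  by move=> y Yy; rewrite -gE // mulr_sumr; apply: eq_bigr => k _; rewrite mulrA.
have [g Ag gE] := Rq' ((i, j) :: r); exists g => // y Yy; rewrite -gE //; apply: eq_bigr => k _.
by rewrite /mono big_cons /=; ring.
Qed.

(** If no translate by a root of unity were in the closure, some q would vanish on all words but at
    none of these translates. Its norm is invariant, so it descends to a function on [G] that
    vanishes on words, hence everywhere: a contradiction at (x, M). *)
Lemma lift_closure x M : lift_pairs (x, M) -> exists k, pclosure Gam (zact k (x, M)).
Proof.
move=> Y; apply/not_existsP => nc.
have nk (k : 'I_m) : exists q, [/\ prod_alg q, forall g, ms_set Gam g -> q g = 0 & q (zact k (x, M)) != 0].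
  have /existsNP[q /not_implyP[Pq /not_implyP[q0 qn]]] := nc k.
  by exists q; split=> //; apply/eqP.
have [qq qqP] := choice nk.
(* Each translate comes with its own function. A combination with coefficients t^j is non-zero at
   all of them at once, provided t is not a root of this product of non-zero polynomials. *)
pose p := \prod_(k < m) \poly_(j < m) (if insub j is Some j' then qq j' (zact k (x, M)) else 0).
have p0 : p != 0.
  apply/prodf_neq0 => k _; apply/eqP => /polyP/(_ k); rewrite coef_poly ltn_ord coef0.
  rewrite insubT /= => [|lt]; first exact: ltn_ord.
  rewrite (_ : Sub _ _ = k); last exact: val_inj.
  by have [_ _ /eqP] := qqP k.
have [t pt] : exists t, p.[t] != 0.
  apply/not_existsP => H0; move/eqP: p0; apply; apply: polyP_eval => t; rewrite horner0.
  by apply/eqP; apply/negPn/negP; exact: H0.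
pose q (y : T) := \sum_(j < m) t ^+ j * qq j y.
have Pq : prod_alg q.
  apply: (subalg_sum subP) => j _; apply: (subalgZ subP); by have [] := qqP j.
have q0 g : ms_set Gam g -> q g = 0.
  by move=> Gg; rewrite /q big1 // => j _; have [_ qj _] := qqP j; rewrite qj // mulr0.
have qn (k : 'I_m) : q (zact k (x, M)) != 0.
  move: pt; rewrite horner_prod => /prodf_neq0/(_ k isT).
  rewrite horner_poly; congr (_ != 0); apply: eq_bigr => j _.
  by rewrite mulrC insubT ?ltn_ord // => lt; congr (_ * qq _ _); exact: val_inj.
pose Nq (y : T) := \prod_(k < m) q (zact k y).
have PN : prod_alg Nq.
  apply: (subalg_prod subP) => k _; apply: prod_alg_comp Pq => [f Af|i j] /=; first exact: prod_alg_fst.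
  rewrite (_ : (fun y => _) = fun y : T => z ^+ k * y.2 i j); last by apply: funext => y; rewrite mxE.
  by apply: (subalgZ subP); exact: prod_alg_entry.
have zactD k l y : zact k (zact l y) = zact (k + l) y by rewrite /zact /= scalerA exprD.
have Nshift k y : Nq (zact k y) = Nq y.
  elim: k => [|k IH]; first by rewrite /zact expr0 scale1r; case: y.
  rewrite -IH /Nq; case: (m) m0 zP => // m' _ zP'.
  rewrite big_ord_recr big_ord_recl /= mulrC; congr (_ * _).
    rewrite !zactD addnS /zact; congr (q (_, _ *: _)).
    by rewrite addnC -addnS exprD (prim_expr_order zP') mulr1 add0n.
  by apply: eq_bigr => j _; rewrite !zactD addnS.
have [f Af fE] := average_desc PN.
have f0 : forall x, f x = 0.
  apply: (word_dense connG (D := D)) => // w.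
  have cw : pclosure Gam (word_elt D w, word_mx E F w) by apply: pclosure_sub; exists w.
  rewrite -(fE _ (closure_lift cw)) big1 // => k _; rewrite Nshift /Nq.
  rewrite (bigD1 (Ordinal m0)) //= /zact expr0 scale1r q0 ?mul0r //; by exists w.
have := fE _ Y; rewrite f0 (eq_bigr (fun=> Nq (x, M))) => [|k _]; last exact: Nshift.
rewrite sumr_const card_ord -mulr_natr => /eqP; rewrite mulf_eq0 pnatr_eq0 -leqn0 leqNgt m0 orbF.
by apply/negP/prodf_neq0 => k _.
Qed.

End Lifts.

Hypothesis scG : simply_connected G.

(** The closure of the word pairs maps onto [G] by [lift_ex] and [lift_closure], and with finite
    kernel. By simple connectedness the projection has a regular inverse, whose matrix component is
    the representation. *)
Theorem cover_rep : exists rho : G -> 'M[C]_m, rational_rep rho /\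
  forall b s t, rho (root_elt D b s t) = mexp (t *: (if b then E s else F s)).
Proof.
have [z zP] := closed_prim_root C m0; have [U [UA UE]] := unit_lifts.
pose K := closure_group Gam; pose pr (y : K) : G := (cp_val y).1.
have mor : group_morphism pr.
  by split=> // f Af; exists (fun y => f y.1) => //; exact: prod_alg_fst.
have iso : isogeny pr.
  split=> // [x|].
    have [M YM] := lift_ex UA UE x; have [k ck] := lift_closure UA UE zP YM.
    by exists (ClosurePts ck).
  have fin : finite_set [set c : C | c ^+ m = 1].
    have [r rE] := closed_field_poly_normal ('X^m - 1 : {poly C}).
    apply: (@sub_finite_set _ _ [set` r]) => // c /= cm1.
    have : root ('X^m - 1) c by rewrite /root !hornerE cm1 subrr.
    have lc : lead_coef ('X^m - 1 : {poly C}) = 1 by apply/eqP; exact: monic_Xn_sub_1.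
    by rewrite rE lc scale1r root_prod_XsubC.
  have [] := pselect (exists y0 : K, True) => [[y0 _]|no]; last first.
    by apply: (@sub_finite_set _ _ set0) => // y _; apply: no; exists y.
  pose mk (c : C) : K := if pselect (pclosure Gam (1%g, c%:M)) is left P then ClosurePts P else y0.
  apply: (sub_finite_set _ (finite_image mk fin)) => y /= y1.
  have [d1 YU] := closure_lift UA UE (cp_P y).
  (* Above 1 the lifted units are the standard ones, so the matrix part of a kernel element commutes
     with all matrices: it is a scalar c, with c^m = 1 by its determinant. *)
  have Usc a b : U a b 1%g = delta_mx a b.
    by have := UE a b [::]; rewrite /= mulmx1 mul1mx.
  have com X : X *m (cp_val y).2 = (cp_val y).2 *m X.
    rewrite [X]matrix_sum_delta mulmx_suml mulmx_sumr; apply: eq_bigr => a _.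
    rewrite mulmx_suml mulmx_sumr; apply: eq_bigr => b _.
    by rewrite -scalemxAl -scalemxAr -YU -[(cp_val y).1]/(pr y) y1 Usc.
  have [c cE] := central_scalar m0 com.
  exists c; first by rewrite cE det_scalar in d1.
  have yE : cp_val y = (1%g, c%:M) by rewrite [LHS]surjective_pairing cE -[(cp_val y).1]/(pr y) y1.
  rewrite /mk; case: pselect => [P|]; first by apply: cp_val_inj; rewrite yE.
  by move=> []; rewrite -yE; exact: (cp_P y).
have [_ sc] := scG; have [_ [inv prK invK] lift] := sc K pr (@word_group_connected _ _ _ D _ E F) iso.
exists (fun x => (cp_val (inv x)).2); split; first split.
- suff -> : inv 1%g = 1%g by [].
  by rewrite -(prK 1%g).
- move=> x y; suff -> : inv (x * y)%g = (inv x * inv y)%g by [].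
  by apply: (can_inj prK); rewrite invK (proj1 mor) !invK.
- move=> i j; have [|f Af fE] := lift (fun y => (cp_val y).2 i j).
    by exists (fun y : T => y.2 i j) => //; exact: prod_alg_entry.
  rewrite (_ : (fun x => _) = f) //; apply: funext => x.
  by rewrite -[RHS](congr1 f (invK x)) -[RHS](congr1 (fun h => h (inv x)) fE).
- move=> b s t; have Gw : ms_set Gam (root_elt D b s t, mexp (t *: (if b then E s else F s))).
    by exists [:: (b, s, t)]; rewrite /= mulg1 mulmx1.
  by rewrite -[root_elt D b s t]/(pr (ClosurePts (pclosure_sub Gw))) prK.
Qed.

End Cover.

(** * Extremal coefficients are minors *)

Section MexpInj.
Variable C : numClosedFieldType.

Lemma mexp_inj n (X Y : 'M[C]_n) : nilpotent_mx X -> nilpotent_mx Y ->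
  (forall t, mexp (t *: X) = mexp (t *: Y)) -> X = Y.
Proof.
move=> [N1 XN] [N2 YN] E; pose N := (N1 + N2).+2.
have XN' : X ^+ N = 0 by apply: nilpotent_le XN _; rewrite /N; lia.
have YN' : Y ^+ N = 0 by apply: nilpotent_le YN _; rewrite /N; lia.
have lin0 : linear_set [set 0 : 'M[C]_n] by split=> // c u v -> ->; rewrite scaler0 addr0.
have := @linear_set_coef _ _ _ lin0 N (fun k : 'I_N => k`!%:R^-1 *: X ^+ k - k`!%:R^-1 *: Y ^+ k) _ (@Ordinal N 1 isT).
rewrite /= (_ : 1`! = 1%N) // invr1 !scale1r !expr1 => H; apply/eqP; rewrite -subr_eq0; apply/eqP; apply: H => t _.
rewrite (eq_bigr (fun k : 'I_N => t ^+ k *: (k`!%:R^-1 *: X ^+ k) - t ^+ k *: (k`!%:R^-1 *: Y ^+ k))).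
  by rewrite sumrB -(mexp_scale t XN') -(mexp_scale t YN') E subrr.
by move=> k _; rewrite scalerBr.
Qed.

End MexpInj.

Section WeightReps.
Variables (C : numClosedFieldType) (G : affineGroup C) (S : finType).
Variable D : chevalley_data G S.
Local Notation A := (coord_ring G).

Lemma weight_rep_diag n (rho : G -> 'M[C]_n) wt : rational_rep rho ->
  (forall s, drep rho (gen_h D s) = diag_mx (\row_i (wt i s)%:~R)) -> weight_rep D rho wt.
Proof.
move=> rat wH; split=> // s t t0; have [N [K [M [M1 _ HM torE]]]] := tor_projections D rat s.
rewrite torE //; apply/matrixP => i j; rewrite summxE !mxE.
have MK (k : 'I_K) : t ^ (k%:Z - N%:Z) * M k i j = t ^ wt i s * M k i j.
  have /matrixP/(_ i j) := HM k; rewrite wH mul_diag_mx !mxE.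
  have [->|nz] := eqVneq (M k i j) 0; first by rewrite !mulr0.
  by move/(mulIf nz)/eqP; rewrite eqr_int => /eqP ->.
rewrite (eq_bigr (fun k : 'I_K => t ^ wt i s * M k i j)) => [|k _]; last by rewrite mxE MK.
rewrite -mulr_sumr; have /matrixP/(_ i j) := M1; rewrite summxE mxE => ->.
by rewrite mulr_natr.
Qed.

Lemma irreducible_gen n (rho : G -> 'M[C]_n) : rational_rep rho -> (0 < n)%N ->
  mx_generated (fun s => drep rho (gen_e D s)) (fun s => drep rho (gen_f D s)) ->
  irreducible_rep rho.
Proof.
move=> rat n0 gen; split=> // U U0 UD Ust.
have linU : linear_set U by split.
have [U00|/existsNP[u /not_implyP[Uu u0]]] := pselect (forall u, U u -> u = 0).
  by left; apply/seteqP; split=> [u /U00 //|u ->].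
right; apply/seteqP; split=> // v _.
have stab : forall X : 'M[C]_n, forall u, U u -> U (X *m u).
  apply: gen.
  - split=> [u' _|c X Y HX HY u' Uu']; first by rewrite mul0mx.
    by rewrite mulmxDl -scalemxAl; apply: UD; [exact: HX | exact: HY].
  - by move=> u'; rewrite mul1mx.
  - by move=> X Y HX HY u' Uu'; rewrite -mulmxA; apply: (HX); exact: HY.
  - by move=> s; split; [apply: (rep_stable_gen (D := D) (b := true) rat linU) => t u' |
      apply: (rep_stable_gen (D := D) (b := false) rat linU) => t u']; exact: Ust.
have [i ui] : exists i, u i 0 != 0.
  by apply/not_existsP => H; apply: u0; apply/colP => i; have /negP/negPn/eqP -> := H i; rewrite mxE.
suff -> : v = (\matrix_(k, l) ((l == i)%:R * (v k 0 / u i 0))) *m u by exact: stab.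
apply/colP => k; rewrite !mxE (bigD1 i) //= mxE eqxx mul1r mulfVK // big1 ?addr0 // => l li.
by rewrite mxE (negPf li) !mul0r.
Qed.

Theorem cover_weight_rep m (E F H : S -> 'M[C]_m) wt : simply_connected G -> (0 < m)%N ->
  chevalley_mx (cartan D) E F H -> mx_generated E F ->
  (forall s, H s = diag_mx (\row_i (wt i s)%:~R)) ->
  exists rho : G -> 'M[C]_m, [/\ rational_rep rho, weight_rep D rho wt, irreducible_rep rho,
    forall s, drep rho (gen_e D s) = E s & forall s, drep rho (gen_f D s) = F s].
Proof.
move=> sc m0 cm gen HE; have [connG _] := sc.
have [rho [rat rhoE]] := cover_rep connG m0 cm gen sc.
have dE s : drep rho (gen_e D s) = E s.
  apply: mexp_inj => [||t]; first exact: (rep_nilpotent D rat true s).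
    exact: (cm_nilE cm).
  by rewrite -(rhoE true s t) (rep_root_elt D rat true).
have dF s : drep rho (gen_f D s) = F s.
  apply: mexp_inj => [||t]; first exact: (rep_nilpotent D rat false s).
    exact: (cm_nilF cm).
  by rewrite -(rhoE false s t) (rep_root_elt D rat false).
exists rho; split=> //.
- apply: weight_rep_diag => // s; rewrite -HE; have := cm_ef (drep_chevalley D rat) s s.
  by rewrite eqxx dE dF (cm_ef cm) eqxx => ->.
- apply: irreducible_gen => //; rewrite (_ : (fun s => _) = E); last exact: funext.
  by rewrite (_ : (fun s => drep rho (gen_f D s)) = F) //; exact: funext.
Qed.

Definition irefl (s : S) (mu : S -> int) (t : S) : int := mu t - mu s * cartan D t s.
Definition iact (w : seq S) (mu : S -> int) : S -> int := foldr irefl mu w.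
Definition toC (mu : S -> int) : weight C S := [ffun s => (mu s)%:~R].

Lemma iactP w mu : word_act D w (toC mu) = toC (iact w mu).
Proof.
elim: w => //= s w ->; apply/ffunP => t; rewrite !ffunE /irefl rmorphB rmorphM //.
Qed.

Lemma iact_cat w w' mu : iact (w ++ w') mu = iact w (iact w' mu).
Proof. by rewrite /iact foldr_cat. Qed.

Lemma irefl2 s mu : irefl s (irefl s mu) = mu.
Proof.
have [a_diag _ _] := cartanP D.
by apply: funext => t; rewrite /irefl a_diag; ring.
Qed.

Lemma iact_rev w mu : iact (rev w) (iact w mu) = mu.
Proof.
elim: w mu => //= s w IH mu; rewrite rev_cons -cats1 iact_cat /= irefl2; exact: IH.
Qed.

Section OneWeightRep.
Variables (n : nat) (rho : G -> 'M[C]_n) (wt : 'I_n -> S -> int).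
Hypothesis rat : rational_rep rho.
Hypothesis wr : weight_rep D rho wt.

Definition has_weight (mu : S -> int) (v : 'cV[C]_n) :=
  forall s, drep rho (gen_h D s) *m v = (mu s)%:~R *: v.

Lemma has_weight_delta i : has_weight (wt i) (delta_mx i 0).
Proof.
move=> s; have [wH _] := wr; rewrite wH; apply/colP => k; rewrite mul_diag_mx !mxE.
by case: eqP => [->|_]; rewrite ?mulr0.
Qed.

Lemma has_weight_coord mu v k : has_weight mu v -> v k 0 != 0 -> wt k = mu.
Proof.
move=> hv vk; apply: funext => s; have [wH _] := wr.
have /colP/(_ k) := hv s; rewrite wH mul_diag_mx !mxE => /(mulIf vk)/eqP.
by rewrite eqr_int => /eqP.
Qed.

Lemma has_weight_rbar s mu v : has_weight mu v -> has_weight (irefl s mu) (rho (rbar D s) *m v).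
Proof.
move=> hv t; have [a_diag _ _] := cartanP D.
rewrite rep_rbar // mulmxA (rbar_mx_weyl (drep_chevalley D rat) a_diag) -mulmxA mulmxBl -scalemxAl.
by rewrite !hv scalerA -scalerBl -scalemxAr /irefl rmorphB rmorphM /= [_ * (mu s)%:~R]mulrC.
Qed.

Definition wbar (w : seq S) : G := (\prod_(s <- w) rbar D s)%g.

Lemma has_weight_wbar w mu v : has_weight mu v -> has_weight (iact w mu) (rho (wbar w) *m v).
Proof.
have [r1 rM _] := rat; rewrite /wbar => hv; elim: w => [|s w IH] /=.
  by rewrite big_nil r1 mul1mx.
by rewrite big_cons rM -mulmxA; exact: has_weight_rbar.
Qed.

Lemma rep_mul_neq0 x (v : 'cV[C]_n) : v != 0 -> rho x *m v != 0.
Proof.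
move=> v0; apply/eqP => E; move/eqP: v0; apply.
by rewrite -[v]mul1mx -[1%:M](mulVmx (rep_unit rat x)) -mulmxA E mulmx0.
Qed.

Lemma delta_neq0 i : delta_mx i 0 != 0 :> 'cV[C]_n.
Proof. by apply/eqP => /matrixP/(_ i 0)/eqP; rewrite !mxE !eqxx oner_eq0. Qed.

Lemma nz_coord (v : 'cV[C]_n) : v != 0 -> exists i, v i 0 != 0.
Proof.
move=> v0; apply/not_existsP => H; move/eqP: v0; apply; apply/colP => i.
by have /negP/negPn/eqP -> := H i; rewrite mxE.
Qed.

Lemma weight_iact i w : exists j, wt j = iact w (wt i).
Proof.
have [j nz] := nz_coord (rep_mul_neq0 (wbar w) (delta_neq0 i)).
by exists j; exact: has_weight_coord (has_weight_wbar w (has_weight_delta i)) nz.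
Qed.

Lemma mult_one_delta i mu v : has_weight mu v -> wt i = mu -> (forall j, wt j = wt i -> j = i) ->
  v = v i 0 *: delta_mx i 0.
Proof.
move=> hv wi one; apply/colP => k; rewrite !mxE eqxx andbT.
have [->|ki] := eqVneq k i; first by rewrite mulr1.
rewrite mulr0; apply/eqP; apply: contraNT ki => vk.
by apply/eqP; apply: one; rewrite wi; exact: has_weight_coord vk.
Qed.

Variable c : S -> rat.rat.
Hypothesis cP : forall t, \sum_s (cartan D s t)%:~R * c s = 1.
Local Notation ht := (height c wt true).

Lemma height_irefl i j s : wt j = irefl s (wt i) -> ht j = ht i - (wt i s)%:~R.
Proof.
move=> E; have -> : (wt i s)%:~R = \sum_t (wt i s)%:~R * ((cartan D t s)%:~R * c t).
  by rewrite -mulr_sumr cP mulr1.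
rewrite /height !mul1r E /irefl -sumrB.
by apply: eq_bigr => t _; rewrite rmorphB rmorphM /=; ring.
Qed.

(** Each [e s] would raise the height, and the reflection in s changes it by - wt i0 s. At the
    maximum, the first forces e_s to kill the vector and the second forces dominance. *)
Lemma max_height_highest i0 : (forall i, ht i <= ht i0) ->
  (forall s, drep rho (gen_e D s) *m delta_mx i0 0 = 0 :> 'cV[C]_n) /\ forall s, 0 <= wt i0 s.
Proof.
move=> mx; split=> s.
  apply/colP => k; rewrite -colE mxE [RHS]mxE; apply/eqP; apply/negPn/negP => nz.
  have := height_gen cP (b := true) rat wr nz; rewrite ltNge mx //.
have [j E] := weight_iact i0 [:: s]; have := mx j; rewrite (height_irefl E).
by rewrite gerBl ler0z.
Qed.

(** Orbits are described by arbitrary words, whereas minors are defined through reduced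
    expressions. *)
Lemma reduced_ex w : exists w', reduced_expression D w' (word_act D w).
Proof.
pose P k := `[< exists2 w', word_act D w' = word_act D w & size w' = k >].
have exP : exists k, P k by exists (size w); apply/asboolP; exists w.
case: (ex_minnP exP) => k /asboolP[w' E szw] mn; exists w'; split=> // j jE.
by rewrite szw; apply: mn; apply/asboolP; exists j.
Qed.

(** The representatives of the Weyl group carry the highest weight vector to weight vectors of the
    indices in [N]. As these weights have multiplicity one, the images are non-zero multiples of
    basis vectors. *)
Lemma extremal_coef (N : pred 'I_n) i0 : irreducible_rep rho -> N i0 -> (forall i, ht i <= ht i0) ->
  (forall i, N i -> exists w, iact w (wt i0) = wt i) ->
  (forall i j, N i -> wt j = wt i -> j = i) ->
  forall i j, N i -> N j -> algebra_generated (generalized_minors D) (fun x => rho x i j).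
Proof.
move=> irr N0 mx tr one i j Ni Nj; have [eh dom] := max_height_highest mx.
have [r1 rM rA] := rat.
have red k : N k -> exists w (d : C), [/\ reduced_expression D w (word_act D w), d != 0,
    rho (wbar w) *m delta_mx i0 0 = d *: delta_mx k 0 :> 'cV[C]_n & iact w (wt i0) = wt k].
  move=> Nk; have [w0 w0E] := tr k Nk; have [w rw] := reduced_ex w0.
  have wE : iact w (wt i0) = wt k.
    have [E _] := rw; have := iactP w (wt i0); rewrite E iactP w0E => /ffunP EE.
    by apply: funext => t; have /eqP := EE t; rewrite !ffunE eqr_int => /eqP.
  have hw := has_weight_wbar w (has_weight_delta i0).
  have vE := mult_one_delta hw (esym wE) (fun j => @one k j Nk).
  exists w, ((rho (wbar w) *m (delta_mx i0 0 : 'cV[C]_n)) k 0); split=> //.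
    by have [E rd] := rw; split=> // w'; rewrite E; exact: rd.
  by apply/eqP => d0; have := rep_mul_neq0 (wbar w) (delta_neq0 i0); rewrite vE d0 scale0r eqxx.
have [w [d [rw d0 wv wE]]] := red i Ni; have [w' [d' [rw' d0' wv' wE']]] := red j Nj.
have subB := algebra_generated_subalgebra (generalized_minors D).
(* The factor 1 / d normalises the linear form to value 1 on its own extremal vector, as the
   definition of a minor demands, and d' comes from the vector on the right; d / d' undoes both. *)
rewrite (_ : (fun x => _) = fun x => (d / d') * (d^-1 *: (delta_mx 0 i : 'rV[C]_n) *m (rho x *m (rho (wbar w') *m (delta_mx i0 0 : 'cV[C]_n)))) 0 0); last first.
  apply: funext => x; rewrite wv' -scalemxAr -scalemxAl -scalemxAr mxE [X in _ * (_ * X)]mxE.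
  rewrite -colE -rowE !mxE mulrA mulrA.
  rewrite (_ : d / d' * d^-1 * d' = 1) ?mul1r //; by field; rewrite d0 d0'.
apply: (subalgZ subB); apply: algebra_generated_sub.
exists (toC (wt i0)), (word_act D w), (word_act D w'); split.
- move=> s; exists `|wt i0 s|%N; rewrite ffunE -{1}(gez0_abs (dom s)) //.
- by exists w.
- by exists w'.
exists n, rho, (delta_mx i0 0), (wbar w), (wbar w'), (d^-1 *: (delta_mx 0 i : 'rV[C]_n)); split=> //.
- split=> //; first exact: delta_neq0.
  by move=> s; rewrite ffunE; exact: has_weight_delta.
- by exists w.
- by exists w'.
split.
  move=> s; have [wH _] := wr; rewrite wH iactP wE !ffunE.
  apply/rowP => k; rewrite mul_mx_diag !mxE; case: (k =P i) => [->|_] /=; rewrite ?mulr0 ?mul0r ?oppr0 //.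
  by rewrite mulNr [in RHS]mulrC.
rewrite wv -scalemxAr -scalemxAl scalerA mulfV // scale1r mul_delta_mx !mxE !eqxx //.
Qed.

End OneWeightRep.
End WeightReps.

Lemma max_rat n (ht : 'I_n -> rat) : (0 < n)%N -> exists i0, forall i, ht i <= ht i0.
Proof.
move=> n0; pose o := Ordinal n0.
by exists [arg max_(i > o) ht i]%O => i; case: Order.TotalTheory.arg_maxP => // j _ jm; exact: jm.
Qed.

Section MatrixLie.
Variables (C : numClosedFieldType) (S : finType) (a : S -> S -> int) (n : nat).

Lemma mxad_lie : lie_bracket (@mxad C n).
Proof.
split=> [x c u v|x y|x y z]; [by rewrite mxadDr mxadZr | exact: mxadC | exact: mxad_jacobi].
Qed.

Lemma mxad_chevalley (E F H : S -> 'M[C]_n) : chevalley_mx a E F H ->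
  chevalley_elts a (@mxad C n) E F H.
Proof.
case=> hh ef he hf nE nF; split=> // s x.
  by have [K [K0 _]] := mexp_conj x (nE s); exists K.
by have [K [K0 _]] := mexp_conj x (nF s); exists K.
Qed.

End MatrixLie.

Section IntegralForm.
Variables (S : finType) (a : S -> S -> int).

Lemma posdef_int : posdef_cartan a -> exists d : S -> int,
  [/\ forall s, 0 < d s, forall s t, d s * a s t = d t * a t s &
   forall z : S -> rat, (exists s, z s != 0) ->
    0 < \sum_s (d s)%:~R * z s * (\sum_t (a s t)%:~R * z t)].
Proof.
case=> K [Ksym Ka Kpos].
have Kss s : 0 < K s s.
  have := Kpos (fun t => (t == s)%:R) (ex_intro _ s _); rewrite eqxx oner_eq0 => /(_ isT).
  rewrite (bigD1 s) //= [X in _ + X]big1 => [|t /negPf ts]; last first.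
    by rewrite big1 // => u _; rewrite ts !mul0r.
  rewrite addr0 (bigD1 s) //= big1 => [|t /negPf ts]; last by rewrite ts mulr0 mul0r.
  by rewrite eqxx !mul1r addr0 ltr0z.
(* The symmetriser of the matrix is 1 / K s s; multiplying by the product of all K t t makes it
   integral. *)
pose M := \prod_t K t t; pose d s := \prod_(t | t != s) K t t.
have dK s : d s * K s s = M by rewrite /M (bigD1 s) //= mulrC.
have d0 s : 0 < d s by apply: prodr_gt0 => t _.
have aK s t : a t s * K s s = a s t * K t t by rewrite -!Ka Ksym.
have Kn s : K s s != 0 by rewrite gt_eqF.
have sym s t : d s * a s t = d t * a t s.
  apply: (mulIf (mulf_neq0 (Kn s) (Kn t))).
  transitivity (M * (a s t * K t t)); first by rewrite -(dK s); ring.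
  by rewrite -aK -(dK t); ring.
exists d; split=> // z [s0 zs0].
have KnQ s : (K s s)%:~R != 0 :> rat by rewrite intr_eq0.
have ex0 : exists s, z s / (K s s)%:~R != 0.
  by exists s0; rewrite mulf_neq0 // invr_neq0.
have M0 : 0 < M by apply: prodr_gt0 => t _.
rewrite (_ : \sum_s _ = M%:~R * 2 * \sum_s \sum_t (z s / (K s s)%:~R) * (z t / (K t t)%:~R) * (K s t)%:~R).
  by rewrite pmulr_rgt0 ?(Kpos _ ex0) // pmulr_rgt0 // ltr0z.
rewrite mulr_sumr; apply: eq_bigr => s _.
rewrite !mulr_sumr; apply: eq_bigr => t _.
have E := congr1 (fun x : int => x%:~R : rat) (Ka t s); rewrite /= !rmorphM /= in E.
have E' := congr1 (fun x : int => x%:~R : rat) (dK s); rewrite /= !rmorphM /= in E'.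
rewrite (_ : (a s t)%:~R = (K t s)%:~R * 2%:~R / (K t t)%:~R); last by rewrite E mulfK.
by rewrite -E' Ksym; field; rewrite !KnQ.
Qed.

Lemma posdef_intZ (d : S -> int) :
  (forall z : S -> rat, (exists s, z s != 0) ->
    0 < \sum_s (d s)%:~R * z s * (\sum_t (a s t)%:~R * z t)) ->
  forall z : S -> int, (exists s, z s != 0) -> 0 < \sum_s d s * z s * (\sum_t a s t * z t).
Proof.
move=> pos z [s0 zs0]; have := pos (fun s => (z s)%:~R) (ex_intro _ s0 _).
rewrite intr_eq0 => /(_ zs0); rewrite -(ltr0z rat) rmorph_sum /=; congr (_ < _).
apply: eq_bigr => s _; rewrite !rmorphM /= rmorph_sum /=; congr (_ * _).
by apply: eq_bigr => t _; rewrite rmorphM.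
Qed.

End IntegralForm.

(** * Minuscule representations *)

(** Distinct weights can be separated by some h_s; products of the affine functions of the diagonal
    matrices so obtained interpolate the diagonal units, as in Lagrange's formula. *)
Lemma weight_units (C : numClosedFieldType) (S : Type) n (wt : 'I_n -> S -> int) (Q : set 'M[C]_n) :
  linear_set Q -> Q 1%:M -> (forall X Y, Q X -> Q Y -> Q (X *m Y)) -> injective wt ->
  (forall s, Q (diag_mx (\row_i (wt i s)%:~R))) -> forall i, Q (delta_mx i i).
Proof.
move=> linQ Q1 QM wt_inj QH.
pose Qd (f : 'I_n -> C) := Q (diag_mx (\row_k f k)).
have QdM f g : Qd f -> Qd g -> Qd (fun k => f k * g k).
  move=> Qf Qg; rewrite /Qd (_ : diag_mx _ = diag_mx (\row_k f k) *m diag_mx (\row_k g k)); first exact: QM.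
  by rewrite mulmx_diag; congr diag_mx; apply/rowP => k; rewrite !mxE.
have Qd1 : Qd (fun=> 1).
  by rewrite /Qd (_ : diag_mx _ = 1%:M) //; apply/matrixP => i j; rewrite !mxE.
have sep i j : exists g, [/\ Qd g, g i = 1 & j != i -> g j = 0].
  have [->|ji] := eqVneq j i; first by exists (fun=> 1).
  have [s sij] : exists s, wt i s != wt j s.
    apply/not_existsP => H0; move/eqP: ji; apply; apply: wt_inj; apply: funext => s.
    by apply/esym/eqP/negPn/negP; exact: H0.
  have sC : (wt i s)%:~R - (wt j s)%:~R != 0 :> C by rewrite subr_eq0 eqr_int.
  exists (fun k => ((wt i s)%:~R - (wt j s)%:~R)^-1 * ((wt k s)%:~R - (wt j s)%:~R)); split.
  - rewrite /Qd (_ : diag_mx _ = ((wt i s)%:~R - (wt j s)%:~R)^-1 *: (diag_mx (\row_i (wt i s)%:~R) - (wt j s)%:~R *: 1%:M)).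
      by apply: (linear_setZ linQ); apply: (linear_setB linQ) => //; exact: (linear_setZ linQ).
    apply/matrixP => k l; rewrite !mxE; case: (k == l); rewrite ?mulr1n ?mulr0n ?mulr1 //.
    by rewrite mulr0 subr0 mulr0.
  - by rewrite mulVf.
  - by move=> _; rewrite subrr mulr0.
move=> i.
have [g gP] := choice (sep i).
have QP (l : seq 'I_n) : Qd (fun k => \prod_(j <- l) g j k).
  elim: l => [|j l IH]; first by have := Qd1; congr Qd; apply: funext => k; rewrite big_nil.
  have [gj _ _] := gP j; have := QdM _ _ gj IH; congr Qd; apply: funext => k; by rewrite big_cons.
have := QP (index_enum 'I_n); rewrite /Qd; congr Q; apply/matrixP => k l; rewrite !mxE.
have [<-|kl] := eqVneq k l; last first.
  by rewrite mulr0n; case: eqP => //= <-; rewrite eq_sym (negPf kl).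
rewrite mulr1n andbb; have [->|ki] := eqVneq k i.
  by rewrite big1 // => j _; have [] := gP j.
by rewrite (bigD1 k) //=; have [_ _ ->] := gP k; rewrite ?mul0r.
Qed.

Section Minuscule.
Variables (C : numClosedFieldType) (G : affineGroup C) (S : finType).
Variable D : chevalley_data G S.
Hypothesis scG : simply_connected G.
Variables (n : nat) (wt : 'I_n -> S -> int).
Hypothesis n0 : (0 < n)%N.
Hypothesis wt1 : forall i s, -1 <= wt i s <= 1.
Hypothesis wt_refl : forall i s, exists j, wt j = irefl D s (wt i).
Hypothesis wt_inj : injective wt.
Hypothesis wt_tr : forall i j, exists w, iact D w (wt i) = wt j.
Local Notation a := (cartan D).

(** All pairings with coroots lie in {-1, 0, 1}, so every sl_2 string has at most two members. Hence
    [E s] and [F s] can simply exchange a vector with its reflection, with coefficient 1. *)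
Theorem minuscule_rep : exists rho : G -> 'M[C]_n, [/\ rational_rep rho, weight_rep D rho wt &
  forall i j, algebra_generated (generalized_minors D) (fun x => rho x i j)].
Proof.
have [a_diag a_neg a_sym] := cartanP D.
have [r0 r0P] := choice (fun p : S * 'I_n => wt_refl p.2 p.1).
pose r s i := r0 (s, i); have rP s i : wt (r s i) = irefl D s (wt i) by exact: (r0P (s, i)).
have rK s i : r s (r s i) = i by apply: wt_inj; rewrite !rP irefl2.
have rs s i : wt (r s i) s = - wt i s by rewrite rP /irefl a_diag; ring.
have rt s i t : wt (r s i) t = wt i t - wt i s * a t s by rewrite rP.
pose E s : 'M[C]_n := \matrix_(j, i) ((wt j s == 1) && (i == r s j))%:R.
pose F s : 'M[C]_n := \matrix_(j, i) ((wt j s == -1) && (i == r s j))%:R.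
pose H s : 'M[C]_n := diag_mx (\row_i (wt i s)%:~R).
have mulP (b : int) s (M : 'M[C]_n) j i :
    ((\matrix_(j, i) ((wt j s == b) && (i == r s j))%:R) *m M) j i = (wt j s == b)%:R * M (r s j) i.
  rewrite mxE (bigD1 (r s j)) //= mxE eqxx andbT big1 ?addr0 // => k /negPf kr.
  by rewrite mxE kr andbF mul0r.
have mulE := mulP 1; have mulF := mulP (-1).
have boolM (b1 b2 : bool) : b1%:R * b2%:R = (b1 && b2)%:R :> C by case: b1; rewrite ?mul1r ?mul0r.
have cm : chevalley_mx a E F H.
  split=> [s t|s t|s t|s t|s|s].
  - by rewrite /mxad /H !mulmx_diag; apply/matrixP => i j; rewrite !mxE [_ * (wt _ s)%:~R]mulrC subrr.
  - apply/matrixP => j i; rewrite /mxad mxE [X in _ + X]mxE mulE mulF [F t _ _]mxE [E s _ _]mxE !boolM.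
    case: (s =P t) => [<-|/eqP st].
      rewrite !rs !rK !mxE [i == j]eq_sym.
      have := wt1 j s; case: (j == i); rewrite ?andbF ?subrr ?mulr0n // !andbT mulr1n.
      by case: (wt j s) => [[|[|k]]|[|k]] //= _; rewrite ?subr0 ?sub0r ?subrr.
    rewrite mxE !rt.
    (* For s and t distinct, a product of [E s] and [F t] in either order is non-zero only if a s t
       = 0: otherwise some pairing would leave [-1, 1]. In that case the two reflections commute,
       and so do the operators. *)
    have Hc : (wt j s == 1) && (wt j t - wt j s * a t s == -1) = (a s t == 0) && (wt j s == 1) && (wt j t == -1).
      have := wt1 j t; have := a_neg t s; rewrite eq_sym st => /(_ isT) ats.
      have E0 : (a s t == 0) = (a t s == 0) by apply/eqP/eqP => /a_sym.
      rewrite E0 => wjt; case: (wt j s =P 1) => [->|_]; last by rewrite andbF.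
      rewrite mul1r andbT /=; apply/idP/idP; lia.
    have Hc' : (wt j t == -1) && (wt j s - wt j t * a s t == 1) = (a s t == 0) && (wt j s == 1) && (wt j t == -1).
      have := wt1 j s; have := a_neg s t; rewrite st => /(_ isT) ast wjs.
      case: (wt j t =P -1) => [->|_]; last by rewrite andbF.
      rewrite mulN1r andbT /=; apply/idP/idP; lia.
    rewrite !andbA Hc Hc'; case: eqP => //= [ast|_]; last by rewrite subrr.
    have ats := a_sym _ _ ast.
    suff -> : r t (r s j) = r s (r t j) by rewrite subrr.
    by apply: wt_inj; apply: funext => u; rewrite !rt ast ats; ring.
  - apply/matrixP => j i; rewrite /mxad mul_diag_mx mul_mx_diag !mxE.
    case: andP => [[/eqP j1 /eqP ->]|_]; last by rewrite !mulr0 mul0r subr0.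
    by rewrite mulr1n !mulr1 mul1r rt j1 mul1r rmorphB /= subKr.
  - apply/matrixP => j i; rewrite /mxad mul_diag_mx mul_mx_diag !mxE.
    case: andP => [[/eqP j1 /eqP ->]|_]; last by rewrite !mulr0 mul0r subr0.
    by rewrite mulr1n !mulr1 mul1r rt j1 mulN1r opprK rmorphD /= opprD addrA subrr sub0r.
  - exists 2; rewrite expr2; apply/matrixP => j i; rewrite mulE [E s _ _]mxE boolM rs mxE.
    by case: eqP => //= ->.
  - exists 2; rewrite expr2; apply/matrixP => j i; rewrite mulF [F s _ _]mxE boolM rs mxE.
    by case: eqP => //= ->.
have gen : mx_generated E F.
  move=> Q linQ Q1 QM QEF X.
  have QH s : Q (H s).
    have := cm_ef cm s s; rewrite eqxx => <-; have [QE QF] := QEF s.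
    by apply: (linear_setB linQ); exact: QM.
  have Qii := weight_units linQ Q1 QM wt_inj QH.
  have Qr s i : Q (delta_mx (r s i) i).
    have := wt1 i s; case wis: (wt i s) => [[|[|k]]|[|k]] // _.
    + suff -> : r s i = i by exact: Qii.
      by apply: wt_inj; apply: funext => t; rewrite rt wis mul0r subr0.
    + have := QM _ _ (proj2 (QEF s)) (Qii i); congr Q; apply/matrixP => k l.
      rewrite mulF !mxE; have [->|kr] := eqVneq k (r s i); first by rewrite rs wis rK eqxx mul1r.
      by rewrite (_ : r s k == i = false) ?mulr0 //; apply/negP => /eqP E0; move/eqP: kr; rewrite -E0 rK.
    + have := QM _ _ (proj1 (QEF s)) (Qii i); congr Q; apply/matrixP => k l.
      rewrite mulE !mxE; have [->|kr] := eqVneq k (r s i); first by rewrite rs wis rK eqxx mul1r.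
      by rewrite (_ : r s k == i = false) ?mulr0 //; apply/negP => /eqP E0; move/eqP: kr; rewrite -E0 rK.
  have Qw w i j : iact D w (wt i) = wt j -> Q (delta_mx j i).
    elim: w j => [|s w IH] j /=; first by move/wt_inj ->; exact: Qii.
    have [k kE] : exists k, wt k = iact D w (wt i).
      elim: w {IH} => [|t w [k kE]]; first by exists i.
      by exists (r t k); rewrite rP kE.
    rewrite -kE -rP => /wt_inj <-; have := QM _ _ (Qr s k) (IH k (esym kE)).
    by rewrite mul_delta_mx.
  rewrite (matrix_sum_delta X); apply: (linear_set_sum linQ) => j _; apply: (linear_set_sum linQ) => i _.
  by apply: (linear_setZ linQ); have [w wE] := wt_tr i j; exact: Qw wE.
have [rho [rat wr irr dE dF]] := cover_weight_rep scG n0 cm gen (fun=> erefl).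
exists rho; split=> // i j.
have [c cP] := cartan_solveT (cartan_posdef D) (fun=> 1).
have [i0 mx] := max_rat (height c wt true) n0.
by apply: (extremal_coef rat wr cP (N := predT) irr isT mx) => // k l _; exact: wt_inj.
Qed.

End Minuscule.

(** * Shortest weights in a coset of the root lattice *)

Section MinimalCoset.
Variables (C : numClosedFieldType) (G : affineGroup C) (S : finType).
Variable D : chevalley_data G S.
Local Notation a := (cartan D).
Variable lam : S -> int.

Let mu (x : S -> int) (t : S) : int := lam t + \sum_s a t s * x s.

(** Minimise an invariant norm on the coset of [lam]. Adding or subtracting a simple root cannot
    shorten a minimal weight, which bounds its pairings by 1. Reflections preserve the norm, so the
    bound holds on the whole orbit. *)
Lemma minimal_coset : exists n (wt : 'I_n -> S -> int),
  [/\ (0 < n)%N, forall i s, -1 <= wt i s <= 1,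
      forall i s, exists j, wt j = irefl D s (wt i), injective wt &
      (forall i j, exists w, iact D w (wt i) = wt j) /\
      forall i, exists x : S -> int, forall t, wt i t = lam t + \sum_s a t s * x s].
Proof.
have [a_diag a_neg a_sym] := cartanP D.
have pd := cartan_posdef D; have [d [d0 dsym dpos]] := posdef_int pd.
(* Up to a constant, the norm of the weight lam + a x, arranged so as to be an integer. By [gE] the
   constant is the norm of [lam] itself, reached at the rational solution [x0] of a x0 = - lam. *)
pose g (x : S -> int) : int := \sum_s d s * x s * (2 * lam s + \sum_t a s t * x t).
have step x s k : let x' := fun t => x t + (t == s)%:R * k in
    g x' = g x + 2 * d s * k * (mu x s + k).
  move=> x'; have A' u : \sum_t a u t * x' t = \sum_t a u t * x t + a u s * k.
    rewrite /x'; under eq_bigr do rewrite mulrDr.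
    rewrite big_split /=; congr (_ + _); rewrite (bigD1 s) //= eqxx mul1r big1 ?addr0 // => t /negPf ->.
    by rewrite mul0r mulr0.
  rewrite /g; under eq_bigr do rewrite A' /x'.
  rewrite (eq_bigr (fun u => d u * x u * (2 * lam u + \sum_t a u t * x t) + (k * (d u * a u s * x u) +
     (u == s)%:R * (d u * k * (2 * lam u + \sum_t a u t * x t + a u s * k))))) => [|u _]; last by ring.
  rewrite big_split /= -addrA; congr (_ + _); rewrite big_split /= -mulr_sumr.
  rewrite [X in _ + X](bigD1 s) //= eqxx mul1r [X in _ + (_ + X)]big1 ?addr0 => [|u /negPf ->]; last by rewrite mul0r.
  rewrite (eq_bigr (fun u => d s * (a s u * x u))) => [|u _]; last by rewrite dsym mulrA.
  by rewrite -mulr_sumr a_diag /mu; ring.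
have [x0 x0P] := cartan_solve pd (fun s => - (lam s)%:~R).
pose q (z : S -> rat) := \sum_s (d s)%:~R * z s * (\sum_t (a s t)%:~R * z t).
have q_ge0 z : 0 <= q z.
  have [H|H] := pselect (exists s, z s != 0); first exact: ltW (dpos z H).
  rewrite /q big1 // => s _; suff -> : z s = 0 by rewrite mulr0 mul0r.
  by apply/eqP/negPn/negP => nz; apply: H; exists s.
have gE x : (g x)%:~R = q (fun s => (x s)%:~R - x0 s) - q x0.
  rewrite /q; have -> : \sum_s (d s)%:~R * ((x s)%:~R - x0 s) * (\sum_t (a s t)%:~R * ((x t)%:~R - x0 t)) =
     \sum_s ((d s)%:~R * (x s)%:~R * ((lam s)%:~R + \sum_t (a s t)%:~R * (x t)%:~R)
       - (d s)%:~R * x0 s * (\sum_t (a s t)%:~R * (x t)%:~R) - (d s)%:~R * x0 s * (lam s)%:~R).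
    apply: eq_bigr => s _; have -> : \sum_t (a s t)%:~R * ((x t)%:~R - x0 t) =
      \sum_t (a s t)%:~R * (x t)%:~R + (lam s)%:~R.
      under eq_bigr do rewrite mulrBr; by rewrite sumrB x0P opprK.
    by ring.
  rewrite sumrB sumrB.
  have -> : \sum_s (d s)%:~R * x0 s * (\sum_t (a s t)%:~R * (x t)%:~R) = - \sum_s (d s)%:~R * (x s)%:~R * (lam s)%:~R.
    under eq_bigr do rewrite mulr_sumr.
    rewrite exchange_big /= -sumrN; apply: eq_bigr => t _.
    rewrite (eq_bigr (fun s => (d t)%:~R * (x t)%:~R * ((a t s)%:~R * x0 s))) => [|s _].
      by rewrite -mulr_sumr x0P mulrN.
    have := congr1 (fun k : int => k%:~R : rat) (dsym s t); rewrite /= !rmorphM /= => E.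
    by rewrite mulrACA E; ring.
  have -> : \sum_s (d s)%:~R * x0 s * (\sum_t (a s t)%:~R * x0 t) = - \sum_s (d s)%:~R * x0 s * (lam s)%:~R.
    by rewrite -sumrN; apply: eq_bigr => s _; rewrite x0P mulrN.
  rewrite !opprK subrK -big_split /g rmorph_sum /=; apply: eq_bigr => s _.
  rewrite !rmorphM rmorphD rmorphM rmorph_sum /= (eq_bigr (fun t => (a s t)%:~R * (x t)%:~R)).
    by ring.
  by move=> t _; rewrite rmorphM.
(* [g] is bounded below because the form is positive; a shift by [b] reduces the search for a
   minimum to natural numbers. *)
have [b bP] : exists b : nat, forall x, 0 <= g x + b%:Z.
  exists (Num.Def.archi_bound (q x0)) => x; rewrite -(ler0z rat) rmorphD /= gE.
  have := archi_boundP (q_ge0 x0); have := q_ge0 (fun s => (x s)%:~R - x0 s).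
  move: (q _) (q x0) (Num.Def.archi_bound _) => u v k u0 vk.
  by rewrite -addrA addr_ge0 // addrC subr_ge0 ltW.
pose P k := `[< exists x, g x + b%:Z = k%:Z >].
have exP : exists k, P k.
  by exists (absz (g (fun=> 0) + b%:Z)%R); apply/asboolP; exists (fun=> 0); rewrite gez0_abs.
case: (ex_minnP exP) => k /asboolP[xm gm] kmin.
have mn x : g xm <= g x.
  have Px : P (absz (g x + b%:Z)%R) by apply/asboolP; exists x; rewrite gez0_abs.
  have := kmin _ Px; rewrite -lez_nat gez0_abs // -gm; lia.
have bound x : g x = g xm -> forall s, -1 <= mu x s <= 1.
  move=> gx s; have := mn (fun t => x t + (t == s)%:R * 1); have := mn (fun t => x t + (t == s)%:R * -1).
  rewrite !step gx; have := d0 s; move: (mu x s) (d s) (g xm) => m' ds gg ds0.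
  rewrite lerDl lerDl => h1 h2.
  have {}h1 : 0 <= - (m' + -1) by rewrite -(pmulr_rge0 _ ds0); move: h1; lia.
  have {}h2 : 0 <= m' + 1 by rewrite -(pmulr_rge0 _ ds0); move: h2; lia.
  by lia.
have orb w : exists2 x, g x = g xm & mu x = iact D w (mu xm).
  elim: w => [|s w [x gx xE]]; first by exists xm.
  exists (fun t => x t + (t == s)%:R * - mu x s); first by rewrite step gx addrN mulr0 addr0.
  rewrite /= -xE; apply: funext => t; rewrite /irefl /mu; under eq_bigr do rewrite mulrDr.
  rewrite big_split /= addrA; congr (_ + _); rewrite (bigD1 s) //= eqxx mul1r [X in _ + X]big1 ?addr0 => [|u /negPf ->].
    by rewrite mulrN mulrC.
  by rewrite mul0r mulr0.
(* Weights of the orbit take the values -1, 0, 1, coded as 0, 1, 2. This makes the orbit a finite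
   type. *)
pose dec (f : {ffun S -> 'I_3}) (s : S) : int := (f s : nat)%:Z - 1.
pose O := [pred f : {ffun S -> 'I_3} | `[< exists w, dec f = iact D w (mu xm) >]].
have decP w : exists f, O f /\ dec f = iact D w (mu xm).
  have [x gx xE] := orb w.
  exists [ffun s => inord (absz (mu x s + 1)%R)]; suff E : dec [ffun s => inord (absz (mu x s + 1)%R)] = iact D w (mu xm).
    by split=> //; apply/asboolP; exists w.
  rewrite -xE; apply: funext => s; rewrite /dec ffunE inordK; have := bound x gx s; move: (mu x s); lia.
have Oval (i : 'I_#|O|) : exists w, dec (enum_val i) = iact D w (mu xm).
  by have := enum_valP i => /asboolP.
have Oex w : exists i : 'I_#|O|, dec (enum_val i) = iact D w (mu xm).
  have [f [Of fE]] := decP w; exists (enum_rank_in Of f); by rewrite enum_rankK_in.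
exists #|O|, (fun i => dec (enum_val i)); split.
- by have [i _] := Oex [::]; apply: leq_ltn_trans (ltn_ord i).
- move=> i s; have [w ->] := Oval i; have [x gx <-] := orb w; exact: bound.
- by move=> i s; have [w wE] := Oval i; have [j jE] := Oex (s :: w); exists j; rewrite jE wE.
- move=> i j E; apply: enum_val_inj; apply/ffunP => s; apply: val_inj.
  by have := congr1 (fun h => h s) E; rewrite /dec => /addIr[].
split=> [i j|i].
  have [w wE] := Oval i; have [w' wE'] := Oval j; exists (w' ++ rev w).
  by rewrite iact_cat wE wE' iact_rev.
have [w wE] := Oval i; have [x gx xE] := orb w; exists x => t.
by rewrite wE -xE.
Qed.

End MinimalCoset.

(** * Quasi-minuscule representations *)

Section QuasiMinuscule.
Variables (C : numClosedFieldType) (G : affineGroup C) (n : nat) (rho : G -> 'M[C]_n).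
Variables (B : set (G -> C)) (N : pred 'I_n).
Variables (mu : 'I_n -> 'M[C]_n) (Phi Phi' : 'M[C]_n).
Hypothesis subB : is_subalgebra B.
Hypothesis muE : forall x a b i, \sum_k \sum_l rho x k a * rho x l b * mu k i l = \sum_j rho x i j * mu a j b.
Hypothesis muZ : forall i k l, ~~ N i -> mu k i l != 0 -> N k && N l.
Hypothesis mu_span : forall j, exists t : 'I_n -> 'I_n -> C,
  (forall a b, t a b != 0 -> N a && N b) /\
  forall i, \sum_a \sum_b t a b * mu a i b = (i == j)%:R.
Hypothesis PhiE : forall x, rho (x^-1)%g = Phi' *m (rho x)^T *m Phi.
Hypothesis PhiN : forall i j, Phi i j != 0 -> N i = N j.
Hypothesis Phi'N : forall i j, Phi' i j != 0 -> N i = N j.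
Hypothesis coefN : forall i j, N i -> N j -> B (fun x => rho x i j).

Lemma scaled_coef (c : C) f : (c != 0 -> B f) -> B (fun x => c * f x).
Proof.
move=> Bf; have [->|c0] := eqVneq c 0; last by apply: (subalgZ subB); exact: Bf.
by under eq_fun do rewrite mul0r; exact: (subalg_cst subB).
Qed.

Lemma inv_coef i j : (forall k l, N k = N i -> N l = N j -> B (fun x => rho x l k)) ->
  B (fun x => rho (x^-1)%g i j).
Proof.
move=> Bc; rewrite (_ : (fun x => _) = fun x => \sum_l \sum_k (Phi' i k * Phi l j) * rho x l k).
  apply: (subalg_sum subB) => l _; apply: (subalg_sum subB) => k _; apply: scaled_coef.
  by rewrite mulf_eq0 negb_or => /andP[/Phi'N ik /PhiN lj]; apply: Bc.
apply: funext => x; rewrite PhiE mxE; apply: eq_bigr => l _; rewrite mxE mulr_suml.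
by apply: eq_bigr => k _; rewrite mxE; ring.
Qed.

(** Write the j-th vector as a combination of products of vectors of non-zero weight, apply the
    group element to the factors and read off component i. Being of weight zero, it only involves
    non-zero weights, so all coefficients that occur are known. The map [y] will be the identity or
    inversion. *)
Lemma zero_coef (y : G -> G) : (forall i j, N i -> N j -> B (fun x => rho (y x) i j)) ->
  forall i j, ~~ N i -> B (fun x => rho (y x) i j).
Proof.
move=> By i j Ni; have [t [tN tE]] := mu_span j.
rewrite (_ : (fun x => _) = fun x => \sum_a \sum_b \sum_k \sum_l
    (t a b * mu k i l) * (rho (y x) k a * rho (y x) l b)).
  do 4! (apply: (subalg_sum subB) => ? _); apply: scaled_coef.
  rewrite mulf_eq0 negb_or => /andP[/tN/andP[? ?] /(muZ Ni)/andP[? ?]].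
  by apply: (subalgM subB); exact: By.
apply: funext => x.
transitivity (\sum_a \sum_b t a b * \sum_j' rho (y x) i j' * mu a j' b).
  transitivity (\sum_j' rho (y x) i j' * (j' == j)%:R).
    by rewrite (bigD1 j) //= eqxx mulr1 big1 ?addr0 // => k /negPf ->; rewrite mulr0.
  under eq_bigr do rewrite -tE mulr_sumr.
  rewrite exchange_big; apply: eq_bigr => a _ /=; under eq_bigr do rewrite mulr_sumr.
  rewrite exchange_big; apply: eq_bigr => b _ /=; rewrite mulr_sumr; apply: eq_bigr => k _; ring.
apply: eq_bigr => a _; apply: eq_bigr => b _; rewrite -muE mulr_sumr; apply: eq_bigr => k _.
by rewrite mulr_sumr; apply: eq_bigr => l _; ring.
Qed.

(** Rows of weight zero are covered by [zero_coef]. A column of weight zero becomes, through the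
    invariant form, a row of weight zero for the inverse, to which [zero_coef] applies again. *)
Lemma quasi_minuscule_coef i j : B (fun x => rho x i j).
Proof.
have Z := @zero_coef id coefN.
have ZV : forall i j, ~~ N i -> B (fun x => rho (x^-1)%g i j).
  apply: (@zero_coef (fun x => x^-1)%g) => k l Nk Nl; apply: inv_coef => k' l' E E'.
  by apply: coefN; rewrite ?E ?E'.
have [Ni|Ni] := boolP (N i); last exact: Z.
have [Nj|Nj] := boolP (N j); first exact: coefN.
rewrite (_ : (fun x => _) = fun x => \sum_l \sum_k (Phi' i k * Phi l j) * rho (x^-1)%g l k).
  apply: (subalg_sum subB) => l _; apply: (subalg_sum subB) => k _; apply: scaled_coef.
  by rewrite mulf_eq0 negb_or => /andP[_ /PhiN lj]; apply: ZV; rewrite lj.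
apply: funext => x; have -> : rho x i j = (Phi' *m (rho (x^-1)%g)^T *m Phi) i j by rewrite -PhiE invgK.
rewrite mxE; apply: eq_bigr => l _; rewrite mxE mulr_suml.
by apply: eq_bigr => k _; rewrite mxE; ring.
Qed.

End QuasiMinuscule.

(** * Cartan matrices of determinant one *)

Definition indecomposable (S : finType) (a : S -> S -> int) :=
  forall P : pred S, (exists s, P s) -> (forall s t, P s -> ~~ P t -> a s t = 0) -> forall t, P t.

Section NonSimplyLaced.
Variables (S : finType) (a : S -> S -> int).
Hypothesis aP : is_cartan_matrix a.
Hypothesis pd : posdef_cartan a.
Hypothesis indec : indecomposable a.
Hypothesis unimodular : forall lam : S -> int, exists x : S -> int, forall t, lam t = \sum_s a t s * x s.

Section Form.
Variable d : S -> int.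
Hypothesis d0 : forall s, 0 < d s.
Hypothesis dsym : forall s t, d s * a s t = d t * a t s.
Hypothesis dpos : forall z : S -> int, (exists s, z s != 0) -> 0 < \sum_s d s * z s * (\sum_t a s t * z t).

(** The symmetrised form on a list of vertices with coefficients, so that small diagrams can be
    evaluated without ranging over [S]. *)
Definition quad (l : seq (S * int)) : int :=
  \sum_(p <- l) \sum_(q <- l) p.2 * q.2 * (d p.1 * a p.1 q.1).

Lemma quad_gt0 p l : 0 < p.2 -> all (fun q : S * int => 0 <= q.2) l -> 0 < quad (p :: l).
Proof.
move=> p0 l0; pose y s := \sum_(q <- p :: l) (q.1 == s)%:R * q.2.
have pick (F : S -> int) : \sum_s F s * y s = \sum_(q <- p :: l) F q.1 * q.2.
  rewrite /y; under eq_bigr do rewrite mulr_sumr.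
  rewrite exchange_big; apply: eq_bigr => q _ /=.
  rewrite (bigD1 q.1) //= eqxx mul1r big1 ?addr0 // => s /negPf sq.
  by rewrite eq_sym sq mul0r mulr0.
have -> : quad (p :: l) = \sum_s d s * y s * (\sum_t a s t * y t).
  rewrite (eq_bigr (fun s => (d s * \sum_t a s t * y t) * y s)) => [|s _]; last by ring.
  rewrite (pick (fun s => d s * _)); apply: eq_bigr => q _; rewrite pick mulr_sumr mulr_suml.
  by apply: eq_bigr => q' _; ring.
apply: dpos; exists p.1; rewrite gt_eqF // /y big_cons eqxx mul1r ltr_wpDr //.
elim: l l0 {y pick} => [|q l IH] /=; first by rewrite big_nil.
by case/andP=> q0 l0; rewrite big_cons addr_ge0 ?IH // mulr_ge0 // ler0n.
Qed.

(** Extend the configuration by a new vertex [u] and use positivity. Other edges from [u] only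
    decrease the form, as their entries are non-positive, so the bound on the edge from [u] to [x]
    is unaffected by them. *)
Lemma quad_attach u x c l : 0 < c -> all (fun q : S * int => 0 <= q.2) l -> (x, 2 * c) \in l ->
  all (fun q => q.1 != u) l -> a u x != 0 -> 2 * c ^+ 2 * d x * (a u x * a x u) < quad l.
Proof.
move=> c0 l0 xl ul aux; have [_ a_neg _] := aP.
have xu : u != x by have /allP/(_ _ xl) := ul; rewrite eq_sym.
have aux0 : a u x < 0 by rewrite lt_neqAle aux a_neg.
(* The coefficient that minimises the enlarged form when [x] carries 2 c; the factor 2 keeps it
   integral. *)
pose y := - a u x * c; have y0 : 0 < y by rewrite /y mulNr oppr_gt0 nmulr_rlt0.
have := @quad_gt0 (u, y) l y0 l0; rewrite /quad big_cons big_cons /=.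
under [X in _ + X]eq_bigr do rewrite big_cons /=.
rewrite big_split /= -/(quad l) => Q0.
have sumle : \sum_(q <- l) q.2 * (d u * a u q.1) <= 2 * c * (d u * a u x).
  elim: l l0 xl ul {Q0} => // q l IH /= /andP[q0 l0] + /andP[qu ul].
  have neg r : r != u -> d u * a u r <= 0.
    by move=> ru; rewrite pmulr_rle0 // a_neg // eq_sym.
  have suml : \sum_(j <- l) j.2 * (d u * a u j.1) <= 0.
    elim: l l0 ul {IH} => [|r l IH] /=; first by rewrite big_nil.
    case/andP=> r0 l0 /andP[ru ul]; rewrite big_cons -[X in _ <= X](addr0 0) lerD ?IH //.
    by rewrite mulr_ge0_le0 // neg.
  rewrite inE big_cons => /orP[/eqP <- /=|xl]; first by rewrite gerDl.
  rewrite -[X in _ <= X]add0r lerD ?IH //; by rewrite mulr_ge0_le0 // neg.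
have E1 : \sum_(q <- l) y * q.2 * (d u * a u q.1) = y * \sum_(q <- l) q.2 * (d u * a u q.1).
  by rewrite mulr_sumr; apply: eq_bigr => q _; ring.
have E2 : \sum_(q <- l) q.2 * y * (d q.1 * a q.1 u) = y * \sum_(q <- l) q.2 * (d u * a u q.1).
  by rewrite mulr_sumr; apply: eq_bigr => q _; rewrite dsym; ring.
rewrite E1 E2 in Q0; have [a_diag _ _] := aP; rewrite a_diag in Q0.
have := ler_wpM2l (ltW y0) sumle.
have K : y * (2 * c * (d u * a u x)) = - (2 * c ^+ 2 * d x * (a u x * a x u)).
  transitivity (- (2 * c ^+ 2 * (d u * a u x) * a u x)); first by rewrite /y; ring.
  by rewrite dsym; ring.
have K' : y * y * (d u * 2) = 2 * c ^+ 2 * d x * (a u x * a x u).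
  transitivity (2 * c ^+ 2 * (d u * a u x) * a u x); first by rewrite /y; ring.
  by rewrite dsym; ring.
rewrite K => h; rewrite K' in Q0.
move: Q0 h; move: (y * _) (2 * _ * _ * _) (quad l) => P1 P2 P3; lia.
Qed.

Lemma edge_product s t : s != t -> a s t * a t s < 4.
Proof.
move=> st; have [a0|a0] := eqVneq (a t s) 0; first by rewrite a0 mulr0.
have := @quad_attach t s 1 [:: (s, 2)] isT isT; rewrite inE eqxx /= st => /(_ isT isT a0).
have [a_diag _ _] := aP.
rewrite /quad !big_cons !big_nil /= a_diag; have := d0 s.
move: (a s t) (a t s) (d s) => x y z z0; rewrite expr1n !addr0 => h.
have : z * (y * x) < z * 4 by lia.
by rewrite ltr_pM2l // mulrC.
Qed.

Lemma edge_unit s t : s != t -> a s t != 0 -> a s t * a t s < 2 -> a s t = -1 /\ a t s = -1.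
Proof.
move=> st a0 p2; have [_ a_neg a_sym] := aP.
have a0' : a t s != 0 by apply: contraNneq a0 => /a_sym ->.
have := a_neg s t st; have := a_neg t s; rewrite eq_sym st => /(_ isT).
move: (a s t) (a t s) a0 a0' p2 => x y; nia.
Qed.

End Form.

Lemma outer_edge (P : pred S) : (exists s, P s) -> ~ (forall t, P t) ->
  exists x u, [/\ P x, ~~ P u & a x u != 0].
Proof.
move=> exP nall; apply: contrapT => H; apply: nall; apply: indec => // s t Ps Pt.
by apply/eqP/negPn/negP => st; apply: H; exists s, t.
Qed.

(** Vertices are attached to the multiple bond until positivity forbids it. A triple bond admits
    none. A double bond alone is not unimodular: parity forces a neighbour on either side, and the
    resulting four vertices admit no further one. *)
Theorem non_simply_laced s t : s != t -> a t s < -1 ->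
  type_F4 a \/ [/\ a s t = -1, a t s = -3 & forall u, u = s \/ u = t].
Proof.
have [a_diag a_neg a_sym] := aP.
have [d [d0 dsym dposQ]] := posdef_int pd; have dpos := posdef_intZ dposQ.
have att := quad_attach d0 dsym dpos.
move=> st ats; have ts : t != s by rewrite eq_sym.
have nz x y : a x y != 0 -> a y x != 0 by apply: contraNneq => /a_sym ->.
have pe x y : x != y -> a x y != 0 -> 1 <= a x y * a y x.
  move=> xy axy; have := nz _ _ axy; have := a_neg x y xy; have := a_neg y x.
  by rewrite eq_sym xy => /(_ isT); move: (a x y) (a y x) axy => k l; nia.
have ast0 : a s t != 0 by apply: nz; move: ats; case: (a t s) => //; lia.
have pst := edge_product d0 dsym dpos st.
have [ast atsE] : a s t = -1 /\ (a t s = -2 \/ a t s = -3).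
  have := a_neg s t st; move: (a s t) (a t s) ast0 pst ats => x y x0 p4 y1 x1.
  have xE : x = -1 by nia.
  by subst x; split=> //; lia.
have ds := dsym s t; rewrite ast in ds.
case: atsE => atsE; last first.
  right; split=> // u; apply: contrapT => /not_orP[/eqP us /eqP ut].
  rewrite atsE in ds; have {}ds : d s = 3 * d t by lia.
  have [|//|x [v [Px Pv xv]]] := @outer_edge [pred x | (x == s) || (x == t)].
  - by exists s; rewrite /= eqxx.
  - by move/(_ u); rewrite /= (negPf us) (negPf ut).
  move: Pv; rewrite /= negb_or => /andP[vs vt].
  case/orP: Px => /eqP ?; subst x.
    (* The coefficients (2, 3), and (1, 2) below, are the fundamental weights of G2 in terms of
       simple roots; such vectors give the sharpest test for attaching a vertex. *)
    have := att v s 1 [:: (s, 2); (t, 3)] isT isT; rewrite !inE eqxx /= [s == v]eq_sym vs [t == v]eq_sym vt.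
    move=> /(_ isT isT (nz _ _ xv)); rewrite /quad !big_cons !big_nil /= !a_diag ast atsE ds expr1n.
    have := pe _ _ vs (nz _ _ xv); have := d0 t; move: (a v s * a s v) (d t) => p dt; nia.
  have := att v t 1 [:: (s, 1); (t, 2)] isT isT; rewrite !inE eqxx orbT /= [s == v]eq_sym vs [t == v]eq_sym vt.
  move=> /(_ isT isT (nz _ _ xv)); rewrite /quad !big_cons !big_nil /= !a_diag ast atsE ds expr1n.
  have := pe _ _ vt (nz _ _ xv); have := d0 t; move: (a v t * a t v) (d t) => p dt; nia.
left; rewrite atsE in ds; have {}ds : d s = 2 * d t by lia.
(* Without another neighbour, the row of t has only the entries 2 and -2 besides zeros, so it cannot
   produce the value 1. *)
have [t2 [t2s t2t at2]] : exists t2, [/\ t2 != s, t2 != t & a t2 t != 0].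
  apply: contrapT => H; have [x /(_ t)] := unimodular (fun u => (u == t)%:R).
  rewrite eqxx (bigD1 t) //= (bigD1 s) //= a_diag atsE big1 => [|u /andP[ut us]]; first by lia.
  suff -> : a t u = 0 by rewrite mul0r.
  by apply/eqP/negPn/negP => /nz tu; apply: H; exists u.
(* Without another neighbour, the column of s is twice e_s - e_t. An integral x with a x = e_s - e_t
   would give a (2 x - e_s) = 0, hence 2 x_s = 1. *)
have [s2 [s2s s2t as2]] : exists s2, [/\ s2 != s, s2 != t & a s2 s != 0].
  apply: contrapT => H; have [x xP] := unimodular (fun u => (u == s)%:R - (u == t)%:R).
  have := @cartan_inj _ _ pd (fun v => (2 * x v - (v == s)%:R)%:~R) _ s.
  rewrite eqxx => H0; have /eqP : (2 * x s - 1)%:~R = 0 :> rat.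
    apply: H0 => u; transitivity ((2 * (\sum_v a u v * x v) - a u s)%:~R : rat).
      rewrite rmorphB rmorphM rmorph_sum /= mulr_sumr.
      rewrite (eq_bigr (fun v => 2 * (a u v * x v)%:~R - (a u v)%:~R * ((v == s)%:R : int)%:~R)) => [|v _].
        rewrite sumrB; congr (_ - _).
        rewrite (bigD1 s) //= eqxx mulr1 big1 ?addr0 // => v /negPf ->; by rewrite mulr0.
      by rewrite rmorphB !rmorphM /=; ring.
    rewrite -xP; have [->|us] := eqVneq u s; first by rewrite a_diag (negPf st).
    have [->|ut] := eqVneq u t; first by rewrite atsE.
    suff -> : a u s = 0 by [].
    by apply/eqP/negPn/negP => us0; apply: H; exists u.
  rewrite intr_eq0; lia.
have [as2E ass2] : a s2 s = -1 /\ a s s2 = -1.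
  apply: edge_unit => //.
  have := att s2 s 1 [:: (s, 2); (t, 2)] isT isT; rewrite !inE eqxx /= [s == s2]eq_sym s2s [t == s2]eq_sym s2t.
  move=> /(_ isT isT as2); rewrite /quad !big_cons !big_nil /= !a_diag ast atsE ds expr1n.
  have := d0 t; move: (a s2 s * a s s2) (d t) => p dt; nia.
have [at2E att2] : a t2 t = -1 /\ a t t2 = -1.
  apply: edge_unit => //.
  have := att t2 t 1 [:: (s, 1); (t, 2)] isT isT; rewrite !inE eqxx orbT /= [s == t2]eq_sym t2s [t == t2]eq_sym t2t.
  move=> /(_ isT isT at2); rewrite /quad !big_cons !big_nil /= !a_diag ast atsE ds expr1n.
  have := d0 t; move: (a t2 t * a t t2) (d t) => p dt; nia.
have ds2 : d s2 = 2 * d t by have := dsym s s2; rewrite ass2 as2E ds; lia.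
have dt2 : d t2 = d t by have := dsym t t2; rewrite att2 at2E; lia.
have pos3 p l := @quad_gt0 d dpos p l.
(* The sum of the simple roots around a cycle would not have positive norm, so no edge closes a
   cycle; likewise for the next two pairs. *)
have as2t : a s2 t = 0.
  apply/eqP/negPn/negP => H; have lt0 : a s2 t < 0 by rewrite lt_neqAle H a_neg.
  have := pos3 (s2, 1) [:: (s, 1); (t, 1)] isT isT; have := dsym t s2.
  rewrite /quad !big_cons !big_nil /= !a_diag ast atsE ass2 as2E ds2 ds.
  have := d0 t; move: (a s2 t) (a t s2) (d t) lt0 => p p' dt; nia.
have ats2 := a_sym _ _ as2t.
have ast2 : a s t2 = 0.
  apply/eqP/negPn/negP => H; have lt0 : a s t2 < 0 by rewrite lt_neqAle H a_neg // eq_sym.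
  have := pos3 (t2, 1) [:: (s, 1); (t, 1)] isT isT; have := dsym s t2.
  rewrite /quad !big_cons !big_nil /= !a_diag ast atsE att2 at2E dt2 ds.
  have := d0 t; move: (a s t2) (a t2 s) (d t) lt0 => p p' dt; nia.
have at2s := a_sym _ _ ast2.
have s2t2 : s2 != t2 by apply: contraNneq at2 => <-; rewrite as2t.
have as2t2 : a s2 t2 = 0.
  apply/eqP/negPn/negP => H; have lt0 : a s2 t2 < 0 by rewrite lt_neqAle H a_neg.
  have := pos3 (s2, 1) [:: (s, 1); (t, 1); (t2, 1)] isT isT; have := dsym s2 t2.
  rewrite /quad !big_cons !big_nil /= !a_diag ast atsE att2 at2E ass2 as2E ast2 at2s as2t ats2 dt2 ds ds2.
  have := d0 t; move: (a s2 t2) (a t2 s2) (d t) lt0 => p p' dt; nia.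
have at2s2 := a_sym _ _ as2t2.
have all4 u : [|| u == s2, u == s, u == t | u == t2].
  apply: contrapT => nu.
  have [|/(_ u) //|x [v [Px Pv xv]]] := @outer_edge [pred u | [|| u == s2, u == s, u == t | u == t2]].
    by exists s; rewrite /= eqxx orbT.
  move: Pv; rewrite /= !negb_or ![v == _]eq_sym => /and4P[vs2 vs vt vt2].
  (* The right-hand side is the form of the F4 diagram, divided by d t. The four vectors used below,
     (2, 3, 4, 2), (3, 6, 8, 4), (2, 4, 6, 3) and (1, 2, 3, 2), are its fundamental weights in
     simple roots, one for each vertex where something could be attached. *)
  have attx k1 k2 k3 k4 k w x' : 0 < k -> 0 <= k1 -> 0 <= k2 -> 0 <= k3 -> 0 <= k4 ->
      (x', 2 * k) \in [:: (s2, k1); (s, k2); (t, k3); (t2, k4)] -> a v x' != 0 -> d x' = w * d t ->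
      2 * k ^+ 2 * w * (a v x' * a x' v) < 4 * k1 * k1 + 4 * k2 * k2 + 2 * k3 * k3 + 2 * k4 * k4
        - 4 * k1 * k2 - 4 * k2 * k3 - 2 * k3 * k4.
    move=> k0 h1 h2 h3 h4 xin avx dx.
    have := att v x' k [:: (s2, k1); (s, k2); (t, k3); (t2, k4)] k0.
    rewrite /= h1 h2 h3 h4 vs2 vs vt vt2 => /(_ isT xin isT avx).
    rewrite /quad !big_cons !big_nil /= !a_diag ast atsE att2 at2E ass2 as2E ast2 at2s as2t ats2 as2t2 at2s2 dt2 ds ds2 dx.
    by move=> h; rewrite -(ltr_pM2r (d0 t)); move: h; congr (_ < _); ring.
  case/or4P: Px => /eqP ?; subst x.
  - have := attx 2 3 4 2 1 2 s2 isT isT isT isT isT; rewrite inE eqxx => /(_ isT (nz _ _ xv) ds2).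
    have : 1 <= a v s2 * a s2 v by apply: pe; [rewrite eq_sym | exact: nz].
    by move: (a v s2 * a s2 v) => p; clear; lia.
  - have := attx 3 6 8 4 3 2 s isT isT isT isT isT; rewrite !inE eqxx orbT => /(_ isT (nz _ _ xv) ds).
    have : 1 <= a v s * a s v by apply: pe; [rewrite eq_sym | exact: nz].
    by move: (a v s * a s v) => p; clear; lia.
  - have := attx 2 4 6 3 3 1 t isT isT isT isT isT; rewrite !inE eqxx !orbT mul1r => /(_ isT (nz _ _ xv) erefl).
    have : 1 <= a v t * a t v by apply: pe; [rewrite eq_sym | exact: nz].
    by move: (a v t * a t v) => p; clear; lia.
  - have := attx 1 2 3 2 1 1 t2 isT isT isT isT isT; rewrite !inE eqxx !orbT mul1r => /(_ isT (nz _ _ xv) dt2).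
    have : 1 <= a v t2 * a t2 v by apply: pe; [rewrite eq_sym | exact: nz].
    by move: (a v t2 * a t2 v) => p; clear; lia.
pose u (v : S) : 'I_4 := if v == t2 then inord 0 else if v == t then inord 1 else if v == s then inord 2 else inord 3.
pose u' (i : 'I_4) : S := nth s [:: t2; t; s; s2] i.
have neqs := (negPf st, negPf ts, negPf t2s, negPf t2t, negPf s2s, negPf s2t, negPf s2t2).
have neqs' : [/\ (s == t2) = false, (t == t2) = false, (s == s2) = false, (t == s2) = false & (t2 == s2) = false].
  by rewrite ![_ == t2]eq_sym ![_ == s2]eq_sym !neqs; split=> //; rewrite eq_sym neqs.
have [n1 n2 n3 n4 n5] := neqs'.
have ut2 : u t2 = inord 0 by rewrite /u eqxx.
have ut : u t = inord 1 by rewrite /u n2 eqxx.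
have us : u s = inord 2 by rewrite /u n1 (negPf st) eqxx.
have us2 : u s2 = inord 3 by rewrite /u (negPf s2t2) (negPf s2t) (negPf s2s).
exists u.
  exists u' => [v|i].
    by have /or4P[] := all4 v => /eqP ->; rewrite /u' ?ut2 ?ut ?us ?us2 inordK.
  by case: i => [[|[|[|[|i]]]] Hi] //; apply: val_inj; rewrite /u' /= ?ut2 ?ut ?us ?us2 inordK.
move=> v w; have /or4P[] := all4 v => /eqP ->; have /or4P[] := all4 w => /eqP ->;
  by rewrite ?ut2 ?ut ?us ?us2 /cartan_F4 !inordK // ?a_diag ?ast ?atsE ?att2 ?at2E ?ass2 ?as2E ?ast2 ?at2s ?as2t ?ats2 ?as2t2 ?at2s2.
Qed.

End NonSimplyLaced.

(** * Simple groups have indecomposable Cartan matrices *)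

Section Indecomposable.
Variables (C : numClosedFieldType) (G : affineGroup C) (S : finType).
Variable D : chevalley_data G S.
Local Notation A := (coord_ring G).
Local Notation subA := (coord_ring_subalgebra G).
Local Notation a := (cartan D).

Lemma linear_mexp_gen n (P : set 'M[C]_n) (M : 'M[C]_n) : linear_set P -> nilpotent_mx M ->
  (forall t, P (mexp (t *: M))) -> P M.
Proof.
move=> linP [N MN] PM; have MN' : M ^+ N.+2 = 0 by apply: nilpotent_le MN _; lia.
have := @linear_set_coef _ _ _ linP N.+2 (fun k : 'I_N.+2 => k`!%:R^-1 *: M ^+ k) _ (@Ordinal N.+2 1 isT).
by rewrite /= (_ : 1`! = 1%N) // invr1 scale1r expr1; apply=> t _; rewrite -(mexp_scale t MN').
Qed.

Lemma mexp_commute n (X Y : 'M[C]_n) : nilpotent_mx X -> nilpotent_mx Y -> X *m Y = Y *m X ->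
  mexp X *m mexp Y = mexp Y *m mexp X.
Proof.
by move=> nX nY XY; have [_ <-] := mexp_comm nX nY XY; have [_ <-] := mexp_comm nY nX (esym XY); rewrite addrC.
Qed.

(** When a s t = 0, the bracket of the two generators is killed by every [f u], so [no_lowest_nest]
    makes it zero. *)
Lemma nest2_comm (V : lmodType C) (br : V -> V -> V) (e f h : S -> V) s t :
  lie_bracket br -> chevalley_elts a br e f h -> a s t = 0 -> br (e s) (e t) = 0.
Proof.
move=> lie ce ast; have [a_diag _ a_sym] := cartanP D; have ats := a_sym _ _ ast.
have := @no_lowest_nest _ _ _ _ br e f h lie ce a_diag (cartan_posdef D) [:: (1, [:: s; t])] isT.
rewrite /nest_sum big_seq1 /= scale1r; apply=> u.
rewrite (br_jacobi lie) (br_anti lie (f u) (e s)) (br_anti lie (f u) (e t)) !(ce_ef ce).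
rewrite -!scaleN1r (brZl lie) (brZ lie).
have -> : br (if s == u then h s else 0) (e t) = 0.
  by case: eqP => _; rewrite ?(ce_he ce) ?ast ?scale0r ?(br0l lie).
have -> : br (e s) (if t == u then h t else 0) = 0.
  by case: eqP => _; rewrite ?(br0 lie) // (br_anti lie) (ce_he ce) ats scale0r oppr0.
by rewrite !scaler0 addr0.
Qed.

Lemma orth_comm n (rho : G -> 'M[C]_n) b b' s t : rational_rep rho -> s != t -> a s t = 0 ->
  drep rho (gen_ef D b s) *m drep rho (gen_ef D b' t) = drep rho (gen_ef D b' t) *m drep rho (gen_ef D b s).
Proof.
move=> rat st ast; have cm := drep_chevalley D rat.
have lie := mxad_lie C n; have ce := mxad_chevalley cm; have ce' := chevalley_elts_opp lie ce.
apply/eqP; rewrite -subr_eq0; apply/eqP; rewrite -/(mxad _ _) /gen_ef.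
case: b; case: b'.
- exact: nest2_comm ce ast.
- by rewrite (cm_ef cm) (negPf st).
- by rewrite mxadC (cm_ef cm) eq_sym (negPf st) oppr0.
- exact: nest2_comm ce' ast.
Qed.

Lemma orth_root_comm b b' s t u v : s != t -> a s t = 0 ->
  (root_elt D b s u * root_elt D b' t v)%g = (root_elt D b' t v * root_elt D b s u)%g.
Proof.
move=> st ast; have [n [rho [rat faith]]] := faithful_rep_ex G; have [_ rM _] := rat.
apply: (faithful_inj faith); rewrite !rM !rep_root_elt //; apply: mexp_commute.
- by apply: nilpotentZ; exact: rep_nilpotent.
- by apply: nilpotentZ; exact: rep_nilpotent.
by rewrite -!scalemxAl -!scalemxAr (orth_comm _ _ rat st ast) !scalerA mulrC.
Qed.

Lemma coord_ring_conj f x : A f -> A (fun y => f (x ^ y)%g).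
Proof.
move=> Af; have [n [rho [xi [v [rat fE]]]]] := coord_ring_rep Af; have [_ rM rA] := rat.
rewrite (_ : (fun y => _) = fun y => (xi *m (rho (y^-1)%g *m (rho x *m rho y)) *m v) 0 0); last first.
  by apply: funext => y; rewrite fE conjgE !rM.
apply: (subalg_mulmx subA) => [i j|i j]; last exact: (subalg_cst subA).
apply: (subalg_mulmx subA) => [i' j'|i' j']; first exact: (subalg_cst subA).
apply: (subalg_mulmx subA) => [k l|k l]; first exact: (coord_ring_inv (rA _ _)).
by apply: (subalg_mulmx subA) => [k' l'|k' l']; [exact: (subalg_cst subA) | exact: rA].
Qed.

Lemma drep_h_neq0 n (rho : G -> 'M[C]_n) s : rational_rep rho -> faithful_rep rho ->
  drep rho (gen_h D s) != 0.
Proof.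
move=> rat faith; apply/eqP => h0.
have := @faithful_h_free _ _ _ D _ rho rat faith (fun t => (t == s)%:R) _ s; rewrite eqxx => H.
have /eqP : (1 : C) = 0.
  apply: H; rewrite (bigD1 s) //= eqxx h0 scaler0 add0r big1 // => t /negPf ->.
  by rewrite scale0r.
by rewrite oner_eq0.
Qed.

(** Consider the closure of the subgroup generated by the root elements indexed by [P]. It is closed
    and connected, and normal since the other root elements commute with it. If it is trivial then
    e_s0 vanishes; if it is everything then the root elements of t0 are central, so h_t0 vanishes.
    Both contradict faithfulness. *)
Theorem simple_indecomposable : simple_group G -> indecomposable a.
Proof.
case=> connG _ simG P [s0 Ps0] orth; apply: contrapT => /existsNP[t0 /negP Pt0].
have [n [rho [rat faith]]] := faithful_rep_ex G; have [r1 rM rA] := rat.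
pose inP (w : seq (bool * S * C)) := all (fun p => P p.1.2) w.
pose N : set G := [set x | forall f, A f -> (forall w, inP w -> f (word_elt D w) = 0) -> f x = 0].
have Nw w : inP w -> N (word_elt D w) by move=> Pw f _; exact.
have clN : zariski_closed N.
  exists [set f | A f /\ forall w, inP w -> f (word_elt D w) = 0]; split; first by move=> f [].
  by apply/seteqP; split=> x H; [move=> f [Af f0]; exact: H | move=> f Af f0; apply: H].
have conjw v w : inP w -> exists2 w', inP w' & (word_elt D w ^ word_elt D v)%g = word_elt D w'.
  elim: v w => [|p v IH] w Pw /=; first by exists w => //; rewrite conjg1.
  suff [w1 Pw1 E] : exists2 w1, inP w1 & (word_elt D w ^ root_elt D p.1.1 p.1.2 p.2)%g = word_elt D w1.
    by have [w' Pw' E'] := IH w1 Pw1; exists w' => //; rewrite conjgM E.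
  have [Pp|Pp] := boolP (P p.1.2).
    exists ([:: (p.1, - p.2)] ++ w ++ [:: p]); first by move: Pw; rewrite /inP !all_cat /= Pp => ->.
    by rewrite !word_elt_cat conjgE /= !mulg1 root_elt_V.
  exists w => //; apply/conjg_fixP/commgP; rewrite /commute.
  elim: w Pw => [|q w IHw] /=; first by rewrite mul1g mulg1.
  case/andP=> Pq /IHw E; rewrite -mulgA E !mulgA; congr (_ * _)%g.
  apply: orth_root_comm; last exact: orth.
  by apply: contraNneq Pp => <-.
have normN : normal_subgroup N.
  split.
  - exact: (Nw [::]).
  - move=> x y Nx Ny f Af f0; apply: (Nx (fun x => f (x * y)%g)); first exact: coord_ring_right.
    move=> w Pw; apply: (Ny (fun y => f (word_elt D w * y)%g)); first exact: coord_ring_left.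
    by move=> w' Pw'; rewrite -word_elt_cat; apply: f0; rewrite /inP all_cat; apply/andP.
  - move=> x Nx f Af f0; apply: (Nx (fun x => f (x^-1)%g)); first exact: coord_ring_inv.
    move=> w Pw; rewrite -word_elt_inv; apply: f0; rewrite /inP /winv all_rev all_map.
    by apply: sub_all Pw.
  - move=> x y Nx f Af f0.
    apply: (word_dense connG (D := D) (f := fun y => f (x ^ y)%g)); first exact: coord_ring_conj.
    move=> v; apply: (Nx (fun x => f (x ^ word_elt D v)%g)).
      rewrite (_ : (fun x => _) = fun x => f ((word_elt D v)^-1 * (x * word_elt D v))%g).
        by apply: (@coord_ring_right _ _ (fun x => f (_ * x)%g)); exact: coord_ring_left.
      by apply: funext => z; rewrite conjgE.
    by move=> w Pw; have [w' Pw' ->] := conjw v w Pw; exact: f0.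
have connN : zariski_connected N.
  have pathp f w : A f -> exists p : {poly C}, forall t, f (word_elt D (wscale t w)) = p.[t].
    (* Matrices of size 0 reduce the statement about pairs to one about the group alone. *)
    move=> Af; have [p pE] := @poly_path_alg _ _ _ D 0 (fun=> 0) (fun=> 0) (fun y => f y.1) w (@prod_alg_fst _ _ _ f Af).
    by exists p.
  have inPs t w : inP w -> inP (wscale t w) by rewrite /inP /wscale all_map.
  have w0 w : word_elt D (wscale 0 w) = 1%g.
    elim: w => //= p w ->; rewrite mul0r mulg1.
    by rewrite /root_elt; case: p.1.1; rewrite mx2_1 gen_phi1.
  have closed_all (Z : set G) w : zariski_closed Z ->
      (forall t, Z (word_elt D (wscale t w))) \/
      exists2 p : {poly C}, p != 0 & forall t, Z (word_elt D (wscale t w)) -> p.[t] = 0.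
    move=> [I [IA ->]].
    have [allp|/existsNP[f /not_implyP[If nz]]] := pselect (forall f, I f -> forall t,
       f (word_elt D (wscale t w)) = 0).
      by left=> t f If; exact: allp.
    right; have [p pE] := pathp f w (IA f If); exists p => [|t Zt]; last by rewrite -pE Zt.
    by apply/eqP => p0; apply: nz => t; rewrite pE p0 horner0.
  have step (Z Z' : set G) w : zariski_closed Z -> zariski_closed Z' -> N `<=` Z `|` Z' ->
      N `&` (Z `&` Z') = set0 -> Z 1%g -> inP w -> Z (word_elt D w).
    move=> cZ cZ' covZ disZ Z1g Pw.
    have [allZ|[p p0 pZ]] := closed_all Z w cZ; first by have := allZ 1; rewrite wscale1.
    have [allZ'|[p' p0' pZ']] := closed_all Z' w cZ'.
      have : (N `&` (Z `&` Z')) 1%g by split; [exact: (Nw [::]) | split=> //; rewrite -(w0 w)].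
      by rewrite disZ.
    have : p * p' = 0.
      apply: polyP_eval => t; rewrite hornerM horner0; apply/eqP; rewrite mulf_eq0; apply/orP.
      by have [/pZ ->|/pZ' ->] := covZ _ (Nw _ (inPs t w Pw)); [left | right].
    by move/eqP; rewrite mulf_eq0 (negPf p0) (negPf p0').
  have fin (Z Z' : set G) : zariski_closed Z -> zariski_closed Z' -> N `<=` Z `|` Z' ->
      N `&` (Z `&` Z') = set0 -> Z 1%g -> N `<=` Z.
    move=> cZ cZ' covZ disZ Z1g x Nx; have [J [JA ZE]] := cZ; rewrite ZE => f Jf.
    apply: Nx => [|w Pw]; first exact: JA.
    by have := step Z Z' w cZ cZ' covZ disZ Z1g Pw; rewrite ZE; exact.
  move=> Z1 Z2 cZ1 cZ2 cov dis; have [Z1g|Z2g] := cov 1%g (Nw [::] isT).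
    by left; exact: (fin Z1 Z2).
  by right; apply: (fin Z2 Z1) => //; [rewrite setUC | rewrite (setIC Z2)].
have [N1|NT] := simG N normN clN connN.
  have E0 : drep rho (gen_ef D true s0) = 0.
    apply: mexp_inj => [||u]; first exact: rep_nilpotent.
      by exists 1%N; rewrite expr1.
    rewrite scaler0 mexp0 -rep_root_elt //.
    have : N (word_elt D [:: (true, s0, u)]) by apply: Nw; rewrite /inP /= Ps0.
    by rewrite N1 /= mulg1 => ->.
  have := cm_ef (drep_chevalley D rat) s0 s0; rewrite eqxx.
  rewrite -[drep rho (gen_e D s0)]/(drep rho (gen_ef D true s0)) E0 mxadC mxad0r oppr0 => h0.
  by have /eqP := drep_h_neq0 s0 rat faith; rewrite -h0.
have com b u y : (y * root_elt D b t0 u)%g = (root_elt D b t0 u * y)%g.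
  have Ny : N y by rewrite NT.
  apply: coord_ring_separates => f Af; apply/eqP; rewrite -subr_eq0; apply/eqP.
  apply: (Ny (fun y => f (y * root_elt D b t0 u)%g - f (root_elt D b t0 u * y)%g)).
    by apply: (subalgB subA); [exact: coord_ring_right | exact: coord_ring_left].
  move=> w Pw; suff -> : (word_elt D w * root_elt D b t0 u = root_elt D b t0 u * word_elt D w)%g by rewrite subrr.
  elim: w Pw => [|q w IHw] /=; first by rewrite mul1g mulg1.
  case/andP=> Pq /IHw E; rewrite -mulgA E !mulgA; congr (_ * _)%g.
  by apply: orth_root_comm; [apply: contraNneq Pt0 => <- | exact: orth].
have EF : drep rho (gen_e D t0) *m drep rho (gen_f D t0) = drep rho (gen_f D t0) *m drep rho (gen_e D t0).
  have linc (Y : 'M[C]_n) : linear_set [set X : 'M[C]_n | X *m Y = Y *m X].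
    by split=> /= [|c X X' E E']; rewrite ?mul0mx ?mulmx0 // mulmxDl mulmxDr -scalemxAl -scalemxAr E E'.
  have E1 v : drep rho (gen_e D t0) *m rho (root_elt D false t0 v) = rho (root_elt D false t0 v) *m drep rho (gen_e D t0).
    apply: (linear_mexp_gen (linc (rho (root_elt D false t0 v))) (rep_nilpotent D rat true t0)) => u.
    by rewrite -(rep_root_elt D rat true) /= -!rM com.
  apply/esym; apply: (linear_mexp_gen (linc (drep rho (gen_e D t0))) (rep_nilpotent D rat false t0)) => v.
  by rewrite -(rep_root_elt D rat false) /= E1.
have := cm_ef (drep_chevalley D rat) t0 t0; rewrite eqxx /mxad EF subrr => h0.
by have /eqP := drep_h_neq0 t0 rat faith; rewrite -h0.
Qed.

End Indecomposable.

(** * The adjoint representation *)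

Lemma subalg_linear (C : numClosedFieldType) (X : Type) (B : set (X -> C)) n m (M : X -> 'M[C]_(n, m))
    (psi : 'M[C]_(n, m) -> C) : is_subalgebra B -> (forall i j, B (fun x => M x i j)) ->
  (forall c u v, psi (c *: u + v) = c * psi u + psi v) -> B (fun x => psi (M x)).
Proof.
move=> subB BM lin.
have psi0 : psi 0 = 0.
  by have := lin (-1) 0 0; rewrite scaler0 addr0 mulN1r addNr.
have psiS (I : Type) (r : seq I) (c : I -> C) (u : I -> 'M[C]_(n, m)) :
    psi (\sum_(i <- r) c i *: u i) = \sum_(i <- r) c i * psi (u i).
  by elim: r => [|i r IH]; rewrite ?big_nil // !big_cons lin IH.
rewrite (_ : (fun x => _) = fun x => \sum_(p : 'I_n * 'I_m) M x p.1 p.2 * psi (delta_mx p.1 p.2)).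
  by apply: (subalg_sum subB) => p _; apply: (subalgM subB) => //; exact: (subalg_cst subB).
apply: funext => x; rewrite {1}(matrix_sum_delta (M x)) pair_big /=.
exact: (psiS _ _ (fun p : 'I_n * 'I_m => M x p.1 p.2) (fun p => delta_mx p.1 p.2)).
Qed.

Section SubRepresentation.
Variables (C : numClosedFieldType) (G : affineGroup C) (S : finType).
Variable D : chevalley_data G S.
Hypothesis connG : connected_group G.
Local Notation A := (coord_ring G).
Local Notation subA := (coord_ring_subalgebra G).
Variables (n : nat) (rho : G -> 'M[C]_n).
Hypothesis rat : rational_rep rho.

Lemma conj_coord X i j : A (fun g => (rho g *m X *m rho (g^-1)%g) i j).
Proof.
have [_ _ rA] := rat.
apply: (subalg_mulmx subA) => [k l|k l]; last exact: (coord_ring_inv (rA _ _)).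
by apply: (subalg_mulmx subA) => [k' l'|k' l']; [exact: rA | exact: (subalg_cst subA)].
Qed.

(** The component of a conjugate outside [L] is a regular function of the group element; it vanishes
    on words, because conjugation by a root element is exp(ad) of a generator. *)
Lemma conj_stable (L : set 'M[C]_n) : linear_set L ->
  (forall b s X, L X -> L (mxad (drep rho (gen_ef D b s)) X)) ->
  forall g X, L X -> L (rho g *m X *m rho (g^-1)%g).
Proof.
move=> linL stL g X LX; have [U UP] := linear_set_vspace linL; have [r1 rM _] := rat.
apply/UP; suff E : forall g i j, (rho g *m X *m rho (g^-1)%g - projv U (rho g *m X *m rho (g^-1)%g)) i j = 0.
  have -> : rho g *m X *m rho (g^-1)%g = projv U (rho g *m X *m rho (g^-1)%g).
    by apply/eqP; rewrite -subr_eq0; apply/eqP/matrixP => i j; rewrite E mxE.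
  exact: memv_proj.
move=> {}g i j; move: g; apply: (word_dense connG (D := D)).
  apply: (@subalg_linear _ _ _ _ _ (fun g => rho g *m X *m rho (g^-1)%g) (fun Y => (Y - projv U Y) i j) subA).
    exact: conj_coord.
  by move=> c u v; rewrite linearP /= !mxE; ring.
move=> w; have [w' w'E] : exists w', word_elt D w' = ((word_elt D w)^-1)%g by exists (winv w); exact: word_elt_inv.
suff LX' : L (rho (word_elt D w) *m X *m rho ((word_elt D w)^-1)%g).
  by rewrite projv_id ?subrr ?mxE //; exact/UP.
elim: w {w' w'E} => [|p w IH] /=; first by rewrite invg1 r1 mul1mx mulmx1.
rewrite invgM root_elt_V !rM !rep_root_elt // !mulmxA scaleNr.
have := @mexp_conj_stable _ _ (p.2 *: drep rho (gen_ef D p.1.1 p.1.2)) L (nilpotentZ _ (rep_nilpotent D rat _ _)) linL.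
move=> /(_ _ _ IH); rewrite !mulmxA; apply=> Y LY.
by rewrite mxadZl; apply: (linear_setZ linL); exact: stL.
Qed.

Lemma subrep_weight (L : set 'M[C]_n) : linear_set L ->
  (forall g X, L X -> L (rho g *m X *m rho (g^-1)%g)) ->
  exists d (rho' : G -> 'M[C]_d) wt (iota : {linear 'cV[C]_d -> 'M[C]_n}),
    [/\ rational_rep rho', weight_rep D rho' wt, injective iota,
        forall X, L X <-> exists u, X = iota u &
        forall g u, iota (rho' g *m u) = rho g *m iota u *m rho (g^-1)%g].
Proof.
move=> linL stL; have [U UP] := linear_set_vspace linL; have [r1 rM rA] := rat.
pose d := \dim U; pose b := vbasis U.
pose io (u : 'cV[C]_d) : 'M[C]_n := \sum_i u i 0 *: b`_i.
have io_lin : linear io.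
  move=> c u v; rewrite /io scaler_sumr -big_split; apply: eq_bigr => i _ /=.
  by rewrite !mxE scalerDl scalerA.
have ioU u : io u \in U by apply: memv_suml => i _; apply: memvZ; apply: vbasis_mem; apply: memt_nth.
have ioK u i : coord b i (io u) = u i 0 by rewrite coord_sum_free // (basis_free (vbasisP U)).
have Kio X : X \in U -> io (\col_i coord b i X) = X.
  by move=> XU; rewrite [RHS](coord_vbasis XU); apply: eq_bigr => i _; rewrite mxE.
have io_inj : injective io by move=> u v E; apply/colP => i; rewrite -!ioK E.
pose Ad g : 'M[C]_d := \matrix_(i, j) coord b i (rho g *m b`_j *m rho (g^-1)%g).
have AdE g u : io (Ad g *m u) = rho g *m io u *m rho (g^-1)%g.
  have inU : rho g *m io u *m rho (g^-1)%g \in U by apply/UP; apply: stL; apply/UP; exact: ioU.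
  rewrite -[RHS]Kio //; congr io; apply/colP => i; rewrite !mxE.
  rewrite /io mulmx_sumr mulmx_suml linear_sum /=; apply: eq_bigr => j _.
  by rewrite mxE -scalemxAr -scalemxAl linearZ /= mulrC.
have mx_ext (M M' : 'M[C]_d) : (forall u : 'cV_d, M *m u = M' *m u) -> M = M'.
  move=> E; apply/matrixP => i j; have /colP/(_ i) := E (delta_mx j 0).
  by rewrite -!colE !mxE.
have ratAd : rational_rep Ad.
  split=> [|x y|i j].
  - by apply: mx_ext => u; apply: io_inj; rewrite AdE r1 invg1 r1 !mul1mx mulmx1.
  - by apply: mx_ext => u; apply: io_inj; rewrite -[in RHS]mulmxA !AdE invgM !rM !mulmxA.
  - rewrite (_ : (fun x => _) = fun g => coord b i (rho g *m b`_j *m rho (g^-1)%g)); last first.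
      by apply: funext => g; rewrite mxE.
    apply: (@subalg_linear _ _ _ _ _ (fun g => rho g *m b`_j *m rho (g^-1)%g) (coord b i) subA).
      exact: conj_coord.
    by move=> c u v; rewrite linearP.
have [P [wt [uP wr]]] := weight_basis D ratAd.
pose io' (u : 'cV[C]_d) := io (invmx P *m u).
have io'_lin : linear io' by move=> c u v; rewrite /io' mulmxDr -scalemxAr io_lin.
pose ioL := GRing.isLinear.Build C 'cV[C]_d 'M[C]_n _ io' io'_lin.
pose iota : {linear 'cV[C]_d -> 'M[C]_n} := HB.pack io' ioL.
exists d, (fun x => P *m Ad x *m invmx P), wt, iota; split=> //.
- exact: rational_rep_conj.
- by move=> u v /io_inj E; rewrite -[u](mulKVmx uP) E mulKVmx.
- move=> X; split=> [/UP XU|[u ->]]; last by apply/UP; exact: ioU.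
  by exists (P *m \col_i coord b i X); rewrite /= /io' mulKmx // Kio.
- by move=> g u; rewrite /= /io' -AdE; congr io; rewrite !mulmxA mulVmx // mul1mx.
Qed.

Lemma iota_drep d (rho' : G -> 'M[C]_d) (iota : {linear 'cV[C]_d -> 'M[C]_n}) X u :
  rational_rep rho' -> (forall g u, iota (rho' g *m u) = rho g *m iota u *m rho (g^-1)%g) ->
  lie X -> iota (drep rho' X *m u) = mxad (drep rho X) (iota u).
Proof.
move=> rat' eqv lX; have [r1 rM rA] := rat; have [r1' _ rA'] := rat'.
have fE i k : (fun g => iota (rho' g *m u) i k) = fun g => \sum_a \sum_b (u b 0 * iota (delta_mx a 0) i k) * rho' g a b.
  apply: funext => g; have -> : rho' g *m u = \sum_a (rho' g *m u) a 0 *: delta_mx a 0.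
    by rewrite [LHS]matrix_sum_delta; apply: eq_bigr => a _; rewrite big_ord1.
  rewrite linear_sum summxE; apply: eq_bigr => a _; rewrite linearZ !mxE mulr_suml.
  by apply: eq_bigr => b _; ring.
have fA i k : A (fun g => iota (rho' g *m u) i k).
  rewrite fE; apply: (subalg_sum subA) => a _; apply: (subalg_sum subA) => b _.
  by apply: (subalgZ subA).
have Xf i k : X (fun g => iota (rho' g *m u) i k) = iota (drep rho' X *m u) i k.
  rewrite fE (lie_sum lX) => [|a]; last first.
    by apply: (subalg_sum subA) => b _; apply: (subalgZ subA).
  have -> : drep rho' X *m u = \sum_a (drep rho' X *m u) a 0 *: delta_mx a 0.
    by rewrite [LHS]matrix_sum_delta; apply: eq_bigr => a _; rewrite big_ord1.
  rewrite linear_sum summxE; apply: eq_bigr => a _; rewrite (lie_sum lX) => [|b]; last by apply: (subalgZ subA).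
  rewrite linearZ !mxE mulr_suml; apply: eq_bigr => b _.
  by rewrite (lieZ lX) // mxE; ring.
apply/matrixP => i j.
(* The inverse is moved to the other side before differentiating, so that only products of two
   coefficients occur. *)
have E : (fun g => \sum_k iota (rho' g *m u) i k * rho g k j) = fun g => \sum_k iota u k j * rho g i k.
  apply: funext => g; transitivity ((iota (rho' g *m u) *m rho g) i j); first by rewrite mxE.
  rewrite eqv -!mulmxA -[rho (g^-1)%g *m _]rM mulVg r1 mulmx1 mxE.
  by apply: eq_bigr => k _; rewrite mulrC.
have := congr1 X E; rewrite (lie_sum lX) => [|k]; last by apply: (subalgM subA).
rewrite (lie_sum lX) => [|k]; last by apply: (subalgZ subA).
under eq_bigr do rewrite (lieM lX) // Xf r1' mul1mx r1.
rewrite big_split /= => E'; rewrite /mxad !mxE.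
have -> : iota (drep rho' X *m u) i j = \sum_k iota (drep rho' X *m u) i k * 1%:M k j.
  rewrite (bigD1 j) //= mxE eqxx mulr1 big1 ?addr0 // => k /negPf kj; by rewrite mxE kj mulr0.
apply/eqP; rewrite -subr_eq opprK addrC; apply/eqP.
transitivity (\sum_k X (fun g => iota u k j * rho g i k)).
  by rewrite -E'; congr (_ + _); apply: eq_bigr => k _; rewrite mxE.
by apply: eq_bigr => k _; rewrite (lieZ lX) // mxE mulrC.
Qed.

End SubRepresentation.

Section CartanIndependence.
Variables (S : finType) (a : S -> S -> int).
Hypothesis pd : posdef_cartan a.

Lemma cartan_injZ (x y : S -> int) : (forall s, \sum_t a s t * x t = \sum_t a s t * y t) -> x = y.
Proof.
move=> E; apply: funext => s; apply/eqP; rewrite -subr_eq0 -(intr_eq0 rat); apply/eqP.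
apply: (cartan_inj pd (z := fun s => (x s - y s)%:~R)) => u.
transitivity ((\sum_t a u t * x t - \sum_t a u t * y t)%:~R : rat); last by rewrite E subrr.
rewrite -sumrB rmorph_sum /=; apply: eq_bigr => t _; by rewrite -mulrBr rmorphM.
Qed.

Lemma cartan_injC (C : numClosedFieldType) (z : S -> C) :
  (forall t, \sum_s z s * (a s t)%:~R = 0) -> forall s, z s = 0.
Proof.
move=> z0 u; have [y yP] := cartan_solve pd (fun s => (s == u)%:R).
have : \sum_t ratr (y t) * (\sum_s z s * (a s t)%:~R) = 0 by rewrite big1 // => t _; rewrite z0 mulr0.
under eq_bigr do rewrite mulr_sumr.
rewrite exchange_big /= (bigD1 u) //= [X in _ + X]big1 ?addr0 => [|s su].
  rewrite (eq_bigr (fun t => z u * ratr ((a u t)%:~R * y t))) => [|t _]; last first.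
    by rewrite rmorphM /= ratr_int; ring.
  by rewrite -mulr_sumr -rmorph_sum yP eqxx rmorph1 mulr1.
rewrite (eq_bigr (fun t => z s * ratr ((a s t)%:~R * y t))) => [|t _]; last first.
  by rewrite rmorphM /= ratr_int; ring.
by rewrite -mulr_sumr -rmorph_sum yP (negPf su) rmorph0 mulr0.
Qed.

Lemma word_wt_count w s : word_wt a w s = \sum_t a s t * (count_mem t w)%:Z.
Proof.
rewrite /word_wt; elim: w => [|u w IH]; first by rewrite big_nil big1 // => t _; rewrite mulr0.
rewrite big_cons IH (bigD1 u) //= [in RHS](bigD1 u) //= eqxx PoszD mulrDr mulr1 -addrA; congr (_ + (_ + _)).
by apply: eq_bigr => t /negPf tu; rewrite eq_sym tu.
Qed.

End CartanIndependence.

Lemma unit_of_ker (K : fieldType) n (M : 'M[K]_n) : (forall u : 'cV_n, M *m u = 0 -> u = 0) ->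
  M \in unitmx.
Proof.
move=> ker; rewrite -row_full_unit -cokermx_eq0; apply/eqP/matrixP => i j.
have := ker (col j (cokermx M)); rewrite colE mulmxA mulmx_coker mul0mx => /(_ erefl).
by rewrite -colE => /colP/(_ i); rewrite !mxE.
Qed.

Section Adjoint.
Variables (C : numClosedFieldType) (G : affineGroup C) (S : finType).
Variable D : chevalley_data G S.
Hypothesis connG : connected_group G.
Local Notation a := (cartan D).
Hypothesis indec : indecomposable a.
Hypothesis unimodular : forall lam : S -> int, exists x : S -> int, forall t, lam t = \sum_s a t s * x s.
Hypothesis laced : forall s t, s != t -> -1 <= a s t.
Variable s0 : S.

Variables (n : nat) (rho : G -> 'M[C]_n) (wtF : 'I_n -> S -> int).
Hypothesis rat : rational_rep rho.
Hypothesis faith : faithful_rep rho.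
Hypothesis wrF : weight_rep D rho wtF.
Local Notation E := (fun s => drep rho (gen_e D s)).
Local Notation F := (fun s => drep rho (gen_f D s)).
Local Notation H := (fun s => drep rho (gen_h D s)).
Local Notation br := (@mxad C n).
Local Notation L := (Lall br E F H).

Let lieM : lie_bracket br := mxad_lie C n.
Let cm : chevalley_mx a E F H := drep_chevalley D rat.
Let ce : chevalley_elts a br E F H := mxad_chevalley cm.
Let ce' : chevalley_elts a br F E (fun s => - H s) := chevalley_elts_opp lieM ce.
Let linL : linear_set L := Lall_linear br E F H.
Let a_diag : forall s, a s s = 2. Proof. by have [] := cartanP D. Qed.
Let a_sym s t : a s t = 0 -> a t s = 0. Proof. by have [_ _] := cartanP D; exact. Qed.
Let pd := cartan_posdef D.

Let LE b s X : L X -> L (br (drep rho (gen_ef D b s)) X).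
Proof. by case: b => LX; [exact: (Lall_e lieM ce) | exact: (Lall_f lieM ce)]. Qed.

Lemma adjoint_conj g X : L X -> L (rho g *m X *m rho (g^-1)%g).
Proof. exact: (conj_stable connG rat linL (fun b s X => @LE b s X)). Qed.

Let nestL w : w != [::] -> L (nest br E w) /\ L (nest br F w).
Proof.
move=> w0; have sz : (0 < size w)%N by case: w w0.
split; first by apply: (Lp_Lall _ _ sz); exact: Lp_nest.
by rewrite -Lall_oppE; apply: (Lp_Lall _ _ sz); exact: Lp_nest.
Qed.

Let HL s : L (H s). Proof. by have [] := Lall_gens br E F H s. Qed.

Let L_ind0 (K : set 'M[C]_n) : linear_set K -> (forall s, K (H s)) ->
  (forall w, w != [::] -> K (nest br E w) /\ K (nest br F w)) -> L `<=` K.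
Proof.
move=> linK KH Kn _ [z [r [r' [nr nr' ->]]]].
apply: (linear_setD linK); first apply: (linear_setD linK).
- by apply: (linear_set_sum linK) => s _; exact: (linear_setZ linK).
- rewrite /nest_sum; elim: r nr => [|p r IH] /=; first by rewrite big_nil; have [] := linK.
  case/andP=> p0 nr; rewrite big_cons; apply: (linear_setD linK); last exact: IH.
  by apply: (linear_setZ linK); have [] := Kn _ p0.
- rewrite /nest_sum; elim: r' nr' => [|p r' IH] /=; first by rewrite big_nil; have [] := linK.
  case/andP=> p0 nr'; rewrite big_cons; apply: (linear_setD linK); last exact: IH.
  by apply: (linear_setZ linK); have [] := Kn _ p0.
Qed.

Let L_br X Y : L X -> L Y -> L (br X Y).
Proof.
move=> LX; move: X LX Y; apply: (@L_ind0 [set X | forall Y, L Y -> L (br X Y)]).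
- split=> [Y _|c X X' HX HX' Y LY] /=; first by rewrite (br0l lieM); have [] := linL.
  rewrite (brDl lieM) (brZl lieM); apply: (linear_setD linL); last exact: HX'.
  by apply: (linear_setZ linL); exact: HX.
- by move=> s Y LY; exact: (Lall_h lieM ce).
move=> w w0; have gen b : forall Y, L Y -> L (br (nest br (if b then E else F) w) Y).
  elim: w w0 => // s [|t w] IH _ Y LY.
    by have := LE b s LY; rewrite /gen_ef; case: (b).
  have -> : nest br (if b then E else F) [:: s, t & w] =
     br (drep rho (gen_ef D b s)) (nest br (if b then E else F) (t :: w)) by case: (b).
  set Z := nest _ _ _ in IH *; set e := drep _ _.
  have -> : br (br e Z) Y = br e (br Z Y) - br Z (br e Y) by rewrite (br_jacobi lieM e) addrK.
  by apply: (linear_setB linL); [apply: LE; exact: IH | apply: IH => //; exact: LE].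
by split; [exact: (gen true) | exact: (gen false)].
Qed.

Variables (d : nat) (rho' : G -> 'M[C]_d) (wt : 'I_d -> S -> int) (iota : {linear 'cV[C]_d -> 'M[C]_n}).
Hypothesis rat' : rational_rep rho'.
Hypothesis wr : weight_rep D rho' wt.
Hypothesis iota_inj : injective iota.
Hypothesis iotaL : forall X, L X <-> exists u, X = iota u.
Hypothesis iotaE : forall g u, iota (rho' g *m u) = rho g *m iota u *m rho (g^-1)%g.

Let pre X : L X -> exists u, iota u = X. Proof. by move/iotaL => [u ->]; exists u. Qed.
Let Liota u : L (iota u). Proof. by apply/iotaL; exists u. Qed.

Let L_ind (Q : set 'cV[C]_d) : linear_set Q -> (forall u s, iota u = H s -> Q u) ->
  (forall u w, w != [::] -> iota u = nest br E w -> Q u) ->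
  (forall u w, w != [::] -> iota u = nest br F w -> Q u) -> forall u, Q u.
Proof.
move=> [Q0 QD] QH QE QF u.
have : [set X | exists2 u, iota u = X & Q u] (iota u).
  apply: (L_ind0 _ _ _ (Liota u)).
  - split=> [|c _ _ [v <- Qv] [w <- Qw]]; first by exists 0; rewrite ?linear0.
    by exists (c *: v + w); [rewrite linearP | exact: QD].
  - by move=> s; have [v vE] := pre (HL s); exists v => //; exact: QH vE.
  - move=> w w0; have [/pre[v vE] /pre[v' vE']] := nestL w0.
    by split; [exists v => //; exact: QE vE | exists v' => //; exact: QF vE'].
by case=> v /iota_inj ->.
Qed.

Let gl s : lie (gen_h D s). Proof. by have [] := gen_lie D s. Qed.

Let hw mu u : has_weight D rho' mu u <-> forall s, br (H s) (iota u) = (mu s)%:~R *: iota u.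
Proof.
split=> h s.
  by rewrite -(iota_drep rat u rat' iotaE (gl s)) h linearZ.
by apply: iota_inj; rewrite (iota_drep rat u rat' iotaE (gl s)) h linearZ.
Qed.

Let hw_nestE w u : iota u = nest br E w -> has_weight D rho' (word_wt a w) u.
Proof. by move=> uE; apply/hw => s; rewrite uE (br_h_nest lieM ce). Qed.

Let hw_nestF w u : iota u = nest br F w -> has_weight D rho' (fun s => - word_wt a w s) u.
Proof.
move=> uE; apply/hw => s; rewrite uE; have := br_h_nest lieM ce' s w.
by rewrite -scaleN1r (brZl lieM) scaleN1r rmorphN scaleNr => <-; rewrite opprK.
Qed.

Let hw_H s u : iota u = H s -> has_weight D rho' (fun=> 0) u.
Proof. by move=> uE; apply/hw => t; rewrite uE (ce_hh ce) scale0r. Qed.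

Let N (i : 'I_d) := [exists s, wt i s != 0].

Let NP i : reflect (wt i <> fun=> 0) (N i).
Proof.
apply: (iffP existsP) => [[s /eqP nz] E0|nz]; first by apply: nz; rewrite E0.
by apply: contrapT => H0; apply: nz; apply: funext => s; apply/eqP/negPn/negP => ?; apply: H0; exists s.
Qed.

(** Projection onto a weight space. Being linear, it reduces questions about a weight space to the
    spanning brackets, each of which it fixes or kills. *)
Let pr mu (u : 'cV[C]_d) : 'cV[C]_d := \col_k (if [forall s, wt k s == mu s] then u k 0 else 0).

Let pr_lin mu c u v : pr mu (c *: u + v) = c *: pr mu u + pr mu v.
Proof. by apply/colP => k; rewrite !mxE; case: ifP => _ //; rewrite mulr0 addr0. Qed.

Let pr_id mu u : has_weight D rho' mu u -> pr mu u = u.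
Proof.
move=> hu; apply/colP => k; rewrite mxE; case: ifP => // /negbT nk.
apply/esym/eqP; apply: contraNT nk => uk; apply/forallP => s.
by rewrite (has_weight_coord wr hu uk).
Qed.

Let pr_0 mu nu u : has_weight D rho' nu u -> mu <> nu -> pr mu u = 0.
Proof.
move=> hu mn; apply/colP => k; rewrite !mxE; case: ifP => // /forallP Hk.
apply/eqP/negPn/negP => uk; apply: mn; rewrite -(has_weight_coord wr hu uk).
by apply: funext => s; apply/esym/eqP.
Qed.

Let iota0 u : iota u = 0 -> u = 0.
Proof. by rewrite -(linear0 iota) => /iota_inj. Qed.

Let root_form i : N i -> exists w, w != [::] /\
  ((wt i = word_wt a w /\ nest br E w <> 0) \/ (wt i = (fun s => - word_wt a w s) /\ nest br F w <> 0)).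
Proof.
move=> Ni; apply: contrapT => no.
have : [set u : 'cV[C]_d | u i 0 = 0] (delta_mx i 0).
  apply: L_ind.
  - by split=> /= [|c u v u0 v0]; rewrite !mxE ?u0 ?v0 ?mulr0 ?addr0.
  - move=> u s uE /=; apply/eqP/negPn/negP => ui; move/NP: Ni; apply.
    exact: has_weight_coord (hw_H uE) ui.
  - move=> u w w0 uE /=; apply/eqP/negPn/negP => ui; apply: no; exists w; split=> //; left; split.
      exact: has_weight_coord (hw_nestE uE) ui.
    by move=> n0; move: uE ui; rewrite n0 => /iota0 ->; rewrite mxE eqxx.
  - move=> u w w0 uE /=; apply/eqP/negPn/negP => ui; apply: no; exists w; split=> //; right; split.
      exact: has_weight_coord (hw_nestF uE) ui.
    by move=> n0; move: uE ui; rewrite n0 => /iota0 ->; rewrite mxE eqxx.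
by rewrite /= mxE !eqxx => /eqP; rewrite oner_eq0.
Qed.

Let al s (t : S) : int := a t s.
Let comb (x : S -> int) (t : S) : int := \sum_s a t s * x s.

Let al_comb s : al s = comb (fun u => (u == s)%:R).
Proof.
apply: funext => t; rewrite /comb (bigD1 s) //= eqxx mulr1 big1 ?addr0 // => u /negPf ->.
by rewrite mulr0.
Qed.

Let combP x y : comb x = comb y -> x = y.
Proof. by move=> E0; apply: (cartan_injZ pd) => s; have := congr1 (fun f => f s) E0. Qed.

Let combN x : comb (fun s => - x s) = fun t => - comb x t.
Proof. by apply: funext => t; rewrite /comb -sumrN; apply: eq_bigr => s _; rewrite mulrN. Qed.

Let comb0 : comb (fun=> 0) = fun=> 0.
Proof. by apply: funext => t; rewrite /comb big1 // => s _; rewrite mulr0. Qed.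

Let wwE w : word_wt a w = comb (fun t => (count_mem t w)%:Z).
Proof. by apply: funext => s; rewrite word_wt_count. Qed.

Let irefl_comb s x : irefl D s (comb x) = comb (fun t => x t - (t == s)%:R * comb x s).
Proof.
apply: funext => t; rewrite /irefl {3}/comb; under [RHS]eq_bigr do rewrite mulrBr.
rewrite sumrB; congr (_ - _); rewrite (bigD1 s) //= eqxx mul1r [X in _ + X]big1 ?addr0 => [|u /negPf ->].
  by rewrite mulrC.
by rewrite mul0r mulr0.
Qed.

Let nest_nseq (g : S -> 'M[C]_n) s k : nest br g (nseq k.+2 s) = 0.
Proof.
elim: k => [|k IH]; first by rewrite /= mxadxx.
by rewrite -[nseq _ _]/(s :: nseq k.+2 s) nest_cons // IH (br0 lieM).
Qed.

(** A non-zero weight comes from a non-zero nested bracket of e's or of f's. A word repeating a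
    single letter brackets to 0 beyond length one, so no proper multiple of a simple root occurs. *)
Let root_count i : N i -> exists (m : S -> nat) (e : bool), [/\ exists s, m s != 0%N,
  wt i = comb (fun s => (if e then 1 else -1) * (m s)%:Z) & forall s, (forall t, t != s -> m t = 0%N) -> m s = 1%N].
Proof.
move=> Ni; have [w [w0 Hw]] := root_form Ni.
have ex : exists s, count_mem s w != 0%N.
  by case: w w0 {Hw} => // s w _; exists s; rewrite /= eqxx.
have one (g : S -> 'M[C]_n) s : nest br g w <> 0 -> (forall t, t != s -> count_mem t w = 0%N) -> count_mem s w = 1%N.
  move=> n0 only; have ws : all (pred1 s) w.
    apply/allP => t tw; apply/negPn/negP => /only /eqP.
    by rewrite -leqn0 leqNgt -has_count has_pred1 tw.
  move: ws n0 w0 => /all_pred1P ->; case: (size w) => [//|[|k]] n0 _; first by rewrite /= eqxx.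
  by case: (n0 (nest_nseq g s k)).
case: Hw => -[wE n0].
  exists (fun s => count_mem s w), true; split=> [|| s]; [exact: ex | | exact: one n0].
  by rewrite wE wwE; congr comb; apply: funext => t; rewrite mul1r.
exists (fun s => count_mem s w), false; split=> [|| s]; [exact: ex | | exact: one n0].
by rewrite wE wwE -combN; congr comb; apply: funext => t; rewrite mulN1r.
Qed.

Let mult1 i := forall j, wt j = wt i -> j = i.

Let count1 s (w : seq S) : (forall t, count_mem t w = (t == s) :> nat) -> w = [:: s].
Proof.
move=> cw; have ws : all (pred1 s) w.
  apply/allP => t tw; apply/negPn/negP => /negPf /= ts; have := cw t.
  by rewrite ts => /eqP; rewrite -leqn0 leqNgt -has_count has_pred1 tw.
have := cw s; rewrite eqxx; move/all_pred1P: ws => ->.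
by rewrite count_nseq /= eqxx mul1n => ->.
Qed.

Let simple_line (b : bool) s g u : iota g = (if b then E s else F s) ->
  has_weight D rho' (comb (fun t => (if b then 1 else -1) * (t == s)%:R)) u -> exists c, u = c *: g.
Proof.
move=> gE hu; rewrite -(pr_id hu); set mu := comb _.
have hg : has_weight D rho' mu g.
  have -> : mu = (fun t => (if b then 1 else -1) * word_wt a [:: s] t).
    apply: funext => t; rewrite /mu wwE /comb mulr_sumr; apply: eq_bigr => v _ /=.
    by rewrite addn0 eq_sym; case: (b); case: eqP => _ /=; ring.
  case: b gE @mu hu => gE mu hu.
    have := @hw_nestE [:: s] g gE; by congr has_weight; apply: funext => t; rewrite mul1r.
  have := @hw_nestF [:: s] g gE; by congr has_weight; apply: funext => t; rewrite mulN1r.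
move: u {hu}; apply: (@L_ind [set u | exists c, pr mu u = c *: g]).
- split=> [|c u1 u2 [c1 E1] [c2 E2]].
    exists 0; rewrite scale0r; apply/colP => k; rewrite !mxE; by case: ifP.
  by exists (c * c1 + c2); rewrite pr_lin E1 E2 scalerDl scalerA.
- move=> v t vE; exists 0; rewrite scale0r; apply: pr_0 (hw_H vE) _ => E0.
  have /(congr1 (fun f => f s)) : (fun t => (if b then 1 else -1) * (t == s)%:R) = (fun=> 0 : int).
    by apply: combP; rewrite comb0.
  by rewrite eqxx; case: (b).
- move=> v w w0 vE; have [E0|ne] := pselect (mu = word_wt a w); last first.
    by exists 0; rewrite scale0r; exact: pr_0 (hw_nestE vE) ne.
  rewrite wwE in E0; have {}E0 := combP E0.
  have bT : b = true by have := congr1 (fun f => f s) E0; rewrite eqxx; case: (b).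
  rewrite bT in gE E0; have ws : w = [:: s].
    by apply: count1 => t; have := congr1 (fun f => f t) E0; rewrite mul1r; case: eqP => _ [].
  exists 1; rewrite scale1r; have -> : v = g by apply: iota_inj; rewrite vE gE ws.
  exact: pr_id.
- move=> v w w0 vE; have [E0|ne] := pselect (mu = (fun t => - word_wt a w t)); last first.
    by exists 0; rewrite scale0r; exact: pr_0 (hw_nestF vE) ne.
  rewrite wwE -combN in E0; have {}E0 := combP E0.
  have bF : b = false by have := congr1 (fun f => f s) E0; rewrite eqxx; case: (b) => //; lia.
  rewrite bF in gE E0; have ws : w = [:: s].
    apply: count1 => t; have := congr1 (fun f => f t) E0; rewrite mulN1r => /oppr_inj; by case: eqP => _ [].
  exists 1; rewrite scale1r; have -> : v = g by apply: iota_inj; rewrite vE gE ws.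
  exact: pr_id.
Qed.

Let gen_pre (b : bool) s : exists g, iota g = (if b then E s else F s).
Proof.
have [LEs LFs _] := Lall_gens br E F H s.
by case: b; [exact: pre LEs | exact: pre LFs].
Qed.

Let simple_mult (b : bool) s i : wt i = comb (fun t => (if b then 1 else -1) * (t == s)%:R) -> mult1 i.
Proof.
move=> wi j wj; have [g gE] := gen_pre b s.
have hd k : wt k = wt i -> exists c, delta_mx k 0 = c *: g.
  move=> wk; apply: (simple_line gE); rewrite -wi -wk; exact: has_weight_delta.
have [c cE] := hd i erefl; have [c' cE'] := hd j wj.
have c'0 : c' != 0.
  by apply: contraNneq (delta_neq0 C j) => E0; rewrite cE' E0 scale0r.
have : delta_mx i 0 = (c / c') *: (delta_mx j 0 : 'cV[C]_d) by rewrite cE cE' scalerA mulfVK.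
move/colP/(_ i); rewrite !mxE eqxx; case: (i =P j) => [//|_] /=.
by rewrite mulr0 => /eqP; rewrite oner_eq0.
Qed.

Let irefl_mult s i j : wt j = irefl D s (wt i) -> mult1 j -> mult1 i.
Proof.
move=> wj mj k wk.
have im l : wt l = wt i -> exists2 c, c != 0 & rho' (rbar D s) *m delta_mx l 0 = c *: delta_mx j 0 :> 'cV[C]_d.
  move=> wl; have := has_weight_rbar rat' s (has_weight_delta wr l); rewrite wl -wj => h.
  have vE := mult_one_delta wr h erefl mj.
  exists ((rho' (rbar D s) *m (delta_mx l 0 : 'cV[C]_d)) j 0) => //.
  by apply/eqP => d0; have := rep_mul_neq0 rat' (rbar D s) (delta_neq0 C l); rewrite vE d0 scale0r eqxx.
have [c c0 cE] := im i erefl; have [c' c0' cE'] := im k wk.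
have E0 : c' *: delta_mx i 0 - c *: delta_mx k 0 = 0 :> 'cV[C]_d.
  apply/eqP/negPn/negP => /(rep_mul_neq0 rat' (rbar D s)).
  by rewrite mulmxBr -!scalemxAr cE cE' !scalerA mulrC subrr eqxx.
have /colP/(_ i) := E0; rewrite !mxE eqxx; case: (i =P k) => [//|_] /=.
by rewrite mulr1 mulr0 subr0 => /eqP; rewrite (negPf c0').
Qed.

(** Induction on the height of the root. A root that is not simple up to sign pairs positively, up
    to that sign, with some simple coroot; the reflection lowers its height, and both conclusions
    transfer back. *)
Let root_orbit i : N i -> (exists w s, wt i = iact D w (al s)) /\ mult1 i.
Proof.
move=> Ni; have [m [e [mx wi _]]] := root_count Ni.
have [k km] := ubnP (\sum_s m s)%N.
elim: k i Ni m e mx wi km => // k IH i Ni m e mx wi; rewrite ltnS => km.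
have [[s only]|nonly] := pselect (exists s, forall t, t != s -> m t = 0%N).
  have [m' [e' [mx' wi' one']]] := root_count Ni.
  have E0 := combP (etrans (esym wi) wi').
  have E1 t : e' = e /\ m' t = m t.
    have ms : m s != 0%N.
      by case: mx => u mu; have [us|us] := eqVneq u s; [rewrite -us | move: mu; rewrite only].
    have := congr1 (fun f => f s) E0; have := congr1 (fun f => f t) E0.
    move: ms; move: (m s) (m t) (m' s) (m' t) => p q r u /=; case: (e); case: (e'); clear; lia.
  have ms1 : m s = 1%N by rewrite -(E1 s).2; apply: one' => t ts; rewrite (E1 t).2 only.
  have wiE : wt i = comb (fun t => (if e then 1 else -1) * (t == s)%:R).
    rewrite wi; congr comb; apply: funext => t; have [->|/only ->] := eqVneq t s; first by rewrite ms1.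
    by rewrite !mulr0.
  split; last exact: simple_mult wiE.
  case: e {wi E0 E1} wiE => wiE.
    by exists [::], s; rewrite wiE al_comb; congr comb; apply: funext => t; rewrite mul1r.
  exists [:: s], s; rewrite wiE /= al_comb irefl_comb; congr comb; apply: funext => t.
  by rewrite -al_comb /al a_diag; case: eqP => _; lia.
have [s [ms0 pos]] := posdef_root pd mx.
have wis : wt i s = (if e then 1 else -1) * (\sum_t a s t * (m t)%:Z).
  rewrite wi /comb mulr_sumr; apply: eq_bigr => t _; ring.
set p := \sum_t a s t * (m t)%:Z in pos wis.
have [j wj] := weight_iact rat' wr i [:: s].
have wjE : wt j = comb (fun t => (if e then 1 else -1) * ((m t)%:Z - (t == s)%:R * p)).
  rewrite wj /= wi irefl_comb -wi wis; congr comb; apply: funext => t; ring.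
have Nj : N j.
  apply/NP => wj0; move/NP: Ni; apply; rewrite -(irefl2 D s (wt i)) -[irefl D s (wt i)]wj wj0.
  by apply: funext => t; rewrite /irefl mul0r subr0.
have [m' [e' [mx' wj' _]]] := root_count Nj.
have E0 := combP (etrans (esym wjE) wj').
have [u us mu] : exists2 u, u != s & m u != 0%N.
  have /existsNP[u /not_implyP[us /eqP mu]] : ~ forall t, t != s -> m t = 0%N.
    by move=> Hs; apply: nonly; exists s.
  by exists u.
(* The reflection changes the coefficient at s only. The non-zero coefficient at another vertex u
   keeps its sign, and it determines the sign of the whole root. *)
have ee : e' = e.
  have := congr1 (fun f => f u) E0; rewrite (negPf us) mul0r subr0; move: mu; move: (m u) (m' u) => q r.
  by case: (e); case: (e') => //=; clear; lia.
have mE t : (m' t)%:Z = (m t)%:Z - (t == s)%:R * p.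
  by have := congr1 (fun f => f t) E0; rewrite ee; case: (e); rewrite ?mul1r ?mulN1r; [move=> <- | move/oppr_inj => <-].
have lt : (\sum_t m' t < k)%N.
  apply: leq_trans km; rewrite (bigD1 s) //= [X in (_ < X)%N](bigD1 s) //=.
  rewrite (eq_bigr m) => [|t ts].
    rewrite ltn_add2r; have := mE s; rewrite eqxx mul1r; move: pos; move: (p) (m s) (m' s); clear; lia.
  by have := mE t; rewrite (negPf ts) mul0r subr0 => -[].
have [[w [v wv]] mj] := IH j Nj m' e' mx' wj' lt.
split; last exact: irefl_mult wj mj.
by exists (s :: w), v; rewrite /= -wv wj /= irefl2.
Qed.

(** In the simply laced case neighbouring simple roots are conjugate, since r_u r_v sends alpha_u to
    alpha_v; indecomposability connects all of them. *)
Let al_conn s t : exists w, iact D w (al s) = al t.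
Proof.
have := @indec [pred t | `[< exists w, iact D w (al s) = al t >]]; rewrite /=.
case/(_ _ _ t)/asboolP; first by exists s; apply/asboolP; exists [::].
  move=> u v /asboolP[w wE] /asboolP nv; apply: contrapT => uv0; apply: (nv).
  have uv : u != v by apply/eqP => uv; apply: nv; exists w; rewrite -uv.
  have [_ a_neg _] := cartanP D.
  have vu0 : a v u <> 0 by move=> /a_sym.
  have uvE : a u v = -1 by have := a_neg u v uv; have := laced uv; lia.
  have vu : v != u by rewrite eq_sym.
  have vuE : a v u = -1 by have := a_neg v u vu; have := laced vu; lia.
  exists ([:: u; v] ++ w); rewrite iact_cat wE /= /irefl /al; apply: funext => x.
  by rewrite !a_diag uvE vuE; lia.
by move=> w wE; exists w.
Qed.


Let E_neq0 s : E s <> 0 /\ F s <> 0.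
Proof.
have /eqP h0 := drep_h_neq0 D s rat faith.
by split=> e0; apply: h0; have := cm_ef cm s s; rewrite eqxx e0 ?mxad0r // mxadC mxad0r oppr0.
Qed.

(** A non-zero stable subspace contains a non-zero element of the Cartan part, by [Lall_kernel].
    Injectivity of the Cartan matrix then gives some e_t, hence h_t, and the relations spread this
    along the diagram to all generators. *)
Let irr : irreducible_rep rho'.
Proof.
split.
  have [g gE] := gen_pre true s0; have [e0 _] := E_neq0 s0.
  have [i _] : exists i, g i 0 != 0.
    by apply: nz_coord; apply/eqP => g0; apply: e0; rewrite -gE g0 linear0.
  exact: leq_ltn_trans (ltn_ord i).
move=> U U0 UD Ust; have linU : linear_set U by split.
pose K := [set X | exists2 u, U u & iota u = X].
have linK : linear_set K.
  split=> [|c _ _ [u Uu <-] [v Uv <-]]; first by exists 0; rewrite ?linear0.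
  by exists (c *: u + v); [exact: UD | rewrite linearP].
have efK b s X : K X -> K (br (drep rho (gen_ef D b s)) X).
  move=> [u Uu <-]; exists (drep rho' (gen_ef D b s) *m u).
    by apply: (rep_stable_gen (D := D) rat' linU) => // t v; exact: Ust.
  exact: (iota_drep rat u rat' iotaE (gen_ef_lie D b s)).
have eK s X : K X -> K (br (E s) X) by exact: (efK true).
have fK s X : K X -> K (br (F s) X) by exact: (efK false).
have hK s X : K X -> K (br (H s) X).
  move=> KX; have := cm_ef cm s s; rewrite eqxx => <-.
  have -> : br (br (E s) (F s)) X = br (E s) (br (F s) X) - br (F s) (br (E s) X).
    by rewrite (br_jacobi lieM (E s)) addrK.
  by apply: (linear_setB linK); [apply: eK; exact: fK | apply: fK; exact: eK].
have [hK0|/existsNP[z /not_implyP[Kz /existsNP[u0 zu0]]]] :=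
    pselect (forall z : S -> C, K (\sum_s z s *: H s) -> forall s, z s = 0).
  left; apply/seteqP; split=> [u Uu|u ->] //.
  apply: iota0; apply: (Lall_kernel lieM a_diag pd ce linK eK fK hK hK0 (Liota u)).
  by exists u.
right.
have KeH s : K (E s) -> K (H s).
  by move=> Ke; have := fK s _ Ke; rewrite mxadC (cm_ef cm) eqxx => /(linear_setZ linK (-1)); rewrite scaleN1r opprK.
have Kcan (c : C) X : c != 0 -> K (c *: X) -> K X.
  by move=> c0 /(linear_setZ linK c^-1); rewrite scalerA mulVf // scale1r.
have KHe s t : K (H s) -> a s t != 0 -> K (E t).
  move=> KH st; have := eK t _ KH; rewrite mxadC (cm_he cm) -scaleNr; apply: Kcan.
  by rewrite oppr_eq0 intr_eq0.
have KHf s : K (H s) -> K (F s).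
  move=> KH; have := fK s _ KH; rewrite mxadC (cm_hf cm) -scaleNr opprK; apply: Kcan.
  by rewrite a_diag intr_eq0.
have [t nz] : exists t, \sum_s z s * (a s t)%:~R != 0.
  apply/not_existsP => H0; apply: zu0; apply: (cartan_injC pd) => t.
  by have /negP/negPn/eqP := H0 t.
have KEt : K (E t).
  have := eK t _ Kz; rewrite (br_sum lieM) (eq_bigr (fun s => - (z s * (a s t)%:~R) *: E t)) => [|s _]; last first.
    by rewrite mxadZr mxadC (cm_he cm) scalerN scalerA scaleNr.
  by rewrite -scaler_suml sumrN; apply: Kcan; rewrite oppr_eq0.
have allH s : K (H s).
  suff /asboolP : [pred s | `[< K (H s) >]] s by [].
  apply: indec => /=.
    by exists t; apply/asboolP; exact: KeH.
  move=> u v /asboolP KHu /asboolP nv; apply/eqP/negPn/negP => uv; apply: nv.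
  by apply: KeH; exact: KHe KHu uv.
have gens s : K (E s) /\ K (F s).
  by split; [apply: (KHe s s (allH s)); rewrite a_diag | exact: KHf].
apply/seteqP; split=> // u _.
have : K (iota u).
  apply: (L_ind0 linK allH _ (Liota u)) => w w0.
  elim: w w0 => // s [|v w] IH _; first exact: gens.
  by have [Ka Kb] := IH isT; split; [exact: (eK s _ Ka) | exact: (fK s _ Kb)].
by case=> v Uv /iota_inj <-.
Qed.

Let al_index s : exists i, wt i = al s.
Proof.
have [g gE] := gen_pre true s; have [e0 _] := E_neq0 s.
have [i gi] : exists i, g i 0 != 0.
  by apply: nz_coord; apply/eqP => g0; apply: e0; rewrite -gE g0 linear0.
exists i; rewrite (has_weight_coord wr (@hw_nestE [:: s] g gE) gi).
by apply: funext => t; rewrite /word_wt big_seq1.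
Qed.

Local Notation B := (algebra_generated (generalized_minors D)).

Let coefN i j : N i -> N j -> B (fun x => rho' x i j).
Proof.
have [c cP] := cartan_solveT pd (fun=> 1).
have [d0 _] := irr; have [i0 mx] := max_rat (height c wt true) d0.
have N0 : N i0.
  apply/NP => w0; have [k wk] := al_index s0.
  have := mx k; rewrite /height wk w0 !mul1r (_ : \sum_s c s * (al s0 s)%:~R = 1).
    by rewrite big1 // => s _; rewrite mulr0.
  by rewrite -[RHS](cP s0); apply: eq_bigr => s _; rewrite mulrC.
apply: (extremal_coef rat' wr cP irr N0 mx) => [k Nk|k l Nk].
  have [[w [s ws]] _] := root_orbit Nk; have [[w' [s' ws']] _] := root_orbit N0.
  have [w'' w''E] := al_conn s' s.
  by exists (w ++ w'' ++ rev w'); rewrite !iact_cat ws' iact_rev w''E ws.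
by have [_] := root_orbit Nk; exact.
Qed.

Let x_ i : 'M[C]_n := iota (delta_mx i 0).

Let iota_sum u : iota u = \sum_k u k 0 *: x_ k.
Proof.
rewrite {1}(matrix_sum_delta u) linear_sum; apply: eq_bigr => k _; by rewrite big_ord1 linearZ.
Qed.

Let xw i s : br (H s) (x_ i) = (wt i s)%:~R *: x_ i.
Proof. by move: s; apply/hw; exact: has_weight_delta. Qed.

Let count_neq0 (w : seq S) : w != [::] -> comb (fun t => (count_mem t w)%:Z) <> fun=> 0.
Proof.
case: w => // s w _; rewrite -comb0 => /combP/(congr1 (fun f => f s)) /=.
by rewrite eqxx.
Qed.

Let zero_hspan i : ~~ N i -> hspan H (x_ i).
Proof.
move=> Ni; have wi : wt i = fun=> 0 by apply: contrapT => /NP; rewrite (negPf Ni).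
rewrite /x_ -(pr_id (has_weight_delta wr i)) wi.
have lh := @hspan_linear C S _ H.
apply: (@L_ind [set u | hspan H (iota (pr (fun=> 0) u))]).
- split=> [|c u v hu hv] /=; last by rewrite pr_lin linearP; have [_] := lh; exact.
  rewrite (_ : pr _ 0 = 0) ?linear0; first by have [] := lh.
  by apply/colP => k; rewrite !mxE; case: ifP.
- by move=> u s uE /=; rewrite (pr_id (hw_H uE)) uE; exact: hspan_h.
- move=> u w w0 uE /=; rewrite (pr_0 (hw_nestE uE)) ?linear0; first by have [] := lh.
  by rewrite wwE => /esym; exact: count_neq0.
- move=> u w w0 uE /=; rewrite (pr_0 (hw_nestF uE)) ?linear0; first by have [] := lh.
  move=> E0; apply: (count_neq0 w0); rewrite -wwE; apply: funext => t.
  by have := congr1 (fun f => f t) E0; rewrite /= => /esym/eqP; rewrite oppr_eq0 => /eqP.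
Qed.

Let hspan_comm X Y : hspan H X -> hspan H Y -> br X Y = 0.
Proof.
move=> [z ->] [y ->]; rewrite (br_sum lieM) big1 // => t _; rewrite (brZ lieM) (br_anti lieM) (br_sum lieM).
by rewrite big1 ?oppr0 ?scaler0 // => s _; rewrite (brZ lieM) (ce_hh ce) scaler0.
Qed.

Let tr_br (X Y Z : 'M[C]_n) : \tr (br X Y *m Z) = - \tr (Y *m br X Z).
Proof.
rewrite /mxad mulmxBl mulmxBr !linearB /= opprB -!mulmxA [\tr (X *m _)]mxtrace_mulC.
by rewrite -!mulmxA.
Qed.

Let tr_H s t : \tr (H s *m H t) = (a s t)%:~R * \tr (E t *m F t).
Proof.
have := tr_br (E t) (H s) (F t); rewrite (cm_ef cm) eqxx mxadC (cm_he cm) mulNmx -scalemxAl.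
by rewrite linearN linearZ /= => /oppr_inj.
Qed.

(** The trace of the square of h_t is a sum of squares of integers, not all zero; by invariance it
    equals 2 tr(e_t f_t). *)
Let tr_EF t : \tr (E t *m F t) != 0.
Proof.
have : \tr (H t *m H t) != 0.
  have [wH _] := wrF; have /eqP h0 := drep_h_neq0 D t rat faith.
  rewrite wH mulmx_diag mxtrace_diag.
  have [i wi] : exists i, wtF i t != 0.
    apply/not_existsP => H0; apply: h0; rewrite wH; apply/matrixP => k l; rewrite !mxE.
    by have /negP/negPn/eqP -> := H0 k; rewrite mul0rn.
  have -> : \sum_k (\row_j ((\row_i (wtF i t)%:~R) 0 j * (\row_i (wtF i t)%:~R) 0 j)) 0 k = (\sum_k wtF k t ^+ 2)%:~R :> C.
    by rewrite rmorph_sum; apply: eq_bigr => k _; rewrite !mxE expr2 rmorphM.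
  rewrite intr_eq0 gt_eqF // (bigD1 i) //= ltr_wpDr //; last by rewrite exprn_even_gt0.
  by apply: sumr_ge0 => k _; exact: sqr_ge0.
by rewrite tr_H mulf_eq0 negb_or => /andP[].
Qed.

Let Phi : 'M[C]_d := \matrix_(i, j) \tr (x_ i *m x_ j).

Let tr_iota u v : \tr (iota u *m iota v) = (u^T *m Phi *m v) 0 0.
Proof.
rewrite (iota_sum u) (iota_sum v) mulmx_sumr linear_sum mxE; apply: eq_bigr => l _.
rewrite mulmx_suml linear_sum /= mxE mulr_suml; apply: eq_bigr => k _.
by rewrite -scalemxAl -scalemxAr scalerA mxtraceZ !mxE; ring.
Qed.

(** The radical of the trace form is stable under brackets, and it avoids the Cartan part because
    [tr_EF] and the Cartan matrix make the form non-degenerate there: [Lall_kernel] applies. *)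
Let Phi_unit : Phi \in unitmx.
Proof.
apply: unit_of_ker => u Pu.
pose K := [set X | L X /\ forall Y, L Y -> \tr (X *m Y) = 0].
have linK : linear_set K.
  split=> [|c X Y [LX HX] [LY HY]]; first by split=> [|Y _]; [have [] := linL | rewrite mul0mx mxtrace0].
  split=> [|Z LZ]; first by have [_] := linL; exact.
  by rewrite mulmxDl -scalemxAl mxtraceD mxtraceZ HX // HY // mulr0 addr0.
have stK X : (forall Y, L Y -> L (br X Y)) -> forall Y, K Y -> K (br X Y).
  by move=> st Y [LY HY]; split=> [|Z LZ]; [exact: st | rewrite tr_br HY ?oppr0 //; exact: st].
have eK s := stK _ (fun Y => @LE true s Y); have fK s := stK _ (fun Y => @LE false s Y).
have hK s := stK (H s) (fun Y LY => L_br (HL s) LY).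
have hK0 (z : S -> C) : K (\sum_s z s *: H s) -> forall s, z s = 0.
  move=> [_ Hz]; apply: (cartan_injC pd) => t; apply: (mulIf (tr_EF t)).
  rewrite mul0r -[RHS](Hz _ (HL t)) mulmx_suml linear_sum mulr_suml; apply: eq_bigr => s _.
  by rewrite -scalemxAl /= mxtraceZ tr_H mulrA.
apply: iota0; apply: (Lall_kernel lieM a_diag pd ce linK eK fK hK hK0 (Liota u)).
split=> // _ /iotaL[v ->].
rewrite mxtrace_mulC tr_iota -mulmxA Pu mulmx0 mxE //.
Qed.

Let wt_opp i j (M : 'M[C]_d) : (forall s, (wt i s + wt j s)%:~R * M i j = 0) -> M i j != 0 -> N i = N j.
Proof.
move=> wM nz; have wE s : wt i s = - wt j s.
  by have /eqP := wM s; rewrite mulf_eq0 (negPf nz) orbF intr_eq0 addr_eq0 => /eqP.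
apply/existsP/existsP => -[s ws]; exists s; move: ws; by rewrite wE oppr_eq0.
Qed.

Let br_conj g X Y : rho g *m br X Y *m rho (g^-1)%g =
  br (rho g *m X *m rho (g^-1)%g) (rho g *m Y *m rho (g^-1)%g).
Proof.
have gg : rho (g^-1)%g *m rho g = 1%:M by apply: mulmx1C; exact: rep_inv.
have c Z W : (rho g *m Z *m rho (g^-1)%g) *m (rho g *m W *m rho (g^-1)%g) = rho g *m (Z *m W) *m rho (g^-1)%g.
  by rewrite -!mulmxA (mulmxA (rho (g^-1)%g)) gg mul1mx.
by rewrite /mxad !c mulmxBr mulmxBl.
Qed.

Let Phi_inv g : (rho' g)^T *m Phi *m rho' g = Phi.
Proof.
apply/matrixP => i j.
have pick (M : 'M[C]_d) : ((delta_mx i 0 : 'cV[C]_d)^T *m M *m (delta_mx j 0 : 'cV[C]_d)) 0 0 = M i j.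
  by rewrite trmx_delta -rowE -colE !mxE.
have := tr_iota (rho' g *m delta_mx i 0) (rho' g *m delta_mx j 0).
rewrite trmx_mul !mulmxA -(mulmxA _ _ Phi) -(mulmxA _ _ (rho' g)) pick => <-.
rewrite !iotaE [RHS]mxE -/(x_ i) -/(x_ j).
rewrite mxtrace_mulC !mulmxA -(mulmxA _ (rho (g^-1)%g) (rho g)) (mulmx1C (rep_inv rat g)) mulmx1.
rewrite -!mulmxA mxtrace_mulC -!mulmxA (mulmx1C (rep_inv rat g)) mulmx1.
by rewrite mxtrace_mulC.
Qed.

(** An isolated vertex would be the whole diagram, with Cartan matrix (2), which is not
    unimodular. *)
Let neighbour s : exists2 t, t != s & a t s != 0.
Proof.
apply: contrapT => no; have only t : t = s.
  apply/eqP; suff : pred1 s t by [].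
  apply: indec; first by exists s => /=.
  move=> u v /eqP -> /= vs; apply: a_sym; apply/eqP/negPn/negP => vs0; apply: no; by exists v.
have [x /(_ s)] := unimodular (fun=> 1).
rewrite (bigD1 s) //= a_diag big1 ?addr0 => [|t ts]; first by lia.
by move: ts; rewrite (only t) eqxx.
Qed.

(** The equivariant product is the Lie bracket and the invariant form is the trace form; non-zero
    weights are extremal because the roots form a single orbit. *)
Theorem adjoint_coefs : (forall i j, B (fun x => rho' x i j)) /\ forall s, exists i, forall t, wt i t = a t s.
Proof.
split; last by move=> s; have [i wi] := al_index s; exists i => t; rewrite wi.
have [ub ubE] := choice (fun p : 'I_d * 'I_d => pre (L_br (Liota (delta_mx p.1 0)) (Liota (delta_mx p.2 0)))).
have ubw k l : has_weight D rho' (fun s => wt k s + wt l s) (ub (k, l)).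
  apply/hw => s; rewrite ubE (br_jacobi lieM) xw xw (brZl lieM) (brZ lieM) -scalerDl rmorphD //.
pose mu k : 'M[C]_d := \matrix_(i, l) ub (k, l) i 0.
have brS u v : br (iota u) (iota v) = \sum_k \sum_l (u k 0 * v l 0) *: br (x_ k) (x_ l).
  rewrite (iota_sum u) (iota_sum v) (br_anti lieM) (br_sum lieM) -sumrN; apply: eq_bigr => k _.
  rewrite (brZ lieM) -scalerN -(br_anti lieM) (br_sum lieM) scaler_sumr; apply: eq_bigr => l _.
  by rewrite (brZ lieM) scalerA.
have ub_sum u v w : iota w = br (iota u) (iota v) -> w = \sum_k \sum_l (u k 0 * v l 0) *: ub (k, l).
  move=> wE; apply: iota_inj; rewrite wE brS linear_sum; apply: eq_bigr => k _; rewrite linear_sum.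
  by apply: eq_bigr => l _; rewrite linearZ /= ubE.
have muE x k l i : \sum_k' \sum_l' rho' x k' k * rho' x l' l * mu k' i l' = \sum_j rho' x i j * mu k j l.
  have := @ub_sum (rho' x *m delta_mx k 0) (rho' x *m delta_mx l 0) (rho' x *m ub (k, l)).
  rewrite !iotaE -br_conj ubE => /(_ erefl)/colP/(_ i); rewrite mxE.
  rewrite (eq_bigr (fun j => rho' x i j * mu k j l)) => [->|j _]; last by rewrite [mu _ _ _]mxE.
  rewrite summxE; apply: eq_bigr => k' _; rewrite summxE; apply: eq_bigr => l' _.
  by rewrite -!colE !mxE.
(* A bracket has weight zero only for opposite weights, which vanish together. If both are zero, the
   factors lie in the Cartan part and commute. *)
have muZ i k l : ~~ N i -> mu k i l != 0 -> N k && N l.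
  move=> Ni; rewrite mxE => nz.
  have wi : wt i = fun=> 0 by apply: contrapT => /NP; rewrite (negPf Ni).
  have wkl s : wt k s + wt l s = 0.
    by have := congr1 (fun f => f s) (has_weight_coord wr (ubw k l) nz); rewrite wi.
  have NN : N k = N l.
    by apply/existsP/existsP => -[s ws]; exists s; move: ws (wkl s); move: (wt k s) (wt l s); clear; lia.
  rewrite NN andbb; apply: contraT => Nl; have Nk : ~~ N k by rewrite NN.
  have /iota0 u0 : iota (ub (k, l)) = 0 by rewrite ubE; exact: hspan_comm (zero_hspan Nk) (zero_hspan Nl).
  by rewrite u0 mxE eqxx in nz.
pose Sp := [set u : 'cV[C]_d | exists t : 'I_d -> 'I_d -> C, (forall k l, t k l != 0 -> N k && N l) /\
   u = \sum_k \sum_l t k l *: ub (k, l)].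
have linSp : linear_set Sp.
  split=> [|c u v [t [tN ->]] [t' [tN' ->]]].
    by exists (fun _ _ => 0); split=> [k l|]; [rewrite eqxx | rewrite big1 // => k _; rewrite big1 // => l _; rewrite scale0r].
  exists (fun k l => c * t k l + t' k l); split=> [k l|].
    have [tkl|tkl] := eqVneq (t k l) 0; last by move=> _; exact: tN.
    by rewrite tkl mulr0 add0r; exact: tN'.
  rewrite scaler_sumr -big_split; apply: eq_bigr => k _; rewrite scaler_sumr -big_split; apply: eq_bigr => l _.
  by rewrite /= scalerDl scalerA.
have SpB u v w mu1 mu2 : has_weight D rho' mu1 u -> has_weight D rho' mu2 v -> mu1 <> (fun=> 0) -> mu2 <> (fun=> 0) ->
    iota w = br (iota u) (iota v) -> Sp w.
  move=> hu hv m1 m2 wE; exists (fun k l => u k 0 * v l 0); split; last exact: ub_sum.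
  move=> k l; rewrite mulf_eq0 negb_or => /andP[uk vl]; apply/andP; split; apply/NP.
    by rewrite (has_weight_coord wr hu uk).
  by rewrite (has_weight_coord wr hv vl).
have cE w : w != [::] -> word_wt a w <> fun=> 0 by rewrite wwE; exact: count_neq0.
have cF w : w != [::] -> (fun t => - word_wt a w t) <> fun=> 0.
  move=> w0 E0; apply: (cE w w0); apply: funext => t.
  by have := congr1 (fun f => f t) E0; rewrite /= => /eqP; rewrite oppr_eq0 => /eqP.
have allSp : forall u, Sp u.
  apply: L_ind => //.
  - move=> w s wE; have [u uE] := gen_pre true s; have [v vE] := gen_pre false s.
    apply: (SpB u v w _ _ (@hw_nestE [:: s] u uE) (@hw_nestF [:: s] v vE) (cE [:: s] isT) (cF [:: s] isT)).
    by rewrite uE vE wE (cm_ef cm) eqxx.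
  - move=> w [//|s [|t r]] _ wE.
      (* A simple root vector is not visibly a bracket of vectors of non-zero weight. With a
         neighbour t, the element [[e_s, e_t], f_t] is a non-zero multiple of e_s. *)
      have [t ts nz] := neighbour s; have [L1 _] := @nestL [:: s; t] isT; have [u uE] := pre L1.
      have [v vE] := gen_pre false t.
      have e1 : br (iota u) (iota v) = - (a t s)%:~R *: E s.
        rewrite uE vE mxadC /= (br_jacobi lieM) [br (F t) (E s)](br_anti lieM) [br (F t) (E t)](br_anti lieM).
        rewrite !(cm_ef cm) eq_sym (negPf ts) eqxx oppr0 (br0l lieM) add0r -scaleN1r (brZ lieM).
        by rewrite (br_anti lieM) (cm_he cm) scaleN1r opprK scaleNr.
      have nz' : - (a t s)%:~R != 0 :> C by rewrite oppr_eq0 intr_eq0.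
      have [w' w'E] := pre (L_br (Liota u) (Liota v)).
      have Sw := SpB u v w' _ _ (@hw_nestE [:: s; t] u uE) (@hw_nestF [:: t] v vE) (cE [:: s; t] isT) (cF [:: t] isT) w'E.
      have -> : w = (- (a t s)%:~R)^-1 *: w'.
        by apply: iota_inj; rewrite linearZ /= w'E e1 scalerA mulVf // scale1r.
      exact: (linear_setZ linSp).
    have [L1 _] := @nestL (t :: r) isT; have [v vE] := pre L1; have [u uE] := gen_pre true s.
    apply: (SpB u v w _ _ (@hw_nestE [:: s] u uE) (@hw_nestE (t :: r) v vE) (cE [:: s] isT) (cE (t :: r) isT)).
    by rewrite uE vE wE.
  - move=> w [//|s [|t r]] _ wE.
      have [t ts nz] := neighbour s; have [_ L1] := @nestL [:: s; t] isT; have [u uE] := pre L1.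
      have [v vE] := gen_pre true t.
      have e1 : br (iota u) (iota v) = - (a t s)%:~R *: F s.
        rewrite uE vE mxadC /= (br_jacobi lieM) !(cm_ef cm) (negPf ts) eqxx (br0l lieM) add0r.
        by rewrite (br_anti lieM) (cm_hf cm) opprK.
      have nz' : - (a t s)%:~R != 0 :> C by rewrite oppr_eq0 intr_eq0.
      have [w' w'E] := pre (L_br (Liota u) (Liota v)).
      have Sw := SpB u v w' _ _ (@hw_nestF [:: s; t] u uE) (@hw_nestE [:: t] v vE) (cF [:: s; t] isT) (cE [:: t] isT) w'E.
      have -> : w = (- (a t s)%:~R)^-1 *: w'.
        by apply: iota_inj; rewrite linearZ /= w'E e1 scalerA mulVf // scale1r.
      exact: (linear_setZ linSp).
    have [_ L1] := @nestL (t :: r) isT; have [v vE] := pre L1; have [u uE] := gen_pre false s.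
    apply: (SpB u v w _ _ (@hw_nestF [:: s] u uE) (@hw_nestF (t :: r) v vE) (cF [:: s] isT) (cF (t :: r) isT)).
    by rewrite uE vE wE.
have mu_span j : exists t : 'I_d -> 'I_d -> C, (forall k l, t k l != 0 -> N k && N l) /\
    forall i, \sum_k \sum_l t k l * mu k i l = (i == j)%:R.
  have [t [tN tE]] := allSp (delta_mx j 0); exists t; split=> // i.
  have /colP/(_ i) := tE; rewrite !mxE eqxx andbT => ->; rewrite summxE; apply: eq_bigr => k _.
  by rewrite summxE; apply: eq_bigr => l _; rewrite !mxE.
have wD s : diag_mx (\row_i (wt i s)%:~R) *m Phi = - (Phi *m diag_mx (\row_i (wt i s)%:~R)).
  apply/matrixP => i j; rewrite mul_diag_mx mxE [RHS]mxE mul_mx_diag !mxE.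
  rewrite -mxtraceZ scalemxAl -xw tr_br xw -scalemxAr mxtraceZ mulrC //.
apply: (quasi_minuscule_coef (algebra_generated_subalgebra _) muE muZ mu_span (Phi := Phi) (Phi' := invmx Phi)) => //.
- move=> x; rewrite rep_invmx // -[LHS]mul1mx -(mulVmx Phi_unit) -{2}(Phi_inv x) -!mulmxA mulmxV ?mulmx1 //.
  exact: rep_unit.
- move=> i j; apply: wt_opp => s; have /matrixP/(_ i j) := wD s; rewrite mul_diag_mx mxE [RHS]mxE mul_mx_diag.
  by rewrite mxE [in X in _ = - X]mxE => E0; rewrite rmorphD /= mulrDl E0 mxE [X in - (_ * X)]mxE mulrC addNr.
- move=> i j; apply: wt_opp => s.
  have wD' : diag_mx (\row_i (wt i s)%:~R) *m invmx Phi = - (invmx Phi *m diag_mx (\row_i (wt i s)%:~R)).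
    have := congr1 (fun M => invmx Phi *m M *m invmx Phi) (wD s).
    rewrite mulmxN mulNmx !mulmxA mulVmx // mul1mx -!mulmxA mulmxV // mulmx1 => ->; by rewrite opprK.
  have /matrixP/(_ i j) := wD'; rewrite mul_diag_mx mxE [RHS]mxE mul_mx_diag [in X in _ = - X]mxE.
  by move: (invmx Phi i j) => y; rewrite !mxE => E0; rewrite rmorphD /= mulrDl E0 mulrC addNr.
Qed.

End Adjoint.

(** * The seven-dimensional representation of type G2 *)

Section IntegerTables.
Variables (C : numClosedFieldType) (n : nat).
(** Integral matrices as functions on natural numbers, so that their identities can be decided by
    computation and then mapped to [C]. *)
Definition table := nat -> nat -> int.
Implicit Types f g : table.

Definition sparse (l : seq (nat * nat * int)) : table := fun i j =>
  foldr (fun p acc => if (p.1.1 == i) && (p.1.2 == j) then p.2 else acc) 0 l.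
Definition tmul f g : table := fun i j => foldr (fun k acc => f i k * g k j + acc) 0 (iota 0 n).
Definition tbr f g : table := fun i j => tmul f g i j - tmul g f i j.
Definition tscale (c : int) f : table := fun i j => c * f i j.
Definition teq f g : bool := all (fun i => all (fun j => f i j == g i j) (iota 0 n)) (iota 0 n).
Definition tmx f : 'M[C]_n := \matrix_(i, j) (f i j)%:~R.

Lemma teqP f g : teq f g -> forall i j : 'I_n, f i j = g i j.
Proof.
move=> /allP H i j; have mem (k : 'I_n) : (k : nat) \in iota 0 n by rewrite mem_iota add0n ltn_ord.
by have /allP/(_ _ (mem j))/eqP := H _ (mem i).
Qed.

Lemma tmx_eq f g : teq f g -> tmx f = tmx g.
Proof. by move=> /teqP H; apply/matrixP => i j; rewrite !mxE H. Qed.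

Lemma tmx_mul f g : tmx f *m tmx g = tmx (tmul f g).
Proof.
apply/matrixP => i j; rewrite !mxE (eq_bigr (fun k : 'I_n => (f i k)%:~R * (g k j)%:~R)).
  rewrite -(big_mkord xpredT (fun k => (f i k)%:~R * (g k j)%:~R : C)) /index_iota subn0 /tmul.
  by elim: (iota 0 n) => [|k r IH]; rewrite ?big_nil // big_cons IH /= rmorphD rmorphM.
by move=> k _; rewrite !mxE.
Qed.

Lemma tmx_br f g : mxad (tmx f) (tmx g) = tmx (tbr f g).
Proof. by rewrite /mxad !tmx_mul; apply/matrixP => i j; rewrite !mxE rmorphB. Qed.

Lemma tmx_scale c f : c%:~R *: tmx f = tmx (tscale c f).
Proof. by apply/matrixP => i j; rewrite !mxE rmorphM. Qed.

Lemma tmx0 f : teq f (fun _ _ => 0) -> tmx f = 0.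
Proof. by move=> /teqP H; apply/matrixP => i j; rewrite !mxE H. Qed.

End IntegerTables.

Section Intertwining.
Variable C : numClosedFieldType.

Lemma mexp_derivation d n (iota : {linear 'cV[C]_d -> 'M[C]_n}) (X' : 'M[C]_d) (X : 'M[C]_n) u :
  nilpotent_mx X' -> nilpotent_mx X -> (forall u, iota (X' *m u) = mxad X (iota u)) ->
  iota (mexp X' *m u) = mexp X *m iota u *m mexp (- X).
Proof.
move=> [N XN] nX eqv; have [K [K0 ->]] := mexp_conj (iota u) nX.
have it k : iota (X' ^+ k *m u) = iter k (mxad X) (iota u).
  by elim: k => [|k IH]; rewrite ?expr0 ?mul1mx // exprS -[X' * _]/(X' *m _) -mulmxA eqv IH.
rewrite (mexpE (nilpotent_le XN (leq_addl K N))) /mexp_upto mulmx_suml linear_sum big_split_ord /=.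
rewrite [X in _ + X]big1 ?addr0 => [|k _].
  by apply: eq_bigr => k _; rewrite -scalemxAl linearZ /= it.
rewrite -scalemxAl linearZ /= it addnC iterD K0.
suff -> : iter k (mxad X) 0 = 0 by rewrite scaler0.
by elim: (k : nat) => [|l IH] //=; rewrite IH mxad0r.
Qed.

Lemma trmx_mexp n (M : 'M[C]_n) : nilpotent_mx M -> (mexp M)^T = mexp M^T.
Proof.
move=> [N MN]; have trX k : (M ^+ k)^T = M^T ^+ k.
  elim: k => [|k IH]; first by rewrite !expr0 trmx1.
  by rewrite exprS exprSr -[M * _]/(M *m _) trmx_mul IH.
have MN' : M^T ^+ N = 0 by rewrite -trX MN trmx0.
rewrite (mexpE MN) (mexpE MN') /mexp_upto linear_sum; apply: eq_bigr => k _.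
by rewrite linearZ /= trX.
Qed.

End Intertwining.

Section G2Tables.

(** [true] stands for the long simple root. The seven weights form a chain, along which the basis is
    ordered; the entries 2 come from the three-term string of the short root through the zero
    weight, which has index 3. *)
Definition g2E (b : bool) : table :=
  if b then sparse [:: (1, 2, 1 : int); (4, 5, 1 : int)]%N
  else sparse [:: (0, 1, 1 : int); (2, 3, 2 : int); (3, 4, 1 : int); (5, 6, 1 : int)]%N.
Definition g2F (b : bool) : table :=
  if b then sparse [:: (2, 1, 1 : int); (5, 4, 1 : int)]%N
  else sparse [:: (1, 0, 1 : int); (3, 2, 1 : int); (4, 3, 2 : int); (6, 5, 1 : int)]%N.
Definition g2wt (b : bool) (i : nat) : int :=
  nth 0 (if b then [:: 0; 1; -1; 0; 1; -1; 0] else [:: 1; -1; 2; 0; -2; 1; -1]) i.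
Definition g2H (b : bool) : table := fun i j => if i == j then g2wt b i else 0.
Definition g2cartan (b b' : bool) : int := if b == b' then 2 else if b then -1 else -3.

(* The cross product of the imaginary octonions: [g2mu k] is the matrix of the
   product with the k-th weight vector. *)
Definition g2mu (k : nat) : table := sparse (nth [::] [::
  [:: (0, 3, -2 : int); (1, 4, -2 : int); (2, 5, -2 : int); (3, 6, -1 : int)];
  [:: (0, 2, 2 : int); (1, 3, 2 : int); (3, 5, -1 : int); (4, 6, -2 : int)];
  [:: (0, 1, -2 : int); (2, 3, 2 : int); (3, 4, 1 : int); (5, 6, -2 : int)];
  [:: (0, 0, 2 : int); (1, 1, -2 : int); (2, 2, -2 : int); (4, 4, 2 : int); (5, 5, 2 : int); (6, 6, -2 : int)];
  [:: (1, 0, 2 : int); (3, 2, -1 : int); (4, 3, -2 : int); (6, 5, 2 : int)];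
  [:: (2, 0, 2 : int); (3, 1, 1 : int); (5, 3, -2 : int); (6, 4, -2 : int)];
  [:: (3, 0, 1 : int); (4, 1, 2 : int); (5, 2, 2 : int); (6, 3, 2 : int)]]%N k).
Definition g2Phi : table :=
  sparse [:: (0, 6, 1 : int); (1, 5, -1 : int); (2, 4, 1 : int); (3, 3, -2 : int); (4, 2, 1 : int); (5, 1, -1 : int); (6, 0, 1 : int)]%N.
(** Twice the inverse of [g2Phi], to keep the entries integral. *)
Definition g2Phi' : table :=
  sparse [:: (0, 6, 2 : int); (1, 5, -2 : int); (2, 4, 2 : int); (3, 3, -1 : int); (4, 2, 2 : int); (5, 1, -2 : int); (6, 0, 2 : int)]%N.
(** Two indices of non-zero weight whose cross product is a non-zero multiple of the j-th basis
    vector. *)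
Definition g2pair (j : nat) : nat * nat := nth (0, 0)%N
  [:: (1, 2); (4, 0); (5, 0); (6, 0); (6, 1); (6, 2); (4, 5)]%N j.

End G2Tables.

Section TypeG2.
Variables (C : numClosedFieldType) (G : affineGroup C) (S : finType).
Variable D : chevalley_data G S.
Hypothesis scG : simply_connected G.
Local Notation a := (cartan D).
Local Notation A := (coord_ring G).
Local Notation subA := (coord_ring_subalgebra G).
Variables (s t : S).
Hypothesis st : s != t.
Hypothesis ast : a s t = -1.
Hypothesis ats : a t s = -3.
Hypothesis allst : forall u, u = s \/ u = t.
Local Notation tm := (@tmx C 7).
Local Notation E := (fun x : S => tm (g2E (x == s))).
Local Notation F := (fun x : S => tm (g2F (x == s))).
Local Notation H := (fun x : S => tm (g2H (x == s))).
Let wt (i : 'I_7) (x : S) : int := g2wt (x == s) i.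

Let aE x y : a x y = g2cartan (x == s) (y == s).
Proof.
have [a_diag _ _] := cartanP D; have ts : (t == s) = false by rewrite eq_sym (negPf st).
by case: (allst x) => ->; case: (allst y) => ->; rewrite ?eqxx ?ts ?a_diag ?ast ?ats.
Qed.

Let eqE x y : (x == y) = ((x == s) == (y == s)).
Proof.
have ts : (t == s) = false by rewrite eq_sym (negPf st).
by case: (allst x) => ->; case: (allst y) => ->; rewrite ?eqxx ?ts ?(negPf st).
Qed.

Let cm : chevalley_mx a E F H.
Proof.
split=> [x y|x y|x y|x y|x|x].
- by rewrite tmx_br; apply: tmx0; case: (x == s); case: (y == s); vm_compute.
- rewrite tmx_br (eqE x y); case: ifP.
    by case: (x == s); case: (y == s) => // _; apply: tmx_eq; vm_compute.
  by case: (x == s); case: (y == s) => // _; apply: tmx0; vm_compute.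
- by rewrite tmx_br aE tmx_scale; apply: tmx_eq; case: (x == s); case: (y == s); vm_compute.
- by rewrite tmx_br aE -rmorphN tmx_scale; apply: tmx_eq; case: (x == s); case: (y == s); vm_compute.
- by exists 3; rewrite !exprS expr0 mulr1 -[_ * _]/(_ *m (_ *m _)) !tmx_mul; apply: tmx0; case: (x == s); vm_compute.
- by exists 3; rewrite !exprS expr0 mulr1 -[_ * _]/(_ *m (_ *m _)) !tmx_mul; apply: tmx0; case: (x == s); vm_compute.
Qed.

Let HE x : H x = diag_mx (\row_i (wt i x)%:~R).
Proof. by apply/matrixP => i j; rewrite !mxE /g2H -val_eqE; case: ifP => //= _; rewrite mulr0n. Qed.

Let wt_inj : injective wt.
Proof.
move=> i j Eij; have ts : (t == s) = false by rewrite eq_sym (negPf st).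
have := congr1 (fun f => f s) Eij; have := congr1 (fun f => f t) Eij; rewrite /wt eqxx ts.
move=> h1 h2; apply/eqP; move: h1 h2.
by case: i {Eij} => [[|[|[|[|[|[|[|?]]]]]]] ?] //; case: j => [[|[|[|[|[|[|[|?]]]]]]] ?].
Qed.

Let gen : mx_generated E F.
Proof.
move=> Q linQ Q1 QM QEF X.
have ts : (t == s) = false by rewrite eq_sym (negPf st).
have QH x : Q (diag_mx (\row_i (wt i x)%:~R)).
  rewrite -HE; have := cm_ef cm x x; rewrite eqxx => <-; have [QE QF] := QEF x.
  by apply: (linear_setB linQ); exact: QM.
have Qii := weight_units linQ Q1 QM wt_inj QH.
have pick f (i j : 'I_7) : Q (tm f) -> f i j != 0 -> Q (delta_mx i j).
  move=> Qf fij; have := linear_setZ linQ (f i j)%:~R^-1 (QM _ _ (QM _ _ (Qii i) Qf) (Qii j)); congr Q.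
  apply/matrixP => k l; rewrite mxE mxE (bigD1 j) //= [X in _ + X]big1 ?addr0 => [|m mj]; last first.
    by rewrite [X in _ * X]mxE (negPf mj) mulr0.
  rewrite [(delta_mx i i *m tm f) k j]mxE (bigD1 i) //= [X in _ + X]big1 ?addr0 => [|m mi]; last by rewrite mxE (negPf mi) andbF mul0r.
  rewrite !mxE !eqxx andbT /=; case: (k == i); rewrite ?mul0r ?mulr0 //= mul1r.
  by rewrite mulrA mulVf ?mul1r // intr_eq0.
have step (i : nat) (H0 : (i.+1 < 7)%N) : Q (delta_mx (inord i : 'I_7) (inord i.+1 : 'I_7)) /\ Q (delta_mx (inord i.+1 : 'I_7) (inord i : 'I_7)).
  have [QEs QFs] := QEF s; have [QEt QFt] := QEF t; rewrite eqxx in QEs QFs; rewrite ts in QEt QFt.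
  case: i H0 => [|[|[|[|[|[|i]]]]]] // _; split;
    solve [apply: (pick _ _ _ QEs); rewrite !inordK //; vm_compute | apply: (pick _ _ _ QFs); rewrite !inordK //; vm_compute
          | apply: (pick _ _ _ QEt); rewrite !inordK //; vm_compute | apply: (pick _ _ _ QFt); rewrite !inordK //; vm_compute].
have from0 (i : nat) : (i < 7)%N -> Q (delta_mx (inord i : 'I_7) (inord 0 : 'I_7)) /\ Q (delta_mx (inord 0 : 'I_7) (inord i : 'I_7)).
  elim: i => [_|i IH i7]; first by split; exact: Qii.
  have [Qa Qb] := IH (ltnW i7); have [Qc Qd] := step i i7.
  split; first by have := QM _ _ Qd Qa; rewrite mul_delta_mx.
  by have := QM _ _ Qb Qc; rewrite mul_delta_mx.
rewrite (matrix_sum_delta X); apply: (linear_set_sum linQ) => i _; apply: (linear_set_sum linQ) => j _.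
apply: (linear_setZ linQ); have [Qa _] := from0 i (ltn_ord i); have [_ Qb] := from0 j (ltn_ord j).
by have := QM _ _ Qa Qb; rewrite mul_delta_mx !inord_val.
Qed.

Let W (p q : int) (x : S) : int := if x == s then p else q.

Let reflW (b : bool) p q : irefl D (if b then s else t) (W p q) = if b then W (- p) (q + 3 * p) else W (p + q) (- q).
Proof.
have ts : (t == s) = false by rewrite eq_sym (negPf st).
apply: funext => x; rewrite /irefl aE; case: b; rewrite /W ?eqxx ?ts; case: (x == s); rewrite /g2cartan /=; lia.
Qed.

(** Invariance of the product and of the form is checked infinitesimally on the tables,
    exponentiated to words and extended by density. The six non-zero weights form one orbit, reached
    by alternating reflections, and the first two weights already span the weight lattice. *)
Theorem g2_rep : exists rho : G -> 'M[C]_7, [/\ rational_rep rho, weight_rep D rho wt,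
  forall i j, algebra_generated (generalized_minors D) (fun x => rho x i j) &
  forall u, exists z : 'I_7 -> int, forall v, \sum_i z i * wt i v = (u == v)%:R].
Proof.
have ts : (t == s) = false by rewrite eq_sym (negPf st).
have [connG _] := scG.
have [rho [rat wr irr dE dF]] := cover_weight_rep scG (isT : (0 < 7)%N) cm gen HE; have [r1 rM rA] := rat.
exists rho; split=> //; last first.
  move=> u; have w0 v : wt ord0 v = (t == v)%:R.
    by rewrite /wt (eqE t v) ts; case: (v == s).
  have w1 v : wt (inord 1) v = (s == v)%:R - (t == v)%:R.
    by rewrite /wt inordK // (eqE s v) (eqE t v) ts eqxx; case: (v == s).
  have d1 : (inord 1 == ord0 :> 'I_7) = false by rewrite -val_eqE /= inordK.
  case: (allst u) => ->.
    exists (fun i => (i == ord0)%:R + (i == inord 1)%:R) => v.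
    rewrite (bigD1 ord0) //= (bigD1 (inord 1)) /= ?d1 // big1 => [|i /andP[/negPf -> /negPf ->]]; last by rewrite mul0r.
    by rewrite ?eqxx [ord0 == _]eq_sym d1 ?eqxx w0 w1 ?mulr0n ?mulr1n !addr0 ?add0r !mul1r addrC subrK.
  exists (fun i => (i == ord0)%:R) => v.
  by rewrite (bigD1 ord0) //= ?eqxx mul1r w0 big1 ?addr0 // => i /negPf ->; rewrite mul0r.
pose N (i : 'I_7) := (i != 3 :> nat).
have coefN i j : N i -> N j -> algebra_generated (generalized_minors D) (fun x => rho x i j).
  have [c cP] := cartan_solveT (cartan_posdef D) (fun=> 1).
  have [i0 mx] := max_rat (height c wt true) (isT : (0 < 7)%N).
  have N0 : N i0.
    apply/negP => /eqP i03; have := mx (inord 2); rewrite leNgt => /negP; apply.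
    apply: (height_gen cP (b := true) (s := t) rat wr); rewrite /= dE ts mxE i03 inordK //.
    by rewrite intr_eq0.
  have toW (k : 'I_7) p q : g2wt true k = p -> g2wt false k = q -> wt k = W p q.
    by move=> e1 e2; apply: funext => x; rewrite /wt /W; case: (x == s).
  have from0 k : N k -> exists w, iact D w (W 0 1) = wt k.
    have R1 p q : irefl D s (W p q) = W (- p) (q + 3 * p) := reflW true p q.
    have R2 p q : irefl D t (W p q) = W (p + q) (- q) := reflW false p q.
    case: k => [[|[|[|[|[|[|[|k]]]]]]] Hk] //= _.
    - by exists [::]; apply/esym; apply: toW.
    - by exists [:: t]; rewrite /= R2; apply/esym; apply: toW.
    - by exists [:: s; t]; rewrite /= R2 R1; apply/esym; apply: toW.
    - by exists [:: t; s; t]; rewrite /= R2 R1 R2; apply/esym; apply: toW.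
    - by exists [:: s; t; s; t]; rewrite /= R2 R1 R2 R1; apply/esym; apply: toW.
    - by exists [:: t; s; t; s; t]; rewrite /= R2 R1 R2 R1 R2; apply/esym; apply: toW.
  apply: (extremal_coef rat wr cP irr N0 mx) => [k Nk|k l _ /wt_inj //].
  have [w wE] := from0 k Nk; have [w' wE'] := from0 i0 N0.
  by exists (w ++ rev w'); rewrite iact_cat -wE' iact_rev.
pose io (u : 'cV[C]_7) : 'M[C]_7 := \sum_k u k 0 *: tm (g2mu k).
have io_lin : linear io.
  move=> c u v; rewrite /io scaler_sumr -big_split; apply: eq_bigr => i _ /=.
  by rewrite !mxE scalerDl scalerA.
pose ioL := GRing.isLinear.Build C 'cV[C]_7 'M[C]_7 _ io io_lin.
pose imx : {linear 'cV[C]_7 -> 'M[C]_7} := HB.pack io ioL.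
have io_delta k : io (delta_mx k 0) = tm (g2mu k).
  rewrite /io (bigD1 k) //= mxE !eqxx scale1r big1 ?addr0 // => l lk.
  by rewrite mxE (negPf lk) scale0r.
have der b x u : imx (drep rho (gen_ef D b x) *m u) = mxad (drep rho (gen_ef D b x)) (imx u).
  have -> : drep rho (gen_ef D b x) = tm (if b then g2E (x == s) else g2F (x == s)).
    by case: b; rewrite /gen_ef ?dE ?dF.
  set f := (if b then _ else _).
  have base (k : 'I_7) : io (tm f *m delta_mx k 0) = mxad (tm f) (tm (g2mu k)).
    rewrite tmx_br /io; apply/matrixP => i j; rewrite summxE [RHS]mxE.
    transitivity ((foldr (fun l acc => f l k * g2mu l i j + acc) 0 (iota 0 7))%:~R : C).
      rewrite (eq_bigr (fun l : 'I_7 => (f l k)%:~R * (g2mu l i j)%:~R)) => [|l _]; last by rewrite -colE !mxE.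
      rewrite -(big_mkord xpredT (fun l => (f l k)%:~R * (g2mu l i j)%:~R : C)) /index_iota subn0.
      by elim: (iota 0 7) => [|l r IH]; rewrite ?big_nil // big_cons IH /= rmorphD rmorphM.
    congr (_%:~R); apply/eqP.
    have chk : all (fun k => teq 7 (fun i j => foldr (fun l acc => f l k * g2mu l i j + acc) 0 (iota 0 7)) (tbr 7 f (g2mu k))) (iota 0 7).
      by rewrite /f; case: (b); case: (x == s); vm_compute.
    have /allP/(_ k) := chk; rewrite mem_iota add0n ltn_ord => /(_ isT)/teqP/(_ i j) ->.
    by [].
  rewrite [in LHS](matrix_sum_delta u) [in RHS](matrix_sum_delta u) mulmx_sumr !linear_sum.
  have lie := mxad_lie C 7; rewrite (br_sum lie); apply: eq_bigr => k _.
  by rewrite !big_ord1 -scalemxAr !linearZ /= mxadZr base io_delta.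
have iow w u : imx (rho (word_elt D w) *m u) = rho (word_elt D w) *m imx u *m rho ((word_elt D w)^-1)%g.
  elim: w u => [|p w IH] u /=; first by rewrite invg1 r1 !mul1mx mulmx1.
  rewrite invgM root_elt_V !rM !rep_root_elt // -mulmxA scaleNr.
  have nl : nilpotent_mx (p.2 *: drep rho (gen_ef D p.1.1 p.1.2)) by apply: nilpotentZ; exact: rep_nilpotent.
  rewrite -[io _]/(imx _) (mexp_derivation _ nl nl) => [|v]; first by rewrite -[io _]/(imx _) IH !mulmxA.
  by rewrite -scalemxAl linearZ der mxadZl.
pose mu k := tm (g2mu k).
have muE x k l i : \sum_k' \sum_l' rho x k' k * rho x l' l * mu k' i l' = \sum_j rho x i j * mu k j l.
  move: x; apply: (word_dense_eq connG (D := D)).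
  - apply: (subalg_sum subA) => k' _; apply: (subalg_sum subA) => l' _.
    by apply: (subalgM subA); [exact: (subalgM subA) | exact: (subalg_cst subA)].
  - by apply: (subalg_sum subA) => j _; apply: (subalgM subA); [exact: rA | exact: (subalg_cst subA)].
  move=> w; set x := word_elt D w.
  have E1 : io (rho x *m delta_mx k 0) *m rho x = rho x *m mu k.
    rewrite -[io _]/(imx _) iow -mulmxA (mulmx1C (rep_inv rat _)) mulmx1 /= io_delta //.
  have /matrixP/(_ i l) := E1; rewrite mxE [RHS]mxE => <-.
  under [RHS]eq_bigr do rewrite /io summxE mulr_suml.
  rewrite exchange_big; apply: eq_bigr => k' _ /=; apply: eq_bigr => l' _.
  by rewrite -colE !mxE; ring.
have muZ (i k l : 'I_7) : ~~ N i -> mu k i l != 0 -> N k && N l.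
  rewrite /N negbK => /eqP i3; rewrite /mu mxE intr_eq0 i3.
  have chk : all (fun k => all (fun l => (g2mu k 3 l != 0) ==> (k != 3) && (l != 3))%N (iota 0 7)) (iota 0 7) by vm_compute.
  have mem (m : 'I_7) : (m : nat) \in iota 0 7 by rewrite mem_iota add0n ltn_ord.
  by have /allP/(_ _ (mem k))/allP/(_ _ (mem l))/implyP := chk.
have mu_span (j : 'I_7) : exists c : 'I_7 -> 'I_7 -> C, (forall k l, c k l != 0 -> N k && N l) /\
    forall i, \sum_k \sum_l c k l * mu k i l = (i == j)%:R.
  pose k0 := (g2pair j).1; pose l0 := (g2pair j).2.
  have chk : all (fun j => [&& (g2pair j).1 < 7, (g2pair j).2 < 7, (g2pair j).1 != 3, (g2pair j).2 != 3,
     g2mu (g2pair j).1 j (g2pair j).2 != 0 :> int &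
     all (fun i => (i != j) ==> (g2mu (g2pair j).1 i (g2pair j).2 == 0 :> int)) (iota 0 7)])%N (iota 0 7) by vm_compute.
  have mem (m : 'I_7) : (m : nat) \in iota 0 7 by rewrite mem_iota add0n ltn_ord.
  have /allP/(_ _ (mem j))/and5P[k7 l7 k3 l3 /andP[nz /allP oth]] := chk.
  exists (fun k l => ((k == Ordinal k7) && (l == Ordinal l7))%:R / (g2mu (g2pair j).1 j (g2pair j).2)%:~R); split.
    by move=> k l; case: andP => [[/eqP -> /eqP ->] _|_]; rewrite ?mul0r ?eqxx // /N /= k3 l3.
  move=> i; rewrite (bigD1 (Ordinal k7)) //= [X in _ + X]big1 ?addr0 => [|k /negPf kk]; last first.
    by rewrite big1 // => l _; rewrite kk /= !mul0r.
  rewrite (bigD1 (Ordinal l7)) //= [X in _ + X]big1 ?addr0 => [|l /negPf ll]; last by rewrite ll andbF /= !mul0r.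
  rewrite !eqxx /= mul1r /mu mxE /=; have [->|ij] := eqVneq i j; first by rewrite mulVf // intr_eq0.
  by have /implyP/(_ ij)/eqP -> := oth _ (mem i); rewrite mulr0.
have PhiX b x : tm g2Phi *m drep rho (gen_ef D b x) = (- (drep rho (gen_ef D b x))^T) *m tm g2Phi.
  have -> : drep rho (gen_ef D b x) = tm (if b then g2E (x == s) else g2F (x == s)).
    by case: b; rewrite /gen_ef ?dE ?dF.
  set f := (if b then _ else _).
  have -> : - (tm f)^T = tm (fun i j => - f j i) by apply/matrixP => i j; rewrite !mxE rmorphN.
  by rewrite !tmx_mul; apply: tmx_eq; rewrite /f; case: (b); case: (x == s); vm_compute.
have Phi_inv x : (rho x)^T *m tm g2Phi *m rho x = tm g2Phi.
  apply/matrixP => i j; move: x; apply: (word_dense_eq connG (D := D)); last 1 first.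
  - move=> w; congr (fun_of_matrix _ i j); elim: w => [|p w IH] /=; first by rewrite r1 trmx1 mul1mx mulmx1.
    rewrite !rM trmx_mul -!mulmxA (mulmxA _ (rho (root_elt _ _ _ _)) _) (mulmxA (rho (root_elt _ _ _ _))^T).
    have nl : nilpotent_mx (p.2 *: drep rho (gen_ef D p.1.1 p.1.2)) by apply: nilpotentZ; exact: rep_nilpotent.
    have nlT : nilpotent_mx (p.2 *: drep rho (gen_ef D p.1.1 p.1.2))^T.
      have [K K0] := nl; exists K; have trX k : ((p.2 *: drep rho (gen_ef D p.1.1 p.1.2)) ^+ k)^T = (p.2 *: drep rho (gen_ef D p.1.1 p.1.2))^T ^+ k.
        elim: k => [|k IHk]; first by rewrite !expr0 trmx1.
        by rewrite exprS exprSr -[_ * _ in LHS]/(_ *m _) trmx_mul IHk.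
      by rewrite -trX K0 trmx0.
    have nlN := nilpotentN nlT.
    rewrite rep_root_elt // (mexp_intertwine nl nlN) => [|]; last first.
      by rewrite -scalemxAr PhiX linearZ /= -scalerN -scalemxAl.
    by rewrite trmx_mexp // (mulmxA (mexp _) (mexp (- _))) mexp_inv mul1mx mulmxA IH.
  - by apply: (subalg_mulmx subA) => // k l; apply: (subalg_mulmx subA) => [k' l'|k' l'];
      [under eq_fun do rewrite mxE; exact: rA | exact: (subalg_cst subA)].
  - exact: (subalg_cst subA).
have PP : 2^-1 *: tm g2Phi' *m tm g2Phi = 1%:M.
  rewrite -scalemxAl tmx_mul (_ : tm _ = tm (fun i j => if i == j then 2 else 0)); last by apply: tmx_eq; vm_compute.
  apply/matrixP => i j; rewrite !mxE -val_eqE; case: eqP => _; last by rewrite mulr0.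
  by rewrite mulVf // pnatr_eq0.
have symN f : all (fun i => all (fun j => (f i j != 0 :> int) ==> ((i != 3) == (j != 3)))%N (iota 0 7)) (iota 0 7) ->
    forall i j : 'I_7, f i j != 0 -> N i = N j.
  move=> chk i j; have mem (m : 'I_7) : (m : nat) \in iota 0 7 by rewrite mem_iota add0n ltn_ord.
  by have /allP/(_ _ (mem i))/allP/(_ _ (mem j))/implyP H0 := chk => /H0/eqP.
apply: (quasi_minuscule_coef (algebra_generated_subalgebra _) muE muZ mu_span (Phi := tm g2Phi) (Phi' := 2^-1 *: tm g2Phi')) => //.
- move=> x; rewrite rep_invmx // -[LHS]mul1mx -PP -{1}(Phi_inv x) -!mulmxA mulmxV ?mulmx1 //.
  exact: rep_unit.
- by move=> i j; rewrite mxE intr_eq0; apply: symN; vm_compute.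
- by move=> i j; rewrite !mxE mulf_eq0 negb_or intr_eq0 => /andP[_]; apply: symN; vm_compute.
Qed.

End TypeG2.

(** * Generation by minors *)

Section Generation.
Variables (C : numClosedFieldType) (G : affineGroup C) (S : finType).
Variable D : chevalley_data G S.
Local Notation A := (coord_ring G).
Local Notation subA := (coord_ring_subalgebra G).
Local Notation a := (cartan D).
Local Notation B := (algebra_generated (generalized_minors D)).

Definition minor_rep n (rho : G -> 'M[C]_n) (wt : 'I_n -> S -> int) :=
  [/\ rational_rep rho, weight_rep D rho wt & forall i j, B (fun x => rho x i j)].

Definition in_lattice n (wt : 'I_n -> S -> int) (mu : S -> int) :=
  exists z : 'I_n -> int, forall t, \sum_i z i * wt i t = mu t.

Section Lattice.
Variables (n : nat) (wt : 'I_n -> S -> int).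

Lemma in_lattice_wt i : in_lattice wt (wt i).
Proof.
exists (fun j => (j == i)%:R) => t.
by rewrite (bigD1 i) //= eqxx mul1r big1 ?addr0 // => j /negPf ->; rewrite mul0r.
Qed.

Lemma in_lattice_lin c mu nu : in_lattice wt mu -> in_lattice wt nu ->
  in_lattice wt (fun t => c * mu t + nu t).
Proof.
move=> [z zE] [y yE]; exists (fun i => c * z i + y i) => t; rewrite -zE -yE mulr_sumr -big_split.
by apply: eq_bigr => i _ /=; ring.
Qed.

Lemma in_lattice_sum (x : S -> int) : (forall u, in_lattice wt (fun t => a t u)) ->
  in_lattice wt (fun t => \sum_u a t u * x u).
Proof.
move=> la; elim: (index_enum S) => [|u r IH].
  by exists (fun=> 0) => t; rewrite big_nil big1 // => i _; rewrite mul0r.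
have [z zE] := in_lattice_lin (x u) (la u) IH; exists z => t; by rewrite zE big_cons mulrC.
Qed.

End Lattice.

Lemma minor_rep_sum n1 n2 (r1 : G -> 'M[C]_n1) (r2 : G -> 'M[C]_n2) w1 w2 :
  minor_rep r1 w1 -> minor_rep r2 w2 -> exists n (rho : G -> 'M[C]_n) wt,
  [/\ minor_rep rho wt, forall mu, in_lattice w1 mu -> in_lattice wt mu
    & forall mu, in_lattice w2 mu -> in_lattice wt mu].
Proof.
move=> [rat1 wr1 B1] [rat2 wr2 B2]; have rat := rational_rep_sum rat1 rat2.
pose wt (i : 'I_(n1 + n2)) := match split i with inl j => w1 j | inr j => w2 j end.
have wl j : wt (lshift n2 j) = w1 j by rewrite /wt (unsplitK (inl j)).
have wr j : wt (rshift n1 j) = w2 j by rewrite /wt (unsplitK (inr j)).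
exists (n1 + n2)%N, (fun x => block_mx (r1 x) 0 0 (r2 x)), wt; split.
- split=> //.
    apply: weight_rep_diag => // s; have [H1 _] := wr1; have [H2 _] := wr2.
    have [_ _ lh] := gen_lie D s.
    have -> : drep (fun x => block_mx (r1 x) 0 0 (r2 x)) (gen_h D s) =
        block_mx (drep r1 (gen_h D s)) 0 0 (drep r2 (gen_h D s)).
      apply/matrixP => i j; rewrite mxE; case: (split_ordP i) => k ->; case: (split_ordP j) => l ->.
      + by under eq_fun do rewrite block_mxEul; rewrite block_mxEul mxE.
      + by under eq_fun do rewrite block_mxEur mxE; rewrite block_mxEur mxE (lie_cst lh).
      + by under eq_fun do rewrite block_mxEdl mxE; rewrite block_mxEdl mxE (lie_cst lh).
      + by under eq_fun do rewrite block_mxEdr; rewrite block_mxEdr mxE.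
    rewrite H1 H2; apply/matrixP => i j.
    case: (split_ordP i) => k ->; case: (split_ordP j) => l ->; rewrite ?block_mxEul ?block_mxEur ?block_mxEdl ?block_mxEdr !mxE ?wl ?wr.
    + by rewrite (inj_eq (@lshift_inj _ _)).
    + by rewrite eq_lrshift.
    + by rewrite eq_rlshift.
    + by rewrite (inj_eq (@rshift_inj _ _)).
  move=> i j; have subB := algebra_generated_subalgebra (generalized_minors D).
  case: (split_ordP i) => k ->; case: (split_ordP j) => l ->.
  + by under eq_fun do rewrite block_mxEul; exact: B1.
  + by under eq_fun do rewrite block_mxEur mxE; exact: (subalg_cst subB).
  + by under eq_fun do rewrite block_mxEdl mxE; exact: (subalg_cst subB).
  + by under eq_fun do rewrite block_mxEdr; exact: B2.
- move=> mu [z zE]; exists (fun i => if split i is inl j then z j else 0) => t.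
  rewrite big_split_ord /= [X in _ + X]big1 ?addr0 => [|j _]; last by rewrite (unsplitK (inr j)) mul0r.
  by rewrite -zE; apply: eq_bigr => j _; rewrite wl (unsplitK (inl j)).
- move=> mu [z zE]; exists (fun i => if split i is inr j then z j else 0) => t.
  rewrite big_split_ord /= [X in X + _]big1 ?add0r => [|j _]; last by rewrite (unsplitK (inl j)) mul0r.
  by rewrite -zE; apply: eq_bigr => j _; rewrite wr (unsplitK (inr j)).
Qed.

Lemma minors_coord : B `<=` A.
Proof.
apply: algebra_generated_min; first exact: subA.
move=> _ [lam [w [w' [_ _ _ [n [rho [v [g [g' [xi [[[_ _ rA] _ _ _ _] _ _ _ ->]]]]]]]]]]].
apply: (subalg_mulmx subA) => [i j|i j]; first exact: (subalg_cst subA).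
by apply: (subalg_mulmx subA) => [k l|k l]; [exact: rA | exact: (subalg_cst subA)].
Qed.

Lemma minor_rep_generates n (rho : G -> 'M[C]_n) wt : connected_group G -> minor_rep rho wt ->
  (forall s, in_lattice wt (fun t => (s == t)%:R)) -> A = B.
Proof.
move=> connG [rat wr Bc] lat; apply/seteqP; split; last exact: minors_coord.
have [c cP] := cartan_solveT (cartan_posdef D) (fun=> 1).
rewrite (lattice_faithful connG cP rat wr lat).
apply: algebra_generated_min; first exact: algebra_generated_subalgebra.
by move=> _ [i [j ->]].
Qed.

(** Each fundamental weight has a coset, hence a representation [V s] on a minimal orbit. One of
    them outside the root lattice has all roots among the differences of its weights; adding all the
    others then reaches every fundamental weight. If a coset is trivial, its minimal orbit is {0},
    which does no harm. *)
Lemma minuscule_case : simply_connected G -> indecomposable a ->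
  (exists lam : S -> int, ~ exists x : S -> int, forall t, lam t = \sum_s a t s * x s) ->
  exists n (rho : G -> 'M[C]_n) wt, minor_rep rho wt /\ forall s, in_lattice wt (fun t => (s == t)%:R).
Proof.
move=> sc indec [lam nlam]; have [a_diag _ a_sym] := cartanP D.
have V s : exists n (rho : G -> 'M[C]_n) wt, [/\ minor_rep rho wt, (0 < n)%N,
    forall i s, -1 <= wt i s <= 1, forall i s, exists j, wt j = irefl D s (wt i) &
    forall i, exists x : S -> int, forall t, wt i t = (s == t)%:R + \sum_u a t u * x u].
  have [n [wt [n0 w1 wr wi [wtr wq]]]] := minimal_coset D (fun t => (s == t)%:R).
  have [rho [rat wrr Bc]] := minuscule_rep sc n0 w1 wr wi wtr.
  by exists n, rho, wt; split.
have [s ns] : exists s, ~ exists x : S -> int, forall t, (s == t)%:R = \sum_u a t u * x u.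
  apply: contrapT => H; apply: nlam.
  have Q s : exists x : S -> int, forall t, (s == t)%:R = \sum_u a t u * x u.
    by apply: contrapT => ns; apply: H; exists s.
  have [x xE] := choice Q; exists (fun u => \sum_s lam s * x s u) => t.
  transitivity (\sum_s lam s * (s == t)%:R).
    by rewrite (bigD1 t) //= eqxx mulr1 big1 ?addr0 // => u /negPf ->; rewrite mulr0.
  under eq_bigr do rewrite xE mulr_sumr.
  rewrite exchange_big; apply: eq_bigr => u _ /=; rewrite mulr_sumr; apply: eq_bigr => v _; ring.
have [n [rho [wt [good n0 w1 wrf wq]]]] := V s.
(* The vertices at which some weight is non-zero are closed under adjacency, since reflecting at v
   changes the value at a neighbour. There is one, as otherwise the coset would contain 0. *)
have allu u : exists i, wt i u != 0.
  suff /asboolP : [pred u | `[< exists i, wt i u != 0 >]] u by [].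
  apply: indec => /=.
    apply: contrapT => H; pose i := Ordinal n0; have [x xE] := wq i.
    apply: ns; exists (fun u => - x u) => t; have := xE t.
    have -> : wt i t = 0 by apply/eqP/negPn/negP => nz; apply: H; exists t; apply/asboolP; exists i.
    by move/esym/eqP; rewrite addr_eq0 => /eqP ->; rewrite -sumrN; apply: eq_bigr => u' _; rewrite mulrN.
  move=> v v' /asboolP[i iv] /asboolP nv'; apply: a_sym; apply/eqP/negPn/negP => av.
  have z k : wt k v' = 0 by apply/eqP/negPn/negP => nz; apply: nv'; exists k.
  have [j jE] := wrf i v; have := z j; rewrite jE /irefl z sub0r => /eqP.
  by rewrite oppr_eq0 mulf_eq0 (negPf iv) (negPf av).
have la u : in_lattice wt (fun t => a t u).
  have [i iu] := allu u; have [j jE] := wrf i u.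
  (* A weight with value 1 or -1 at u differs from its reflection by a simple root up to sign. The
     combination taken is wt i u times this difference; the trailing terms add up to 0 and only
     close the nesting. *)
  have [z zE] := in_lattice_lin (- wt i u) (in_lattice_wt wt j)
    (in_lattice_lin (wt i u) (in_lattice_wt wt i) (in_lattice_lin 0 (in_lattice_wt wt i) (in_lattice_lin (-1) (in_lattice_wt wt i) (in_lattice_wt wt i)))).
  exists z => t; rewrite zE jE /irefl.
  have : wt i u * wt i u = 1.
    by have := w1 i u; move: iu; case: (wt i u) => [[|[|k]]|[|k]].
  move=> sq; transitivity (wt i u * wt i u * a t u); last by rewrite sq mul1r.
  by ring.
suff : exists n (rho : G -> 'M[C]_n) wt, [/\ minor_rep rho wt, forall u, in_lattice wt (fun t => a t u) &
    forall s, s \in enum S -> in_lattice wt (fun t => (s == t)%:R)].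
  move=> [n' [rho' [wt' [good' _ lat']]]]; exists n', rho', wt'; split=> // s'.
  by apply: lat'; rewrite mem_enum.
elim: (enum S) => [|u r [n1 [r1 [wt1 [good1 la1 lat1]]]]]; first by exists n, rho, wt.
have [n2 [r2 [wt2 [good2 n20 _ _ wq2]]]] := V u.
have [n3 [r3 [wt3 [good3 i1 i2]]]] := minor_rep_sum good1 good2.
exists n3, r3, wt3; split=> // [v|v]; first exact/i1/la1.
rewrite inE => /orP[/eqP ->|vr]; last exact/i1/lat1.
have [x xE] := wq2 (Ordinal n20).
have [y yE] := in_lattice_lin (-1) (in_lattice_sum x (fun v => i1 _ (la1 v))) (i2 _ (in_lattice_wt wt2 (Ordinal n20))).
by exists y => t; rewrite yE xE mulN1r addrC addrK.
Qed.

(** Three sources of a representation with all its coefficients generated by minors and with enough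
    weights: minuscule ones if the root lattice is proper, the seven-dimensional one of G2, and the
    adjoint one in the simply laced unimodular case, where the roots already span. *)
Theorem minors_generate : simply_connected G -> simple_group G -> ~ type_F4 a -> A = B.
Proof.
move=> sc sim nF4; have [connG _] := sc; have indec := simple_indecomposable (D := D) sim.
suff [n [rho [wt [good lat]]]] : exists n (rho : G -> 'M[C]_n) wt, minor_rep rho wt /\
    forall s, in_lattice wt (fun t => (s == t)%:R).
  exact: minor_rep_generates good lat.
have [ex|nex] := pselect (exists lam : S -> int, ~ exists x : S -> int, forall t, lam t = \sum_s a t s * x s).
  exact: minuscule_case.
have uni (lam : S -> int) : exists x : S -> int, forall t, lam t = \sum_s a t s * x s.
  by apply: contrapT => nx; apply: nex; exists lam.
have subB := algebra_generated_subalgebra (generalized_minors D).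
have [[s0 _]|noS] := pselect (exists s : S, True); last first.
  exists 1%N, (fun=> 1%:M), (fun _ _ => 0); split; last by move=> s; case: noS; exists s.
  split; last by move=> i j; exact: (subalg_cst subB).
    by split=> [//|x y|i j]; [rewrite mulmx1 | exact: (subalg_cst subA)].
  by split=> s; case: noS; exists s.
have [laced|nl] := pselect (forall s t, s != t -> -1 <= a s t); last first.
  have [t [s [ts lt]]] : exists t s, t != s /\ a t s < -1.
    apply: contrapT => H; apply: nl => s t st; rewrite leNgt; apply/negP => lt.
    by apply: H; exists s, t.
  have st : s != t by rewrite eq_sym.
  have [//|[ast ats all2]] := non_simply_laced (cartanP D) (cartan_posdef D) indec uni st lt.
  have [rho [rat wr Bc lat]] := g2_rep sc st ast ats all2.
  by exists 7%N, rho, (fun i x => g2wt (x == s) i); split.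
have [n [rho0 [rat0 faith0]]] := faithful_rep_ex G.
have [P [wtF [uP wrF]]] := weight_basis D rat0.
have rat := rational_rep_conj uP rat0; have faith := faithful_conj uP rat0 faith0.
have linL := Lall_linear (@mxad C n) (fun s => drep (fun x => P *m rho0 x *m invmx P) (gen_e D s))
  (fun s => drep (fun x => P *m rho0 x *m invmx P) (gen_f D s)) (fun s => drep (fun x => P *m rho0 x *m invmx P) (gen_h D s)).
have [d [rho' [wt [iota [rat' wr inj iL iE]]]]] := subrep_weight D rat linL (adjoint_conj connG rat).
have [Bc alw] := adjoint_coefs indec uni laced s0 rat faith wrF rat' wr inj iL iE.
exists d, rho', wt; split=> // s.
have la u : in_lattice wt (fun t => a t u).
  by have [i iE'] := alw u; have [z zE] := in_lattice_wt wt i; exists z => t; rewrite zE iE'.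
have [x xE] := uni (fun t => (s == t)%:R).
by have [z zE] := in_lattice_sum x la; exists z => t; rewrite zE xE.
Qed.

End Generation.

Theorem theorem3p2 (R : realType) (G : affineGroup R[i]%C) (S : finType)
    (D : chevalley_data G S) :
  simply_connected G -> simple_group G -> ~ type_F4 (cartan D) ->
  coord_ring G = algebra_generated (generalized_minors D).
Proof. exact: minors_generate. Qed.
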